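(* Assume the following. (i) The parameter $\theta$ belongs to a compact set. (ii) $m(Z,\theta)$ is a concave function of $\theta$ with a unique and finite maximum, and $E\{m^2(Z,\theta)\}<\infty$ for any $\theta$. (iii) The matrix $-E\{\ddot m(Z,\theta)\}$ is positive-definite, $E\{\ddot m_{k,l}^2(Z,\theta)\}<\infty$, and there exists a function $\psi(z)$ with $E\{\psi^2(Z)\}<\infty$ such that for every $\theta_1,\theta_2$, $|\ddot m_{k,l}(z,\theta_1)-\ddot m_{k,l}(z,\theta_2)|\le\psi(z)\|\theta_1-\theta_2\|$ for $k,l=1,\dots,d$. (iv) The matrix $\Lambda(\theta)=E\{\dot m(Z,\theta)\dot m^{T}(Z,\theta)\}$ is positive-definite, and for $\theta$ in the neighborhood of $\hat\theta_n$, $\frac1n\sum_{i=1}^n\|\dot m(Z_i,\theta)\|^4=O_P(1)$. Let $\tilde\theta_{s_n,R}^{\alpha}$ be the estimator from the practical algorithm based on optimal subsampling with replacement (defined in the context). Then, as $s_0,s_n,n\to\infty$, given $\mathcal D_n$ and $\tilde\theta_{s_0,R}^{0*}$ in probability, $$\sqrt{s_n}\,\{V_{n,R}^{\alpha}(\hat\theta_n)\}^{-1/2}(\tilde\theta_{s_n,R}^{\alpha}-\hat\theta_n)\ \longrightarrow\ N(0,I)$$ in conditional distribution, where $V_{n,R}^{\alpha}(\hat\theta_n)=\ddot M_n^{-1}(\hat\theta_n)\Lambda_R^{\alpha}(\hat\theta_n)\ddot M_n^{-1}(\hat\theta_n)$, $$\Lambda_R^{\alpha}(\hat\theta_n)=\frac1{n^2}\sum_{i=1}^n\frac{\dot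 m(Z_i,\hat\theta_n)\dot m^{T}(Z_i,\hat\theta_n)}{\pi_{n,R\alpha i}^{\mathrm{opt}}(\hat\theta_n)},\qquad \pi_{n,R\alpha i}^{\mathrm{opt}}(\hat\theta_n)=(1-\alpha)\pi_{n,Ri}^{\mathrm{opt}}(\hat\theta_n)+\alpha\frac1n,$$ and $\pi_{n,Ri}^{\mathrm{opt}}(\hat\theta_n)=\|\dot m(Z_i,\hat\theta_n)\|/\sum_{j=1}^n\|\dot m(Z_j,\hat\theta_n)\|$.
   Context: The full data $\mathcal D_n=\{Z_i\}_{i=1}^n$ are independent observations from the distribution of $Z$; $\theta\in\mathbb R^d$ is a parameter; $m(Z,\theta)$ is a real-valued function; $\dot m$ and $\ddot m$ are the gradient and Hessian of $m$ with respect to $\theta$, with $\ddot m_{k,l}$ the $(k,l)$ entry. The full data estimator $\hat\theta_n$ is the maximizer of $M_n(\theta)=\frac1n\sum_{i=1}^n m(Z_i,\theta)$, and $\ddot M_n(\theta)=\frac1n\sum_{i=1}^n\ddot m(Z_i,\theta)$. $\|\cdot\|$ is the Euclidean norm for vectors. $s_n<n$. Practical algorithm with replacement, with $\alpha\in(0,1)$ fixed. Pilot step: draw $Z_1^{0*},\dots,Z_{s_0}^{0*}$ with replacement, uniformly from the full data, and let $\tilde\theta_{s_0,R}^{0*}$ maximize $\frac1{s_0}\sum_{i=1}^{s_0}m(Z_i^{0*},\theta)$. Second step: compute for $i=1,\dots,n$ $$\tilde\pi_{n,Ri}^{\mathrm{opt}}=\frac{\|\dot m(Z_i,\tilde\theta_{s_0,R}^{0*})\|}{\sum_{j=1}^n\|\dot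 m(Z_j,\tilde\theta_{s_0,R}^{0*})\|},\qquad\tilde\pi_{n,R\alpha i}^{\mathrm{opt}}=(1-\alpha)\tilde\pi_{n,Ri}^{\mathrm{opt}}+\alpha\frac1n,$$ draw a subsample $Z_1^*,\dots,Z_{s_n}^*$ with replacement using the probabilities $\{\tilde\pi_{n,R\alpha i}^{\mathrm{opt}}\}_{i=1}^n$, and let $\tilde\pi_{n,R\alpha i}^{\mathrm{opt}*}$ be the probabilities corresponding to the selected points. Estimation: $\tilde\theta_{s_n,R}^{\alpha}$ maximizes $\sum_{i=1}^{s_n}\frac{m(Z_i^*,\theta)}{ns_n\tilde\pi_{n,R\alpha i}^{\mathrm{opt}*}}$. Convergence of $\Delta$ in conditional distribution to a continuous random vector $U$ given $\mathcal D_n$ and the pilot estimator in probability means that for every $x\in\mathbb R^d$, $\Pr(\Delta\le x\mid\mathcal D_n,\tilde\theta_{s_0,R}^{0*})-\Pr(U\le x)=o_P(1)$.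
   Formalization: The formal theorem also assumes that every maximizer of E m(Z,θ) over the compact parameter set is an interior point; without this the claim fails, e.g. m=-(Z-θ)²/2 on [-1,1] with Z uniform on (9,11), where both estimators equal 1. *)

(* Defs.v *)
From HB Require Import structures.
From mathcomp Require Import all_boot all_order all_algebra.
From mathcomp Require Import all_classical all_reals all_analysis.

Set Implicit Arguments.
Unset Strict Implicit.
Unset Printing Implicit Defensive.

Import Order.TTheory GRing.Theory Num.Theory.
Import numFieldNormedType.Exports.

Local Open Scope classical_set_scope.
Local Open Scope ring_scope.

(** * Vectors, matrices and derivatives *)

Section vectors.
Context {R : realType} {d : nat}.
Implicit Types (v : 'cV[R]_d) (A : 'M[R]_d) (f : 'cV[R]_d -> R).

(* The canonical norm on ['cV[R]_d] is the sup norm, hence this definition. *)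
Definition enorm v : R := Num.sqrt (\sum_(k < d) v k 0 ^+ 2).

Definition gradient f (theta : 'cV[R]_d) : 'cV[R]_d :=
  \col_k 'D_(delta_mx k 0) f theta.

Definition hessian f (theta : 'cV[R]_d) : 'M[R]_d :=
  \matrix_(k, l) 'D_(delta_mx l 0) (fun t => gradient f t k 0) theta.

Definition twice_differentiable f (theta : 'cV[R]_d) : Prop :=
  (\forall t \near theta, differentiable f t) /\
  differentiable (gradient f) theta.

Definition posdef A : Prop :=
  A^T = A /\ forall v, v != 0 -> 0 < (v^T *m A *m v) 0 0.

(* [A^(-1/2)]: the positive-definite [B] with [B^2 = A^-1].  It exists, and is
   then unique, exactly when [A] is positive-definite; otherwise the value
   is 0. *)
Definition invsqrtmx A : 'M[R]_d :=
  xget 0 [set B | posdef B /\ B *m B = invmx A].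

(* Concavity on a set includes convexity of that set. *)
Definition concave_on (D : set 'cV[R]_d) f : Prop :=
  convex_set D /\ convex_function D (fun t => - f t).

Definition is_maximizer (D : set 'cV[R]_d) f (theta : 'cV[R]_d) : Prop :=
  D theta /\ forall t, D t -> f t <= f theta.

(* The order on [R^d] is componentwise. *)
Definition le_cV (u v : 'cV[R]_d) : Prop := forall k, u k 0 <= v k 0.

End vectors.

(** * Probability *)

Section probability.
Context {R : realType} {dO : measure_display} {Omega : measurableType dO}.
Variable P : probability Omega R.

(* Independence of the whole sequence: [A i] may be [setT], so the product rule
   over initial segments covers every finite subfamily. *)
Definition iid {dT : measure_display} {T : measurableType dT}
    (mu : probability T R) (Z : nat -> Omega -> T) : Prop :=
  (forall i, measurable_fun setT (Z i)) /\
  (forall (n : nat) (A : nat -> set T), (forall i, measurable (A i)) ->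
    P [set w | forall i, (i < n)%N -> A i (Z i w)]
      = (\prod_(i < n) mu (A i))%E).

Definition measurable_wrt {d' : measure_display} {T' : measurableType d'}
    (G : set (set Omega)) (X : Omega -> T') : Prop :=
  forall A : set T', measurable A -> G (X @^-1` A).

Definition random_vector {d : nat} (X : Omega -> 'cV[R]_d) : Prop :=
  forall k, measurable_fun setT (fun w => X w k 0).

(* [X n = o_P(1)] *)
Definition cvg0_in_probability (X : nat -> Omega -> R) : Prop :=
  forall e : R, 0 < e -> (fun n => P [set w | e <= `|X n w|]) @ \oo --> 0%E.

(* [X n = O_P(1)], stated with a measurable cover of the exceptional event so
   that it also makes sense for an uncountable supremum. *)
Definition bounded_in_probability (X : nat -> Omega -> \bar R) : Prop :=
  forall e : R, 0 < e -> exists K : R, \forall n \near \oo,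
    exists A : set Omega, [/\ measurable A, (P A <= e%:E)%E &
      [set w | (K%:E < `|X n w|)%E] `<=` A].

(* [g] is a version of the conditional probability [P(E | G)], for [G] a
   sub-sigma-algebra. *)
Definition is_cond_prob (G : set (set Omega)) (E : set Omega) (g : Omega -> R) :
    Prop :=
  [/\ measurable_wrt G g,
      P.-integrable setT (EFin \o g) &
      forall B, G B -> (\int[P]_(w in B) (g w)%:E)%E = P (B `&` E)].

(* Convergence of [X n] to [U] in conditional distribution given [G n], in
   probability, for [U] with continuous distribution function; conditional
   probabilities being defined up to null events, the convergence is required
   of all their versions. *)
Definition cvg_cond_distribution {d : nat} {dU : measure_display}
    {OmegaU : measurableType dU} (Q : probability OmegaU R)
    (U : OmegaU -> 'cV[R]_d)
    (G : nat -> set (set Omega)) (X : nat -> Omega -> 'cV[R]_d) : Prop :=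
  forall (x : 'cV[R]_d) (g : nat -> Omega -> R),
    (forall n, is_cond_prob (G n) [set w | le_cV (X n w) x] (g n)) ->
    cvg0_in_probability (fun n w => g n w - fine (Q [set u | le_cV (U u) x])).

(* [N(0, I)]: independent standard normal coordinates. *)
Definition std_normal_vector {d : nat} (U : Omega -> 'cV[R]_d) : Prop :=
  random_vector U /\
  (forall B : 'I_d -> set R, (forall k, measurable (B k)) ->
    P [set u | forall k, B k (U u k 0)]
      = (\prod_(k < d) normal_prob 0 1 (B k))%E).

(* Given [G], on the event [D] of [G], the indices [J 0, ..., J s.-1] are drawn
   independently from [{0, ..., n.-1}], each with the [G]-measurable
   probabilities [p w 0, ..., p w n.-1].  Off [D], where the [p w i] may fail to
   be a probability vector, nothing is said about the law of the draws. *)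
Definition drawn_with_replacement (G : set (set Omega)) (D : set Omega)
    (n s : nat) (p : Omega -> nat -> R) (J : nat -> Omega -> nat) : Prop :=
  [/\ forall k i, measurable [set w | J k w = i],
      forall k w, (0 < n)%N -> (k < s)%N -> (J k w < n)%N &
      forall (j : {ffun 'I_s -> 'I_n}) (B : set Omega), G B -> B `<=` D ->
        P (B `&` [set w | forall k : 'I_s, J k w = j k])
          = (\int[P]_(w in B) (\prod_(k < s) p w (j k))%:E)%E].

(* [sigma(Z_0, ..., Z_(n-1))] *)
Definition sigma_data {dT : measure_display} {T : measurableType dT}
    (Z : nat -> Omega -> T) (n : nat) : set (set Omega) :=
  <<s [set B | exists i A, [/\ (i < n)%N, measurable A & B = Z i @^-1` A]] >>.

(* [sigma(Z_0, ..., Z_(n-1), X)] *)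
Definition sigma_data_and {dT : measure_display} {T : measurableType dT}
    {d : nat} (Z : nat -> Omega -> T) (X : Omega -> 'cV[R]_d) (n : nat) :
    set (set Omega) :=
  <<s sigma_data Z n `|`
      [set B | exists k (A : set R),
         measurable A /\ B = [set w | A (X w k 0)]] >>.

End probability.

(** * Optimal subsampling *)

Section subsampling.
Context {R : realType} {d : nat} {T : Type}.
Variable m : T -> 'cV[R]_d -> R.
Implicit Types (z : nat -> T) (theta : 'cV[R]_d) (n : nat).

(* [z] lists the observations, of which only [z 0, ..., z n.-1] are used. *)
Definition mean_objective n z theta : R :=
  n%:R^-1 * \sum_(i < n) m (z i) theta.

Definition mean_hessian n z theta : 'M[R]_d :=
  n%:R^-1 *: \sum_(i < n) hessian (m (z i)) theta.

Definition sum_score_norm n z theta : R :=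
  \sum_(j < n) enorm (gradient (m (z j)) theta).

Definition pi_opt n z theta (i : nat) : R :=
  enorm (gradient (m (z i)) theta) / sum_score_norm n z theta.

Definition pi_opt_mix (alpha : R) n z theta (i : nat) : R :=
  (1 - alpha) * pi_opt n z theta i + alpha * n%:R^-1.

Definition Lambda_mix (alpha : R) n z theta : 'M[R]_d :=
  (n%:R ^+ 2)^-1 *:
    \sum_(i < n) (pi_opt_mix alpha n z theta i)^-1 *:
      (gradient (m (z i)) theta *m (gradient (m (z i)) theta)^T).

Definition V_mix (alpha : R) n z theta : 'M[R]_d :=
  invmx (mean_hessian n z theta) *m Lambda_mix alpha n z theta
    *m invmx (mean_hessian n z theta).

(* Objective of the subsample [zs 0, ..., zs s.-1] taken from [n] points, with
   sampling probabilities [ps 0, ..., ps s.-1]. *)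
Definition weighted_objective n (s : nat) (zs : nat -> T) (ps : nat -> R) theta :
    R :=
  \sum_(k < s) m (zs k) theta / (n%:R * s%:R * ps k).

End subsampling.

(* Main.v *)
Require Import Defs.
From HB Require Import structures.
From mathcomp Require Import all_boot all_order all_algebra.
From mathcomp Require Import all_classical all_reals all_analysis.
From mathcomp Require Import measurable_realfun ring lra.

Set Implicit Arguments.
Unset Strict Implicit.
Unset Printing Implicit Defensive.

Import Order.TTheory GRing.Theory Num.Theory.
Import numFieldNormedType.Exports.

Local Open Scope classical_set_scope.
Local Open Scope ring_scope.


Section finite_sampling.
Context {R : realType} {n : nat}.
Variable p : 'I_n -> R.

Definition walk (V : zmodType) (xi : 'I_n -> V) (s : nat) (F : V -> R) (x : V) : R :=
  \sum_(j : {ffun 'I_s -> 'I_n})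
    (\prod_(k < s) p (j k)) * F (x + \sum_(k < s) xi (j k)).

Lemma walk0 (V : zmodType) (xi : 'I_n -> V) F x : walk xi 0 F x = F x.
Proof.
rewrite /walk; under eq_bigr do rewrite !big_ord0 addr0 mul1r.
by rewrite sumr_const card_ffun !card_ord expn0 mulr1n.
Qed.

Definition fcons s (i : 'I_n) (j : {ffun 'I_s -> 'I_n}) : {ffun 'I_s.+1 -> 'I_n} :=
  [ffun k => oapp j i (unlift ord0 k)].

Lemma fcons0 s i (j : {ffun 'I_s -> 'I_n}) : fcons i j ord0 = i.
Proof. by rewrite ffunE unlift_none. Qed.

Lemma fconsS s i (j : {ffun 'I_s -> 'I_n}) k : fcons i j (lift ord0 k) = j k.
Proof. by rewrite ffunE liftK. Qed.

Lemma sum_ffun_cons s (G : {ffun 'I_s.+1 -> 'I_n} -> R) :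
  \sum_j G j = \sum_(i < n) \sum_(j : {ffun 'I_s -> 'I_n}) G (fcons i j).
Proof.
rewrite pair_bigA /= (reindex (fun ij => fcons ij.1 ij.2)) //=.
exists (fun j : {ffun 'I_s.+1 -> 'I_n} =>
  (j ord0, [ffun k => j (lift ord0 k)])) => [[i j] _|j _] /=.
  by congr pair; [rewrite fcons0|apply/ffunP => k; rewrite ffunE fconsS].
apply/ffunP => k; rewrite ffunE; case: unliftP => [l ->|->] //=.
by rewrite ffunE.
Qed.

Lemma walkS (V : zmodType) (xi : 'I_n -> V) s F x :
  walk xi s.+1 F x = \sum_(i < n) p i * walk xi s F (x + xi i).
Proof.
rewrite /walk sum_ffun_cons; apply: eq_bigr => i _; rewrite mulr_sumr.
apply: eq_bigr => j _; rewrite !big_ord_recl fcons0 -!mulrA; congr (_ * _).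
congr (_ * _); first by apply: eq_bigr => k _; rewrite fconsS.
by rewrite addrA; congr (F (_ + _)); apply: eq_bigr => k _; rewrite fconsS.
Qed.

Hypothesis p0 : forall i, 0 <= p i.
Hypothesis p1 : \sum_i p i = 1.

Lemma walk_cst (V : zmodType) (xi : 'I_n -> V) s c x : walk xi s (fun=> c) x = c.
Proof.
elim: s x => [|s IH] x; first by rewrite walk0.
by rewrite walkS; under eq_bigr do rewrite IH; rewrite -mulr_suml p1 mul1r.
Qed.

Lemma walk_le (V : zmodType) (xi : 'I_n -> V) s F F' x :
  (forall y, F y <= F' y) -> walk xi s F x <= walk xi s F' x.
Proof.
move=> FF'; apply: ler_sum => j _; apply: ler_wpM2l => //.
by apply: prodr_ge0.
Qed.

Lemma walk_sqr (xi : 'I_n -> R) s x : \sum_i p i * xi i = 0 ->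
  walk xi s (fun y => y ^+ 2) x = x ^+ 2 + s%:R * \sum_i p i * xi i ^+ 2.
Proof.
move=> xi0; elim: s x => [|s IH] x; first by rewrite walk0 mul0r addr0.
rewrite walkS; under eq_bigr do rewrite IH.
rewrite (_ : \sum_i _ = \sum_i p i * (x ^+ 2 + s%:R * \sum_j p j * xi j ^+ 2)
   + 2 * x * (\sum_i p i * xi i) + \sum_i p i * xi i ^+ 2).
  by rewrite -mulr_suml p1 xi0 -natr1; ring.
rewrite [2 * x * _]mulr_sumr -!big_split /=; apply: eq_bigr => i _; ring.
Qed.

(** Chebyshev's inequality for the sum of [s] draws. *)
Lemma walk_chebyshev (xi : 'I_n -> R) s (e v : R) : 0 < e -> \sum_i p i * xi i = 0 ->
  \sum_i p i * xi i ^+ 2 <= v ->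
  walk xi s (fun y => (e <= `|y|)%R%:R) 0 <= s%:R * v / e ^+ 2.
Proof.
move=> e0 xi0 xiv.
apply: (@le_trans _ _ (walk xi s (fun y => y ^+ 2 / e ^+ 2) 0)).
  apply: walk_le => y; case: (leP e `|y|) => ey /=; last first.
    by rewrite divr_ge0 ?sqr_ge0.
  rewrite ler_pdivlMr ?exprn_gt0// mul1r -(real_normK (num_real y)).
  by rewrite ler_pXn2r// nnegrE ltW.
rewrite (_ : walk _ _ _ _ = walk xi s (fun y => y ^+ 2) 0 / e ^+ 2).
  rewrite walk_sqr// expr0n add0r ler_pM2r ?invr_gt0 ?exprn_gt0//.
  by rewrite ler_wpM2l.
by rewrite /walk mulr_suml; apply: eq_bigr => j _; rewrite mulrA.
Qed.

End finite_sampling.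

Section taylor.
Context {R : realType}.

Lemma normr_le_add (a b A B : R) : `|a| <= A -> `|b| <= B -> `|a + b| <= A + B.
Proof. by move=> aA bB; rewrite (le_trans (ler_normD _ _))// lerD. Qed.

Lemma normr_le_sub (a b A B : R) : `|a| <= A -> `|b| <= B -> `|a - b| <= A + B.
Proof. by move=> aA bB; rewrite normr_le_add// normrN. Qed.

Lemma normr_le_mul (a b A B : R) : `|a| <= A -> `|b| <= B -> `|a * b| <= A * B.
Proof. by move=> aA bB; rewrite normrM ler_pM. Qed.

(** Second-order expansions multiply, the product of the remainders being again
    of third order.  For large increments the bound is trivial. *)
Lemma mul_taylor (C D N A A0 a1 a2 B B0 b1 b2 : R) : 0 <= N ->
  `|A| <= C -> `|A0| <= C -> `|a1| <= C * N -> `|a2| <= C * N ^+ 2 ->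
  `|A - A0 - a1 - a2 / 2| <= C * N ^+ 3 ->
  `|B| <= D -> `|B0| <= D -> `|b1| <= D * N -> `|b2| <= D * N ^+ 2 ->
  `|B - B0 - b1 - b2 / 2| <= D * N ^+ 3 ->
  `|A * B - A0 * B0 - (a1 * B0 + A0 * b1) -
    (a2 * B0 + 2 * (a1 * b1) + A0 * b2) / 2| <= 10 * (C * D) * N ^+ 3.
Proof.
move=> N0 AC A0C a1C a2C raC BD B0D b1D b2D rbD.
have C0 : 0 <= C by exact: le_trans AC.
have D0 : 0 <= D by exact: le_trans BD.
have CD0 : 0 <= C * D by exact: mulr_ge0.
have [N1|N1] := leP N 1.
  set ra := A - A0 - a1 - a2 / 2; set rb := B - B0 - b1 - b2 / 2.
  rewrite (_ : _ - _ = A * rb - ra * rb + ra * B + a1 * b2 / 2 + a2 * b1 / 2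
    + a2 * b2 / 4); last by rewrite /ra /rb; field.
  have h2 : `|2^-1 : R| <= 1 by rewrite ger0_norm; lra.
  have h4 : `|4^-1 : R| <= 1 by rewrite ger0_norm; lra.
  have := normr_le_add (normr_le_add (normr_le_add (normr_le_add (normr_le_sub
    (normr_le_mul AC rbD) (normr_le_mul raC rbD)) (normr_le_mul raC BD))
    (normr_le_mul (normr_le_mul a1C b2D) h2))
    (normr_le_mul (normr_le_mul a2C b1D) h2))
    (normr_le_mul (normr_le_mul a2C b2D) h4).
  move/le_trans; apply.
  rewrite (_ : _ + _ = C * D * N ^+ 3 * (4 + N ^+ 3 + N)); last by ring.
  rewrite (_ : 10 * (C * D) * N ^+ 3 = C * D * N ^+ 3 * 10); last by ring.
  apply: ler_wpM2l; first by rewrite mulr_ge0 ?exprn_ge0.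
  have : N ^+ 3 <= 1 by rewrite exprn_ile1.
  lra.
have := normr_le_sub (normr_le_sub (normr_le_sub (normr_le_mul AC BD)
   (normr_le_mul A0C B0D)) (normr_le_add (normr_le_mul a1C B0D)
    (normr_le_mul A0C b1D))) (normr_le_mul (normr_le_add (normr_le_add
      (normr_le_mul a2C B0D) (normr_le_mul (lexx `|2|) (normr_le_mul a1C b1D)))
      (normr_le_mul A0C b2D)) (lexx `|2^-1|)).
move/le_trans; apply; rewrite !ger0_norm//.
rewrite (_ : _ + _ = C * D * (2 + 2 * N + 2 * N ^+ 2)); last by field.
rewrite (_ : 10 * (C * D) * N ^+ 3 = C * D * (10 * N ^+ 3)); last by ring.
apply: ler_wpM2l => //.
have N2 : N <= N ^+ 2 by rewrite expr2; apply: ler_peMr => //; exact: ltW.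
have N3 : N ^+ 2 <= N ^+ 3 by rewrite (exprS _ 2); apply: ler_peMl; [exact: exprn_ge0|exact: ltW].
lra.
Qed.

Definition smooth3 (C : R) (f f1 f2 : R -> R) : Prop :=
  [/\ forall y, `|f y| <= C, forall y, `|f1 y| <= C, forall y, `|f2 y| <= C &
      forall y h, `|f (y + h) - f y - f1 y * h - f2 y * h ^+ 2 / 2|
         <= C * `|h| ^+ 3].

Context {d : nat}.
Implicit Types h : 'cV[R]_d.

Definition norm1 (h : 'cV[R]_d) : R := \sum_k `|h k 0|.

Lemma norm1_ge0 h : 0 <= norm1 h. Proof. exact: sumr_ge0. Qed.

Lemma le_norm1 h k : `|h k 0| <= norm1 h.
Proof. by rewrite /norm1 (bigD1 k)//= lerDl sumr_ge0. Qed.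

Lemma linear_le_norm1 (a : 'I_d -> R) D h : (forall k, `|a k| <= D) ->
  `|\sum_k a k * h k 0| <= D * norm1 h.
Proof.
move=> aD; rewrite (le_trans (ler_norm_sum _ _ _))// mulr_sumr.
by apply: ler_sum => k _; rewrite normrM ler_wpM2r.
Qed.

Lemma quadratic_le_norm1 (q : 'I_d -> 'I_d -> R) D h : (forall k l, `|q k l| <= D) ->
  `|\sum_k \sum_l q k l * (h k 0 * h l 0)| <= D * norm1 h ^+ 2.
Proof.
move=> qD; rewrite (le_trans (ler_norm_sum _ _ _))//.
rewrite expr2 [X in D * (X * _)]/norm1 mulr_suml mulr_sumr; apply: ler_sum => k _.
under eq_bigr do rewrite mulrCA.
rewrite -mulr_sumr normrM mulrCA; apply: ler_wpM2l => //.
exact: linear_le_norm1.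
Qed.

Lemma prod_taylor (C : R) (r : seq 'I_d) : uniq r -> 0 <= C ->
  exists2 D : R, 0 <= D & forall (t : R) (f f1 f2 g : 'I_d -> R -> R),
  0 <= t <= 1 -> (forall k, smooth3 C (f k) (f1 k) (f2 k)) ->
  (forall k y, `|g k y| <= C) ->
  (forall k y, `|g k y - f k y - t ^+ 2 * f2 k y / 2| <= C * t ^+ 3) ->
  exists (a : 'cV[R]_d -> 'I_d -> R) (q : 'cV[R]_d -> 'I_d -> 'I_d -> R),
  let F (x : 'cV[R]_d) := \prod_(k <- r) f k (x k 0) in
  let G (x : 'cV[R]_d) := \prod_(k <- r) g k (x k 0) in
  [/\ forall x, [/\ `|F x| <= D, `|G x| <= D, forall k, `|a x k| <= D,
        forall k : 'I_d, k \notin r -> a x k = 0 & forall k l, `|q x k l| <= D],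
      forall (x h : 'cV[R]_d), `|F (x + h) - F x - \sum_k a x k * h k 0 -
         (\sum_k \sum_l q x k l * (h k 0 * h l 0)) / 2| <= D * norm1 h ^+ 3 &
      forall x, `|G x - F x - t ^+ 2 * (\sum_k q x k k) / 2| <= D * t ^+ 3].
Proof.
elim: r => [_ C0|k0 r IH /= /andP[k0r ur] C0].
  exists 1 => // t f f1 f2 g t01 fC gC gfC.
  exists (fun _ _ => 0), (fun _ _ _ => 0) => /=.
  split=> [x|x h|x].
  - by rewrite !big_nil normr1 normr0; split.
  - rewrite !big_nil !big1.
    + by rewrite subrr subr0 mul0r subr0 normr0 mul1r exprn_ge0 ?norm1_ge0.
    + by move=> k _; rewrite big1// => l _; rewrite mul0r.
    + by move=> k _; rewrite mul0r.
  - rewrite !big_nil big1// mulr0 mul0r subrr subr0 normr0 mul1r exprn_ge0//.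
    by case/andP: t01.
have [D' D'0 IHr] := IH ur C0.
set D := D' * (d%:R + 1).
have D0 : 0 <= D by rewrite mulr_ge0// addr_ge0.
have D'D : D' <= D by rewrite ler_peMr// lerDr.
have D'd : D' * d%:R <= D by rewrite ler_wpM2l// lerDl.
exists (10 * (C * D)); first by rewrite !mulr_ge0.
move=> t f f1 f2 g t01 fC gC gfC.
have [a [q [/= bnd tay gau]]] := IHr t f f1 f2 g t01 fC gC gfC.
have [f_b f1_b f2_b f_t] := fC k0.
pose F (x : 'cV[R]_d) := \prod_(k <- r) f k (x k 0).
pose dl (k : 'I_d) : R := (k0 == k)%:R.
exists (fun (x : 'cV[R]_d) k => dl k * f1 k0 (x k0 0) * F x + f k0 (x k0 0) * a x k).
exists (fun (x : 'cV[R]_d) k l => dl k * dl l * (f2 k0 (x k0 0) * F x)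
   + f1 k0 (x k0 0) * (dl k * a x l + dl l * a x k) + f k0 (x k0 0) * q x k l).
have dl1 k : `|dl k| <= 1 by rewrite /dl; case: eqP; rewrite ?normr1 ?normr0.
have CD0 : 0 <= C * D by exact: mulr_ge0.
have CD'0 : 0 <= C * D' by exact: mulr_ge0.
have CDD : C * D' <= C * D by exact: ler_wpM2l.
have sum_dl (u : 'I_d -> R) : \sum_k dl k * u k = u k0.
  rewrite (bigD1 k0)//= /dl eqxx mul1r big1 ?addr0// => k kk0.
  by rewrite eq_sym (negbTE kk0) mul0r.
split=> [x|x h|x] /=.
- have [F_b G_b a_b a_0 q_b] := bnd x.
  have le10 (u : R) (e : nat) : (e <= 10)%N -> `|u| <= e%:R * (C * D') ->
      `|u| <= 10 * (C * D).
    move=> e10 /le_trans; apply; apply: ler_pM => //; by rewrite ler_nat.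
  split.
  + rewrite big_cons; apply: (@le10 _ 1) => //; rewrite mul1r.
    exact: normr_le_mul.
  + rewrite big_cons; apply: (@le10 _ 1) => //; rewrite mul1r.
    exact: normr_le_mul.
  + move=> k; apply: (@le10 _ 2) => //.
    have := normr_le_add (normr_le_mul (normr_le_mul (dl1 k) (f1_b (x k0 0))) F_b)
       (normr_le_mul (f_b (x k0 0)) (a_b k)).
    by move/le_trans; apply; lra.
  + move=> k; rewrite inE negb_or eq_sym => /andP[kk0 kr].
    by rewrite /dl (negbTE kk0) !mul0r add0r a_0// mulr0.
  + move=> k l; apply: (@le10 _ 4) => //.
    have := normr_le_add (normr_le_add (normr_le_mul (normr_le_mul (dl1 k) (dl1 l))
      (normr_le_mul (f2_b (x k0 0)) F_b)) (normr_le_mul (f1_b (x k0 0))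
        (normr_le_add (normr_le_mul (dl1 k) (a_b l)) (normr_le_mul (dl1 l) (a_b k)))))
      (normr_le_mul (f_b (x k0 0)) (q_b k l)).
    by move/le_trans; apply; lra.
- have [F_b G_b a_b a_0 q_b] := bnd x.
  have [Fh_b _ _ _ _] := bnd (x + h).
  rewrite !big_cons.
  set N := norm1 h; set y := x k0 0; set u := h k0 0.
  have N0 : 0 <= N by exact: norm1_ge0.
  have uN : `|u| <= N by exact: le_norm1.
  have uN2 : `|u ^+ 2| <= N ^+ 2 by rewrite normrX lerXn2r// nnegrE.
  have uN3 : `|u| ^+ 3 <= N ^+ 3 by rewrite lerXn2r// nnegrE.
  have := @mul_taylor C D N (f k0 (y + u)) (f k0 y) (f1 k0 y * u)
    (f2 k0 y * u ^+ 2) (F (x + h)) (F x) (\sum_k a x k * h k 0)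
    (\sum_k \sum_l q x k l * (h k 0 * h l 0)) N0 (f_b _) (f_b _)
    (normr_le_mul (f1_b _) uN) (normr_le_mul (f2_b _) uN2)
    (le_trans (f_t _ _) (ler_wpM2l C0 uN3)) (le_trans Fh_b D'D)
    (le_trans F_b D'D).
  have h1 : `|\sum_k a x k * h k 0| <= D * N.
    by rewrite linear_le_norm1// => k; exact: le_trans (a_b k) D'D.
  have h2 : `|\sum_k \sum_l q x k l * (h k 0 * h l 0)| <= D * N ^+ 2.
    by rewrite quadratic_le_norm1// => k l; exact: le_trans (q_b k l) D'D.
  move=> /(_ h1 h2 (le_trans (tay x h) (ler_wpM2r (exprn_ge0 _ N0) D'D))).
  rewrite !mxE; apply: le_trans; rewrite le_eqVlt; apply/orP; left; apply/eqP.
  congr `| _ - _ - _ / _|.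
  + under eq_bigr do rewrite mulrDl -!mulrA.
    rewrite big_split /= sum_dl -mulr_sumr -/y -/u; ring.
  + have -> : \sum_k \sum_l (dl k * dl l * (f2 k0 y * F x)
       + f1 k0 y * (dl k * a x l + dl l * a x k) + f k0 y * q x k l) * (h k 0 * h l 0)
      = \sum_k (dl k * (h k 0 * (f2 k0 y * F x * u))
       + dl k * (f1 k0 y * h k 0 * \sum_l a x l * h l 0)
       + f1 k0 y * u * (a x k * h k 0)
       + f k0 y * \sum_l q x k l * (h k 0 * h l 0)).
      apply: eq_bigr => k _.
      have -> : dl k * (h k 0 * (f2 k0 y * F x * u)) =
        \sum_l dl l * (dl k * (h k 0 * (f2 k0 y * F x * h l 0))).
        by rewrite sum_dl.
      have -> : f1 k0 y * u * (a x k * h k 0) =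
         \sum_l dl l * (f1 k0 y * h l 0 * (a x k * h k 0)) by rewrite sum_dl.
      rewrite !mulr_sumr -!big_split /=; apply: eq_bigr => l _; ring.
    rewrite !big_split /= !sum_dl -!mulr_sumr -/u; ring.
- have [F_b G_b a_b a_0 q_b] := bnd x.
  rewrite !big_cons.
  have [t0 t1] := andP t01.
  have tr_b : `|t ^+ 2 * \sum_k q x k k| <= D * t ^+ 2.
    rewrite mulrC; apply: normr_le_mul; last by rewrite ger0_norm ?exprn_ge0.
    apply: le_trans D'd; rewrite (le_trans (ler_norm_sum _ _ _))//.
    rewrite mulr_natr; have -> : D' *+ d = \sum_(k < d) D'.
      by rewrite sumr_const card_ord.
    by apply: ler_sum.
  have := @mul_taylor C D t (g k0 (x k0 0)) (f k0 (x k0 0)) 0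
    (t ^+ 2 * f2 k0 (x k0 0)) (\prod_(k <- r) g k (x k 0)) (F x) 0
    (t ^+ 2 * \sum_k q x k k) t0 (gC _ _) (f_b _).
  have t2_b : `|t ^+ 2 * f2 k0 (x k0 0)| <= C * t ^+ 2.
    by rewrite mulrC; apply: normr_le_mul => //; rewrite ger0_norm ?exprn_ge0.
  rewrite !normr0 !subr0 !mulr_ge0// => /(_ isT t2_b (gfC _ _)).
  move=> /(_ (le_trans G_b D'D) (le_trans F_b D'D) isT tr_b).
  move=> /(_ (le_trans (gau x) (ler_wpM2r (exprn_ge0 _ t0) D'D))).
  rewrite !mul0r !mulr0 !addr0 subr0.
  apply: le_trans; rewrite le_eqVlt; apply/orP; left; apply/eqP.
  congr `| _ - _ / _|.
  have -> : \sum_k (dl k * dl k * (f2 k0 (x k0 0) * F x) +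
     f1 k0 (x k0 0) * (dl k * a x k + dl k * a x k) + f k0 (x k0 0) * q x k k) =
    \sum_k (dl k * (dl k * (f2 k0 (x k0 0) * F x)) + dl k * (f1 k0 (x k0 0) * a x k * 2)
      + f k0 (x k0 0) * q x k k).
    apply: eq_bigr => k _; ring.
  rewrite !big_split /= !sum_dl -mulr_sumr a_0// /dl eqxx /=; ring.
Qed.

End taylor.

Section lindeberg.
Context {R : realType} {d : nat}.

(** One draw with mean zero against one step of smoothing: both expansions agree
    up to second order when the covariance of the draw is close to [t ^+ 2] times
    the identity. *)
Lemma one_step (C : R) : 0 <= C ->
  exists2 D : R, 0 <= D & forall (t : R) (f f1 f2 g : 'I_d -> R -> R),
  0 <= t <= 1 -> (forall k, smooth3 C (f k) (f1 k) (f2 k)) ->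
  (forall k y, `|g k y| <= C) ->
  (forall k y, `|g k y - f k y - t ^+ 2 * f2 k y / 2| <= C * t ^+ 3) ->
  forall n (p : 'I_n -> R) (xi : 'I_n -> 'cV[R]_d) (e m3 : R),
  0 <= e -> (forall i, 0 <= p i) -> \sum_i p i = 1 ->
  (forall k, \sum_i p i * xi i k 0 = 0) ->
  (forall k l, `|\sum_i p i * (xi i k 0 * xi i l 0) - t ^+ 2 * (k == l)%:R| <= e) ->
  \sum_i p i * norm1 (xi i) ^+ 3 <= m3 ->
  forall x : 'cV[R]_d,
  `|\sum_i p i * (\prod_k f k ((x + xi i) k 0)) - \prod_k g k (x k 0)|
    <= D * (e + m3 + t ^+ 3).
Proof.
move=> C0.
have [D D0 HD] := @prod_taylor R d C (index_enum 'I_d) (index_enum_uniq _) C0.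
exists (D * (1 + (d * d)%:R)); first by rewrite mulr_ge0// addr_ge0.
move=> t f f1 f2 g t01 fC gC gfC n p xi e m3 e0 p0 p1 xi0 xi2 xi3 x.
have [t0 t1] := andP t01.
have [a [q [/= bnd tay gau]]] := HD t f f1 f2 g t01 fC gC gfC.
have [F_b G_b a_b _ q_b] := bnd x.
set F := fun y : 'cV[R]_d => \prod_k f k (y k 0).
set G := \prod_k g k (x k 0).
set rem := fun h => F (x + h) - F x - \sum_k a x k * h k 0 -
         (\sum_k \sum_l q x k l * (h k 0 * h l 0)) / 2.
have -> : \sum_i p i * (\prod_k f k ((x + xi i) k 0)) - G =
   \sum_i p i * rem (xi i) +
   (\sum_k \sum_l q x k l *
      (\sum_i p i * (xi i k 0 * xi i l 0) - t ^+ 2 * (k == l)%:R)) / 2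
   - (G - F x - t ^+ 2 * (\sum_k q x k k) / 2).
  have -> : \sum_i p i * rem (xi i) = \sum_i p i * F (x + xi i) - F x
     - (\sum_k \sum_l q x k l * (\sum_i p i * (xi i k 0 * xi i l 0))) / 2.
    rewrite /rem; under eq_bigr do rewrite !mulrBr.
    rewrite !sumrB -mulr_suml p1 mul1r.
    have -> : \sum_i p i * (\sum_k a x k * xi i k 0) = 0.
      under eq_bigr do rewrite mulr_sumr.
      rewrite exchange_big big1//= => k _.
      by under eq_bigr do rewrite mulrCA; rewrite -mulr_sumr xi0 mulr0.
    rewrite subr0; congr (_ - _).
    under eq_bigr do rewrite mulrA.
    rewrite -mulr_suml; congr (_ / _).
    under eq_bigr do rewrite mulr_sumr.
    rewrite exchange_big; apply: eq_bigr => k _ /=.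
    under eq_bigr do rewrite mulr_sumr.
    rewrite exchange_big; apply: eq_bigr => l _ /=.
    by rewrite mulr_sumr; apply: eq_bigr => i _; rewrite mulrCA.
  have -> : \sum_k \sum_l q x k l *
      (\sum_i p i * (xi i k 0 * xi i l 0) - t ^+ 2 * (k == l)%:R) =
     \sum_k \sum_l q x k l * (\sum_i p i * (xi i k 0 * xi i l 0))
     - t ^+ 2 * \sum_k q x k k.
    rewrite mulr_sumr -sumrB; apply: eq_bigr => k _.
    under eq_bigr do rewrite mulrBr.
    rewrite sumrB; congr (_ - _); rewrite (bigD1 k)//= eqxx mulr1 mulrC big1 ?addr0//.
    by move=> l lk; rewrite eq_sym (negbTE lk) !mulr0.
  rewrite /F; ring.
have m30 : 0 <= m3.
  by apply: le_trans xi3; apply: sumr_ge0 => i _; rewrite mulr_ge0 ?exprn_ge0 ?norm1_ge0.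
have b1 : `|\sum_i p i * rem (xi i)| <= D * m3.
  rewrite (le_trans (ler_norm_sum _ _ _))//.
  apply: (@le_trans _ _ (D * \sum_i p i * norm1 (xi i) ^+ 3)); last exact: ler_wpM2l.
  rewrite mulr_sumr; apply: ler_sum => i _; rewrite normrM (ger0_norm (p0 i)).
  by rewrite [leRHS]mulrCA; apply: ler_wpM2l => //; exact: tay.
have b2 : `|(\sum_k \sum_l q x k l *
      (\sum_i p i * (xi i k 0 * xi i l 0) - t ^+ 2 * (k == l)%:R)) / 2|
   <= D * ((d * d)%:R * e).
  rewrite normrM (@ger0_norm _ 2^-1)//.
  apply: (@le_trans _ _ (`|\sum_k \sum_l q x k l *
      (\sum_i p i * (xi i k 0 * xi i l 0) - t ^+ 2 * (k == l)%:R)|)).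
    by rewrite ler_piMr//; lra.
  rewrite (le_trans (ler_norm_sum _ _ _))//.
  have -> : D * ((d * d)%:R * e) = \sum_(k < d) \sum_(l < d) D * e.
    by rewrite !sumr_const !card_ord -mulrnA -[in RHS]mulr_natr; ring.
  apply: ler_sum => k _; rewrite (le_trans (ler_norm_sum _ _ _))//.
  by apply: ler_sum => l _; exact: normr_le_mul.
apply: le_trans (normr_le_sub (normr_le_add b1 b2) (gau x)) _.
rewrite -!mulrDr -mulrA; apply: ler_wpM2l => //.
have : 0 <= (d * d)%:R * m3 by rewrite mulr_ge0.
have : 0 <= (d * d)%:R * t ^+ 3 by rewrite mulr_ge0 ?exprn_ge0.
lra.
Qed.


(** Telescoping the previous comparison: replacing the draws one at a time, the
    errors of the single steps add up. *)
Lemma lindeberg_comparison (C : R) : 0 <= C ->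
  exists2 D : R, 0 <= D & forall (t : R) (f f1 f2 : nat -> 'I_d -> R -> R),
  0 <= t <= 1 -> (forall j k, smooth3 C (f j k) (f1 j k) (f2 j k)) ->
  (forall j k y, `|f j.+1 k y - f j k y - t ^+ 2 * f2 j k y / 2| <= C * t ^+ 3) ->
  forall n (p : 'I_n -> R) (xi : 'I_n -> 'cV[R]_d) (e m3 : R),
  0 <= e -> (forall i, 0 <= p i) -> \sum_i p i = 1 ->
  (forall k, \sum_i p i * xi i k 0 = 0) ->
  (forall k l, `|\sum_i p i * (xi i k 0 * xi i l 0) - t ^+ 2 * (k == l)%:R| <= e) ->
  \sum_i p i * norm1 (xi i) ^+ 3 <= m3 ->
  forall s (x : 'cV[R]_d),
  `|walk p xi s (fun y => \prod_k f 0 k (y k 0)) x - \prod_k f s k (x k 0)|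
    <= s%:R * (D * (e + m3 + t ^+ 3)).
Proof.
move=> C0; have [D D0 HD] := one_step C0.
exists D => // t f f1 f2 t01 fC gfC n p xi e m3 e0 p0 p1 xi0 xi2 xi3.
elim=> [|s IH] x; first by rewrite walk0 subrr normr0 mul0r.
rewrite walkS.
have fb k y : `|f s.+1 k y| <= C by have [] := fC s.+1 k.
have := HD t (f s) (f1 s) (f2 s) (f s.+1) t01 (fC s) fb (gfC s)
  n p xi e m3 e0 p0 p1 xi0 xi2 xi3 x.
move=> step.
have IHx : `|\sum_i p i * (walk p xi s (fun y => \prod_k f 0 k (y k 0)) (x + xi i)
   - \prod_k f s k ((x + xi i) k 0))| <= s%:R * (D * (e + m3 + t ^+ 3)).
  rewrite (le_trans (ler_norm_sum _ _ _))//.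
  set b := (X in _ <= X).
  have -> : b = \sum_i p i * b by rewrite -mulr_suml p1 mul1r.
  apply: ler_sum => i _.
  by rewrite normrM (ger0_norm (p0 i)); apply: ler_wpM2l => //; exact: IH.
have := normr_le_add IHx step.
rewrite -natr1 mulrDl mul1r; apply: le_trans.
rewrite le_eqVlt; apply/orP; left; apply/eqP; congr `|_|.
rewrite addrA; congr (_ - _); rewrite -big_split /=; apply: eq_bigr => i _.
by rewrite -mulrDr subrK.
Qed.

End lindeberg.

Section normal_moments.
Import HBNNSimple.
Context {R : realType}.
Local Notation leb := (@lebesgue_measure R).
Local Notation N01 := (@normal_prob R 0 1).

Let integral_normal_fin (f : _ -> \bar R) : measurable_fun setT f ->
  (\int[N01]_x `|f x| < +oo)%E ->
  (\int[N01]_x f x = \int[leb]_x (f x * (normal_pdf 0 1 x)%:E))%E.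
Proof.
move=> mf finf.
have dom := @normal_prob_dominates R 0 1.
rewrite -(Radon_Nikodym_change_of_variables dom)//=; last first.
  by apply/integrableP; split.
apply: ae_eq_integral => //.
- exact: emeasurable_funM.
- apply: emeasurable_funM => //.
  by apply/measurable_EFinP; exact: measurable_normal_pdf.
- apply: ae_eqe_mul2l => /=.
  rewrite Radon_NikodymE//=.
  case: cid => /= h [h1 h2 h3].
  apply: integral_ae_eq => //=.
  + by apply/measurableT_comp => //; exact: measurable_normal_pdf.
  + by move=> E _ mE; rewrite -h3.
Qed.

Lemma ge0_integral_normal (f : _ -> \bar R) :
  measurable_fun setT f -> (forall x, 0 <= f x)%E ->
  (\int[N01]_x f x = \int[leb]_x (f x * (normal_pdf 0 1 x)%:E))%E.
Proof.
move=> mf f0.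
pose f_ := nnsfun_approx measurableT mf.
have pdf0 x : (0 <= (normal_pdf 0 1 x)%:E :> \bar R)%E.
  by rewrite lee_fin normal_pdf_ge0.
have mpdf : measurable_fun setT (fun x : R => (normal_pdf 0 1 x)%:E).
  by apply/measurable_EFinP; exact: measurable_normal_pdf.
transitivity (lim (\int[N01]_x (f_ n x)%:E @[n --> \oo])%E).
  rewrite -monotone_convergence//=.
  - apply: eq_integral => ? /[!inE] xD; apply/esym/cvg_lim => //=.
    exact: cvg_nnsfun_approx.
  - by move=> n; exact/measurable_EFinP/measurable_funTS.
  - by move=> n ? _; rewrite lee_fin.
  - by move=> ? _ ? ? mn; rewrite lee_fin; exact/lefP/nd_nnsfun_approx.
transitivity (lim (\int[leb]_x ((f_ n x)%:E * (normal_pdf 0 1 x)%:E) @[n --> \oo])%E).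
  apply: congr_lim; apply/funext => n /=.
  apply: integral_normal_fin; first exact/measurable_EFinP.
  under eq_integral do rewrite gee0_abs ?lee_fin//.
  have [M [Mreal Mf]] := simple_bounded (f_ n).
  apply: (@le_lt_trans _ _ (\int[N01]_x (cst (M + 1)%:E x))%E).
    apply: ge0_le_integral => //=.
    - by move=> x _; rewrite lee_fin.
    - exact/measurable_EFinP.
    - move=> x _; rewrite lee_fin.
      have := Mf (M + 1); rewrite ltrDl ltr01 => /(_ isT x I).
      by apply: le_trans; rewrite ler_norm.
  rewrite integral_cst//= probability_setT mule1.
  by rewrite ltry.
rewrite -monotone_convergence//=.
- apply: eq_integral => x _; apply/cvg_lim => //=.
  by apply: cvgeZr => //; exact: cvg_nnsfun_approx.
- by move=> n; apply: emeasurable_funM => //; exact/measurable_EFinP.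
- by move=> n x _; rewrite mule_ge0// lee_fin.
- move=> x _ n k nk; apply: lee_wpmul2r => //.
  by rewrite lee_fin; exact/lefP/nd_nnsfun_approx.
Qed.

Lemma normal_pdf01E x : normal_pdf 0 1 x = normal_peak 1 * expR (- (x ^+ 2 / 2)) :> R.
Proof.
by rewrite normal_pdfE ?oner_eq0// /normal_fun subr0 expr1n mulNr mulr2n.
Qed.

(** Both exponential moments come from the total mass of a normal density. *)
Lemma normal_expR_sqr (s : R) : 0 < s ->
  (\int[N01]_x (expR ((1 - s ^- 2) * x ^+ 2 / 2))%:E = s%:E)%E.
Proof.
move=> s0; have sn0 : s != 0 by rewrite gt_eqF.
rewrite ge0_integral_normal; last 2 first.
- by apply/measurable_EFinP; apply: measurableT_comp => //;
    do 3 apply: measurable_funM => //.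
- by move=> x; rewrite lee_fin expR_ge0.
have peakE : normal_peak 1 = s * normal_peak s.
  rewrite /normal_peak expr1n mul1r -mulrnAr sqrtrM ?sqr_ge0//.
  by rewrite sqrtr_sqr gtr0_norm// invfM mulVKf.
transitivity (\int[leb]_x (s%:E * (normal_pdf 0 s x)%:E))%E.
  apply: eq_integral => x _; rewrite -!EFinM normal_pdf01E normal_pdfE// /normal_fun subr0 peakE.
  rewrite mulrCA -expRD (mulrA s); congr ((_ * expR _)%:E).
  by rewrite -mulr_natr; field.
rewrite integralZl//; last exact: integrable_normal_pdf.
by rewrite integral_normal_pdf mule1.
Qed.

Lemma normal_expR_linear (a : R) :
  (\int[N01]_x (expR (a * x))%:E = (expR (a ^+ 2 / 2))%:E)%E.
Proof.
rewrite ge0_integral_normal; last 2 first.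
- by apply/measurable_EFinP; apply: measurableT_comp => //; apply: measurable_funM.
- by move=> x; rewrite lee_fin expR_ge0.
transitivity (\int[leb]_x ((expR (a ^+ 2 / 2))%:E * (normal_pdf a 1 x)%:E))%E.
  apply: eq_integral => x _; rewrite -!EFinM normal_pdf01E normal_pdfE ?oner_eq0// /normal_fun.
  rewrite (mulrCA (expR (a * x))) (mulrCA (expR (a ^+ 2 / 2))) -!expRD; congr ((_ * expR _)%:E).
  by rewrite -mulr_natr; field.
rewrite integralZl//; last exact: integrable_normal_pdf.
by rewrite integral_normal_pdf mule1.
Qed.

Lemma normal_integrable_dominated (f : R -> R) (K : R) : measurable_fun setT f ->
  (forall x, `|f x| <= K * expR (x ^+ 2 / 4)) -> N01.-integrable setT (EFin \o f).
Proof.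
move=> mf fK.
suff iK : N01.-integrable setT (fun x => (K%:E * (expR (x ^+ 2 / 4))%:E)%E).
  apply: le_integrable iK => //; first exact/measurable_EFinP.
  by move=> x _ /=; rewrite lee_fin (le_trans (fK x))// ler_norm.
apply: integrableZl => //; apply/integrableP; split.
    by apply/measurable_EFinP; apply: measurableT_comp => //; apply: measurable_funM.
have s0 : 0 < Num.sqrt 2 :> R by rewrite sqrtr_gt0.
suff -> : (\int[N01]_x `|(expR (x ^+ 2 / 4))%:E| = (Num.sqrt 2)%:E)%E by rewrite ltry.
rewrite -normal_expR_sqr//; apply: eq_integral => x _ /=.
rewrite ger0_norm ?expR_ge0// sqr_sqrtr//; congr ((expR _)%:E); by field.
Qed.

Lemma expR_sqr_ge4 (x : R) : x ^+ 4 <= 64 * expR (x ^+ 2 / 4).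
Proof.
have := expR_ge1Dx (x ^+ 2 / 8); have x20 := sqr_ge0 x.
set u := x ^+ 2 / 8 => hu.
rewrite (_ : x ^+ 2 / 4 = u + u) ?expRD; last by rewrite /u; field.
rewrite (_ : x ^+ 4 = 64 * (u * u)); last by rewrite /u; field.
have u0 : 0 <= u by rewrite divr_ge0.
rewrite ler_pM2l// ler_pM//; lra.
Qed.

Lemma normal_integrable_poly (f : R -> R) (K : R) : measurable_fun setT f -> 0 <= K ->
  (forall x, `|f x| <= K * (1 + x ^+ 4)) -> N01.-integrable setT (EFin \o f).
Proof.
move=> mf K0 fK; apply: (@normal_integrable_dominated _ (K * 65)) => // x.
rewrite (le_trans (fK x))// -mulrA ler_wpM2l//.
have := expR_sqr_ge4 x.
have : 1 <= expR (x ^+ 2 / 4) by rewrite -expR0 ler_expR divr_ge0 ?sqr_ge0.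
lra.
Qed.

Lemma le_sqr_1D4 (x : R) : x ^+ 2 <= 1 + x ^+ 4.
Proof. have := sqr_ge0 (x ^+ 2 - 2^-1); rewrite (_ : x ^+ 4 = (x ^+ 2) ^+ 2) ?exprM//; nra. Qed.

Lemma le_norm_1D4 (x : R) : `|x| <= 1 + x ^+ 4.
Proof.
have -> : x ^+ 4 = `|x| ^+ 4 by rewrite -normrX ger0_norm// exprn_even_ge0.
have := normr_ge0 x; set u := `|x| => u0; have := sqr_ge0 (u ^+ 2 - 2^-1).
rewrite (_ : u ^+ 4 = (u ^+ 2) ^+ 2) -?exprM//; have := sqr_ge0 (u - 2^-1); nra.
Qed.

Lemma le_cube_1D4 (x : R) : `|x| ^+ 3 <= 1 + x ^+ 4.
Proof.
have -> : x ^+ 4 = `|x| ^+ 4 by rewrite -normrX ger0_norm// exprn_even_ge0.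
have := normr_ge0 x; set u := `|x| => u0.
have [u1|u1] := leP u 1.
  have := @exprn_ile1 _ 3 _ u0 u1; have := exprn_ge0 4 u0; lra.
have : u ^+ 3 <= u ^+ 4 by rewrite (exprS _ 3); apply: ler_peMl; [exact: exprn_ge0|exact: ltW].
lra.
Qed.

Lemma normal_integrable_id : N01.-integrable setT (EFin \o (fun x : R => x)).
Proof. by apply: (@normal_integrable_poly _ 1) => // x; rewrite mul1r le_norm_1D4. Qed.

Lemma normal_integrable_sqr : N01.-integrable setT (EFin \o (fun x : R => x ^+ 2)).
Proof.
apply: (@normal_integrable_poly _ 1) => // x.
by rewrite mul1r ger0_norm ?sqr_ge0 ?le_sqr_1D4.
Qed.

Lemma normal_integrable_cube : N01.-integrable setT (EFin \o (fun x : R => `|x| ^+ 3)).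
Proof.
apply: (@normal_integrable_poly _ 1) => //.
  by apply: measurable_funX; exact: normr_measurable.
by move=> x; rewrite mul1r ger0_norm ?exprn_ge0 ?le_cube_1D4.
Qed.

Lemma normal_mean : \int[N01]_x x = 0 :> R.
Proof.
set e := \int[N01]_x x.
have key (a : R) : 1 + a * e <= expR (a ^+ 2 / 2).
  have -> : 1 + a * e = \int[N01]_x (1 + a * x).
    rewrite RintegralD//; first last.
    - apply: (@normal_integrable_poly _ `|a|) => //.
      by move=> x; rewrite normrM ler_wpM2l// le_norm_1D4.
    - by apply: (@normal_integrable_poly _ 1) => // x; rewrite normr1 mul1r lerDl
        exprn_even_ge0.
    rewrite RintegralZl//; last exact: normal_integrable_id.
    by rewrite Rintegral_cst//= probability_setT mulr1.
  have -> : expR (a ^+ 2 / 2) = \int[N01]_x expR (a * x).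
    by rewrite /Rintegral normal_expR_linear.
  have mexp : measurable_fun setT (fun x : R => expR (a * x)).
    by apply: measurableT_comp => //; apply: measurable_funM.
  apply: le_Rintegral => //.
  - apply: (@normal_integrable_poly _ (1 + `|a|)) => //.
    + by apply: measurable_funD => //; apply: measurable_funM.
    + move=> x; rewrite mulrDl mul1r normr_le_add//.
        by rewrite normr1 lerDl exprn_even_ge0.
      by rewrite normrM ler_wpM2l// le_norm_1D4.
  - apply/integrableP; split; first exact/measurable_EFinP.
    under eq_integral do rewrite /= ger0_norm ?expR_ge0//.
    by rewrite normal_expR_linear ltry.
  - by move=> x _; exact: expR_ge1Dx.
have small (a : R) : `|a| <= 1 -> a * e <= a ^+ 2.
  move=> a1; have a2 : a ^+ 2 <= 1.
    by rewrite -real_normK ?num_real// exprn_ile1.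
  have h := expR_ge1Dx (- (a ^+ 2 / 2)).
  have h2 := key a; have a20 := sqr_ge0 a.
  have : expR (a ^+ 2 / 2) * expR (- (a ^+ 2 / 2)) = 1 by rewrite -expRD subrr expR0.
  nra.
have e1 : 0 < 1 + `|e| by rewrite ltr_pwDl.
have := small (e / (1 + `|e|)).
rewrite normf_div (ger0_norm (ltW e1)) ler_pdivrMr// mul1r lerDr ler01.
move=> /(_ isT).
rewrite expr_div_n mulrAC -expr2 ler_pdivrMr// -mulrA.
rewrite (_ : (1 + `|e|) ^- 2 * (1 + `|e|) = (1 + `|e|)^-1); last first.
  by rewrite expr2 invfM mulfVK// gt_eqF.
rewrite ler_pdivlMr//  => h.
have : e ^+ 2 * `|e| <= 0 by lra.
rewrite -real_normK ?num_real// -exprSr => h3.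
have : `|e| ^+ 3 == 0 by rewrite eq_le h3 exprn_ge0.
by rewrite expf_eq0 /= normr_eq0 => /eqP.
Qed.

Lemma normal_variance : \int[N01]_x x ^+ 2 = 1 :> R.
Proof.
set v := \int[N01]_x x ^+ 2.
have key (s : R) : 0 < s -> 1 + (1 - s ^- 2) / 2 * v <= s.
  move=> s0.
  set c := (1 - s ^- 2) / 2.
  have -> : 1 + c * v = \int[N01]_x (1 + c * x ^+ 2).
    rewrite RintegralD//; first last.
    - apply: (@normal_integrable_poly _ `|c|) => //; first by apply: measurable_funM.
      by move=> x; rewrite normrM ler_wpM2l// ger0_norm ?sqr_ge0 ?le_sqr_1D4.
    - by apply: (@normal_integrable_poly _ 1) => // x; rewrite normr1 mul1r lerDl
        exprn_even_ge0.
    rewrite RintegralZl//; last exact: normal_integrable_sqr.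
    by rewrite Rintegral_cst//= probability_setT mulr1.
  have -> : s = \int[N01]_x expR ((1 - s ^- 2) * x ^+ 2 / 2).
    by rewrite /Rintegral normal_expR_sqr.
  have mexp : measurable_fun setT (fun x : R => expR ((1 - s ^- 2) * x ^+ 2 / 2)).
    by apply: measurableT_comp => //; do 2 apply: measurable_funM => //.
  apply: le_Rintegral => //.
  - apply: (@normal_integrable_poly _ (1 + `|c|)) => //.
    + by apply: measurable_funD => //; apply: measurable_funM.
    + move=> x; rewrite mulrDl mul1r normr_le_add//.
        by rewrite normr1 lerDl exprn_even_ge0.
      by rewrite normrM ler_wpM2l// ger0_norm ?sqr_ge0 ?le_sqr_1D4.
  - apply/integrableP; split; first exact/measurable_EFinP.
    under eq_integral do rewrite /= ger0_norm ?expR_ge0//.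
    by rewrite normal_expR_sqr// ltry.
  - move=> x _; rewrite /c mulrAC; exact: expR_ge1Dx.
have v0 : 0 <= v by apply: Rintegral_ge0 => x _; rewrite sqr_ge0.
have key2 (s : R) : 0 < s -> (s ^+ 2 - 1) * v <= 2 * s ^+ 2 * (s - 1).
  move=> s0; have := key s s0; rewrite -(ler_pM2l (_ : 0 < 2 * s ^+ 2)).
    have sn0 : s != 0 by rewrite gt_eqF.
    rewrite (_ : _ * (1 + _) = 2 * s ^+ 2 + (s ^+ 2 - 1) * v); last by field.
    lra.
  by rewrite mulr_gt0 ?exprn_gt0.
apply/eqP; rewrite eq_le; apply/andP; split; rewrite leNgt; apply/negP => v1.
- have r1 : 1 < (1 + v) / 2 by lra.
  have s0 : 0 < Num.sqrt ((1 + v) / 2) by rewrite sqrtr_gt0; lra.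
  have := key2 _ s0; rewrite sqr_sqrtr; last by lra.
  have : 1 < Num.sqrt ((1 + v) / 2) by rewrite -[ltLHS]sqrtr1 ltr_sqrt//; lra.
  have := sqr_sqrtr (_ : 0 <= (1 + v) / 2); set s := Num.sqrt _ in s0 * => sE.
  have {}sE : s ^+ 2 = (1 + v) / 2 by apply: sE; lra.
  move=> s1 h; have hv : v = 2 * s ^+ 2 - 1 by rewrite sE; lra.
  have : (s - 1) * ((s + 1) * v - 2 * s ^+ 2) <= 0 by rewrite hv; rewrite -sE in h; nra.
  rewrite pmulr_rle0; last by lra.
  rewrite hv; nra.
- have s0 : 0 < Num.sqrt ((1 + v) / 2) by rewrite sqrtr_gt0; lra.
  have := key2 _ s0; rewrite sqr_sqrtr; last by lra.
  have : Num.sqrt ((1 + v) / 2) < 1 by rewrite -[ltRHS]sqrtr1 ltr_sqrt//; lra.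
  have := sqr_sqrtr (_ : 0 <= (1 + v) / 2); set s := Num.sqrt _ in s0 * => sE.
  have {}sE : s ^+ 2 = (1 + v) / 2 by apply: sE; lra.
  move=> s1 h; have hv : v = 2 * s ^+ 2 - 1 by rewrite sE; lra.
  have : (1 - s) * (2 * s ^+ 2 - (s + 1) * v) <= 0 by rewrite hv; rewrite -sE in h; nra.
  rewrite pmulr_rle0; last by lra.
  rewrite hv; nra.
Qed.

End normal_moments.

Section smoothing.
Context {R : realType}.
Local Notation leb := (@lebesgue_measure R).
Local Notation N01 := (@normal_prob R 0 1).

(** The law of [y + t * N] for a standard normal [N], integrated against [f]. *)
Definition smoothing (t : R) (f : R -> R) (y : R) : R := \int[N01]_x f (y + t * x).

Lemma measurable_affine_comp (f : R -> R) (y t : R) : measurable_fun setT f ->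
  measurable_fun setT (fun x => f (y + t * x)).
Proof.
by move=> mf; apply: measurableT_comp => //; apply: measurable_funD => //;
  apply: measurable_funM.
Qed.

Lemma normal_integrable_bounded (f : R -> R) (C : R) : measurable_fun setT f ->
  (forall x, `|f x| <= C) -> N01.-integrable setT (EFin \o f).
Proof.
move=> mf fC; have C0 : 0 <= C by exact: le_trans (fC 0).
apply: (@normal_integrable_poly _ f C) => // x.
by rewrite (le_trans (fC x))// ler_peMr// lerDl exprn_even_ge0.
Qed.

Lemma smoothing_integrable (f : R -> R) (C y t : R) : measurable_fun setT f ->
  (forall x, `|f x| <= C) -> N01.-integrable setT (EFin \o (fun x => f (y + t * x))).
Proof.
move=> mf fC; apply: (@normal_integrable_bounded _ C) => //.
exact: measurable_affine_comp.
Qed.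

Lemma normal_Rintegral_cst (c : R) : \int[N01]_x (cst c x) = c.
Proof. by rewrite Rintegral_cst//= probability_setT mulr1. Qed.

Lemma smoothing_bounded (f : R -> R) (C t y : R) : measurable_fun setT f ->
  (forall x, `|f x| <= C) -> `|smoothing t f y| <= C.
Proof.
move=> mf fC; rewrite /smoothing.
apply: le_trans (le_normr_Rintegral measurableT (smoothing_integrable y t mf fC)) _.
rewrite -[leRHS]normal_Rintegral_cst; apply: le_Rintegral => //.
- apply: (@normal_integrable_bounded _ C).
    by apply: measurableT_comp => //; exact: measurable_affine_comp.
  by move=> x; rewrite normr_id.
- by apply: (@normal_integrable_bounded _ `|C|).
Qed.

Lemma measurable_smoothing (f : R -> R) (C t : R) : measurable_fun setT f ->
  (forall x, `|f x| <= C) -> measurable_fun setT (smoothing t f).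
Proof.
move=> mf fC.
have C0 : 0 <= C by exact: le_trans (fC 0).
pose g (z : R * R) : \bar R := (f (z.1 + t * z.2) + C)%:E.
have mg : measurable_fun setT g.
  apply/measurable_EFinP; apply: measurable_funD => //.
  by apply: measurableT_comp => //; apply: measurable_funD => //;
    apply: measurable_funM.
have g0 z : (0 <= g z)%E.
  by rewrite lee_fin -lerBlDr sub0r; have := fC (z.1 + t * z.2); rewrite ler_norml => /andP[].
have := @measurable_fun_fubini_tonelli_F _ _ _ _ _ N01 g mg g0.
move=> mF.
have -> : smoothing t f = (fun y => fine (\int[N01]_x g (y, x)) - C).
  apply/funext => y; apply/esym/eqP; rewrite subr_eq; apply/eqP.
  rewrite -[C in RHS]normal_Rintegral_cst -RintegralD//.
    exact: smoothing_integrable fC.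
  by apply: (@normal_integrable_bounded _ C) => // x; rewrite ger0_norm.
by apply: measurable_funB => //; apply: measurableT_comp.
Qed.

Definition bounded_measurable (f : R -> R) : Prop :=
  measurable_fun setT f /\ exists C, forall x, `|f x| <= C.

Lemma bounded_measurableD f g : bounded_measurable f -> bounded_measurable g ->
  bounded_measurable (fun x => f x + g x).
Proof.
move=> [mf [C fC]] [mg [D gD]]; split; first exact: measurable_funD.
by exists (C + D) => x; exact: normr_le_add.
Qed.

Lemma bounded_measurableZ f c : bounded_measurable f ->
  bounded_measurable (fun x => f x * c).
Proof.
move=> [mf [C fC]]; split; first by apply: measurable_funM.
by exists (C * `|c|) => x; exact: normr_le_mul.
Qed.

Lemma bounded_measurable_affine f y t : bounded_measurable f ->
  bounded_measurable (fun x => f (y + t * x)).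
Proof. by move=> [mf [C fC]]; split; [exact: measurable_affine_comp|exists C]. Qed.

Lemma bounded_measurable_integrable f : bounded_measurable f ->
  N01.-integrable setT (EFin \o f).
Proof. by move=> [mf [C fC]]; exact: normal_integrable_bounded fC. Qed.

Lemma smoothingD f g t y : bounded_measurable f -> bounded_measurable g ->
  smoothing t (fun x => f x + g x) y = smoothing t f y + smoothing t g y.
Proof.
by move=> bf bg; apply: RintegralD => //; apply: bounded_measurable_integrable;
  exact: bounded_measurable_affine.
Qed.

Lemma smoothingZ f c t y : bounded_measurable f ->
  smoothing t (fun x => f x * c) y = smoothing t f y * c.
Proof.
by move=> bf; apply: RintegralZr => //; apply: bounded_measurable_integrable;
  exact: bounded_measurable_affine.
Qed.

Lemma smooth3_smoothing (C t : R) (f f1 f2 : R -> R) : smooth3 C f f1 f2 ->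
  measurable_fun setT f -> measurable_fun setT f1 -> measurable_fun setT f2 ->
  smooth3 C (smoothing t f) (smoothing t f1) (smoothing t f2).
Proof.
move=> [fC f1C f2C tay] mf mf1 mf2.
split; [by move=> y; exact: smoothing_bounded..|move=> y h].
have bf : bounded_measurable f by split; [|exists C].
have bf1 : bounded_measurable f1 by split; [|exists C].
have bf2 : bounded_measurable f2 by split; [|exists C].
have bfh : bounded_measurable (fun x => f (x + h)).
  split; last by exists C.
  by apply: measurableT_comp => //; apply: measurable_funD.
pose r x := f (x + h) + (f x * -1 + (f1 x * - h + f2 x * - (h ^+ 2 / 2))).
have b2 : bounded_measurable (fun x => f1 x * - h + f2 x * - (h ^+ 2 / 2)).
  by apply: bounded_measurableD; exact: bounded_measurableZ.
have b1 : bounded_measurable (fun x => f x * -1 + (f1 x * - h + f2 x * - (h ^+ 2 / 2))).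
  by apply: bounded_measurableD => //; exact: bounded_measurableZ.
have [mr _] : bounded_measurable r by exact: bounded_measurableD.
have -> : smoothing t f (y + h) - smoothing t f y - smoothing t f1 y * h -
    smoothing t f2 y * h ^+ 2 / 2 = smoothing t r y.
  rewrite /r smoothingD// smoothingD//; last exact: bounded_measurableZ.
  rewrite smoothingD; [|exact: bounded_measurableZ..].
  rewrite !smoothingZ//.
  have -> : smoothing t (fun x => f (x + h)) y = smoothing t f (y + h).
    by apply: eq_Rintegral => x _; rewrite addrAC.
  by ring.
apply: smoothing_bounded => // x.
rewrite (_ : r x = f (x + h) - f x - f1 x * h - f2 x * h ^+ 2 / 2)//.
by rewrite /r; ring.
Qed.

Lemma smoothing_step (C t : R) (f f1 f2 : R -> R) y : 0 <= t -> smooth3 C f f1 f2 ->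
  measurable_fun setT f ->
  `|smoothing t f y - f y - t ^+ 2 * f2 y / 2| <=
    C * \int[N01]_x `|x| ^+ 3 * t ^+ 3.
Proof.
move=> t0 [fC f1C f2C tay] mf.
have bf : bounded_measurable f by split; [|exists C].
have i0 := bounded_measurable_integrable (bounded_measurable_affine y t bf).
have i1 : N01.-integrable setT (EFin \o (fun x : R => f1 y * t * x)).
  rewrite (_ : EFin \o _ = (fun x => (f1 y * t)%:E * x%:E)%E)//.
  by apply: integrableZl => //; exact: normal_integrable_id.
have i2 : N01.-integrable setT (EFin \o (fun x : R => f2 y * t ^+ 2 / 2 * x ^+ 2)).
  rewrite (_ : EFin \o _ = (fun x => (f2 y * t ^+ 2 / 2)%:E * (x ^+ 2)%:E)%E)//.
  by apply: integrableZl => //; exact: normal_integrable_sqr.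
have ic : N01.-integrable setT (EFin \o cst (f y)).
  by apply: (@normal_integrable_bounded _ `|f y|).
have i01 := integrableB measurableT i0 ic.
have i02 := integrableB measurableT i01 i1.
pose r (x : R) := f (y + t * x) - f y - f1 y * t * x - f2 y * t ^+ 2 / 2 * x ^+ 2.
have i03 : N01.-integrable setT (EFin \o r) := integrableB measurableT i02 i2.
have -> : smoothing t f y - f y - t ^+ 2 * f2 y / 2 =
   \int[N01]_x r x.
  rewrite /r RintegralB// RintegralB// RintegralB//.
  rewrite RintegralZl//; last exact: normal_integrable_id.
  rewrite RintegralZl//; last exact: normal_integrable_sqr.
  rewrite normal_mean normal_variance (normal_Rintegral_cst (f y)) mulr0 mulr1 subr0.
  by rewrite /smoothing; congr (_ - _ - _); ring.
apply: le_trans (le_normr_Rintegral measurableT i03) _.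
rewrite mulrAC -RintegralZl//; last exact: normal_integrable_cube.
apply: le_Rintegral => //.
- exact: (integrable_norm i03).
- rewrite (_ : EFin \o _ = (fun x => (C * t ^+ 3)%:E * (`|x| ^+ 3)%:E)%E)//.
  by apply: integrableZl => //; exact: normal_integrable_cube.
- move=> x _; rewrite [leRHS](_ : _ = C * `|t * x| ^+ 3); last first.
    by rewrite normrM exprMn (ger0_norm t0); ring.
  apply: le_trans (tay y (t * x)).
  rewrite le_eqVlt; apply/orP; left; apply/eqP; congr `|_|.
  by rewrite /r exprMn; field.
Qed.

Lemma smooth3_continuous (C : R) (f f1 f2 : R -> R) : smooth3 C f f1 f2 ->
  continuous f.
Proof.
move=> [fC f1C f2C tay] y.
have C0 : 0 <= C by exact: le_trans (fC 0).
have lip h : `|h| <= 1 -> `|f (y + h) - f y| <= 3 * C * `|h|.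
  move=> h1; have h0 := normr_ge0 h.
  have e1 : `|f1 y * h| <= C * `|h| by rewrite normrM ler_wpM2r.
  have e2 : `|f2 y * h ^+ 2 / 2| <= C * `|h|.
    rewrite normrM (normrM (f2 y)) (@ger0_norm _ 2^-1)// normrX.
    have f2y := f2C y; have f20 := normr_ge0 (f2 y).
    apply: (@le_trans _ _ (C * `|h| ^+ 2 / 2)).
      by rewrite ler_wpM2r// ler_wpM2r// exprn_ge0.
    have h2 : `|h| ^+ 2 <= `|h| by rewrite expr2 ler_piMr.
    have := ler_wpM2l C0 h2; have : 0 <= C * `|h| ^+ 2 by rewrite mulr_ge0 ?exprn_ge0.
    lra.
  have e3 : C * `|h| ^+ 3 <= C * `|h|.
    by apply: ler_wpM2l => //; rewrite -[leRHS]expr1 ler_wiXn2l.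
  rewrite (_ : _ - _ = f (y + h) - f y - f1 y * h - f2 y * h ^+ 2 / 2 + f1 y * h
     + f2 y * h ^+ 2 / 2); last by ring.
  have := normr_le_add (normr_le_add (le_trans (tay y h) e3) e1) e2.
  by move/le_trans; apply; lra.
apply/cvgrPdist_le => e e0.
have D0 : 0 < 3 * C + 1 by lra.
near=> x.
have xy : `|x - y| <= e / (3 * C + 1).
  rewrite distrC; near: x; apply: (@cvgr_dist_le _ _ _ _ _ (fun x => x)) => //.
  by rewrite divr_gt0.
have xy1 : `|x - y| <= 1.
  by rewrite distrC; near: x; apply: (@cvgr_dist_le _ _ _ _ _ (fun x => x)).
rewrite distrC; have := lip _ xy1; rewrite (addrC y) subrK => /le_trans; apply.
move: xy; rewrite ler_pdivlMr// => xy.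
have := normr_ge0 (x - y); nra.
Unshelve. all: by end_near. Qed.

Lemma integral_affine_substitution (G : R -> R) (c b : R) : 0 < c -> continuous G ->
  (forall x, 0 <= G x) ->
  (\int[leb]_x (G x)%:E = \int[leb]_x (G (c * x + b) * c)%:E)%E.
Proof.
move=> c0 cG G0.
pose F x : R := c * x + b.
have dF (x : R) : is_derive x 1 F c.
  have -> : F = (c \*: id) + cst b by [].
  by apply: is_derive_eq; rewrite addr0 scaler1.
have F'E : (F^`())%classic = cst c.
  by apply/funext => x; rewrite derive1E; have := dF x => ?; rewrite derive_val.
rewrite (@increasing_ge0_integration_by_substitutionT _ F G)//.
- by apply: eq_integral => x _; rewrite F'E.
- by move=> x z xz; rewrite /F ltrD2r ltr_pM2l.
- by rewrite F'E => ?; exact: cvg_cst.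
- by rewrite F'E; exact: is_cvg_cst.
- by rewrite F'E; exact: is_cvg_cst.
- rewrite /F; have -> : (fun x => c * x + b) = (fun x => (x - - (b / c)) * c).
    by apply/funext => x; field; rewrite gt_eqF.
  by apply/gt0_cvgMlNy => //; exact: cvg_addrr_Ny.
- rewrite /F; have -> : (fun x => c * x + b) = (fun x => (x - - (b / c)) * c).
    by apply/funext => x; field; rewrite gt_eqF.
  by apply/gt0_cvgMly => //; exact: cvg_addrr.
Qed.

Lemma normal_peakE (s : R) : 0 < s -> normal_peak 1 = s * normal_peak s.
Proof.
move=> s0; have sn0 : s != 0 by rewrite gt_eqF.
rewrite /normal_peak expr1n mul1r -mulrnAr sqrtrM ?sqr_ge0//.
by rewrite sqrtr_sqr gtr0_norm// invfM mulVKf.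
Qed.

(** Stability of the normal law under independent sums, in the form of the
    semigroup property.  After the substitution [c = (s a + t b) / r] in the inner
    integral, completing the square makes the law of [c] standard normal. *)
Lemma smoothing_semigroup (s t : R) (f : R -> R) y : 0 < s -> 0 < t ->
  continuous f -> (forall x, 0 <= f x <= 1) ->
  smoothing s (smoothing t f) y = smoothing (Num.sqrt (s ^+ 2 + t ^+ 2)) f y.
Proof.
move=> s0 t0 cf f01.
have sn0 : s != 0 by rewrite gt_eqF.
have tn0 : t != 0 by rewrite gt_eqF.
set r := Num.sqrt _.
have r0 : 0 < r by rewrite sqrtr_gt0 addr_gt0 ?exprn_gt0.
have rn0 : r != 0 by rewrite gt_eqF.
have rE : r ^+ 2 = s ^+ 2 + t ^+ 2 by rewrite sqr_sqrtr// addr_ge0 ?sqr_ge0.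
have f0 x : 0 <= f x by case/andP: (f01 x).
have fC x : `|f x| <= 1 by rewrite ger0_norm//; case/andP: (f01 x).
have mf : measurable_fun setT f by exact: continuous_measurable_fun.
have iN (g : R -> R) u z : measurable_fun setT g -> (forall x, `|g x| <= 1) ->
    (\int[N01]_x (g (z + u * x))%:E)%E = (smoothing u g z)%:E.
  move=> mg gC; rewrite /smoothing /Rintegral fineK//.
  by apply: integrable_fin_num => //; exact: smoothing_integrable gC.
have n0 x : 0 <= normal_pdf 0 1 x :> R by exact: normal_pdf_ge0.
have mn : measurable_fun setT (@normal_pdf R 0 1) by exact: measurable_normal_pdf.
have inner a : (\int[N01]_b (f (y + s * a + t * b))%:E =
   \int[leb]_c (f (y + r * c) * normal_pdf 0 1 ((r * c - s * a) / t) * (r / t))%:E)%E.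
  rewrite ge0_integral_normal; last 2 first.
  - by apply/measurable_EFinP; exact: measurable_affine_comp.
  - by move=> x; rewrite lee_fin.
  under eq_integral do rewrite -EFinM.
  rewrite (@integral_affine_substitution
     (fun b => f (y + s * a + t * b) * normal_pdf 0 1 b) (r / t) (- (s * a / t)))//.
  - apply: eq_integral => c _; congr (((f _) * normal_pdf _ _ _ * _)%:E); by field.
  - by rewrite divr_gt0.
  - move=> x; apply: cvgM; last by apply: continuous_normal_pdf; rewrite oner_eq0.
    apply: (@cvg_comp _ _ _ (fun b => y + s * a + t * b) f); last exact: cf.
    apply: (@cvgD _ R^o); first exact: cvg_cst.
    by apply: cvgM; [exact: cvg_cst|exact: cvg_id].
  - by move=> x; rewrite mulr_ge0.
apply: EFin_inj.
rewrite -(iN (smoothing t f)); first last.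
- by move=> x; exact: smoothing_bounded.
- exact: measurable_smoothing fC.
rewrite -(iN f)//.
under eq_integral do rewrite -iN// inner.
pose h (z : R * R) : \bar R :=
  (f (y + r * z.2) * normal_pdf 0 1 ((r * z.2 - s * z.1) / t) * (r / t))%:E.
have mh : measurable_fun setT h.
  apply/measurable_EFinP; apply: measurable_funM => //; apply: measurable_funM.
    by apply: measurableT_comp => //; apply: measurable_funD => //;
      apply: measurable_funM.
  apply: measurableT_comp => //; apply: measurable_funM => //.
  apply: measurable_funB; apply: measurable_funM => //.
have h0 z : (0 <= h z)%E.
  rewrite lee_fin; apply: mulr_ge0; first exact: mulr_ge0.
  by apply: divr_ge0; exact: ltW.
have mF : measurable_fun setT (fun a => \int[leb]_c h (a, c))%E :=
  @measurable_fun_fubini_tonelli_F _ _ _ _ _ leb h mh h0.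
rewrite [LHS]ge0_integral_normal; last 2 first.
- exact: mF.
- by move=> x; apply: integral_ge0 => c _; exact: (h0 (x, c)).
pose k (z : R * R) : \bar R := (h z * (normal_pdf 0 1 z.1)%:E)%E.
have mk : measurable_fun setT k.
  by apply: emeasurable_funM => //; apply/measurable_EFinP; apply: measurableT_comp.
have k0 z : (0 <= k z)%E by rewrite mule_ge0// lee_fin.
transitivity (\int[leb]_a \int[leb]_c k (a, c))%E.
  apply: eq_integral => a _; rewrite /k -ge0_integralZr//.
  - exact: (measurableT_comp mh (pair1_measurable a)).
  - by move=> c _; exact: (h0 (a, c)).
  - by rewrite lee_fin.
transitivity (\int[leb]_c \int[leb]_a k (a, c))%E.
  exact: (@fubini_tonelli _ _ _ _ _ leb leb k mk k0).
rewrite ge0_integral_normal; last 2 first.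
- by apply/measurable_EFinP; exact: measurable_affine_comp.
- by move=> x; rewrite lee_fin.
apply: eq_integral => c _.
have tr0 : 0 < t / r by rewrite divr_gt0.
transitivity (\int[leb]_a ((f (y + r * c) * normal_pdf 0 1 c)%:E
    * (normal_pdf (c * s / r) (t / r) a)%:E))%E.
  apply: eq_integral => a _; rewrite /k /h /= -!EFinM; congr EFin.
  rewrite -!mulrA; congr (_ * _).
  rewrite !normal_pdf01E normal_pdfE ?gt_eqF// /normal_fun.
  rewrite (normal_peakE tr0).
  set eA := expR (- (_ / 2)); set eB := expR (- (a ^+ 2 / 2)).
  set eC := expR (- (c ^+ 2 / 2)); set eD := expR (_ / _).
  have eE : eA * eB = eC * eD.
    rewrite -!expRD; congr expR; apply/eqP; rewrite -subr_eq0 -mulr_natr; apply/eqP.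
    transitivity ((a ^+ 2 - c ^+ 2) * (r ^+ 2 - (s ^+ 2 + t ^+ 2)) / (2 * t ^+ 2)).
      by field; rewrite rn0 tn0.
    by rewrite rE subrr mulr0 mul0r.
  transitivity (t / r * normal_peak (t / r) ^+ 2 * (eA * eB)).
    by field; rewrite rn0 tn0.
  by rewrite eE; ring.
rewrite integralZl//; last exact: integrable_normal_pdf.
by rewrite integral_normal_pdf mule1 EFinM.
Qed.

End smoothing.

Section smooth_step.
Context {R : realType}.

(** Truncated cubes [max 0 y ^ 3] have an exact second-order expansion with
    remainder at most [|h| ^ 3]; the step is a combination of four of them, the
    integral of a quadratic B-spline. *)
Let pos (y : R) : R := Num.max 0 y.

Lemma pos_cube_taylor (y h : R) :
  `|pos (y + h) ^+ 3 - pos y ^+ 3 - 3 * pos y ^+ 2 * h - 3 * pos y * h ^+ 2|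
    <= `|h| ^+ 3.
Proof.
rewrite /pos !maxEle.
have [y0|y0] := leP 0 y; have [yh|yh] := leP 0 (y + h).
- by rewrite (_ : _ - _ = h ^+ 3) ?normrX//; ring.
- have hn : h < 0 by lra.
  rewrite (_ : _ - _ = h ^+ 3 - (y + h) ^+ 3); last by ring.
  rewrite (ltr0_norm hn) (_ : (- h) ^+ 3 = - h ^+ 3); last by ring.
  have h1 : h ^+ 3 <= (y + h) ^+ 3.
    rewrite -subr_ge0 (_ : _ - _ = y * ((y + h) ^+ 2 + (y + h) * h + h ^+ 2));
      last by ring.
    rewrite mulr_ge0// addr_ge0 ?sqr_ge0// addr_ge0 ?sqr_ge0//.
    by rewrite -mulrNN mulr_ge0// oppr_ge0 ltW.
  have h2 : (y + h) ^+ 3 <= 0 by rewrite exprn_odd_le0 ?ltW.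
  rewrite ler0_norm; lra.
- have hp : 0 < h by lra.
  rewrite (_ : _ - _ = (y + h) ^+ 3); last by ring.
  rewrite (gtr0_norm hp) ger0_norm ?exprn_ge0//.
  by apply: lerXn2r; rewrite ?nnegrE; lra.
- rewrite (_ : _ - _ = 0); last by ring.
  by rewrite normr0 exprn_ge0.
Qed.

Let spline (y : R) : R :=
  1 - (pos y ^+ 3 - 3 * pos (y - 1) ^+ 3 + 3 * pos (y - 2) ^+ 3 - pos (y - 3) ^+ 3) / 6.
Let spline1 (y : R) : R :=
  - (pos y ^+ 2 - 3 * pos (y - 1) ^+ 2 + 3 * pos (y - 2) ^+ 2 - pos (y - 3) ^+ 2) / 2.
Let spline2 (y : R) : R :=
  - (pos y - 3 * pos (y - 1) + 3 * pos (y - 2) - pos (y - 3)).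

Let posE0 (y : R) : y <= 0 -> pos y = 0.
Proof. by move=> y0; apply/max_idPl. Qed.

Let posE1 (y : R) : 0 <= y -> pos y = y.
Proof. by move=> y0; apply/max_idPr. Qed.

Let split4 (P : R -> Prop) :
  (forall y, y <= 0 -> P y) -> (forall y, 0 <= y <= 1 -> P y) ->
  (forall y, 1 <= y <= 2 -> P y) -> (forall y, 2 <= y <= 3 -> P y) ->
  (forall y, 3 <= y -> P y) -> forall y, P y.
Proof.
move=> P0 P1 P2 P3 P4 y; have [/P0//|y0] := leP y 0.
have [y1|y1] := leP y 1; first by apply: P1; lra.
have [y2|y2] := leP y 2; first by apply: P2; lra.
have [y3|y3] := leP y 3; first by apply: P3; lra.
by apply: P4; lra.
Qed.

Let spline_lo y : y <= 0 -> spline y = 1.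
Proof. by move=> y0; rewrite /spline !posE0; [ring|lra..]. Qed.

Let spline_hi y : 3 <= y -> spline y = 0.
Proof. by move=> y0; rewrite /spline !posE1; [field|lra..]. Qed.

Let spline_ge0_le1 y : 0 <= spline y <= 1.
Proof.
elim/split4: y => y hy.
- by rewrite spline_lo// ler01 lexx.
- rewrite /spline (posE1 (_ : 0 <= y)) ?(posE0 (_ : _ - _ <= 0)); try lra.
  have : y ^+ 3 <= 1 by rewrite exprn_ile1//; lra.
  have : 0 <= y ^+ 3 by rewrite exprn_ge0//; lra.
  lra.
- rewrite /spline !(posE1 (_ : 0 <= y), posE1 (_ : 0 <= y - 1),
    posE0 (_ : y - 2 <= 0), posE0 (_ : y - 3 <= 0)); try lra.
  rewrite (_ : 1 - _ = (2 - y) * (4 + (y - 1) - 2 * (y - 1) ^+ 2) / 6 + 6^-1);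
    last by field.
  have u1 : (y - 1) ^+ 2 <= 1 by rewrite exprn_ile1//; lra.
  have u0 : 0 <= (y - 1) ^+ 2 by rewrite sqr_ge0.
  have v0 : 0 <= (2 - y) * (4 + (y - 1) - 2 * (y - 1) ^+ 2).
    by rewrite mulr_ge0//; lra.
  have : (2 - y) * (4 + (y - 1) - 2 * (y - 1) ^+ 2) <= 1 * 5.
    by rewrite ler_pM//; lra.
  lra.
- rewrite /spline !(posE1 (_ : 0 <= y), posE1 (_ : 0 <= y - 1),
    posE1 (_ : 0 <= y - 2), posE0 (_ : y - 3 <= 0)); try lra.
  rewrite (_ : 1 - _ = (3 - y) ^+ 3 / 6); last by field.
  have : (3 - y) ^+ 3 <= 1 by rewrite exprn_ile1//; lra.
  have : 0 <= (3 - y) ^+ 3 by rewrite exprn_ge0//; lra.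
  lra.
- by rewrite spline_hi// ler01 lexx.
Qed.

Let spline1_bounded y : `|spline1 y| <= 50.
Proof.
rewrite ler_norml; elim/split4: y => y hy.
- rewrite /spline1 !posE0; lra.
- rewrite /spline1 (posE1 (_ : 0 <= y)) ?(posE0 (_ : _ - _ <= 0)); try lra.
  apply/andP; split; nra.
- rewrite /spline1 !(posE1 (_ : 0 <= y), posE1 (_ : 0 <= y - 1),
    posE0 (_ : y - 2 <= 0), posE0 (_ : y - 3 <= 0)); try lra.
  apply/andP; split; nra.
- rewrite /spline1 !(posE1 (_ : 0 <= y), posE1 (_ : 0 <= y - 1),
    posE1 (_ : 0 <= y - 2), posE0 (_ : y - 3 <= 0)); try lra.
  apply/andP; split; nra.
- rewrite /spline1 !posE1; lra.
Qed.

Let spline2_bounded y : `|spline2 y| <= 50.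
Proof.
rewrite ler_norml; elim/split4: y => y hy.
- rewrite /spline2 !posE0; lra.
- rewrite /spline2 (posE1 (_ : 0 <= y)) ?(posE0 (_ : _ - _ <= 0)); lra.
- rewrite /spline2 !(posE1 (_ : 0 <= y), posE1 (_ : 0 <= y - 1),
    posE0 (_ : y - 2 <= 0), posE0 (_ : y - 3 <= 0)); lra.
- rewrite /spline2 !(posE1 (_ : 0 <= y), posE1 (_ : 0 <= y - 1),
    posE1 (_ : 0 <= y - 2), posE0 (_ : y - 3 <= 0)); lra.
- rewrite /spline2 !posE1; lra.
Qed.

Let spline_smooth3 : smooth3 50 spline spline1 spline2.
Proof.
split.
- move=> y; have /andP[h0 h1] := spline_ge0_le1 y; rewrite ger0_norm//; lra.
- exact: spline1_bounded.
- exact: spline2_bounded.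
move=> y h.
pose r (u : R) := pos (u + h) ^+ 3 - pos u ^+ 3 - 3 * pos u ^+ 2 * h -
  3 * pos u * h ^+ 2.
have rC u : `|r u| <= `|h| ^+ 3 by exact: pos_cube_taylor.
rewrite (_ : _ - _ = - (r y - 3 * r (y - 1) + 3 * r (y - 2) - r (y - 3)) / 6).
  have := normr_ge0 h; move: (rC y) (rC (y - 1)) (rC (y - 2)) (rC (y - 3)).
  rewrite !ler_norml => /andP[? ?] /andP[? ?] /andP[? ?] /andP[? ?] h0.
  have := exprn_ge0 3 h0; lra.
rewrite /r /spline /spline1 /spline2 !(addrAC y _ h); by field.
Qed.

Let measurable_pos : measurable_fun setT pos.
Proof. by apply: measurable_maxr. Qed.

Lemma smooth3_affine (C a b : R) (f f1 f2 : R -> R) : 0 <= a -> 0 <= C ->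
  smooth3 C f f1 f2 ->
  smooth3 (C * (1 + a + a ^+ 2 + a ^+ 3)) (fun y => f (a * y + b))
    (fun y => a * f1 (a * y + b)) (fun y => a ^+ 2 * f2 (a * y + b)).
Proof.
move=> a0 C0 [fC f1C f2C tay].
have a2 : 0 <= a ^+ 2 by rewrite exprn_ge0.
have a3 : 0 <= a ^+ 3 by rewrite exprn_ge0.
have le1 (u v : R) : 0 <= v -> v <= 1 + a + a ^+ 2 + a ^+ 3 -> u <= v * C ->
    u <= C * (1 + a + a ^+ 2 + a ^+ 3).
  by move=> v0 va /le_trans; apply; rewrite mulrC ler_wpM2l.
split=> [y|y|y|y h].
- apply: (@le1 _ 1); rewrite ?mul1r//; lra.
- apply: (@le1 _ a) => //; first by lra.
  by rewrite normrM ger0_norm// ler_wpM2l.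
- apply: (@le1 _ (a ^+ 2)) => //; first by lra.
  by rewrite normrM ger0_norm// ler_wpM2l.
- rewrite (_ : a * (y + h) + b = a * y + b + a * h); last by ring.
  rewrite (_ : _ - _ = f (a * y + b + a * h) - f (a * y + b) -
    f1 (a * y + b) * (a * h) - f2 (a * y + b) * (a * h) ^+ 2 / 2); last by field.
  apply: le_trans (tay _ _) _.
  rewrite normrM (ger0_norm a0) exprMn mulrA ler_wpM2r ?exprn_ge0// ler_wpM2l//.
  lra.
Qed.

Lemma smooth_step (x e : R) : 0 < e -> exists C, exists f f1 f2 : R -> R,
  [/\ smooth3 C f f1 f2,
      [/\ measurable_fun setT f, measurable_fun setT f1 & measurable_fun setT f2],
      forall y, 0 <= f y <= 1, forall y, y <= x -> f y = 1 &
      forall y, x + e <= y -> f y = 0].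
Proof.
move=> e0; pose a := 3 / e; pose b := - (a * x).
have a0 : 0 < a by rewrite divr_gt0.
have mp k : measurable_fun setT (fun y => pos (a * y + b - k)).
  apply: measurableT_comp => //; apply: measurable_funD => //.
  by apply: measurable_funD => //; apply: measurable_funM.
have mp0 : measurable_fun setT (fun y => pos (a * y + b)).
  by have := mp 0; under eq_fun do rewrite subr0.
exists (50 * (1 + a + a ^+ 2 + a ^+ 3)).
exists (fun y => spline (a * y + b)), (fun y => a * spline1 (a * y + b)),
  (fun y => a ^+ 2 * spline2 (a * y + b)).
split.
- by apply: smooth3_affine => //; exact: ltW.
- split.
  + apply: measurable_funB => //; apply: measurable_funM => //.
    apply: measurable_funB; last by apply: measurable_funX.
    apply: measurable_funD; last by apply: measurable_funM => //; apply: measurable_funX.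
    apply: measurable_funB; first by apply: measurable_funX.
    by apply: measurable_funM => //; apply: measurable_funX.
  + apply: measurable_funM => //; apply: measurable_funM => //.
    apply: measurable_funN.
    apply: measurable_funB; last by apply: measurable_funX.
    apply: measurable_funD; last by apply: measurable_funM => //; apply: measurable_funX.
    apply: measurable_funB; first by apply: measurable_funX.
    by apply: measurable_funM => //; apply: measurable_funX.
  + apply: measurable_funM => //; apply: measurable_funN.
    apply: measurable_funB => //.
    apply: measurable_funD; last by apply: measurable_funM.
    by apply: measurable_funB => //; apply: measurable_funM.
- by move=> y; exact: spline_ge0_le1.
- move=> y yx; apply: spline_lo; rewrite /b -mulrBr.
  by rewrite mulr_ge0_le0 ?subr_le0 ?(ltW a0).
- move=> y yx; apply: spline_hi; rewrite /b -mulrBr /a mulrAC ler_pdivlMr//.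
  by rewrite ler_pM2l//; lra.
Qed.

End smooth_step.

Section finite_clt.
Context {R : realType} {d : nat}.
Local Notation N01 := (@normal_prob R 0 1).

Definition std_normal_cdf (a : R) : R := fine (N01 `]-oo, a]).

Lemma Rintegral_indic_cdf (a : R) :
  \int[N01]_x (\1_(`]-oo, a]) x : R) = std_normal_cdf a.
Proof. by rewrite /Rintegral integral_indic//= setIT. Qed.

Lemma smooth3_weaken (C C' : R) (f f1 f2 : R -> R) : C <= C' -> smooth3 C f f1 f2 ->
  smooth3 C' f f1 f2.
Proof.
move=> CC' [fC f1C f2C tay]; split=> [y|y|y|y h].
- exact: le_trans CC'.
- exact: le_trans CC'.
- exact: le_trans CC'.
- by apply: le_trans (tay y h) _; rewrite ler_wpM2r ?exprn_ge0.
Qed.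

Lemma smoothing_bounds (t : R) (f : R -> R) y : measurable_fun setT f ->
  (forall x, 0 <= f x <= 1) -> 0 <= smoothing t f y <= 1.
Proof.
move=> mf f01; apply/andP; split.
  by apply: Rintegral_ge0 => x _; case/andP: (f01 (y + t * x)).
have fC x : `|f x| <= 1 by have /andP[? ?] := f01 x; rewrite ger0_norm.
by have := smoothing_bounded t y mf fC; rewrite ler_norml => /andP[].
Qed.

Lemma iter_smoothing_regular (C t : R) (f f1 f2 : R -> R) j : smooth3 C f f1 f2 ->
  measurable_fun setT f -> measurable_fun setT f1 -> measurable_fun setT f2 ->
  let T := iter j (smoothing t) in
  [/\ smooth3 C (T f) (T f1) (T f2), measurable_fun setT (T f),
      measurable_fun setT (T f1) & measurable_fun setT (T f2)].
Proof.
move=> sf mf mf1 mf2; elim: j => [|j [sj mj mj1 mj2]] //=.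
have [b0 b1 b2 _] := sj.
split; first exact: smooth3_smoothing.
- exact: measurable_smoothing b0.
- exact: measurable_smoothing b1.
- exact: measurable_smoothing b2.
Qed.

Lemma iter_smoothingE (C t : R) (f f1 f2 : R -> R) j y : 0 < t -> smooth3 C f f1 f2 ->
  measurable_fun setT f -> measurable_fun setT f1 -> measurable_fun setT f2 ->
  (forall x, 0 <= f x <= 1) ->
  iter j.+1 (smoothing t) f y = smoothing (Num.sqrt j.+1%:R * t) f y.
Proof.
move=> t0 sf mf mf1 mf2 f01.
elim: j y => [|j IH] y; first by rewrite /= sqrtr1 mul1r.
rewrite iterS -[RHS]/(smoothing (Num.sqrt j.+2%:R * t) f y).
have -> : iter j.+1 (smoothing t) f = smoothing (Num.sqrt j.+1%:R * t) f.
  by apply/funext => z; exact: IH.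
rewrite smoothing_semigroup//; first last.
- exact: smooth3_continuous sf.
- by rewrite mulr_gt0// sqrtr_gt0.
congr (smoothing _ f y).
rewrite exprMn sqr_sqrtr// -{1}(mul1r (t ^+ 2)) -mulrDl sqrtrM ?addr_ge0//.
by rewrite sqrtr_sqr gtr0_norm// addrC natr1.
Qed.

(** A quantitative central limit theorem for [s] independent draws from a finite
    population with identity covariance up to [e] and third moment at most [m3]. *)
Lemma finite_clt_smooth (C : R) (f f1 f2 : 'I_d -> R -> R) : 0 <= C ->
  (forall k, smooth3 C (f k) (f1 k) (f2 k)) ->
  (forall k, [/\ measurable_fun setT (f k), measurable_fun setT (f1 k) &
                 measurable_fun setT (f2 k)]) ->
  (forall k y, 0 <= f k y <= 1) ->
  exists2 D : R, 0 <= D & forall n (p : 'I_n -> R) (xi : 'I_n -> 'cV[R]_d) s (e m3 : R),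
  0 <= e -> (forall i, 0 <= p i) -> \sum_i p i = 1 ->
  (forall k, \sum_i p i * xi i k 0 = 0) ->
  (forall k l, `|\sum_i p i * (xi i k 0 * xi i l 0) - (k == l)%:R| <= e) ->
  \sum_i p i * norm1 (xi i) ^+ 3 <= m3 ->
  `|walk p (fun i => (Num.sqrt s.+1%:R)^-1 *: xi i) s.+1
      (fun y => \prod_k f k (y k 0)) 0 - \prod_k smoothing 1 (f k) 0|
    <= D * (e + (m3 + 1) / Num.sqrt s.+1%:R).
Proof.
move=> C0 fC fm f01.
pose M3 := \int[N01]_x `|x| ^+ 3.
have M30 : 0 <= M3 by apply: Rintegral_ge0 => x _; rewrite exprn_ge0.
pose C' := C * (1 + M3).
have C'0 : 0 <= C' by rewrite mulr_ge0// addr_ge0.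
have CC' : C <= C' by rewrite ler_peMr// lerDl.
have [D D0 HD] := @lindeberg_comparison R d C' C'0.
exists D => // n p xi s e m3 e0 p0 p1 xi0 xi2 xi3.
set q := Num.sqrt s.+1%:R.
have q1 : 1 <= q by rewrite /q -[leLHS]sqrtr1 ler_sqrt// ler1n.
have q0 : 0 < q by lra.
pose t := q^-1.
have t0 : 0 < t by rewrite invr_gt0.
have t1 : t <= 1 by rewrite invf_le1.
have qE : q ^+ 2 = s.+1%:R by rewrite sqr_sqrtr.
have reg j k := @iter_smoothing_regular C t (f k) (f1 k) (f2 k) j (fC k).
pose F (g : 'I_d -> R -> R) j k := iter j (smoothing t) (g k).
have := HD t (F f) (F f1) (F f2).
have t01 : 0 <= t <= 1 by rewrite t1 ltW.
have sm j k : smooth3 C' (F f j k) (F f1 j k) (F f2 j k).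
  have [mf mf1 mf2] := fm k.
  by have [sj _ _ _] := reg j k mf mf1 mf2; exact: smooth3_weaken sj.
have st j k y : `|F f j.+1 k y - F f j k y - t ^+ 2 * F f2 j k y / 2| <= C' * t ^+ 3.
  have [mf mf1 mf2] := fm k.
  have [sj mj _ _] := reg j k mf mf1 mf2.
  have := smoothing_step y (ltW t0) sj mj; rewrite -/M3 => /le_trans; apply.
  by rewrite ler_wpM2r ?exprn_ge0 ?(ltW t0)// /C' mulrDr mulr1 lerDr.
move=> /(_ t01 sm st n p (fun i => t *: xi i) (t ^+ 2 * e) (t ^+ 3 * m3)).
have te0 : 0 <= t ^+ 2 * e by rewrite mulr_ge0 ?sqr_ge0.
have txi0 k : \sum_i p i * (t *: xi i) k 0 = 0.
  by under eq_bigr do rewrite mxE mulrCA; rewrite -mulr_sumr xi0 mulr0.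
have txi2 k l : `|\sum_i p i * ((t *: xi i) k 0 * (t *: xi i) l 0) -
    t ^+ 2 * (k == l)%:R| <= t ^+ 2 * e.
  rewrite (_ : \sum_i _ = t ^+ 2 * \sum_i p i * (xi i k 0 * xi i l 0)); last first.
    by rewrite mulr_sumr; apply: eq_bigr => i _; rewrite !mxE; ring.
  by rewrite -mulrBr normrM ger0_norm ?sqr_ge0// ler_wpM2l ?sqr_ge0.
have txi3 : \sum_i p i * norm1 (t *: xi i) ^+ 3 <= t ^+ 3 * m3.
  rewrite (_ : \sum_i _ = t ^+ 3 * \sum_i p i * norm1 (xi i) ^+ 3); last first.
    rewrite mulr_sumr; apply: eq_bigr => i _.
    have -> : norm1 (t *: xi i) = t * norm1 (xi i).
      by rewrite /norm1 mulr_sumr; apply: eq_bigr => k _; rewrite mxE normrM gtr0_norm.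
    by ring.
  by rewrite ler_wpM2l// exprn_ge0 ?(ltW t0).
move=> /(_ te0 p0 p1 txi0 txi2 txi3 s.+1 0).
have -> : \prod_k F f s.+1 k ((0 : 'cV[R]_d) k 0) = \prod_k smoothing 1 (f k) 0.
  apply: eq_bigr => k _; have [mf mf1 mf2] := fm k.
  rewrite mxE /F (iter_smoothingE _ _ t0 (fC k) mf mf1 mf2 (f01 k)).
  by rewrite -/q /t divff// gt_eqF.
move/le_trans; apply; rewrite -/t.
rewrite le_eqVlt; apply/orP; left; apply/eqP.
by rewrite -qE /t; field; rewrite gt_eqF.
Qed.

Lemma finite_clt (x : 'cV[R]_d) (h : R) : 0 < h ->
  exists2 D : R, 0 <= D & forall n (p : 'I_n -> R) (xi : 'I_n -> 'cV[R]_d) s (e m3 : R),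
  0 <= e -> (forall i, 0 <= p i) -> \sum_i p i = 1 ->
  (forall k, \sum_i p i * xi i k 0 = 0) ->
  (forall k l, `|\sum_i p i * (xi i k 0 * xi i l 0) - (k == l)%:R| <= e) ->
  \sum_i p i * norm1 (xi i) ^+ 3 <= m3 ->
  \prod_k std_normal_cdf (x k 0 - h) - D * (e + (m3 + 1) / Num.sqrt s.+1%:R)
    <= walk p (fun i => (Num.sqrt s.+1%:R)^-1 *: xi i) s.+1
         (fun y => `[< le_cV y x >]%:R) 0
    <= \prod_k std_normal_cdf (x k 0 + h) + D * (e + (m3 + 1) / Num.sqrt s.+1%:R).
Proof.
move=> h0.
have step (z : 'cV[R]_d) : exists C, exists f f1 f2 : 'I_d -> R -> R, 0 <= C /\
  [/\ forall k, smooth3 C (f k) (f1 k) (f2 k),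
    forall k, [/\ measurable_fun setT (f k), measurable_fun setT (f1 k) &
                 measurable_fun setT (f2 k)],
    forall k y, 0 <= f k y <= 1, forall k y, y <= z k 0 -> f k y = 1 &
    forall k y, z k 0 + h <= y -> f k y = 0].
  have /boolp.choice[C HC] (k : 'I_d) := smooth_step (z k 0) h0.
  have /boolp.choice[f Hf] := HC.
  have /boolp.choice[f1 Hf1] := Hf.
  have /boolp.choice[f2 Hf2] := Hf1.
  have Ck0 k : 0 <= C k.
    by have [[b _ _ _] _ _ _ _] := Hf2 k; exact: le_trans (b 0).
  exists (\sum_k C k), f, f1, f2; split; first exact: sumr_ge0.
  split=> k; have [sk mk k01 k1 k2] := Hf2 k => //.
  apply: smooth3_weaken sk; rewrite (bigD1 k)//= lerDl sumr_ge0//.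
have smoothing_le (f : R -> R) (a : R) : measurable_fun setT f ->
    (forall y, 0 <= f y <= 1) -> (forall y, a <= y -> f y = 0) ->
    smoothing 1 f 0 <= std_normal_cdf a.
  move=> mf f01 fa; rewrite -Rintegral_indic_cdf /smoothing.
  have fC y : `|f y| <= 1 by have /andP[? ?] := f01 y; rewrite ger0_norm.
  apply: le_Rintegral => //.
  - exact: smoothing_integrable fC.
  - by apply: (@normal_integrable_bounded _ _ 1) => // y; rewrite indicE; case: (_ \in _);
      rewrite ?normr1 ?normr0.
  - move=> y _; rewrite add0r mul1r indicE mem_setE in_itv /=.
    by have [ya|ya] := leP y a; [case/andP: (f01 y)|rewrite fa// ltW].
have smoothing_ge (f : R -> R) (a : R) : measurable_fun setT f ->
    (forall y, 0 <= f y <= 1) -> (forall y, y <= a -> f y = 1) ->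
    std_normal_cdf a <= smoothing 1 f 0.
  move=> mf f01 fa; rewrite -Rintegral_indic_cdf /smoothing.
  have fC y : `|f y| <= 1 by have /andP[? ?] := f01 y; rewrite ger0_norm.
  apply: le_Rintegral => //.
  - by apply: (@normal_integrable_bounded _ _ 1) => // y; rewrite indicE; case: (_ \in _);
      rewrite ?normr1 ?normr0.
  - exact: smoothing_integrable fC.
  - move=> y _; rewrite add0r mul1r indicE mem_setE in_itv /=.
    by have [ya|ya] := leP y a; [rewrite fa|case/andP: (f01 y)].
have cdf0 a : 0 <= std_normal_cdf a by rewrite /std_normal_cdf fine_ge0.
have [C [f [f1 [f2 [C0 [fC fm f01 fl fr]]]]]] := step x.
have [C' [f' [f1' [f2' [C0' [fC' fm' f01' fl' fr']]]]]] := step (x - const_mx h).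
have [D D0 HD] := finite_clt_smooth C0 fC fm f01.
have [D' D0' HD'] := finite_clt_smooth C0' fC' fm' f01'.
exists (D + D'); first exact: addr_ge0.
move=> n p xi s e m3 e0 p0 p1 xi0 xi2 xi3.
set W := walk _ _ _ _ _; set r := (D + D') * _.
have := HD n p xi s e m3 e0 p0 p1 xi0 xi2 xi3.
have := HD' n p xi s e m3 e0 p0 p1 xi0 xi2 xi3.
set W1 := walk _ _ _ _ _; set W2 := walk _ _ _ _ _.
set b := e + _.
have m30 : 0 <= m3.
  by apply: le_trans xi3; apply: sumr_ge0 => i _; rewrite mulr_ge0 ?exprn_ge0 ?norm1_ge0.
have b0 : 0 <= b by rewrite addr_ge0// divr_ge0 ?sqrtr_ge0// addr_ge0.
have rE : r = D * b + D' * b by rewrite /r mulrDl.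
have Db : 0 <= D * b by rewrite mulr_ge0.
have Db' : 0 <= D' * b by rewrite mulr_ge0.
rewrite !ler_norml => /andP[h1 _] /andP[_ h2].
have WW2 : W <= W2.
  apply: walk_le => // y; case: asboolP => [yx|_] /=.
    by rewrite big1// => k _; rewrite fl.
  by apply: prodr_ge0 => k _; case/andP: (f01 k (y k 0)).
have W1W : W1 <= W.
  apply: walk_le => // y; case: asboolP => [yx|yx] /=.
    by apply: prodr_ile1 => k _; exact: f01'.
  have /existsNP[k /negP] : ~ forall k, y k 0 <= x k 0 by [].
  rewrite -ltNge => yk; rewrite (bigD1 k)//= fr' ?mul0r// !mxE subrK ltW//.
have P2 : \prod_k smoothing 1 (f k) 0 <= \prod_k std_normal_cdf (x k 0 + h).
  apply: ler_prod => k _; have [mf _ _] := fm k.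
  by rewrite smoothing_le//= ?andbT; [case/andP: (smoothing_bounds 1 0 mf (f01 k))|
    exact: fr].
have P1 : \prod_k std_normal_cdf (x k 0 - h) <= \prod_k smoothing 1 (f' k) 0.
  apply: ler_prod => k _; rewrite cdf0 /=; have [mf _ _] := fm' k.
  apply: smoothing_ge => // y yk; apply: fl'; rewrite !mxE//.
apply/andP; split; lra.
Qed.

End finite_clt.

Section euclidean.
Context {R : realType} {d : nat}.
Implicit Types (u v w : 'cV[R]_d) (A B : 'M[R]_d).

Definition dot u v : R := \sum_k u k 0 * v k 0.

Lemma dotC u v : dot u v = dot v u.
Proof. by apply: eq_bigr => k _; rewrite mulrC. Qed.

Lemma dotDl u v w : dot (u + v) w = dot u w + dot v w.
Proof. by rewrite -big_split /=; apply: eq_bigr => k _; rewrite mxE mulrDl. Qed.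

Lemma dotDr u v w : dot w (u + v) = dot w u + dot w v.
Proof. by rewrite dotC dotDl !(dotC w). Qed.

Lemma dotZl a u v : dot (a *: u) v = a * dot u v.
Proof. by rewrite mulr_sumr; apply: eq_bigr => k _; rewrite mxE mulrA. Qed.

Lemma dotZr a u v : dot u (a *: v) = a * dot u v.
Proof. by rewrite dotC dotZl dotC. Qed.

Lemma dotNl u v : dot (- u) v = - dot u v.
Proof. by rewrite -scaleN1r dotZl mulN1r. Qed.

Lemma dotNr u v : dot u (- v) = - dot u v.
Proof. by rewrite dotC dotNl dotC. Qed.

Lemma dotBl u v w : dot (u - v) w = dot u w - dot v w.
Proof. by rewrite dotDl dotNl. Qed.

Lemma dotBr u v w : dot w (u - v) = dot w u - dot w v.
Proof. by rewrite dotDr dotNr. Qed.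

Lemma dot0l v : dot 0 v = 0.
Proof. by rewrite -(scale0r 0) dotZl mul0r. Qed.

Lemma dot0r v : dot v 0 = 0.
Proof. by rewrite dotC dot0l. Qed.

Lemma dot_suml (I : Type) (r : seq I) (P : pred I) (F : I -> 'cV[R]_d) v :
  dot (\sum_(i <- r | P i) F i) v = \sum_(i <- r | P i) dot (F i) v.
Proof. by elim/big_rec2: _ => [|i y x _ <-]; rewrite ?dot0l ?dotDl. Qed.

Lemma dotvv_ge0 v : 0 <= dot v v.
Proof. by apply: sumr_ge0 => k _; rewrite -expr2 sqr_ge0. Qed.

Lemma dot_mulmx A u v : dot u (A *m v) = \sum_k \sum_l A k l * (u k 0 * v l 0).
Proof.
apply: eq_bigr => k _; rewrite mxE mulr_sumr; apply: eq_bigr => l _.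
by rewrite mulrCA.
Qed.

Lemma dot_trmx A u v : dot u (A *m v) = dot (A^T *m u) v.
Proof.
rewrite dot_mulmx dotC dot_mulmx exchange_big; apply: eq_bigr => k _ /=.
by apply: eq_bigr => l _; rewrite !mxE (mulrC (v _ _)).
Qed.

Lemma quad_formE A v : (v^T *m A *m v) 0 0 = dot v (A *m v).
Proof. by rewrite -mulmxA mxE; apply: eq_bigr => k _; rewrite mxE. Qed.

Lemma enormE v : enorm v = Num.sqrt (dot v v).
Proof. by congr Num.sqrt; apply: eq_bigr => k _; rewrite expr2. Qed.

Lemma enorm_ge0 v : 0 <= enorm v. Proof. exact: sqrtr_ge0. Qed.

Lemma enorm_sqr v : enorm v ^+ 2 = dot v v.
Proof. by rewrite enormE sqr_sqrtr// dotvv_ge0. Qed.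

Lemma enorm_eq0 v : enorm v = 0 -> v = 0.
Proof.
move=> v0; have /eqP : dot v v = 0 by rewrite -enorm_sqr v0 expr0n.
rewrite psumr_eq0 => [/allP h|k _]; last by rewrite -expr2 sqr_ge0.
apply/matrixP => k j; rewrite ord1 mxE.
by have := h k (mem_index_enum _); rewrite /= mulf_eq0 orbb => /eqP.
Qed.

Lemma enorm0 : enorm (0 : 'cV[R]_d) = 0.
Proof. by rewrite enormE dot0l sqrtr0. Qed.

Lemma enormZ a v : enorm (a *: v) = `|a| * enorm v.
Proof. by rewrite !enormE dotZl dotZr mulrA -expr2 sqrtrM ?sqr_ge0// sqrtr_sqr. Qed.

Lemma enormN v : enorm (- v) = enorm v.
Proof. by rewrite -scaleN1r enormZ normrN1 mul1r. Qed.

Lemma enorm_le v c : 0 <= c -> dot v v <= c ^+ 2 -> enorm v <= c.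
Proof.
move=> c0 vc; rewrite -(@ler_pXn2r _ 2)// ?nnegrE ?enorm_ge0//.
by rewrite enorm_sqr.
Qed.

(** The Cauchy-Schwarz inequality of a positive semidefinite form. *)
Lemma psd_cauchy_schwarz A u v : A^T = A -> (forall w, 0 <= dot w (A *m w)) ->
  dot u (A *m v) ^+ 2 <= dot u (A *m u) * dot v (A *m v).
Proof.
move=> symA psdA.
set a := dot u (A *m u); set b := dot u (A *m v); set c := dot v (A *m v).
have q t : 0 <= a + 2 * t * b + t ^+ 2 * c.
  have := psdA (u + t *: v).
  rewrite mulmxDr -scalemxAr !dotDl !dotDr !dotZl !dotZr -/a -/b -/c.
  have -> : dot v (A *m u) = b by rewrite dot_trmx symA dotC.
  by move/le_trans; apply; rewrite le_eqVlt; apply/orP; left; apply/eqP; ring.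
have a0 : 0 <= a := psdA u; have c0 : 0 <= c := psdA v.
have [c00|cn0] := eqVneq c 0.
  have [->|bn0] := eqVneq b 0; first by rewrite expr0n mulr_ge0.
  have := q (- (a + 1) / (2 * b)).
  rewrite c00 mulr0 addr0 (_ : 2 * _ * b = - (a + 1)); last by field.
  lra.
have cp : 0 < c by rewrite lt_neqAle eq_sym cn0.
have := q (- b / c); rewrite -(ler_pM2r cp) mul0r.
rewrite (_ : (a + _ + _) * c = a * c - b ^+ 2); last by field.
lra.
Qed.

Lemma cauchy_schwarz u v : `|dot u v| <= enorm u * enorm v.
Proof.
rewrite -(@ler_pXn2r _ 2)// ?nnegrE ?mulr_ge0 ?enorm_ge0//.
rewrite real_normK ?num_real// exprMn !enorm_sqr.
have := @psd_cauchy_schwarz 1%:M u v; rewrite !mul1mx; apply.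
  by rewrite tr_scalar_mx.
by move=> w; rewrite mul1mx dotvv_ge0.
Qed.

Lemma enormD u v : enorm (u + v) <= enorm u + enorm v.
Proof.
apply: enorm_le; first by rewrite addr_ge0 ?enorm_ge0.
rewrite dotDl !dotDr (dotC v u) -!enorm_sqr.
have := le_trans (ler_norm _) (cauchy_schwarz u v).
rewrite sqrrD; lra.
Qed.

Lemma enormB u v : enorm (u - v) <= enorm u + enorm v.
Proof. by rewrite -(enormN v) enormD. Qed.

Lemma enormBC u v : enorm (u - v) = enorm (v - u).
Proof. by rewrite -enormN opprB. Qed.

Lemma enorm_triangle w u v : enorm (u - v) <= enorm (u - w) + enorm (w - v).
Proof. by rewrite -[u - v](subrKA w) enormD. Qed.

Lemma enorm_sum (I : Type) (r : seq I) (P : pred I) (F : I -> 'cV[R]_d) :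
  enorm (\sum_(i <- r | P i) F i) <= \sum_(i <- r | P i) enorm (F i).
Proof.
elim/big_rec2: _ => [|i y x _ h]; first by rewrite enorm0.
by rewrite (le_trans (enormD _ _))// lerD2l.
Qed.

Lemma le_coord_enorm v k : `|v k 0| <= enorm v.
Proof.
rewrite -(@ler_pXn2r _ 2)// ?nnegrE ?enorm_ge0// enorm_sqr real_normK ?num_real//.
rewrite /dot (bigD1 k)//= -expr2 lerDl sumr_ge0// => l _.
by rewrite -expr2 sqr_ge0.
Qed.

Lemma enorm_le_norm1 v : enorm v <= norm1 v.
Proof.
apply: enorm_le; first exact: norm1_ge0.
rewrite expr2 {1}/norm1 mulr_suml; apply: ler_sum => k _.
rewrite -expr2 -real_normK ?num_real// expr2 ler_wpM2l//; exact: le_norm1.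
Qed.

Lemma norm1_le_enorm v : norm1 v <= d%:R * enorm v.
Proof.
rewrite /norm1 mulr_natl -[X in _ *+ X]card_ord -sumr_const.
by apply: ler_sum => k _; exact: le_coord_enorm.
Qed.

Lemma enorm_le_coord v c : 0 <= c -> (forall k, `|v k 0| <= c) -> enorm v <= d%:R * c.
Proof.
move=> c0 vc; apply: le_trans (enorm_le_norm1 v) _.
rewrite /norm1 mulr_natl -[X in _ *+ X]card_ord -sumr_const.
by apply: ler_sum.
Qed.

Lemma dot_entry_bound A e u v : 0 <= e -> (forall k l, `|A k l| <= e) ->
  `|dot u (A *m v)| <= d%:R ^+ 2 * e * (enorm u * enorm v).
Proof.
move=> e0 Ae; rewrite dot_mulmx.
apply: le_trans (ler_norm_sum _ _ _) _.
have -> : d%:R ^+ 2 * e * (enorm u * enorm v) =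
  \sum_(k < d) \sum_(l < d) e * (enorm u * enorm v).
  by rewrite !sumr_const !card_ord -mulrnA -[in RHS]mulr_natr natrM; ring.
apply: ler_sum => k _; apply: le_trans (ler_norm_sum _ _ _) _.
apply: ler_sum => l _; rewrite normrM ler_pM// normrM ler_pM//;
  exact: le_coord_enorm.
Qed.

Lemma enorm_mulmx_bound A c v : 0 <= c -> (forall u w, `|dot u (A *m w)| <=
  c * (enorm u * enorm w)) -> enorm (A *m v) <= c * enorm v.
Proof.
move=> c0 Ac; have := Ac (A *m v) v.
rewrite -enorm_sqr ger0_norm ?exprn_ge0 ?enorm_ge0//.
have [->|vn0] := eqVneq (enorm (A *m v)) 0; first by rewrite mulr_ge0 ?enorm_ge0.
have vp : 0 < enorm (A *m v) by rewrite lt_neqAle eq_sym vn0 enorm_ge0.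
by rewrite expr2 mulrCA ler_pM2l.
Qed.

Lemma enorm_mulmx_entry A e v : 0 <= e -> (forall k l, `|A k l| <= e) ->
  enorm (A *m v) <= d%:R ^+ 2 * e * enorm v.
Proof.
move=> e0 Ae; apply: enorm_mulmx_bound; first by rewrite mulr_ge0 ?exprn_ge0.
by move=> u w; exact: dot_entry_bound.
Qed.

Lemma delta_entry A k l : A k l = dot (delta_mx k 0) (A *m delta_mx l 0).
Proof.
rewrite dot_mulmx (bigD1 k)//= (bigD1 l)//= !mxE !eqxx !mulr1.
rewrite big1 => [|j jl]; last by rewrite !mxE (negbTE jl) !mulr0.
rewrite big1 ?addr0// => i ik; rewrite big1// => j _.
by rewrite !mxE (negbTE ik) mul0r mulr0.
Qed.

Lemma enorm_delta (k : 'I_d) : enorm (delta_mx k 0 : 'cV[R]_d) = 1.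
Proof.
rewrite enormE /dot (bigD1 k)//= !mxE !eqxx mulr1 big1 ?addr0 ?sqrtr1// => l lk.
by rewrite !mxE (negbTE lk) mulr0.
Qed.

Lemma posdefP A : posdef A <-> A^T = A /\ forall v, v != 0 -> 0 < dot v (A *m v).
Proof. by split=> -[? h]; split=> // v /h; rewrite quad_formE. Qed.

Lemma posdef_psd A v : posdef A -> 0 <= dot v (A *m v).
Proof.
move=> /posdefP[_ h]; have [->|/h/ltW//] := eqVneq v 0.
by rewrite dot0l.
Qed.

Lemma inj_unitmx A : (forall v, A *m v = 0 -> v = 0) -> A \in unitmx.
Proof.
move=> Ainj; rewrite -unitmx_tr -row_free_unit -kermx_eq0; apply/eqP.
apply/row_matrixP => i; rewrite row0.
have /(congr1 trmx) : row i (kermx A^T) *m A^T = 0.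
  by rewrite -row_mul mulmx_ker row0.
rewrite trmx_mul trmxK trmx0 => /Ainj /(congr1 trmx).
by rewrite trmxK trmx0.
Qed.

Lemma posdef_unit A : posdef A -> A \in unitmx.
Proof.
move=> /posdefP[_ h]; apply: inj_unitmx => v Av0; apply/eqP; apply: contraT => /h.
by rewrite Av0 dot0r ltxx.
Qed.

(** The lower bound that compactness of the sphere would give follows from the
    invertibility of [A] and the Cauchy-Schwarz inequality of its form. *)
Lemma posdef_lower A : posdef A ->
  exists2 l : R, 0 < l & forall v, l * dot v v <= dot v (A *m v).
Proof.
move=> pA; have [sA _] := pA; have Au := posdef_unit pA.
have psdA v := posdef_psd v pA.
pose a := \sum_k \sum_l `|A k l| + 1.
pose b := \sum_k \sum_l `|invmx A k l| + 1.
have entry (B : 'M[R]_d) k l : `|B k l| <= \sum_k \sum_l `|B k l| + 1.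
  rewrite (bigD1 k)//= (bigD1 l)//=.
  have s1 : 0 <= \sum_(i | i != l) `|B k i| by exact: sumr_ge0.
  have s2 : 0 <= \sum_(i | i != k) \sum_l `|B i l|.
    by apply: sumr_ge0 => i _; exact: sumr_ge0.
  lra.
have pos (B : 'M[R]_d) : 0 < \sum_k \sum_l `|B k l| + 1.
  by apply: ltr_wpDl => //; apply: sumr_ge0 => i _; exact: sumr_ge0.
have a0 : 0 < a by exact: pos.
have b0 : 0 < b by exact: pos.
case: (posnP d) => [d0|d_gt0].
  exists 1 => // v; rewrite mul1r /dot !big1// => -[k kd]; exfalso;
    by move: kd; rewrite d0.
pose D : R := d%:R ^+ 2.
have D0 : 0 < D by rewrite exprn_gt0// ltr0n.
have c0 : 0 < (D * b) ^+ 2 * (D * a).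
  by apply: mulr_gt0; [apply: exprn_gt0|]; exact: mulr_gt0.
exists ((D * b) ^+ 2 * (D * a))^-1; first by rewrite invr_gt0.
move=> v; rewrite mulrC ler_pdivrMr//.
have h1 : dot (A *m v) (A *m v) <= dot v (A *m v) * (D * a).
  have := psd_cauchy_schwarz (A *m v) v sA psdA.
  have h : dot (A *m v) (A *m (A *m v)) <= D * a * dot (A *m v) (A *m v).
    rewrite -enorm_sqr expr2; apply: le_trans (ler_norm _) _.
    exact: (dot_entry_bound _ _ (ltW a0) (entry A)).
  set q := dot (A *m v) (A *m v) in h * => h2.
  have q0 : 0 <= q by exact: dotvv_ge0.
  have [->|qn0] := eqVneq q 0; first by rewrite !mulr_ge0// ?psdA// ltW.
  have qp : 0 < q by rewrite lt_neqAle eq_sym qn0.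
  rewrite -(ler_pM2l qp) -expr2; apply: le_trans h2 _.
  rewrite [leRHS](_ : _ = D * a * q * dot v (A *m v)); last by ring.
  by rewrite ler_wpM2r// psdA.
have h2 : dot v v <= (D * b) ^+ 2 * dot (A *m v) (A *m v).
  rewrite -!enorm_sqr -exprMn lerXn2r ?nnegrE ?mulr_ge0 ?enorm_ge0 ?(ltW D0) ?(ltW b0) //.
  rewrite -{1}(mulKmx Au v).
  exact: (enorm_mulmx_entry _ (ltW b0) (entry (invmx A))).
apply: le_trans h2 _.
rewrite [leRHS](_ : _ = (D * b) ^+ 2 * (dot v (A *m v) * (D * a))); last by ring.
by rewrite ler_wpM2l ?sqr_ge0.
Qed.

Lemma posdef_of_lower A l : A^T = A -> 0 < l ->
  (forall v, l * dot v v <= dot v (A *m v)) -> posdef A.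
Proof.
move=> sA l0 Al; apply/posdefP; split=> // v vn0.
apply: lt_le_trans (Al v); rewrite mulr_gt0// -enorm_sqr exprn_gt0//.
rewrite lt_neqAle enorm_ge0 andbT eq_sym; apply: contra vn0 => /eqP/enorm_eq0 ->.
by [].
Qed.

End euclidean.

Section square_root.
Context {R : realType} {d : nat}.
Implicit Types (u v w : 'cV[R]_d) (A B Y : 'M[R]_d).

Definition op_bound Y (y : R) : Prop := forall v, enorm (Y *m v) <= y * enorm v.

Lemma op_boundD Y Y' y y' : op_bound Y y -> op_bound Y' y' -> op_bound (Y + Y') (y + y').
Proof.
move=> Yy Yy' v; rewrite mulmxDl mulrDl; apply: le_trans (enormD _ _) _.
exact: lerD.
Qed.

Lemma op_boundM Y Y' y y' : 0 <= y -> op_bound Y y -> op_bound Y' y' ->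
  op_bound (Y *m Y') (y * y').
Proof.
move=> y0 Yy Yy' v; rewrite -mulmxA -mulrA; apply: le_trans (Yy _) _.
by rewrite ler_wpM2l.
Qed.

Lemma op_boundZ Y y a : op_bound Y y -> op_bound (a *: Y) (`|a| * y).
Proof. by move=> Yy v; rewrite -scalemxAl enormZ -mulrA ler_wpM2l. Qed.

Lemma op_bound_entry Y y k l : op_bound Y y -> `|Y k l| <= y.
Proof.
move=> Yy; rewrite delta_entry; apply: le_trans (cauchy_schwarz _ _) _.
by rewrite enorm_delta mul1r; apply: le_trans (Yy _) _; rewrite enorm_delta mulr1.
Qed.

Lemma op_bound_psd E r : E^T = E -> 0 <= r ->
  (forall v, 0 <= dot v (E *m v) <= r * dot v v) -> op_bound E r.
Proof.
move=> sE r0 Er v; apply: enorm_le; first by rewrite mulr_ge0 ?enorm_ge0.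
have psdE w : 0 <= dot w (E *m w) by case/andP: (Er w).
have := psd_cauchy_schwarz (E *m v) v sE psdE.
set q := dot (E *m v) (E *m v) => h.
have q0 : 0 <= q by exact: dotvv_ge0.
have [->|qn0] := eqVneq q 0; first by rewrite exprn_ge0// mulr_ge0 ?enorm_ge0.
have qp : 0 < q by rewrite lt_neqAle eq_sym qn0.
have /andP[_ h1] := Er (E *m v); have /andP[_ h2] := Er v.
rewrite -(ler_pM2l qp) -expr2; apply: le_trans h _.
rewrite exprMn enorm_sqr.
rewrite [leRHS](_ : _ = (r * q) * (r * dot v v)); last by ring.
by rewrite ler_pM.
Qed.

(** The square root of [1 - E] is [1 - Y] for the fixed point [Y = (E + Y ^ 2) / 2],
    which is the limit of the iteration below when [E] has norm less than 1. *)
Fixpoint sqrt_iter E (n : nat) : 'M[R]_d :=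
  if n is n'.+1 then 2^-1 *: (E + sqrt_iter E n' *m sqrt_iter E n') else 0.

Lemma sqrt_iter_sym E n : E^T = E -> (sqrt_iter E n)^T = sqrt_iter E n.
Proof.
move=> sE; elim: n => [|n IH] /=; first by rewrite trmx0.
by rewrite linearZ /= linearD /= trmx_mul sE IH.
Qed.

Lemma sqrt_iter_bound E r y n : 0 <= y -> y = (r + y ^+ 2) / 2 -> op_bound E r ->
  op_bound (sqrt_iter E n) y.
Proof.
move=> y0 yE Er; elim: n => [v|n IH]; first by rewrite mul0mx enorm0 mulr_ge0 ?enorm_ge0.
rewrite yE mulrC -(@ger0_norm _ 2^-1)//=.
by apply: op_boundZ; apply: op_boundD => //; rewrite expr2; exact: op_boundM.
Qed.

Lemma sqrt_iter_dist E r y n : 0 <= y -> y = (r + y ^+ 2) / 2 -> op_bound E r ->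
  op_bound (sqrt_iter E n.+1 - sqrt_iter E n) (y ^+ n * y).
Proof.
move=> y0 yE Er; elim: n => [|n IH].
  by rewrite expr0 mul1r subr0; exact: sqrt_iter_bound Er.
set Y := sqrt_iter E n.+1; set Y' := sqrt_iter E n; rewrite -/Y -/Y' in IH.
have -> : sqrt_iter E n.+2 - Y = 2^-1 *: (Y *m (Y - Y') + (Y - Y') *m Y').
  rewrite mulmxBr mulmxBl addrA subrK -[X in _ - X]/(2^-1 *: (E + Y' *m Y')).
  by rewrite -scalerBr opprD addrACA subrr add0r.
have -> : y ^+ n.+1 * y = `|2^-1| * (y * (y ^+ n * y) + y ^+ n * y * y).
  by rewrite ger0_norm// exprS; field.
apply: op_boundZ; apply: op_boundD; apply: op_boundM => //.
- exact: sqrt_iter_bound Er.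
- by rewrite mulr_ge0 ?exprn_ge0.
- exact: sqrt_iter_bound Er.
Qed.

Lemma cvgn_sum (I : Type) (r : seq I) (u : I -> nat -> R) (l : I -> R) :
  (forall i, u i n @[n --> \oo] --> l i) ->
  (\sum_(i <- r) u i n) @[n --> \oo] --> \sum_(i <- r) l i.
Proof.
move=> ul; elim: r => [|i r IH].
  rewrite big_nil; under eq_fun do rewrite big_nil; exact: cvg_cst.
by rewrite big_cons; under eq_fun do rewrite big_cons; apply: cvgD.
Qed.

Lemma geometric_steps_cvg (u : R^nat) (y : R) : 0 <= y < 1 ->
  (forall n, `|u n.+1 - u n| <= y ^+ n * y) -> cvgn u.
Proof.
move=> /andP[y0 y1] uy.
have -> : u = (fun n => u 0%N + series (fun k => u k.+1 - u k) n).
  by apply/funext => n; rewrite /series /= telescope_sumr// addrC subrK.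
apply: is_cvgD; first exact: is_cvg_cst.
apply: normed_cvg.
apply: (@series_le_cvg _ _ (geometric y y)).
- by move=> n /=.
- by move=> n; rewrite /= mulr_ge0// exprn_ge0.
- by move=> n /=; rewrite [leRHS]mulrC.
- by apply: is_cvg_geometric_series; rewrite ger0_norm.
Qed.

Lemma posdef_sqrt_exists A : posdef A -> exists2 B, posdef B & B *m B = A.
Proof.
move=> pA; have [sA _] := pA.
have [l l0 Al] := posdef_lower pA.
pose e := \sum_k \sum_l `|A k l|.
have Ae k l' : `|A k l'| <= e.
  rewrite /e (bigD1 k)//= (bigD1 l')//=.
  have s1 : 0 <= \sum_(i | i != l') `|A k i| by exact: sumr_ge0.
  have s2 : 0 <= \sum_(i | i != k) \sum_l `|A i l|.
    by apply: sumr_ge0 => i _; exact: sumr_ge0.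
  lra.
have e0 : 0 <= e by apply: sumr_ge0 => i _; exact: sumr_ge0.
pose a := d%:R ^+ 2 * e + 2 * l.
have de0 : 0 <= d%:R ^+ 2 * e by rewrite mulr_ge0// exprn_ge0.
have a0 : 0 < a by rewrite /a; lra.
have an0 : a != 0 by rewrite gt_eqF.
have Aa v : dot v (A *m v) <= a * dot v v.
  apply: le_trans (ler_norm _) _; apply: le_trans (dot_entry_bound v v e0 Ae) _.
  rewrite -expr2 enorm_sqr ler_wpM2r ?dotvv_ge0// /a; lra.
pose E := 1%:M - a^-1 *: A.
have sE : E^T = E by rewrite /E linearB /= linearZ /= sA trmx1.
pose r := 1 - l / a.
have la : 0 < l / a < 1.
  by rewrite divr_gt0//= ltr_pdivrMr// mul1r /a; lra.
have [la0 la1] := andP la.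
have r0 : 0 <= r by rewrite /r; lra.
have dotE v : dot v (E *m v) = dot v v - a^-1 * dot v (A *m v).
  by rewrite /E mulmxBl mul1mx -scalemxAl dotBr dotZr.
have Er v : 0 <= dot v (E *m v) <= r * dot v v.
  rewrite dotE; apply/andP; split.
    by rewrite subr_ge0 mulrC ler_pdivrMr// mulrC.
  rewrite /r mulrBl mul1r lerD2l lerN2 mulrAC [leRHS]mulrC.
  by rewrite ler_wpM2r ?invr_ge0 ?(ltW a0).
have opE := op_bound_psd sE r0 Er.
have EE : E = 1%:M - a^-1 *: A by [].
clearbody E.
pose q := Num.sqrt (l / a).
have q2 : q ^+ 2 = l / a by rewrite sqr_sqrtr// ltW.
have q0 : 0 < q by rewrite sqrtr_gt0.
have q1 : q < 1 by rewrite -[ltRHS]sqrtr1 ltr_sqrt.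
pose y := 1 - q.
have y0 : 0 <= y by rewrite /y; lra.
have yE : y = (r + y ^+ 2) / 2 by rewrite /y /r -q2; field.
pose Y : 'M[R]_d := \matrix_(k, l) limn (fun n => sqrt_iter E n k l).
have cvgY k l' : (sqrt_iter E n k l') @[n --> \oo] --> Y k l'.
  rewrite mxE; apply: (@geometric_steps_cvg _ y); first by rewrite /y; lra.
  move=> n; have := op_bound_entry k l' (sqrt_iter_dist n y0 yE opE).
  by rewrite !mxE.
have cvgS k l' : (sqrt_iter E n.+1 k l') @[n --> \oo] --> Y k l'.
  by have := cvgY k l'; rewrite -(@cvg_shiftS _ (fun n => sqrt_iter E n k l')).
have YE : Y = 2^-1 *: (E + Y *m Y).
  apply/matrixP => k l'; rewrite [in RHS]mxE [in RHS]mxE [in RHS]mxE.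
  apply: (@cvg_unique _ _ _ _ _ _ (cvgS k l')) => //.
  rewrite (_ : (fun n => _) =
     (fun n => 2^-1 * (E k l' + \sum_j sqrt_iter E n k j * sqrt_iter E n j l'))); last first.
    by apply/funext => n; rewrite /= !mxE.
  apply: cvgM; first exact: cvg_cst.
  apply: cvgD; first exact: cvg_cst.
  by apply: cvgn_sum => j; apply: cvgM.
have sY : Y^T = Y.
  apply/matrixP => k l'; rewrite mxE.
  apply: (@cvg_unique _ _ _ _ _ _ (cvgY l' k)) => //.
  rewrite (_ : (fun n => _) = (fun n => sqrt_iter E n k l')); first exact: cvgY.
  by apply/funext => n; rewrite -[in LHS](sqrt_iter_sym n sE) mxE.
have Yy v : dot v (Y *m v) <= y * dot v v.
  have cv : (dot v (sqrt_iter E n *m v)) @[n --> \oo] --> dot v (Y *m v).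
    under eq_fun do rewrite dot_mulmx.
    rewrite dot_mulmx; apply: cvgn_sum => k; apply: cvgn_sum => l'.
    by apply: cvgM => //; exact: cvg_cst.
  apply: (cvgr_to_le cv).
  near=> n; apply: le_trans (ler_norm _) _; apply: le_trans (cauchy_schwarz _ _) _.
  rewrite -enorm_sqr expr2 mulrCA ler_wpM2l ?enorm_ge0//.
  exact: (sqrt_iter_bound n y0 yE opE).
pose B := Num.sqrt a *: (1%:M - Y).
exists B; last first.
  rewrite /B -scalemxAl -scalemxAr scalerA -expr2 sqr_sqrtr ?(ltW a0)//.
  have YY : Y *m Y = 2 *: Y - E.
    by rewrite [in RHS]YE scalerA divff// scale1r addrAC subrr add0r.
  have -> : (1%:M - Y) *m (1%:M - Y) = 1%:M - Y - (Y - Y *m Y).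
    by rewrite mulmxBl mul1mx mulmxBr mulmx1.
  rewrite YY EE [X in _ *: X](_ : _ = a^-1 *: A); last first.
    by apply/matrixP => i j; rewrite !mxE; ring.
  by rewrite scalerA divff// scale1r.
have sB : B^T = B by rewrite /B linearZ /= linearB /= trmx1 sY.
apply: (@posdef_of_lower _ _ _ (Num.sqrt a * q)) => //.
  by rewrite mulr_gt0// sqrtr_gt0.
move=> v; rewrite /B -scalemxAl dotZr mulmxBl mul1mx dotBr -mulrA.
rewrite ler_wpM2l ?sqrtr_ge0//; have := Yy v; rewrite /y; lra.
Unshelve. all: by end_near.
Qed.

(** The square root is determined, and depends continuously on its square: for
    [D = B1 - B2], the trace of [D (B1 ^ 2 - B2 ^ 2)] is at least a multiple of the
    sum of the squares of the entries of [D]. *)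
Lemma posdef_sqrt_lipschitz B1 B2 l e : posdef B1 -> posdef B2 -> 0 < l ->
  (forall v, l * dot v v <= dot v (B1 *m v)) ->
  0 <= e -> (forall i j, `|(B1 *m B1 - B2 *m B2) i j| <= e) ->
  forall i j, `|(B1 - B2) i j| <= d%:R ^+ 2 * e / l.
Proof.
move=> p1 p2 l0 B1l e0 He i0 j0.
have [s1 _] := p1; have [s2 _] := p2.
pose D := B1 - B2.
have sD : D^T = D by rewrite /D linearB /= s1 s2.
pose N := \sum_i \sum_j D i j ^+ 2.
have N0 : 0 <= N by do 2 apply: sumr_ge0 => ? _; exact: sqr_ge0.
have DN i j : `|D i j| <= Num.sqrt N.
  rewrite -(@ler_pXn2r _ 2)// ?nnegrE ?sqrtr_ge0// sqr_sqrtr//.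
  rewrite real_normK ?num_real// /N (bigD1 i)//= (bigD1 j)//=.
  rewrite -addrA lerDl addr_ge0//; first by apply: sumr_ge0 => ? _; exact: sqr_ge0.
  by do 2 apply: sumr_ge0 => ? _; exact: sqr_ge0.
have trE (C : 'M[R]_d) : \tr (D *m C *m D) =
    \sum_i dot (col i D) (C *m col i D).
  apply: eq_bigr => i _; rewrite -mulmxA mxE /dot; apply: eq_bigr => k _.
  have -> : D i k = D k i by rewrite -[in LHS]sD mxE.
  by rewrite !mxE; congr (_ * _); apply: eq_bigr => j _; rewrite !mxE.
have Ncol : N = \sum_i dot (col i D) (col i D).
  rewrite /N exchange_big; apply: eq_bigr => i _ /=; apply: eq_bigr => k _.
  by rewrite expr2 [col i D k 0]mxE.
have t1 : l * N <= \tr (D *m B1 *m D).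
  by rewrite trE Ncol mulr_sumr; apply: ler_sum => i _; exact: B1l.
have t2 : 0 <= \tr (D *m B2 *m D).
  by rewrite trE; apply: sumr_ge0 => i _; exact: posdef_psd.
have t3 : \tr (D *m (B1 *m B1 - B2 *m B2)) = \tr (D *m B1 *m D) + \tr (D *m B2 *m D).
  have -> : B1 *m B1 - B2 *m B2 = B1 *m D + D *m B2.
    by rewrite /D mulmxBr mulmxBl addrA subrK.
  rewrite mulmxDr mulmxA linearD /=; congr (_ + _).
  by rewrite -mulmxA [LHS]mxtrace_mulC mulmxA.
have t4 : \tr (D *m (B1 *m B1 - B2 *m B2)) <= d%:R ^+ 2 * e * Num.sqrt N.
  apply: le_trans (ler_norm _) _; apply: le_trans (ler_norm_sum _ _ _) _.
  have -> : d%:R ^+ 2 * e * Num.sqrt N = \sum_(i < d) \sum_(j < d) Num.sqrt N * e.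
    by rewrite !sumr_const !card_ord -mulrnA -[in RHS]mulr_natr natrM; ring.
  apply: ler_sum => i _; rewrite mxE; apply: le_trans (ler_norm_sum _ _ _) _.
  by apply: ler_sum => j _; rewrite normrM ler_pM.
apply: le_trans (DN i0 j0) _; rewrite ler_pdivlMr//.
have [->|Nn0] := eqVneq (Num.sqrt N) 0.
  by rewrite mul0r !mulr_ge0// exprn_ge0.
have Np : 0 < Num.sqrt N by rewrite lt_neqAle eq_sym Nn0 sqrtr_ge0.
rewrite -(ler_pM2r Np); apply: le_trans t4.
rewrite t3; apply: le_trans (_ : l * N <= _); last by lra.
by rewrite mulrAC -expr2 sqr_sqrtr// mulrC.
Qed.

Lemma posdef_sqrt_unique B1 B2 : posdef B1 -> posdef B2 -> B1 *m B1 = B2 *m B2 ->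
  B1 = B2.
Proof.
move=> p1 p2 BB; have [l l0 B1l] := posdef_lower p1.
apply/matrixP => i j; apply/eqP; rewrite -subr_eq0 -normr_eq0 eq_le normr_ge0 andbT.
have := @posdef_sqrt_lipschitz B1 B2 l 0 p1 p2 l0 B1l (lexx 0).
rewrite BB subrr mulr0 mul0r => H; have := H _ i j; rewrite !mxE; apply.
by move=> ? ?; rewrite mxE normr0.
Qed.

Lemma posdef_invmx A : posdef A -> posdef (invmx A).
Proof.
move=> pA; have Au := posdef_unit pA; have [sA _] := pA.
apply/posdefP; split; first by rewrite trmx_inv sA.
move=> v vn0; have : invmx A *m v != 0.
  by apply: contra vn0 => /eqP h; rewrite -(mulKVmx Au v) h mulmx0.
move/posdefP: pA => [_ h] /h; rewrite mulKVmx//.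
by rewrite dotC.
Qed.

Definition posdef_sqrt A : 'M[R]_d := xget 0 [set B | posdef B /\ B *m B = A].

Lemma posdef_sqrtP A : posdef A ->
  posdef (posdef_sqrt A) /\ posdef_sqrt A *m posdef_sqrt A = A.
Proof.
move=> /posdef_sqrt_exists[B pB BA]; rewrite /posdef_sqrt; case: xgetP => //.
by move=> /(_ B) /=; elim.
Qed.

Lemma invsqrtmxP A : posdef A ->
  [/\ posdef (invsqrtmx A) & invsqrtmx A *m invsqrtmx A = invmx A].
Proof. by move=> /posdef_invmx/posdef_sqrtP. Qed.

End square_root.

Section measurability.
Context {R : realType} {dO : measure_display} {Om : measurableType dO}.

Lemma measurable_set_le (f g : Om -> R) : measurable_fun setT f ->
  measurable_fun setT g -> measurable [set w | f w <= g w].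
Proof.
move=> mf mg; have := measurable_fun_ler mf mg => /(_ measurableT [set true] I).
by rewrite setTI.
Qed.

Lemma measurable_set_lt (f g : Om -> R) : measurable_fun setT f ->
  measurable_fun setT g -> measurable [set w | f w < g w].
Proof.
move=> mf mg; have := measurable_fun_ltr mf mg => /(_ measurableT [set true] I).
by rewrite setTI.
Qed.

Lemma measurable_set_forall (I : finType) (E : I -> set Om) :
  (forall i, measurable (E i)) -> measurable [set w | forall i, E i w].
Proof.
move=> mE; rewrite (_ : [set _ | _] = \bigcap_(i in [set: I]) E i); last first.
  by apply/seteqP; split => w /= h i; [move=> _; exact: h|exact: h].
by apply: fin_bigcap_measurable => //; exact: finite_finset.
Qed.

Lemma measurable_set_countable_exists (I : countType) (E : I -> set Om) :
  (forall i, measurable (E i)) -> measurable [set w | exists i, E i w].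
Proof.
move=> mE; rewrite (_ : [set _ | _] =
    \bigcup_k (if unpickle k is Some i then E i else set0)).
  by apply: bigcupT_measurable => k; case: unpickle.
apply/seteqP; split => w /= [].
- by move=> i Ei; exists (pickle i) => //; rewrite pickleK.
- by move=> k _; case: unpickle => // i; exists i.
Qed.

(** A function of [w] and of a point of [S] which is measurable in the first and
    continuous in the second variable can be evaluated at a random point of [S]:
    the point is approximated by a fixed element of [S] in the same cell of a fine
    grid.  No separability of [S] has to be assumed. *)
Lemma measurable_caratheodory (I : finType) (S : set (I -> R))
  (F : Om -> (I -> R) -> R) (Y : Om -> I -> R) :
  (forall y, S y -> measurable_fun setT (F^~ y)) ->
  (forall w (u : nat -> I -> R) y, S y -> (forall n, S (u n)) ->
     (forall i, u n i @[n --> \oo] --> y i) -> F w (u n) @[n --> \oo] --> F w y) ->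
  (forall i, measurable_fun setT (fun w => Y w i)) -> (forall w, S (Y w)) ->
  measurable_fun setT (fun w => F w (Y w)).
Proof.
move=> mF cF mY SY.
pose cell n (c : {ffun I -> int}) (y : I -> R) :=
  forall i, (c i)%:~R <= n.+1%:R * y i < (c i + 1)%:~R.
pose cellof n (y : I -> R) : {ffun I -> int} :=
  [ffun i => Num.floor (n.+1%:R * y i)].
have cellofP n y : cell n (cellof n y) y.
  by move=> i; rewrite ffunE; exact: floor_itv.
have cellofE n y c : cell n c y -> cellof n y = c.
  by move=> cy; apply/ffunP => i; rewrite ffunE; exact: floor_def.
pose rep n c := xget (fun=> 0) [set y | S y /\ cell n c y].
have repP n w : S (rep n (cellof n (Y w))) /\
    cell n (cellof n (Y w)) (rep n (cellof n (Y w))).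
  rewrite /rep; case: xgetP => [y _ []//|] /(_ (Y w)) /=.
  by move=> h; exfalso; apply: h; split.
apply: (@measurable_fun_cvg _ _ _ _ (fun n w => F w (rep n (cellof n (Y w))))).
  move=> n _ A mA; rewrite setTI.
  rewrite (_ : _ @^-1` A = [set w | exists c : {ffun I -> int},
    [set w | S (rep n c)] w /\ (cell n c (Y w) /\ A (F w (rep n c)))]); last first.
    apply/seteqP; split => w /=.
      by move=> AF; exists (cellof n (Y w)); have [? _] := repP n w.
    by move=> [c [Sc [/cellofE <-]]].
  apply: (@measurable_set_countable_exists _
     (fun c => [set w | S (rep n c) /\ (cell n c (Y w) /\ A (F w (rep n c)))])) => c.
  have [Sc|nSc] := pselect (S (rep n c)); last first.
    rewrite (_ : [set _ | _] = set0)//.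
    by apply/seteqP; split => w //= [Sc _]; exact: nSc Sc.
  rewrite (_ : [set _ | _] = [set w | cell n c (Y w)] `&` (F^~ (rep n c)) @^-1` A);
    last by apply/seteqP; split => w /=; [case=> _ []|case].
  apply: measurableI; last by have := mF _ Sc measurableT A mA; rewrite setTI.
  apply: (@measurable_set_forall _ (fun i =>
    [set w | (c i)%:~R <= n.+1%:R * Y w i < (c i + 1)%:~R])) => i.
  rewrite (_ : [set _ | _] = [set w | (c i)%:~R <= n.+1%:R * Y w i] `&`
    [set w | n.+1%:R * Y w i < (c i + 1)%:~R]); last first.
    by apply/seteqP; split => w /= /andP.
  have mnY : measurable_fun setT (fun w => n.+1%:R * Y w i) by apply: measurable_funM.
  by apply: measurableI; [exact: measurable_set_le|exact: measurable_set_lt].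
move=> w _; apply: cF => //; first by move=> n; case: (repP n w).
move=> i; apply/cvgrPdist_le => e e0; near=> n.
have [_ /(_ i)/andP[h1 h2]] := repP n w.
have /andP[h3 h4] := cellofP n (Y w) i.
have n0 : 0 < n.+1%:R :> R by [].
have h : `|n.+1%:R * (Y w i - rep n (cellof n (Y w)) i)| <= 1.
  rewrite mulrBr ler_norml; move: h2 h4; rewrite intrD => h2 h4.
  by apply/andP; split; lra.
rewrite normrM gtr0_norm// mulrC -ler_pdivlMr// in h.
apply: le_trans h _; rewrite div1r.
apply: ltW; near: n; exact: (near_infty_natSinv_lt (PosNum e0)).
Unshelve. all: by end_near. Qed.

Definition measurable_mx m n (A : Om -> 'M[R]_(m, n)) : Prop :=
  forall i j, measurable_fun setT (fun w => A w i j).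

Lemma measurable_sumr (I : Type) (r : seq I) (P : pred I) (f : I -> Om -> R) :
  (forall i, measurable_fun setT (f i)) ->
  measurable_fun setT (fun w => \sum_(i <- r | P i) f i w).
Proof.
move=> mf; elim: r => [|i r IH].
  by under eq_fun do rewrite big_nil; exact: measurable_cst.
under eq_fun do rewrite big_cons.
by case: (P i) => //; apply: measurable_funD.
Qed.

Lemma measurable_prodr (I : Type) (r : seq I) (P : pred I) (f : I -> Om -> R) :
  (forall i, measurable_fun setT (f i)) ->
  measurable_fun setT (fun w => \prod_(i <- r | P i) f i w).
Proof.
move=> mf; elim: r => [|i r IH].
  by under eq_fun do rewrite big_nil; exact: measurable_cst.
under eq_fun do rewrite big_cons.
by case: (P i) => //; apply: measurable_funM.
Qed.

Lemma measurable_invr (f : Om -> R) : measurable_fun setT f ->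
  measurable_fun setT (fun w => (f w)^-1).
Proof.
move=> mf.
have -> : (fun w => (f w)^-1) = (fun w => if f w == 0 then 0 else (f w)^-1).
  by apply/funext => w; case: eqVneq => // ->; rewrite invr0.
pose F (w : Om) (y : unit -> R) := (y tt)^-1.
pose Y w (_ : unit) := if f w == 0 then 1 else f w.
have mb : measurable_fun setT (fun w => f w == 0).
  by apply: measurable_fun_eqr.
have mFY : measurable_fun setT (fun w => F w (Y w)).
  apply: (@measurable_caratheodory unit [set y | y tt != 0] F Y).
  - by move=> y _; exact: measurable_cst.
  - by move=> w u y y0 _ uy; apply: cvgV => //; exact: uy.
  - by move=> i; apply: measurable_fun_ifT.
  - by move=> w; rewrite /Y /=; case: (eqVneq (f w) 0) => // _; exact: oner_neq0.
have -> : (fun w => if f w == 0 then 0 else (f w)^-1) =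
    (fun w => if f w == 0 then 0 else F w (Y w)).
  by apply/funext => w; rewrite /F /Y; case: ifP.
by apply: measurable_fun_ifT.
Qed.

Lemma measurable_funV_div (f g : Om -> R) : measurable_fun setT f ->
  measurable_fun setT g -> measurable_fun setT (fun w => f w / g w).
Proof. by move=> mf mg; apply: measurable_funM => //; exact: measurable_invr. Qed.

Lemma measurable_mulmx m n p (A : Om -> 'M[R]_(m, n)) (B : Om -> 'M[R]_(n, p)) :
  measurable_mx A -> measurable_mx B -> measurable_mx (fun w => A w *m B w).
Proof.
move=> mA mB i j; under eq_fun do rewrite mxE.
by apply: measurable_sumr => k; apply: measurable_funM.
Qed.

Lemma measurable_mxZ m n (a : Om -> R) (A : Om -> 'M[R]_(m, n)) :
  measurable_fun setT a -> measurable_mx A -> measurable_mx (fun w => a w *: A w).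
Proof. by move=> ma mA i j; under eq_fun do rewrite mxE; apply: measurable_funM. Qed.

Lemma measurable_trmx m n (A : Om -> 'M[R]_(m, n)) :
  measurable_mx A -> measurable_mx (fun w => (A w)^T).
Proof. by move=> mA i j; under eq_fun do rewrite mxE; exact: mA. Qed.

Lemma measurable_mx_sum m n (I : Type) (r : seq I) (P : pred I)
  (A : I -> Om -> 'M[R]_(m, n)) : (forall i, measurable_mx (A i)) ->
  measurable_mx (fun w => \sum_(i <- r | P i) A i w).
Proof.
by move=> mA i j; under eq_fun do rewrite summxE; apply: measurable_sumr => k; exact: mA.
Qed.

Lemma measurable_mxB m n (A B : Om -> 'M[R]_(m, n)) :
  measurable_mx A -> measurable_mx B -> measurable_mx (fun w => A w - B w).
Proof.
by move=> mA mB i j; under eq_fun do rewrite !mxE; apply: measurable_funB.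
Qed.

Lemma measurable_det n (A : Om -> 'M[R]_n) : measurable_mx A ->
  measurable_fun setT (fun w => \det (A w)).
Proof.
move=> mA; apply: measurable_sumr => s; apply: measurable_funM => //.
by apply: measurable_prodr => i; exact: mA.
Qed.

Lemma measurable_invmx n (A : Om -> 'M[R]_n) : measurable_mx A ->
  measurable_mx (fun w => invmx (A w)).
Proof.
move=> mA i j.
have md := measurable_det mA.
have -> : (fun w => invmx (A w) i j) =
    (fun w => if \det (A w) == 0 then A w i j
              else (\det (A w))^-1 * cofactor (A w) j i).
  apply/funext => w; rewrite /invmx unitmxE unitfE.
  by case: eqVneq => //= _; rewrite !mxE.
apply: measurable_fun_ifT => //; first exact: measurable_fun_eqr.
apply: measurable_funM; first exact: measurable_invr.
apply: measurable_funM => //; apply: measurable_det => k l.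
by under eq_fun do rewrite !mxE; exact: mA.
Qed.

Lemma measurable_dot n (u v : Om -> 'cV[R]_n) : measurable_mx u -> measurable_mx v ->
  measurable_fun setT (fun w => dot (u w) (v w)).
Proof. by move=> mu mv; apply: measurable_sumr => k; apply: measurable_funM. Qed.

Lemma measurable_sqrt (f : Om -> R) : measurable_fun setT f ->
  measurable_fun setT (fun w => Num.sqrt (f w)).
Proof.
by move=> mf; apply: measurableT_comp => //; apply: continuous_measurable_fun;
  exact: sqrt_continuous.
Qed.

Lemma measurable_enorm n (u : Om -> 'cV[R]_n) : measurable_mx u ->
  measurable_fun setT (fun w => enorm (u w)).
Proof.
move=> mu; under eq_fun do rewrite enormE.
by apply: measurable_sqrt; exact: measurable_dot.
Qed.

(** The square root of a random positive-definite matrix is measurable because it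
    is continuous on the positive-definite matrices. *)
Lemma measurable_posdef_sqrt n (A : Om -> 'M[R]_n) : measurable_mx A ->
  (forall w, posdef (A w)) -> measurable_mx (fun w => posdef_sqrt (A w)).
Proof.
move=> mA pA i0 j0.
pose mx (y : 'I_n * 'I_n -> R) : 'M[R]_n := \matrix_(i, j) y (i, j).
pose Y w (ij : 'I_n * 'I_n) := A w ij.1 ij.2.
have mxY w : mx (Y w) = A w by apply/matrixP => i j; rewrite mxE.
pose F (w : Om) y := posdef_sqrt (mx y) i0 j0.
have -> : (fun w => posdef_sqrt (A w) i0 j0) = (fun w => F w (Y w)).
  by apply/funext => w; rewrite /F mxY.
apply: (@measurable_caratheodory _ [set y | posdef (mx y)] F Y) => //; first last.
- by move=> w /=; rewrite mxY.
- by move=> [i j]; exact: mA.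
move=> w u y /= py pu uy; apply/cvgrPdist_le => e e0.
have [pB BB] := posdef_sqrtP py.
have [l l0 Bl] := posdef_lower pB.
have D0 : 0 < n%:R ^+ 2 + 1 :> R by apply: ltr_wpDl => //; exact: exprn_ge0.
pose e' := e * l / (n%:R ^+ 2 + 1).
have e'0 : 0 < e' by rewrite divr_gt0// mulr_gt0.
near=> k.
have ue i j : `|(mx y - mx (u k)) i j| <= e'.
  rewrite !mxE; move: i j.
  suff : forall ij, `|y ij - u k ij| <= e' by move=> h i j; exact: h.
  near: k; apply: filter_forall => ij.
  by have /cvgrPdist_le := uy ij; apply.
have [pC CC] := posdef_sqrtP (pu k).
have := @posdef_sqrt_lipschitz _ _ (posdef_sqrt (mx y)) (posdef_sqrt (mx (u k))) l e'
  pB pC l0 Bl (ltW e'0).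
rewrite BB CC => /(_ ue i0 j0); rewrite !mxE /F => /le_trans; apply.
rewrite ler_pdivrMr// /e' mulrA ler_pdivrMr// mulrC ler_wpM2l//.
  by rewrite ltW// mulr_gt0.
by rewrite lerDl.
Unshelve. all: by end_near. Qed.

End measurability.

Section law.
Context {R : realType} {d1 d2 : measure_display} {Om : measurableType d1}
  {T : measurableType d2}.
Variables (P : {measure set Om -> \bar R}) (nu : {measure set T -> \bar R}).
Variables (X : Om -> T).
Hypotheses (mX : measurable_fun setT X)
  (lawX : forall A, measurable A -> P (X @^-1` A) = nu A).

Let Xm : {mfun Om >-> T} := HB.pack X (isMeasurableFun.Build _ _ _ _ X mX).

Lemma ge0_integral_law (f : T -> \bar R) : measurable_fun setT f ->
  (forall x, 0 <= f x)%E -> (\int[P]_w f (X w) = \int[nu]_x f x)%E.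
Proof.
move=> mf f0; rewrite -[LHS]/(\int[P]_(w in Xm @^-1` setT) (f \o Xm) w)%E.
rewrite -ge0_integral_pushforward//.
by apply: eq_measure_integral => A mA _; exact: lawX.
Qed.

Lemma integrable_law (f : T -> \bar R) : nu.-integrable setT f ->
  P.-integrable setT (f \o X).
Proof.
move=> /integrableP[mf foo]; apply/integrableP; split.
  exact: measurableT_comp.
rewrite (@ge0_integral_law (fun x => `|f x|)%E)//.
exact: measurableT_comp.
Qed.

Lemma integral_law (f : T -> \bar R) : nu.-integrable setT f ->
  (\int[P]_w f (X w) = \int[nu]_x f x)%E.
Proof.
move=> intf; rewrite -[LHS]/(\int[P]_(w in Xm @^-1` setT) (f \o Xm) w)%E.
rewrite -integral_pushforward//.
- by apply: eq_measure_integral => A mA _; exact: lawX.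
- by have /integrableP[] := intf.
- exact: integrable_law.
Qed.

End law.

Section weak_law.
Context {R : realType} {dO dT : measure_display} {Om : measurableType dO}
  {T : measurableType dT}.
Variables (P : probability Om R) (mu : probability T R) (Z : nat -> Om -> T).
Hypothesis Z_iid : iid P mu Z.

Lemma iid_law i A : measurable A -> P (Z i @^-1` A) = mu A.
Proof.
move=> mA; pose A' j := if j == i then A else setT.
have mA' j : measurable (A' j) by rewrite /A'; case: ifP.
have A'i : A' i = A by rewrite /A' eqxx.
have := proj2 Z_iid i.+1 A' mA'.
rewrite big_ord_recr /= A'i big1 ?mul1e => [<-|j _]; last first.
  by rewrite /A' ltn_eqF// probability_setT.
congr (P _); apply/seteqP; split => w /= h.
  by move=> j _; rewrite /A'; case: eqP => // ->.
by rewrite -A'i; exact: h.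
Qed.

Lemma iid_pair_law i j A : i != j -> measurable A -> P ((fun w => (Z i w, Z j w)) @^-1` A)
  = (mu \x mu)%E A.
Proof.
move=> ij mA.
have mZ k : measurable_fun setT (Z k) by have [] := Z_iid.
have mZZ : measurable_fun setT (fun w => (Z i w, Z j w)).
  exact: measurable_fun_pair.
pose X : {mfun Om >-> (T * T)%type} := HB.pack (fun w => (Z i w, Z j w))
  (isMeasurableFun.Build _ _ _ _ (fun w => (Z i w, Z j w)) mZZ).
rewrite (@product_measure_unique _ _ _ _ _ mu mu (distribution P X))//.
move=> B C mB mC.
pose A' k := if k == i then B else if k == j then C else setT.
have mA' k : measurable (A' k) by rewrite /A'; case: ifP => // _; case: ifP.
have := proj2 Z_iid (maxn i j).+1 A' mA'.
have im : (i < (maxn i j).+1)%N by rewrite ltnS leq_maxl.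
have jm : (j < (maxn i j).+1)%N by rewrite ltnS leq_maxr.
have A'i : A' i = B by rewrite /A' eqxx.
have A'j : A' j = C by rewrite /A' eq_sym (negbTE ij) eqxx.
rewrite (bigD1 (Ordinal im))//= A'i (bigD1 (Ordinal jm))/=; last first.
  by rewrite -val_eqE /= eq_sym.
rewrite A'j big1 ?mule1 => [<-|k]; last first.
  rewrite -!val_eqE /= /A' => /andP[/negbTE -> /negbTE ->].
  by rewrite probability_setT.
congr (P _); apply/seteqP; split => w /=.
  by move=> [Bw Cw] k _; rewrite /A'; case: eqP => [->//|_]; case: eqP => [->//|].
by move=> h; split; [rewrite -A'i; exact: h|rewrite -A'j; exact: h].
Qed.

Lemma bounded_integrable d' (T' : measurableType d')
  (nu : {measure set T' -> \bar R}) (f : T' -> R) C : (nu setT < +oo)%E ->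
  measurable_fun setT f -> (forall x, `|f x| <= C) -> nu.-integrable setT (EFin \o f).
Proof.
move=> nuoo mf fC; apply/integrableP; split; first exact/measurable_EFinP.
apply: (@le_lt_trans _ _ (\int[nu]_x (cst `|C|%:E x))%E).
  apply: ge0_le_integral => //=.
  - by do 2 apply: measurableT_comp => //.
  - by move=> x _; rewrite lee_fin (le_trans (fC x))// ler_norm.
by rewrite integral_cst// lte_mul_pinfty.
Qed.

Lemma probability_lty d' (T' : measurableType d') (nu : probability T' R) :
  (nu setT < +oo)%E.
Proof. by rewrite probability_setT ltry. Qed.

Lemma prob_Rintegral_cst d' (T' : measurableType d') (nu : probability T' R) (c : R) :
  \int[nu]_x (cst c x) = c.
Proof.
rewrite Rintegral_cst// -[RHS]mulr1; congr (_ * _).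
by rewrite -[RHS]/(fine 1%E); congr fine; exact: probability_setT.
Qed.

Lemma Rintegral_sum d' (T' : measurableType d') (nu : {measure set T' -> \bar R})
  (I : Type) (r : seq I) (f : I -> T' -> R) :
  (forall i, nu.-integrable setT (EFin \o f i)) ->
  nu.-integrable setT (EFin \o (fun x => \sum_(i <- r) f i x)) /\
  \int[nu]_x (\sum_(i <- r) f i x) = \sum_(i <- r) \int[nu]_x f i x.
Proof.
move=> fi; elim: r => [|i r [IH1 IH2]].
  rewrite big_nil; under [in X in _.-integrable _ X]eq_fun do rewrite big_nil.
  split; first exact: integrable0.
  by under eq_Rintegral do rewrite big_nil; rewrite /Rintegral integral0.
have e : (fun x => \sum_(j <- i :: r) f j x) = (fun x => f i x + \sum_(j <- r) f j x).
  by apply/funext => x; rewrite big_cons.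
rewrite e big_cons; split; first exact: (integrableD measurableT (fi i) IH1).
by rewrite RintegralD// IH2.
Qed.

Lemma markov_Rintegral d' (T' : measurableType d') (nu : probability T' R)
  (X : T' -> R) e : nu.-integrable setT (EFin \o X) -> (forall x, 0 <= X x) -> 0 < e ->
  (nu [set x | (e <= X x)%R] <= (\int[nu]_x X x / e)%:E)%E.
Proof.
move=> iX X0 e0.
have mX : measurable_fun setT X by have /integrableP[/measurable_EFinP] := iX.
have mE : measurable [set x | e <= X x] by exact: measurable_set_le.
rewrite EFinM lee_pdivlMr// /Rintegral fineK; last exact: integrable_fin_num iX.
rewrite -(setIT [set x | _]) -integral_indic// muleC -ge0_integralZl//; last first.
- by rewrite lee_fin ltW.
- by apply/measurable_EFinP; exact: measurable_indic.
apply: ge0_le_integral => //=.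
- by move=> x _; rewrite mule_ge0// lee_fin// ltW.
- by apply: emeasurable_funM => //; apply/measurable_EFinP; exact: measurable_indic.
- exact/measurable_EFinP.
- move=> x _; rewrite -EFinM lee_fin indicE.
  case: (boolP (x \in _)) => [|_]; last by rewrite mulr0.
  by rewrite inE /= mulr1.
Qed.

(** Chebyshev's inequality, from pairwise independence. *)
Lemma weak_law_bounded (h : T -> R) C e n : measurable_fun setT h ->
  (forall z, `|h z| <= C) -> \int[mu]_z h z = 0 -> 0 < e -> (0 < n)%N ->
  (P [set w | (e <= `|n%:R^-1 * \sum_(i < n) h (Z i w)|)%R]
     <= (C ^+ 2 / (n%:R * e ^+ 2))%:E)%E.
Proof.
move=> mh hC h0 e0 n0.
have C0 : 0 <= C by exact: le_trans (hC point).
have mZ k : measurable_fun setT (Z k) by have [] := Z_iid.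
have mhZ k : measurable_fun setT (fun w => h (Z k w)) by exact: measurableT_comp.
have bZZ i j : P.-integrable setT (EFin \o (fun w => h (Z i w) * h (Z j w))).
  apply: (@bounded_integrable _ _ _ _ (C * C)); first exact: probability_lty.
    exact: measurable_funM.
  by move=> w; exact: normr_le_mul.
have ih : mu.-integrable setT (EFin \o h).
  exact: (@bounded_integrable _ _ _ _ C (probability_lty mu)).
have cov i j : i != j -> \int[P]_w (h (Z i w) * h (Z j w)) = 0.
  move=> ij; pose f (z : T * T) := (h z.1 * h z.2)%:E.
  have mf : measurable_fun setT f.
    by apply/measurable_EFinP; apply: measurable_funM; apply: measurableT_comp.
  have iff : (mu \x mu)%E.-integrable setT f.
    apply: (@bounded_integrable _ _ _ (fun z => h z.1 * h z.2) (C * C)).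
    - apply: (@eq_ind_r _ 1%E (fun u => u < +oo)%E); first exact: ltry.
      apply: etrans (esym (@iid_pair_law i j setT ij measurableT)) _.
      by rewrite preimage_setT probability_setT.
    - by apply: measurable_funM; apply: measurableT_comp.
    - by move=> z; exact: normr_le_mul.
  rewrite /Rintegral.
  rewrite (@integral_law _ _ _ _ _ P (mu \x mu)%E (fun w => (Z i w, Z j w)) _ _ f)//.
  - rewrite -integral12_prod_meas1//.
    transitivity (fine (\int[mu]_x (cst 0%E x))%E); last by rewrite integral0.
    congr fine; apply: eq_integral => x _; rewrite /fubini_F /f /=; under eq_integral do rewrite EFinM.
    rewrite integralZl//.
    have := h0; rewrite /Rintegral => h0'.
    rewrite -[X in (_ * X)%E]fineK ?h0' ?mule0//.
    exact: integrable_fin_num ih.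
  - exact: measurable_fun_pair.
  - by move=> A mA; exact: iid_pair_law.
set X := fun w => n%:R^-1 * \sum_(i < n) h (Z i w).
have mX : measurable_fun setT X by apply: measurable_funM => //; exact: measurable_sumr.
have mE : measurable [set w | e <= `|X w|].
  by apply: measurable_set_le => //; apply: measurableT_comp.
have XE w : X w ^+ 2 = n%:R ^- 2 * \sum_(i < n) \sum_(j < n) h (Z i w) * h (Z j w).
  rewrite /X exprMn exprVn; congr (_ * _); rewrite expr2 mulr_suml.
  by apply: eq_bigr => i _; rewrite mulr_sumr.
have isum := @Rintegral_sum _ _ P _ (index_enum 'I_n)
  (fun i w => \sum_(j < n) h (Z i w) * h (Z j w))
  (fun i => (@Rintegral_sum _ _ P _ (index_enum 'I_n) (fun j w => h (Z i w) * h (Z j w))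
    (fun j => bZZ i j)).1).
have VX : \int[P]_w (X w ^+ 2) <= C ^+ 2 / n%:R.
  under eq_Rintegral do rewrite XE.
  rewrite RintegralZl//; last exact: isum.1.
  rewrite isum.2 ler_pdivrMl ?exprn_gt0 ?ltr0n//.
  rewrite (_ : _ * (C ^+ 2 / n%:R) = \sum_(i < n) C ^+ 2); last first.
    rewrite sumr_const card_ord -[RHS]mulr_natr; field.
    by rewrite pnatr_eq0 -lt0n.
  apply: ler_sum => i _.
  have [_ ->] := @Rintegral_sum _ _ P _ (index_enum 'I_n)
    (fun j w => h (Z i w) * h (Z j w)) (fun j => bZZ i j).
  rewrite (bigD1 i)//= big1 ?addr0; last by move=> j ji; rewrite cov// eq_sym.
  have -> : C ^+ 2 = \int[P]_w (cst (C ^+ 2) w).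
    by rewrite prob_Rintegral_cst.
  apply: le_Rintegral => //.
    exact: (@bounded_integrable _ _ _ _ `|C ^+ 2| (probability_lty P)).
  by move=> w _; apply: le_trans (ler_norm _) _; rewrite expr2; exact: normr_le_mul.
have iX : P.-integrable setT (EFin \o (fun w => X w ^+ 2)).
  have -> : (fun w => X w ^+ 2) =
      (fun w => n%:R ^- 2 * \sum_(i < n) \sum_(j < n) h (Z i w) * h (Z j w)).
    by apply/funext => w.
  have := integrableZl measurableT (n%:R ^- 2) isum.1.
  by under eq_fun do rewrite -EFinM.
rewrite (_ : [set w | _] = [set w | e ^+ 2 <= X w ^+ 2]); last first.
  apply/seteqP; split => w /=; rewrite -[X w ^+ 2]real_normK ?num_real//;
    by rewrite ler_pXn2r// ?nnegrE// ltW.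
apply: le_trans (markov_Rintegral iX _ _) _; [by move=> w; exact: sqr_ge0|exact: exprn_gt0|].
rewrite lee_fin (_ : C ^+ 2 / (n%:R * e ^+ 2) = C ^+ 2 / n%:R / e ^+ 2).
  by rewrite ler_pM2r// invr_gt0 exprn_gt0.
by rewrite -mulrA -invfM.
Qed.

Lemma truncation_tail (f : T -> R) (t : R) : mu.-integrable setT (EFin \o f) -> 0 < t ->
  exists K : R, \int[mu]_z `|f z - (if `|f z| <= K then f z else 0)| <= t.
Proof.
move=> fi t0.
have mf : measurable_fun setT f by have /integrableP[/measurable_EFinP] := fi.
pose r n z := `|f z - (if `|f z| <= n%:R then f z else 0)|.
have rf n z : `|r n z| <= `|f z|.
  by rewrite /r normr_id; case: ifP => _; rewrite ?subrr ?normr0 ?subr0.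
have mr n : measurable_fun setT (r n).
  apply: measurableT_comp => //; apply: measurable_funB => //.
  apply: measurable_fun_ifT => //; apply: measurable_fun_ler => //.
  exact: measurableT_comp.
have r0 z : r^~ z n @[n --> \oo] --> (0 : R).
  apply/cvgrPdist_le => e e0; near=> n.
  rewrite /r ifT ?subrr ?normr0 ?subr0 ?normr0 ?(ltW e0)//.
  near: n; exact: nbhs_infty_ger.
have mrE n : measurable_fun setT (fun z => (r n z)%:E) by exact/measurable_EFinP.
have [] := @dominated_convergence _ _ _ mu setT measurableT
  (fun n z => (r n z)%:E) (cst 0%E) (fun z => `|(f z)%:E|%E) mrE.
- exact: measurable_cst.
- apply: aeW => z _.
  by apply/fine_cvgP; split; [exact: nearW|exact: r0].
- exact: integrable_abse.
- by apply: aeW => z n _; rewrite lee_fin.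
move=> _ _; rewrite integral0 => /fine_cvgP[_ /cvgrPdist_le /(_ t t0)] [N _ HN].
exists N%:R; have := HN N (leqnn N); rewrite /= sub0r normrN.
by apply: le_trans; exact: ler_norm.
Unshelve. all: by end_near. Qed.

(** The weak law of large numbers for integrable functions: truncation reduces it
    to the bounded case. *)
Lemma weak_law (f : T -> R) (e t : R) : mu.-integrable setT (EFin \o f) ->
  0 < e -> 0 < t -> \forall n \near \oo,
  (P [set w | (e <= `|n%:R^-1 * \sum_(i < n) f (Z i w) - \int[mu]_z f z|)%R] <= t%:E)%E.
Proof.
move=> fi e0 t0.
have mf : measurable_fun setT f by have /integrableP[/measurable_EFinP] := fi.
have mZ k : measurable_fun setT (Z k) by have [] := Z_iid.
pose tau := Num.min (e / 3) (e / 3 * (t / 2)).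
have tau0 : 0 < tau by rewrite lt_min !divr_gt0//= mulr_gt0// divr_gt0.
have [K HK] := truncation_tail fi tau0.
pose g z := if `|f z| <= K then f z else 0.
have mg : measurable_fun setT g.
  apply: measurable_fun_ifT => //; apply: measurable_fun_ler => //.
  exact: measurableT_comp.
have gK z : `|g z| <= `|K|.
  rewrite /g; case: ifP => [h|_]; last by rewrite normr0.
  by apply: le_trans h _; exact: ler_norm.
have ig : mu.-integrable setT (EFin \o g).
  exact: (@bounded_integrable _ _ _ _ `|K| (probability_lty mu)).
have ifg : mu.-integrable setT (EFin \o (fun z => f z - g z)).
  exact: (integrableB measurableT fi ig).
have ir : mu.-integrable setT (EFin \o (fun z => `|f z - g z|)).
  exact: (integrable_norm ifg).
pose mg0 := \int[mu]_z g z.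
have mK : `|mg0| <= `|K|.
  apply: le_trans (le_normr_Rintegral measurableT ig) _.
  have -> : `|K| = \int[mu]_w (cst `|K| w).
    by rewrite prob_Rintegral_cst.
  apply: le_Rintegral => //; first exact: (integrable_norm ig).
  apply: (@bounded_integrable _ _ _ _ `|K| (probability_lty mu)) => // x.
  by rewrite normr_id.
pose h z := g z - mg0.
have mh : measurable_fun setT h by exact: measurable_funB.
have hK z : `|h z| <= `|K| + `|K| by exact: normr_le_sub.
have h0 : \int[mu]_z h z = 0.
  rewrite /h RintegralB//; last first.
    exact: (@bounded_integrable _ _ _ _ `|mg0| (probability_lty mu)).
  by rewrite prob_Rintegral_cst subrr.
have e30 : 0 < e / 3 by rewrite divr_gt0.
near=> n.
have n0 : (0 < n)%N by near: n; exact: nbhs_infty_gt.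
have := @weak_law_bounded h _ (e / 3) n mh hK h0 e30 n0.
set E1 := [set w | _] => PE1.
pose E2 := [set w | e / 3 <= n%:R^-1 * \sum_(i < n) `|f (Z i w) - g (Z i w)|].
have iZ (u : T -> R) k : mu.-integrable setT (EFin \o u) ->
    P.-integrable setT (EFin \o (fun w => u (Z k w))).
  by move=> iu; apply: (@integrable_law _ _ _ _ _ P mu (Z k) (mZ k) (iid_law k) _ iu).
have eZ (u : T -> R) k : mu.-integrable setT (EFin \o u) ->
    \int[P]_w u (Z k w) = \int[mu]_z u z.
  by move=> iu; congr fine; apply: (@integral_law _ _ _ _ _ P mu (Z k) (mZ k) (iid_law k) _ iu).
have [is1 is2] := @Rintegral_sum _ _ P _ (index_enum 'I_n)
  (fun i w => `|f (Z i w) - g (Z i w)|) (fun i => iZ _ i ir).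
have iav : P.-integrable setT
    (EFin \o (fun w => n%:R^-1 * \sum_(i < n) `|f (Z i w) - g (Z i w)|)).
  have := integrableZl measurableT n%:R^-1 is1.
  by under eq_fun do rewrite -EFinM.
have PE2 : (P E2 <= (t / 2)%:E)%E.
  apply: le_trans (markov_Rintegral iav _ e30) _.
    by move=> w; rewrite mulr_ge0 ?invr_ge0// sumr_ge0.
  rewrite lee_fin ler_pdivrMr// RintegralZl// is2.
  under eq_bigr do rewrite (eZ _ _ ir).
  rewrite sumr_const card_ord -[X in _ * X <= _]mulr_natl mulKf ?pnatr_eq0 -?lt0n//.
  by apply: le_trans HK _; rewrite ge_min [t / 2 * _]mulrC lexx orbT.
have PE1' : (P E1 <= (t / 2)%:E)%E.
  apply: le_trans PE1 _; rewrite lee_fin.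
  have te0 : 0 < t / 2 * (e / 3) ^+ 2 by rewrite mulr_gt0 ?divr_gt0// exprn_gt0.
  rewrite ler_pdivrMr ?mulr_gt0 ?ltr0n ?exprn_gt0// mulrCA -ler_pdivrMr//.
  by near: n; exact: nbhs_infty_ger.
have msum (u : T -> R) : measurable_fun setT u ->
    measurable_fun setT (fun w => n%:R^-1 * \sum_(i < n) u (Z i w)).
  move=> mu'; apply: measurable_funM => //; apply: measurable_sumr => i.
  exact: measurableT_comp.
have mE1 : measurable E1.
  by apply: measurable_set_le => //; apply: measurableT_comp => //; exact: msum.
have mE2 : measurable E2.
  apply: measurable_set_le => //; apply: (msum (fun z => `|f z - g z|)).
  by apply: measurableT_comp => //; exact: measurable_funB.
rewrite [t]splitr EFinD.
apply: le_trans (leeD PE1' PE2).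
apply: le_trans (measureU2 _ mE1 mE2).
apply: le_measure; rewrite ?inE//.
- apply: measurable_set_le => //; apply: measurableT_comp => //.
  by apply: measurable_funB => //; exact: msum.
- exact: measurableU.
move=> w /= ew; apply: contrapT => /not_orP[/negP n1 /negP n2].
move: n1 n2; rewrite -!ltNge => n1 n2.
have n3 : `|\int[mu]_z f z - mg0| <= e / 3.
  rewrite /mg0 -RintegralB//.
  apply: le_trans (le_normr_Rintegral measurableT ifg) _.
  by apply: le_trans HK _; rewrite ge_min lexx.
move: ew; apply/negP; rewrite -ltNge.
have -> : n%:R^-1 * \sum_(i < n) f (Z i w) - \int[mu]_z f z =
  n%:R^-1 * \sum_(i < n) h (Z i w)
  + n%:R^-1 * \sum_(i < n) (f (Z i w) - g (Z i w)) - (\int[mu]_z f z - mg0).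
  rewrite /h !sumrB sumr_const card_ord -[mg0 *+ n]mulr_natl.
  by field; rewrite pnatr_eq0 -lt0n.
have n4 : `|n%:R^-1 * \sum_(i < n) (f (Z i w) - g (Z i w))| <=
    n%:R^-1 * \sum_(i < n) `|f (Z i w) - g (Z i w)|.
  by rewrite normrM ger0_norm ?invr_ge0// ler_wpM2l ?invr_ge0// ler_norm_sum.
apply: le_lt_trans (normr_le_sub (normr_le_add (lexx _) n4) n3) _; lra.
Unshelve. all: by end_near. Qed.

End weak_law.

Section draws.
Context {R : realType} {dO : measure_display} {Om : measurableType dO}.
Variables (P : probability Om R) (G0 : set (set Om)).
Local Notation G := (<<s G0 >>).
Local Notation OmG := (g_sigma_algebraType G0).
Hypothesis Gm : G `<=` measurable.

(** What is known of the draws given [G] determines the probability of every event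
    that depends on the draws and on [G]: on a set of [G] it lies between the
    pointwise bounds of the conditional probabilities, which are finite sums. *)
Lemma draw_probability (D : set Om) n s (p : Om -> nat -> R) (J : nat -> Om -> nat)
  (E : {ffun 'I_s -> 'I_n} -> set Om) (B : set Om) (c1 c2 : R) :
  drawn_with_replacement P G D n s p J -> (0 < n)%N ->
  (forall i : 'I_n, measurable_fun setT (fun w => p w i)) ->
  (forall j, G (E j)) -> G B -> B `<=` D ->
  (forall w (i : 'I_n), B w -> 0 <= p w i) ->
  (forall w, B w -> c1 <= \sum_(j : {ffun 'I_s -> 'I_n}) (\prod_(k < s) p w (j k)) * \1_(E j) w <= c2) ->
  (c1%:E * P B <= P (B `&` [set w | exists j : {ffun 'I_s -> 'I_n},
      (forall k : 'I_s, J k w = j k) /\ E j w]) <= c2%:E * P B)%E.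
Proof.
move=> [mJ Jn HJ] n0 mp GE GB BD p0 Hc.
pose A (j : {ffun 'I_s -> 'I_n}) := B `&` E j `&` [set w | forall k : 'I_s, J k w = j k].
have GBE j : G (B `&` E j) by exact: (@measurableI _ OmG _ _ GB (GE j)).
have mB : measurable B by exact: Gm.
have mE j : measurable (E j) by exact: Gm.
have mA j : measurable (A j).
  apply: measurableI; first exact: measurableI.
  by apply: (@measurable_set_forall _ _ _ (fun k : 'I_s => [set w | J k w = j k])).
have mpr (j : {ffun 'I_s -> 'I_n}) :
    measurable_fun setT (fun w => \prod_(k < s) p w (j k)).
  exact: measurable_prodr.
pose ev := B `&` [set w | exists j : {ffun 'I_s -> 'I_n},
      (forall k : 'I_s, J k w = j k) /\ E j w].
have mev : measurable ev.
  rewrite (_ : ev = [set w | exists j, A j w]).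
    exact: measurable_set_countable_exists.
  apply/seteqP; split => w; first by move=> [Bw [j [Jw Ew]]]; exists j.
  by move=> [j [[Bw Ew] Jw]]; split => //; exists j.
have evE w : \1_ev w = \sum_j \1_(A j) w :> R.
  have [[Bw [j [Jw Ew]]]|nev] := pselect (ev w).
    have Aj : A j w by [].
    rewrite indicE mem_set; last by split => //; exists j.
    rewrite (bigD1 j)//= indicE mem_set// big1 ?addr0// => j' jj'.
    rewrite indicE memNset// => -[_ J'w]; move/eqP: jj'; apply.
    by apply/ffunP => k; apply: val_inj; rewrite /= -Jw -J'w.
  rewrite indicE memNset// big1// => j _; rewrite indicE memNset// => -[[Bw Ew] Jw].
  by apply: nev; split => //; exists j.
have Pev : P ev = (\sum_j P (A j))%E.
  rewrite -[in LHS](setIT ev) -integral_indic//.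
  under eq_integral do rewrite evE -sumEFin.
  rewrite ge0_integral_sum//; first by apply: eq_bigr => j _; rewrite integral_indic// setIT.
  by move=> j; apply/measurable_EFinP; exact: measurable_indic.
have prod_ge0 w (j : {ffun 'I_s -> 'I_n}) : B w -> 0 <= (\prod_(k < s) p w (j k)) * \1_(E j) w.
  by move=> Bw; rewrite mulr_ge0//; apply: prodr_ge0 => k _; exact: p0.
have mprE (j : {ffun 'I_s -> 'I_n}) :
    measurable_fun setT (fun w => (\prod_(k < s) p w (j k)) * \1_(E j) w : R).
  by apply: measurable_funM => //; exact: measurable_indic.
have PA j : P (A j) = (\int[P]_(w in B) ((\prod_(k < s) p w (j k)) * \1_(E j) w)%:E)%E.
  rewrite HJ//; last by move=> w [/BD].
  rewrite integral_mkcondr; apply: eq_integral => w _.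
  by rewrite patchE indicE; case: (w \in E j); rewrite ?mulr1 ?mulr0.
have Psum : P ev = (\int[P]_(w in B) (\sum_(j : {ffun 'I_s -> 'I_n}) (\prod_(k < s) p w (j k)) * \1_(E j) w)%:E)%E.
  rewrite Pev; under eq_bigr do rewrite PA.
  rewrite -ge0_integral_sum//.
  - by apply: eq_integral => w _; rewrite sumEFin.
  - by move=> j; apply/measurable_EFinP; exact: measurable_funTS.
  - by move=> j w Bw; rewrite lee_fin prod_ge0.
have iS : P.-integrable B (EFin \o (fun w =>
    \sum_(j : {ffun 'I_s -> 'I_n}) (\prod_(k < s) p w (j k)) * \1_(E j) w)).
  apply/integrableP; split.
    apply/measurable_EFinP; apply: measurable_funTS.
    exact: measurable_sumr.
  apply: (@le_lt_trans _ _ (P ev)); last first.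
    by apply: le_lt_trans (probability_le1 P mev) _; rewrite ltry.
  rewrite Psum; apply: ge0_le_integral => //=.
  - by apply/measurable_EFinP; apply: measurable_funTS; apply: measurableT_comp => //;
      exact: measurable_sumr.
  - by apply/measurable_EFinP; apply: measurable_funTS; exact: measurable_sumr.
  - move=> w Bw; rewrite lee_fin ger0_norm//.
    by apply: sumr_ge0 => j _; exact: prod_ge0.
have icst c : P.-integrable B (EFin \o cst c).
  apply: (@integrableS _ _ _ P setT) => //.
  exact: (@bounded_integrable _ _ _ P (cst c) `|c| (probability_lty P)).
have cst_int c : (c%:E * P B)%E = (\int[P]_(w in B) cst c%:E w)%E.
  by rewrite integral_cst.
rewrite !cst_int -/ev Psum; apply/andP; split.
- apply: le_integral => //; first exact: icst.
  by move=> w; rewrite inE => /Hc/andP[h _]; rewrite lee_fin.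
- apply: le_integral => //; first exact: icst.
  by move=> w; rewrite inE => /Hc/andP[_ h]; rewrite lee_fin.
Qed.

End draws.

Section line_derivative.
Context {R : realType} {d : nat}.
Implicit Types (f : 'cV[R]_d -> R) (x v p : 'cV[R]_d).

Lemma derive_gradient f p v : differentiable f p -> 'D_v f p = dot (gradient f p) v.
Proof.
move=> df; rewrite deriveE//.
rewrite {1}[v](_ : _ = \sum_k v k 0 *: delta_mx k 0); last first.
  by rewrite {1}[v]matrix_sum_delta; apply: eq_bigr => k _; rewrite big_ord1.
rewrite linear_sum; apply: eq_bigr => k _ /=.
by rewrite linearZ /= -deriveE// mxE mulrC.
Qed.

Lemma is_derive_line f x v (t : R) : differentiable f (x + t *: v) ->
  is_derive t 1 (fun u => f (x + u *: v)) (dot (gradient f (x + t *: v)) v).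
Proof.
move=> df; rewrite -derive_gradient//.
have eqf : (fun h : R => h^-1 *: (((fun u => f (x + u *: v)) \o shift t) (h *: (1 : R))
     - f (x + t *: v))) =
   (fun h : R => h^-1 *: ((f \o shift (x + t *: v)) (h *: v) - f (x + t *: v))).
  apply/funext => h /=; congr (_ *: (f _ - _)).
  by rewrite scalerDl [h *: 1]mulr1 addrCA.
have : derivable f (x + t *: v) v by exact: diff_derivable.
rewrite /derivable -eqf => dv.
by apply: DeriveDef => //; rewrite /derive -eqf.
Qed.

Lemma differentiable_gradient_coord f p k : differentiable (gradient f) p ->
  differentiable (fun t => gradient f t k 0) p.
Proof.
move=> dg; exact: (differentiable_comp dg (differentiable_coord _ _ _)).
Qed.

Lemma gradient_gradient_coord f p k v : 
  dot (gradient (fun t => gradient f t k 0) p) v = (hessian f p *m v) k 0.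
Proof. by rewrite mxE; apply: eq_bigr => l _; rewrite !mxE. Qed.

(** The mean value theorem on a segment. *)
Lemma mvt_line f x v : (forall t : R, 0 <= t <= 1 -> differentiable f (x + t *: v)) ->
  exists2 t : R, 0 <= t <= 1 & f (x + v) - f x = dot (gradient f (x + t *: v)) v.
Proof.
move=> df.
have dl (t : R) : 0 <= t <= 1 ->
    is_derive t 1 (fun u => f (x + u *: v)) (dot (gradient f (x + t *: v)) v).
  by move=> t01; apply: is_derive_line; exact: df.
have der (t : R) : t \in `]0, 1[%R ->
    is_derive t 1 (fun u => f (x + u *: v)) (dot (gradient f (x + t *: v)) v).
  rewrite in_itv /= => /andP[t0 t1]; apply: dl.
  by rewrite (ltW t0) (ltW t1).
have cont : {within `[0, 1], continuous (fun u : R => f (x + u *: v))}.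
  apply: continuous_in_subspaceT => t; rewrite inE /= in_itv /= => t01.
  apply: differentiable_continuous; apply/derivable1_diffP.
  by have [] := dl t t01.
have [c] := MVT_segment ler01 der cont.
rewrite in_itv /= scale1r scale0r addr0 subr0 mulr1 => c01 ->.
by exists c.
Qed.

Lemma differentiable_expansion (g : 'cV[R]_d -> R) x (e : R) : differentiable g x ->
  0 < e -> \forall h \near (0 : 'cV[R]_d), `|g (h + x) - g x - 'd g x h| <= e * `|h|.
Proof.
move=> dg e0; near=> h.
have addK3 (a b c : R) : a + b + c - a - b = c by ring.
rewrite (diff_locallyx dg h) addK3.
near: h; apply: littleoP e0.
Unshelve. all: by end_near. Qed.

Lemma sup_norm_le_enorm v : `|v| <= enorm v.
Proof.
have [v0|] := eqVneq (mx_norm v) 0; first by rewrite [leLHS]v0 enorm_ge0.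
move=> /mx_norm_neq0[[k l]]; rewrite /= ord1 => e.
by rewrite [leLHS]e le_coord_enorm.
Qed.

Lemma coord_le_sup_norm v k : `|v k 0| <= `|v|.
Proof. by rewrite [leRHS]mx_normrE; exact: (@le_bigmax_cond _ _ _ _ (k, 0)). Qed.

(** The symmetry of the second derivative, by Young's argument: the second
    difference over a square of side [t] is [t ^ 2] times the mixed derivative, up to
    [o(t ^ 2)], in either order. *)
Lemma hessian_sym f x : twice_differentiable f x -> (hessian f x)^T = hessian f x.
Proof.
move=> [/nbhs_ballP[r r0 dfr] dg].
pose sd (t : R) (k l : 'I_d) := f (x + t *: delta_mx l 0 + t *: delta_mx k 0)
  - f (x + t *: delta_mx l 0) - f (x + t *: delta_mx k 0) + f x.
have sdC t k l : sd t k l = sd t l k.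
  by rewrite /sd (addrAC x) -!addrA [X in _ + X]addrCA.
have sup_delta (t : R) (k : 'I_d) : 0 <= t -> `|t *: (delta_mx k 0 : 'cV[R]_d)| <= t.
  move=> t0; apply: le_trans (sup_norm_le_enorm _) _.
  by rewrite enormZ enorm_delta mulr1 ger0_norm.
have key e k l : 0 < e -> exists2 D : R, 0 < D & forall t, 0 < t -> t < D ->
    `|sd t k l - t ^+ 2 * hessian f x k l| <= e * t ^+ 2.
  move=> e0.
  have e30 : 0 < e / 3 by rewrite divr_gt0.
  have [D D0 HD] := (nbhs_ballP _ _).1
     (differentiable_expansion (differentiable_gradient_coord k dg) e30).
  exists (Num.min D r / 3); first by rewrite divr_gt0// lt_min D0.
  move=> t t0; rewrite ltr_pdivlMr// lt_min => /andP[tD tr].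
  pose ek : 'cV[R]_d := delta_mx k 0; pose el : 'cV[R]_d := delta_mx l 0.
  have small1 u : 0 <= u <= 1 -> `|u *: (t *: ek)| <= t.
    move=> /andP[u0 u1]; rewrite normrZ ger0_norm//.
    apply: le_trans (ler_wpM2l u0 (sup_delta t k (ltW t0))) _.
    by rewrite ler_piMl// ltW.
  have small2 u : 0 <= u <= 1 -> `|t *: el + u *: (t *: ek)| <= 2 * t.
    move=> u01; apply: le_trans (ler_normD _ _) _.
    by rewrite mulr2n mulrDl mul1r lerD// ?small1// sup_delta// ltW.
  have df1 u : 0 <= u <= 1 -> differentiable f (x + u *: (t *: ek)).
    move=> u01; apply: dfr; rewrite -ball_normE /= opprD addNKr normrN.
    by have := small1 u u01; lra.
  have df2 u : 0 <= u <= 1 -> differentiable f (x + t *: el + u *: (t *: ek)).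
    move=> u01; apply: dfr; rewrite -ball_normE /= -addrA opprD addNKr normrN.
    by have := small2 u u01; lra.
  pose phi (u : R) := f (x + t *: el + u *: (t *: ek)) - f (x + u *: (t *: ek)).
  pose dphi (u : R) := dot (gradient f (x + t *: el + u *: (t *: ek))) (t *: ek)
    - dot (gradient f (x + u *: (t *: ek))) (t *: ek).
  have der (u : R) : 0 <= u <= 1 -> is_derive u 1 phi (dphi u).
    move=> u01; apply: is_deriveB.
      by apply: is_derive_line; exact: df2.
    by apply: is_derive_line; exact: df1.
  have der' (u : R) : u \in `]0, 1[%R -> is_derive u 1 phi (dphi u).
    rewrite in_itv /= => /andP[u0 u1]; apply: der.
    by rewrite (ltW u0) (ltW u1).
  have cont : {within `[0, 1], continuous phi}.
    apply: continuous_in_subspaceT => u; rewrite inE /= in_itv /= => u01.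
    apply: differentiable_continuous; apply/derivable1_diffP.
    by have [] := der u u01.
  have [u] := MVT_segment ler01 der' cont.
  rewrite in_itv /= subr0 mulr1 => u01 phiE.
  have sdE : sd t k l = phi 1 - phi 0.
    by rewrite /sd /phi !scale1r !scale0r !addr0; ring.
  have dotk (g : 'cV[R]_d) : dot g (t *: ek) = t * g k 0.
    rewrite dotZr /dot (bigD1 k)//= mxE !eqxx mulr1 big1 ?addr0// => j jk.
    by rewrite mxE (negbTE jk) mulr0.
  rewrite sdE phiE /dphi !dotk.
  have in_ball (h : 'cV[R]_d) : `|h| <= 2 * t -> ball (0 : 'cV[R]_d) D h.
    by move=> h2; rewrite -ball_normE /= sub0r normrN; lra.
  have b1 : `|u *: (t *: ek)| <= 2 * t by have := small1 u u01; lra.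
  have r1 := HD _ (in_ball _ (small2 u u01)).
  have r2 := HD _ (in_ball _ b1).
  have s1 : e / 3 * `|t *: el + u *: (t *: ek)| <= e / 3 * (2 * t).
    by rewrite ler_wpM2l ?(ltW e30) ?small2.
  have s2 : e / 3 * `|u *: (t *: ek)| <= e / 3 * t.
    by rewrite ler_wpM2l ?(ltW e30) ?small1.
  have := normr_le_sub (le_trans r1 s1) (le_trans r2 s2).
  rewrite /= [_ + _ + x]addrC [_ + x]addrC addrA.
  have -> : 'd (fun t0 => gradient f t0 k 0) x (t *: el + u *: (t *: ek)) =
    t * hessian f x k l + 'd (fun t0 => gradient f t0 k 0) x (u *: (t *: ek)).
    rewrite linearD linearZ /=; congr (_ * _ + _).
    by rewrite -deriveE ?mxE//; exact: differentiable_gradient_coord.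
  set g1 := gradient f _ k 0; set g0 := gradient f _ k 0; set g2 := gradient f _ k 0.
  set L := 'd _ _ _.
  rewrite (_ : _ - _ = g1 - g2 - t * hessian f x k l); last by ring.
  rewrite (_ : e / 3 * _ + _ = e * t); last by field.
  move=> h; rewrite (_ : _ - _ = t * (g1 - g2 - t * hessian f x k l)); last by ring.
  rewrite normrM gtr0_norm// expr2 mulrCA; apply: ler_wpM2l => //; exact: ltW.
apply/matrixP => k l; rewrite [LHS]mxE; apply/eqP; rewrite -subr_eq0 -normr_eq0.
rewrite eq_le normr_ge0 andbT leNgt; apply/negP => gap.
set c := `|_| in gap.
have c40 : 0 < c / 4 by rewrite divr_gt0.
have [D1 D10 H1] := key _ k l c40; have [D2 D20 H2] := key _ l k c40.
pose t := Num.min D1 D2 / 2.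
have t0 : 0 < t by rewrite divr_gt0// lt_min D10.
have tD : t < D1 /\ t < D2.
  have : Num.min D1 D2 <= D1 by rewrite ge_min lexx.
  have : Num.min D1 D2 <= D2 by rewrite ge_min lexx orbT.
  rewrite /t in t0 *; split; lra.
have h1 := H1 t t0 tD.1; have := H2 t t0 tD.2; rewrite sdC => h2.
have := normr_le_sub h1 h2.
rewrite (_ : _ - _ = t ^+ 2 * (hessian f x l k - hessian f x k l)); last by ring.
rewrite normrM ger0_norm ?sqr_ge0// -/c -mulrDl mulrC ler_pM2r ?exprn_gt0//.
lra.
Qed.

End line_derivative.

Section smooth_concave.
Context {R : realType} {d : nat}.
Implicit Types (Th : set 'cV[R]_d) (f : 'cV[R]_d -> R) (g : 'cV[R]_d -> 'cV[R]_d)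
  (H : 'cV[R]_d -> 'M[R]_d).

Lemma coordB (u v : 'cV[R]_d) k : (u - v) k 0 = u k 0 - v k 0.
Proof. by rewrite !mxE. Qed.

Definition quadratic_on Th f g (C : R) : Prop := forall x y, Th x -> Th y ->
  `|f y - f x - dot (g x) (y - x)| <= C * enorm (y - x) ^+ 2.

(** The only consequences of differentiability that are used: expansions with
    explicit constants, which are inherited by weighted sums of objectives. *)
Definition smooth_on Th f g H (L C : R) : Prop :=
  [/\ quadratic_on Th f g C,
      forall x y, Th x -> Th y ->
        enorm (g y - g x - H x *m (y - x)) <= L * enorm (y - x) ^+ 2 &
      forall x y k l, Th x -> Th y -> `|H y k l - H x k l| <= L * enorm (y - x)].

Definition segment_convex Th : Prop := forall x y (t : R), Th x -> Th y ->
  0 <= t <= 1 -> Th (x + t *: (y - x)).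

Definition segment_concave Th f : Prop := forall x y (t : R), Th x -> Th y ->
  0 <= t <= 1 -> (1 - t) * f x + t * f y <= f (x + t *: (y - x)).

Lemma concave_onP Th f : concave_on Th f -> segment_convex Th /\ segment_concave Th f.
Proof.
move=> [cT cf].
have cvE (x y : 'cV[R]_d) (t : R) : y + t *: (x - y) = t *: x + (1 - t) *: y.
  by rewrite scalerBr scalerBl scale1r addrCA.
split=> x y t Tx Ty t01; rewrite cvE; have [t0 t1] := andP t01.
  have := cT y x (Itv01 t0 t1).
  by rewrite !inE => /(_ Ty Tx).
have := cf (Itv01 t0 t1) y x.
rewrite !inE => /(_ Ty Tx) /=.
rewrite convRE /= => h; have {}h : - f (t *: y + (1 - t) *: x) <=
  t * - f y + (1 - t) * - f x by exact: h.
lra.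
Qed.

Lemma segment_concave_weighted Th n (c : 'I_n -> R) (f : 'I_n -> 'cV[R]_d -> R) :
  (forall i, 0 <= c i) -> (forall i, segment_concave Th (f i)) ->
  segment_concave Th (fun x => \sum_i c i * f i x).
Proof.
move=> c0 cf x y t Tx Ty t01.
rewrite !mulr_sumr -big_split /=; apply: ler_sum => i _.
rewrite (_ : _ + _ = c i * ((1 - t) * f i x + t * f i y)); last by ring.
by apply: ler_wpM2l => //; exact: cf.
Qed.

Lemma smooth_on_weighted Th n (c : 'I_n -> R) (f : 'I_n -> 'cV[R]_d -> R)
  (g : 'I_n -> 'cV[R]_d -> 'cV[R]_d) (H : 'I_n -> 'cV[R]_d -> 'M[R]_d)
  (L C : 'I_n -> R) :
  (forall i, 0 <= c i) -> (forall i, smooth_on Th (f i) (g i) (H i) (L i) (C i)) ->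
  smooth_on Th (fun x => \sum_i c i * f i x) (fun x => \sum_i c i *: g i x)
    (fun x => \sum_i c i *: H i x) (\sum_i c i * L i) (\sum_i c i * C i).
Proof.
move=> c0 sm; split=> [x y Tx Ty|x y Tx Ty|x y k l Tx Ty].
- rewrite dot_suml -!sumrB mulr_suml; apply: le_trans (ler_norm_sum _ _ _) _.
  apply: ler_sum => i _; have [h _ _] := sm i.
  rewrite dotZl (_ : _ - _ = c i * (f i y - f i x - dot (g i x) (y - x))); last by ring.
  by rewrite normrM ger0_norm// -mulrA ler_wpM2l// h.
- rewrite mulmx_suml -!sumrB mulr_suml; apply: le_trans (enorm_sum _ _ _) _.
  apply: ler_sum => i _; have [_ h _] := sm i.
  rewrite -scalemxAl -!scalerBr enormZ ger0_norm// -mulrA ler_wpM2l//.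
  exact: h.
- rewrite !summxE -sumrB mulr_suml; apply: le_trans (ler_norm_sum _ _ _) _.
  apply: ler_sum => i _; have [_ _ h] := sm i.
  by rewrite !mxE -mulrBr normrM ger0_norm// -mulrA ler_wpM2l// h.
Qed.

(** Over a convex set, a twice differentiable function with Lipschitz Hessian; the
    constants only involve the Hessian at one point. *)
Lemma smooth_on_lipschitz Th f (ps D A0 : R) x0 : segment_convex Th ->
  (forall x, Th x -> twice_differentiable f x) -> 0 <= ps -> Th x0 ->
  (forall x y, Th x -> Th y -> enorm (x - y) <= D) ->
  (forall k l, `|hessian f x0 k l| <= A0) ->
  (forall x y k l, Th x -> Th y -> `|hessian f x k l - hessian f y k l| <=
     ps * enorm (x - y)) ->
  (0 < d)%N ->
  smooth_on Th f (gradient f) (hessian f) ((1 + d%:R ^+ 2) * ps)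
    (d%:R ^+ 2 * (A0 + ps * D) + (1 + d%:R ^+ 2) * ps * D).
Proof.
move=> cT df ps0 Tx0 diam HA0 Hps d_gt0.
have d20 : 0 <= d%:R ^+ 2 :> R by rewrite exprn_ge0.
have D0 : 0 <= D by apply: le_trans (diam _ _ Tx0 Tx0); exact: enorm_ge0.
have dfl x y t : Th x -> Th y -> 0 <= t <= 1 -> twice_differentiable f (x + t *: (y - x)).
  by move=> Tx Ty t01; apply: df; exact: cT.
have tle (t : R) v : 0 <= t <= 1 -> enorm (t *: v) <= enorm v.
  by move=> /andP[t0 t1]; rewrite enormZ ger0_norm// ler_piMl ?enorm_ge0.
have grad x y : Th x -> Th y ->
    enorm (gradient f y - gradient f x - hessian f x *m (y - x)) <=
    d%:R ^+ 2 * ps * enorm (y - x) ^+ 2.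
  move=> Tx Ty; rewrite expr2 -2!mulrA mulrA.
  rewrite (_ : _ * _ = d%:R * (d%:R * (ps * (enorm (y - x) * enorm (y - x))))); last by ring.
  apply: enorm_le_coord; first by rewrite !mulr_ge0 ?enorm_ge0.
  move=> k.
  have dfk t : 0 <= t <= 1 -> differentiable (fun z => gradient f z k 0) (x + t *: (y - x)).
    by move=> t01; apply: differentiable_gradient_coord; case: (dfl x y t Tx Ty t01).
  have [t t01] := mvt_line dfk.
  rewrite (addrC x (y - x)) subrK gradient_gradient_coord => eq1.
  rewrite !coordB eq1 mxE [X in _ - X]mxE -sumrB.
  apply: le_trans (ler_norm_sum _ _ _) _.
  rewrite mulr_natl -[X in _ *+ X]card_ord -sumr_const; apply: ler_sum => l _.
  rewrite -mulrBl normrM mulrA ler_pM//; last exact: le_coord_enorm.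
  apply: le_trans (Hps _ _ _ _ (cT _ _ _ Tx Ty t01) Tx) _.
  by rewrite addrC addKr ler_wpM2l// tle.
split=> [x y Tx Ty|x y Tx Ty|x y k l Tx Ty].
- have dfx t : 0 <= t <= 1 -> differentiable f (x + t *: (y - x)).
    by move=> t01; case: (dfl x y t Tx Ty t01) => /nbhs_singleton.
  have [t t01] := mvt_line dfx.
  rewrite (addrC x (y - x)) subrK => ->; rewrite -dotBl.
  set z := x + _; have Tz : Th z by exact: cT.
  apply: le_trans (cauchy_schwarz _ _) _.
  rewrite expr2 mulrA ler_wpM2r ?enorm_ge0//.
  have zx : enorm (z - x) <= enorm (y - x) by rewrite /z addrC addKr tle.
  rewrite -[gradient f z - _](subrK (hessian f x *m (z - x))).
  apply: le_trans (enormD _ _) _; rewrite addrC [leRHS]mulrDl lerD//.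
    have A00 k l : `|hessian f x k l| <= A0 + ps * D.
      rewrite -[hessian f x k l](subrK (hessian f x0 k l)) addrC.
      apply: le_trans (ler_normD _ _) _; rewrite lerD//.
      by apply: le_trans (Hps _ _ _ _ Tx Tx0) _; rewrite ler_wpM2l// diam.
    have AD0 : 0 <= A0 + ps * D by apply: le_trans (A00 (Ordinal d_gt0) (Ordinal d_gt0)).
    apply: le_trans (enorm_mulmx_entry _ AD0 A00) _.
    by rewrite ler_wpM2l// mulr_ge0.
  apply: le_trans (grad _ _ Tx Tz) _.
  rewrite expr2 mulrA -[leRHS]mulrA [leRHS]mulrAC mulrA.
  rewrite [leRHS](_ : _ = (1 + d%:R ^+ 2) * ps * D * enorm (y - x)); last by ring.
  apply: ler_pM => //; rewrite ?mulr_ge0 ?enorm_ge0//.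
  apply: ler_pM => //; rewrite ?mulr_ge0 ?enorm_ge0 ?diam//.
  by rewrite ler_wpM2r// lerDr.
- apply: le_trans (grad _ _ Tx Ty) _; rewrite ler_wpM2r ?exprn_ge0 ?enorm_ge0//.
  by rewrite ler_wpM2r// lerDr.
- apply: le_trans (Hps _ _ _ _ Ty Tx) _; rewrite ler_wpM2r ?enorm_ge0//.
  by rewrite ler_peMl// lerDl.
Qed.

Section first_order.
Variables (Th : set 'cV[R]_d) (f : 'cV[R]_d -> R) (g : 'cV[R]_d -> 'cV[R]_d) (C : R).
Hypotheses (cT : segment_convex Th) (sm1 : quadratic_on Th f g C) (C0 : 0 <= C).

Lemma gradient_toward_larger x y : segment_concave Th f -> Th x -> Th y ->
  f x <= f y -> 0 <= dot (g x) (y - x).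
Proof.
move=> cf Tx Ty fxy; rewrite leNgt; apply/negP => neg.
set q := dot _ _ in neg; set E := C * enorm (y - x) ^+ 2.
have E0 : 0 <= E by rewrite mulr_ge0// exprn_ge0 ?enorm_ge0.
pose t := Num.min 1 (- q / (2 * (E + 1))).
have t0 : 0 < t by rewrite lt_min ltr01 divr_gt0//; lra.
have t1 : t <= 1 by rewrite ge_min lexx.
have tq : t * (2 * (E + 1)) <= - q.
  by rewrite -ler_pdivlMr; [rewrite ge_min lexx orbT|lra].
have t01 : 0 <= t <= 1 by rewrite t1 ltW.
have xt : x + t *: (y - x) - x = t *: (y - x) by rewrite addrAC subrr add0r.
have := sm1 Tx (cT Tx Ty t01).
rewrite xt dotZr enormZ (ger0_norm (ltW t0)) exprMn mulrCA -/E -/q.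
move/ler_normlP => [_ h2].
have h1 := cf x y t Tx Ty t01.
have h3 : 0 <= t * (f y - f x) by rewrite mulr_ge0 ?subr_ge0// ltW.
have h4 : 0 <= t * (q + t * E) by rewrite expr2 in h2; nra.
rewrite pmulr_rge0// in h4; nra.
Qed.

Lemma gradient_interior_maximizer x r : Th x -> 0 < r ->
  (forall y, enorm (y - x) <= r -> Th y) -> (forall y, Th y -> f y <= f x) -> g x = 0.
Proof.
move=> Tx r0 ball mx; apply: enorm_eq0; apply/eqP; rewrite eq_le enorm_ge0 andbT.
rewrite leNgt; apply/negP => gp.
pose n := enorm (g x).
pose t := Num.min (r / n) (2 * (C + 1))^-1.
have CC : 0 < 2 * (C + 1) by have := C0; lra.
have t0 : 0 < t by rewrite lt_min divr_gt0//= invr_gt0.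
have tC : t * (2 * (C + 1)) <= 1.
  by rewrite -ler_pdivlMr// div1r ge_min lexx orbT.
have Ty : Th (x + t *: g x).
  apply: ball; rewrite addrC addKr enormZ gtr0_norm// -ler_pdivlMr//.
  by rewrite ge_min lexx.
have xt : x + t *: g x - x = t *: g x by rewrite addrAC subrr add0r.
have := sm1 Tx Ty; rewrite xt dotZr enormZ (gtr0_norm t0) -enorm_sqr -/n.
move/ler_normlP => [h1 _]; have h2 := mx _ Ty.
have n20 : 0 < n ^+ 2 by rewrite exprn_gt0.
rewrite exprMn in h1.
have C0' := C0.
have : t * n ^+ 2 * (1 - C * t) <= 0.
  by rewrite (_ : _ * (1 - C * t) = t * n ^+ 2 - C * (t ^+ 2 * n ^+ 2)); [lra|ring].
have tn : 0 < t * n ^+ 2 by exact: mulr_gt0.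
by rewrite (pmulr_rle0 _ tn) => tC1; lra.
Qed.

End first_order.

Section second_order.
Variables (Th : set 'cV[R]_d) (f : 'cV[R]_d -> R) (g : 'cV[R]_d -> 'cV[R]_d)
  (H : 'cV[R]_d -> 'M[R]_d) (L C : R).
Hypotheses (cT : segment_convex Th) (sm : smooth_on Th f g H L C) (L0 : 0 <= L)
  (C0 : 0 <= C).
Variables (x0 : 'cV[R]_d) (lam r : R).
Hypotheses (Tx0 : Th x0) (lam0 : 0 < lam) (r0 : 0 < r)
  (Hx0 : forall v, dot v (H x0 *m v) <= - lam * dot v v)
  (small : (d%:R ^+ 2 + 2) * L * r <= lam / 2).

Lemma gradient_monotone x y : Th x -> Th y -> enorm (x - x0) <= r ->
  enorm (y - x0) <= r ->
  dot (y - x) (g y - g x) <= - (lam / 2) * enorm (y - x) ^+ 2.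
Proof.
move=> Tx Ty xr yr; have [_ sm2 sm3] := sm.
set v := y - x; set n := enorm v.
have n0 : 0 <= n by exact: enorm_ge0.
have n2r : n <= 2 * r.
  rewrite /n /v; apply: le_trans (enorm_triangle x0 _ _) _.
  by rewrite (enormBC x0 x) mulr2n mulrDl mul1r addrC lerD.
rewrite -[g y - g x](subrK (H x *m v)) dotDr.
have h1 : dot v (g y - g x - H x *m v) <= n * (L * n ^+ 2).
  apply: le_trans (ler_norm _) _; apply: le_trans (cauchy_schwarz _ _) _.
  by rewrite ler_wpM2l// sm2.
have h2 : dot v (H x *m v) <= - lam * n ^+ 2 + d%:R ^+ 2 * (L * r) * n ^+ 2.
  rewrite -[H x](subrK (H x0)) mulmxDl dotDr addrC enorm_sqr lerD//.
  apply: le_trans (ler_norm _) _; rewrite -enorm_sqr expr2.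
  apply: dot_entry_bound; first by rewrite mulr_ge0// ltW.
  move=> k l; rewrite !mxE; apply: le_trans (sm3 _ _ _ _ Tx0 Tx) _.
  by rewrite ler_wpM2l.
have h3 : n * (L * n ^+ 2) <= 2 * r * L * n ^+ 2.
  by rewrite mulrA ler_wpM2r ?exprn_ge0// ler_wpM2r.
have h4 : ((d%:R ^+ 2 + 2) * L * r) * n ^+ 2 <= lam / 2 * n ^+ 2.
  by rewrite ler_wpM2r ?exprn_ge0.
have := lam0; nra.
Qed.

(** A concave function whose gradient at [x0] is small and whose Hessian there is
    negative definite has all its maximizers near [x0]. *)
Lemma maximizer_near x : segment_concave Th f -> Th x -> (forall y, Th y -> f y <= f x) ->
  enorm (g x0) < lam / 2 * r -> enorm (x - x0) <= r.
Proof.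
move=> cf Tx mx gx0; rewrite leNgt; apply/negP => far.
have n0 : 0 < enorm (x - x0) by exact: lt_trans far.
pose t := r / enorm (x - x0).
have t0 : 0 < t by rewrite divr_gt0.
have t1 : t < 1 by rewrite ltr_pdivrMr// mul1r.
have t01 : 0 <= t <= 1 by rewrite !ltW.
pose y := x0 + t *: (x - x0).
have Ty : Th y by exact: cT.
have yx0 : y - x0 = t *: (x - x0) by rewrite /y addrC addKr.
have ny : enorm (y - x0) = r.
  by rewrite yx0 enormZ gtr0_norm// /t divfK// gt_eqF.
have xy : x - y = ((1 - t) / t) *: (y - x0).
  rewrite yx0 scalerA divfK ?gt_eqF// scalerBl scale1r /y.
  by rewrite opprD addrA.
have [sm1 _ _] := sm.
have h1 := gradient_toward_larger cT sm1 C0 cf Ty Tx (mx y Ty).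
rewrite xy dotZr pmulr_rge0 ?divr_gt0 ?subr_gt0// in h1.
have x0r : enorm (x0 - x0) <= r by rewrite subrr enorm0 ltW.
have yr : enorm (y - x0) <= r by rewrite ny.
have := gradient_monotone Tx0 Ty x0r yr; rewrite ny dotBr => h2.
have h3 := le_trans (ler_norm _) (cauchy_schwarz (y - x0) (g x0)).
rewrite ny in h3.
have : r * enorm (g x0) < r * (lam / 2 * r) by rewrite ltr_pM2l.
rewrite dotC in h1; have := r0; nra.
Qed.

Lemma zero_gradient_distance x y : Th x -> Th y -> enorm (x - x0) <= r ->
  enorm (y - x0) <= r -> g y = 0 -> enorm (y - x) <= 2 / lam * enorm (g x).
Proof.
move=> Tx Ty xr yr gy; have := gradient_monotone Tx Ty xr yr.
rewrite gy sub0r; set n := enorm (y - x) => h.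
have [->|nn0] := eqVneq n 0; first by rewrite mulr_ge0 ?enorm_ge0// divr_ge0// ltW.
have np : 0 < n by rewrite lt_neqAle eq_sym nn0 enorm_ge0.
have h3 := le_trans (ler_norm _) (cauchy_schwarz (y - x) (g x)).
rewrite dotNr -/n in h h3.
rewrite mulrAC ler_pdivlMr// -(ler_pM2r np); have := lam0; nra.
Qed.

End second_order.

End smooth_concave.

Definition avg {R : realType} {n : nat} (u : 'I_n -> R) : R :=
  n%:R^-1 * \sum_(i < n) u i.

Section sample.
Context {R : realType} {d n : nat}.
Hypothesis n0 : (0 < n)%N.

Lemma nR_gt0 : 0 < n%:R :> R. Proof. by rewrite ltr0n. Qed.

Lemma avg_le (u v : 'I_n -> R) : (forall i, u i <= v i) -> avg u <= avg v.
Proof. by move=> uv; rewrite /avg ler_wpM2l ?invr_ge0//; apply: ler_sum => i _. Qed.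

Lemma avg_ge0 (u : 'I_n -> R) : (forall i, 0 <= u i) -> 0 <= avg u.
Proof. by move=> u0; rewrite /avg mulr_ge0 ?invr_ge0//; apply: sumr_ge0. Qed.

Lemma avgD (u v : 'I_n -> R) : avg (fun i => u i + v i) = avg u + avg v.
Proof. by rewrite /avg big_split mulrDr. Qed.

Lemma avgZ c (u : 'I_n -> R) : avg (fun i => c * u i) = c * avg u.
Proof. by rewrite /avg -mulr_sumr mulrCA. Qed.

Lemma avg_cst (c : R) : avg (fun _ : 'I_n => c) = c.
Proof.
by rewrite /avg sumr_const card_ord -[X in _ * X]mulr_natl mulKf// gt_eqF// nR_gt0.
Qed.

Lemma avgB (u v : 'I_n -> R) : avg (fun i => u i - v i) = avg u - avg v.
Proof. by rewrite /avg sumrB mulrBr. Qed.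

Lemma norm_avg (u : 'I_n -> R) : `|avg u| <= avg (fun i => `|u i|).
Proof.
by rewrite /avg normrM ger0_norm ?invr_ge0// ler_wpM2l ?invr_ge0// ler_norm_sum.
Qed.

Lemma avg_cauchy_schwarz_le (u v : 'I_n -> R) t : 0 < t ->
  avg (fun i => u i * v i) <= (t * avg (fun i => u i ^+ 2)
     + t^-1 * avg (fun i => v i ^+ 2)) / 2.
Proof.
move=> t0.
have -> : (t * avg (fun i => u i ^+ 2) + t^-1 * avg (fun i => v i ^+ 2)) / 2 =
    avg (fun i => 2^-1 * (t * u i ^+ 2 + t^-1 * v i ^+ 2)).
  by rewrite avgZ avgD !avgZ mulrC.
apply: avg_le => i; rewrite -subr_ge0 (_ : _ - _ = (t * u i - v i) ^+ 2 / (2 * t)).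
  by rewrite divr_ge0 ?sqr_ge0// mulr_ge0// ltW.
by field; rewrite gt_eqF.
Qed.

Section weights.
Variable alpha : R.
Hypotheses (alpha0 : 0 < alpha) (alpha1 : alpha < 1).

Definition mix_weight (a : 'I_n -> 'cV[R]_d) (i : 'I_n) : R :=
  (1 - alpha) * (enorm (a i) / \sum_j enorm (a j)) + alpha * n%:R^-1.

Section one_sample.
Variable a : 'I_n -> 'cV[R]_d.
Local Notation p := (mix_weight a).

Lemma mix_weight_ge i : alpha * n%:R^-1 <= p i.
Proof.
rewrite lerDr mulr_ge0 ?subr_ge0 ?(ltW alpha1)//.
by rewrite divr_ge0 ?enorm_ge0// sumr_ge0// => j _; exact: enorm_ge0.
Qed.

Lemma mix_weight_gt0 i : 0 < p i.
Proof. by apply: lt_le_trans (mix_weight_ge i); rewrite divr_gt0// nR_gt0. Qed.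

Lemma n_mix_weight_ge i : alpha <= n%:R * p i.
Proof. by rewrite mulrC -ler_pdivrMr ?nR_gt0// mix_weight_ge. Qed.

Lemma mix_weight_sum : \sum_j enorm (a j) != 0 -> \sum_i p i = 1.
Proof.
move=> S0; rewrite big_split /= -mulr_sumr -mulr_suml divff// mulr1.
rewrite sumr_const card_ord -[_ *+ n]mulr_natr -mulrA mulVf ?gt_eqF ?nR_gt0//.
by rewrite mulr1 subrK.
Qed.

Lemma n_mix_weightE i : n%:R * p i =
  (1 - alpha) * (enorm (a i) / avg (fun j => enorm (a j))) + alpha.
Proof.
rewrite /mix_weight /avg invfM invrK; set S := \sum_j _.
have nn0 : n%:R != 0 :> R by rewrite gt_eqF// nR_gt0.
rewrite mulrDr (mulrCA n%:R alpha) mulfV// mulr1; congr (_ + _); ring.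
Qed.

End one_sample.

Variable a : 'I_n -> 'cV[R]_d.
Local Notation p := (mix_weight a).

(** The quadratic form of the matrix [Lambda] of the optimal mixture is bounded
    below: [x ^ 2 / q >= 2 t x ^ 2 - t ^ 2 x ^ 2 q] for every [t]. *)
Lemma weighted_form_lower (q : 'I_n -> R) l K v : 0 <= l -> 0 < K ->
  (forall i, 0 < q i) -> avg (fun i => enorm (a i) ^+ 2 * q i) <= K ->
  l * enorm v ^+ 2 <= avg (fun i => dot v (a i) ^+ 2) ->
  l ^+ 2 / K * enorm v ^+ 2 <= avg (fun i => dot v (a i) ^+ 2 / q i).
Proof.
move=> l0 K0 q0 aqK la; pose t := l / K.
have t0 : 0 <= t by rewrite divr_ge0// ltW.
apply: (@le_trans _ _ (avg (fun i => 2 * t * dot v (a i) ^+ 2 +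
    - t ^+ 2 * (dot v (a i) ^+ 2 * q i)))); last first.
  apply: avg_le => i; rewrite -subr_ge0.
  rewrite (_ : _ - _ = dot v (a i) ^+ 2 * (1 - t * q i) ^+ 2 / q i).
    by rewrite divr_ge0 ?(ltW (q0 i))// mulr_ge0 ?sqr_ge0.
  by field; rewrite gt_eqF.
rewrite avgD !avgZ.
have h : avg (fun i => dot v (a i) ^+ 2 * q i) <= K * enorm v ^+ 2.
  apply: (@le_trans _ _ (avg (fun i => enorm v ^+ 2 * (enorm (a i) ^+ 2 * q i)))).
    apply: avg_le => i; rewrite mulrA ler_wpM2r ?(ltW (q0 i))//.
    rewrite -exprMn -real_normK ?num_real// lerXn2r ?nnegrE ?mulr_ge0 ?enorm_ge0//.
    exact: cauchy_schwarz.
  by rewrite avgZ mulrC ler_wpM2r// exprn_ge0 ?enorm_ge0.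
have h1 : 2 * t * (l * enorm v ^+ 2) <= 2 * t * avg (fun i => dot v (a i) ^+ 2).
  by rewrite ler_wpM2l// mulr_ge0.
have h2 : t ^+ 2 * avg (fun i => dot v (a i) ^+ 2 * q i) <= t ^+ 2 * (K * enorm v ^+ 2).
  by rewrite ler_wpM2l ?sqr_ge0.
rewrite (_ : l ^+ 2 / K * _ = 2 * t * (l * enorm v ^+ 2) - t ^+ 2 * (K * enorm v ^+ 2)).
  by rewrite mulNr lerD// lerN2.
by rewrite /t; field; rewrite gt_eqF.
Qed.

Lemma cube_le_1D4 (x : R) : 0 <= x -> x ^+ 3 <= 1 + x ^+ 4.
Proof.
move=> x0; have [x1|x1] := leP x 1.
  have := @exprn_ile1 _ 3 _ x0 x1; have := exprn_ge0 4 x0; lra.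
have : x ^+ 3 <= x ^+ 4.
  by rewrite (exprS _ 3); apply: ler_peMl; [exact: exprn_ge0|exact: ltW].
lra.
Qed.

Lemma sqr_le_1D4 (x : R) : x ^+ 2 <= 1 + x ^+ 4.
Proof.
have := sqr_ge0 (x ^+ 2 - 2^-1); rewrite (_ : x ^+ 4 = (x ^+ 2) ^+ 2) ?exprM//; nra.
Qed.

Lemma avg_cube_le K4 : avg (fun i => enorm (a i) ^+ 4) <= K4 ->
  avg (fun i => enorm (a i) ^+ 3) <= 1 + K4.
Proof.
move=> aK; apply: le_trans (_ : 1 + avg (fun i => enorm (a i) ^+ 4) <= _); last first.
  by rewrite lerD2l.
rewrite -{1}(avg_cst 1) -avgD; apply: avg_le => i.
exact: cube_le_1D4 (enorm_ge0 _).
Qed.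

Lemma avg_sqr_le K4 : avg (fun i => enorm (a i) ^+ 4) <= K4 ->
  avg (fun i => enorm (a i) ^+ 2) <= 1 + K4.
Proof.
move=> aK; apply: le_trans (_ : 1 + avg (fun i => enorm (a i) ^+ 4) <= _); last first.
  by rewrite lerD2l.
by rewrite -{1}(avg_cst 1) -avgD; apply: avg_le => i; exact: sqr_le_1D4.
Qed.

(** The dependence of the optimal mixture on the parameter: the scores [b] at the
    pilot estimator give nearly the same matrix as the scores [a]. *)
Lemma mixture_stability (b : 'I_n -> 'cV[R]_d) c0 K4 kap k l : 0 < c0 -> 0 < kap ->
  c0 <= avg (fun i => enorm (a i)) -> c0 <= avg (fun i => enorm (b i)) ->
  avg (fun i => enorm (a i) ^+ 4) <= K4 ->
  avg (fun i => enorm (a i - b i) ^+ 2) <= kap ^+ 2 ->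
  `|avg (fun i => a i k 0 * a i l 0 / (n%:R * mix_weight b i)) -
    avg (fun i => a i k 0 * a i l 0 / (n%:R * p i))| <=
  alpha ^- 2 * (c0^-1 + c0 ^- 2) * (1 + K4) * kap.
Proof.
move=> c00 kap0 ac bc aK ab.
set A := avg (fun i => enorm (a i)) in ac; set B := avg (fun i => enorm (b i)) in bc.
have A0 : 0 < A by exact: lt_le_trans ac.
have B0 : 0 < B by exact: lt_le_trans bc.
have K40 : 0 <= K4.
  by apply: le_trans aK; apply: avg_ge0 => i; rewrite exprn_ge0 ?enorm_ge0.
set e := fun i => enorm (a i - b i).
have e0 i : 0 <= e i by exact: enorm_ge0.
have ea i : `|enorm (a i) - enorm (b i)| <= e i.
  rewrite ler_norml; apply/andP; split.
    have := enormD (b i - a i) (a i); rewrite subrK enormBC -/(e i); lra.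
  have := enormD (a i - b i) (b i); rewrite subrK -/(e i); lra.
have ekap : avg e <= kap.
  have := @avg_cauchy_schwarz_le (fun=> 1) e kap kap0.
  rewrite /= (_ : avg _ = avg e); last by congr avg; apply: funext => i; rewrite mul1r.
  rewrite (_ : avg (fun _ : 'I_n => 1 ^+ 2) = 1) ?expr1n ?avg_cst// => h.
  have : kap^-1 * avg (fun i => e i ^+ 2) <= kap.
    by rewrite ler_pdivrMl// -expr2.
  lra.
have AB : `|A - B| <= kap.
  rewrite /A /B -avgB; apply: le_trans (norm_avg _) _.
  by apply: le_trans ekap; exact: avg_le.
have pi_ge i : alpha <= n%:R * p i by exact: n_mix_weight_ge.
have pb_ge i : alpha <= n%:R * mix_weight b i by exact: n_mix_weight_ge.
have dif i : `|n%:R * p i - n%:R * mix_weight b i| <=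
   e i / c0 + enorm (a i) * kap / c0 ^+ 2.
  rewrite !n_mix_weightE -/A -/B; clearbody A B.
  rewrite (_ : _ - _ = (1 - alpha) * ((enorm (a i) - enorm (b i)) / B
     + enorm (a i) * (B - A) / (A * B))); last first.
    by field; rewrite !gt_eqF.
  rewrite normrM ger0_norm ?subr_ge0 ?(ltW alpha1)//.
  set X := `|_ + _|; apply: (@le_trans _ _ X).
    by apply: ler_piMl; rewrite /X// gerBl ltW.
  rewrite /X; apply: le_trans (ler_normD _ _) _; apply: lerD.
    rewrite normrM (@ger0_norm _ B^-1) ?invr_ge0 ?(ltW B0)//.
    by rewrite ler_pM ?invr_ge0 ?(ltW B0)// lef_pV2.
  rewrite !normrM ger0_norm ?enorm_ge0// -!mulrA ler_wpM2l ?enorm_ge0//.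
  rewrite distrC ler_pM//.
  rewrite ger0_norm ?invr_ge0 ?mulr_ge0 ?(ltW A0) ?(ltW B0)//.
  by rewrite lef_pV2 ?posrE ?mulr_gt0 ?exprn_gt0// expr2 ler_pM// ltW.
rewrite -avgB; apply: le_trans (norm_avg _) _.
apply: (@le_trans _ _ (avg (fun i => alpha ^- 2 * (c0^-1 * (enorm (a i) ^+ 2 * e i)
   + kap / c0 ^+ 2 * enorm (a i) ^+ 3)))).
  apply: avg_le => i.
  have np0 : 0 < n%:R * p i by exact: lt_le_trans (pi_ge i).
  have nb0 : 0 < n%:R * mix_weight b i by exact: lt_le_trans (pb_ge i).
  rewrite (_ : _ - _ = (a i k 0 * a i l 0) * (n%:R * p i - n%:R * mix_weight b i) *
    ((n%:R * p i) * (n%:R * mix_weight b i))^-1); last first.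
    move: np0 nb0; set x := n%:R * _; set y := n%:R * _ => x0 y0.
    by field; rewrite !gt_eqF.
  rewrite normrM normrM.
  have i1 : `|(n%:R * p i * (n%:R * mix_weight b i))^-1| <= alpha ^- 2.
    move: np0 nb0 (pi_ge i) (pb_ge i).
    move: (n%:R * p i) (n%:R * mix_weight b i) => x y x0 y0 ax ay.
    rewrite ger0_norm ?invr_ge0 ?mulr_ge0 ?(ltW x0) ?(ltW y0)//.
    by rewrite lef_pV2 ?posrE ?mulr_gt0 ?exprn_gt0// expr2 ler_pM// ltW.
  have i2 : `|a i k 0 * a i l 0| <= enorm (a i) ^+ 2.
    by rewrite normrM expr2 ler_pM// le_coord_enorm.
  rewrite [leRHS]mulrC; apply: ler_pM => //.
  apply: le_trans (ler_pM _ _ i2 (dif i)) _ => //.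
  by rewrite le_eqVlt; apply/orP; left; apply/eqP; field; rewrite gt_eqF.
rewrite avgZ avgD !avgZ -!mulrA ler_wpM2l ?invr_ge0 ?sqr_ge0//.
have c3 := avg_cube_le aK.
have c2 : avg (fun i => enorm (a i) ^+ 2 * e i) <= (1 + K4) * kap.
  apply: le_trans (avg_cauchy_schwarz_le _ _ kap0) _.
  have : kap^-1 * avg (fun i => e i ^+ 2) <= kap by rewrite ler_pdivrMl// -expr2.
  have : kap * avg (fun i => (enorm (a i) ^+ 2) ^+ 2) <= kap * K4.
    rewrite ler_wpM2l ?(ltW kap0)//; apply: le_trans aK.
    by apply: avg_le => i; rewrite -exprM.
  have : 0 <= K4 * kap by rewrite mulr_ge0// ltW.
  lra.
rewrite mulrDl; apply: lerD.
  by rewrite ler_wpM2l ?invr_ge0 ?(ltW c00).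
rewrite [leRHS](_ : _ = kap * (c0 ^- 2 * (1 + K4))); last by ring.
by rewrite !ler_wpM2l ?invr_ge0 ?exprn_ge0 ?(ltW kap0) ?(ltW c00).
Qed.

End weights.

End sample.

Section importance_sampling.
Context {R : realType} {n : nat}.
Hypothesis n0 : (0 < n)%N.
Variables (p : 'I_n -> R) (al : R).
Hypotheses (al0 : 0 < al) (p_ge : forall i, al <= n%:R * p i) (p1 : \sum_i p i = 1).

Definition sub_weight (s : nat) i : R := (n%:R * s%:R * p i)^-1.

Lemma np_gt0 i : 0 < n%:R * p i. Proof. exact: lt_le_trans (p_ge i). Qed.

Lemma p_gt0 i : 0 < p i.
Proof. by rewrite -(pmulr_rgt0 _ (nR_gt0 n0)) np_gt0. Qed.

Lemma sub_weight_ge0 s i : 0 <= sub_weight s i.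
Proof. by rewrite invr_ge0 !mulr_ge0 ?(ltW (p_gt0 i)). Qed.

Lemma reweighted_mean (u : 'I_n -> R) : \sum_i p i * (u i / (n%:R * p i)) = avg u.
Proof.
rewrite /avg mulr_sumr; apply: eq_bigr => i _.
by field; rewrite !gt_eqF ?nR_gt0 ?p_gt0.
Qed.

(** Chebyshev's inequality for the importance sampling estimate of a mean. *)
Lemma importance_chebyshev (u : 'I_n -> R) s e K : (0 < s)%N -> 0 < e ->
  avg (fun i => u i ^+ 2) <= K ->
  \sum_(j : {ffun 'I_s -> 'I_n}) (\prod_(k < s) p (j k)) *
     (e <= `|\sum_(k < s) sub_weight s (j k) * u (j k) - avg u|)%R%:R
  <= K / al / (s%:R * e ^+ 2).
Proof.
move=> s0 e0 uK.
have sR : 0 < s%:R :> R by rewrite ltr0n.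
pose xi i := u i / (n%:R * p i) - avg u.
have pge0 i : 0 <= p i by rewrite ltW ?p_gt0.
have xi0 : \sum_i p i * xi i = 0.
  under eq_bigr do rewrite mulrBr.
  by rewrite sumrB reweighted_mean -mulr_suml p1 mul1r subrr.
have xi2 : \sum_i p i * xi i ^+ 2 <= K / al.
  have -> : \sum_i p i * xi i ^+ 2 = \sum_i p i * (u i / (n%:R * p i)) ^+ 2 - avg u ^+ 2.
    have -> : \sum_i p i * xi i ^+ 2 = \sum_i (p i * (u i / (n%:R * p i)) ^+ 2
        - (2 * avg u) * (p i * (u i / (n%:R * p i))) + p i * avg u ^+ 2).
      by apply: eq_bigr => i _; rewrite /xi; ring.
    rewrite big_split sumrB /= -mulr_sumr reweighted_mean -mulr_suml p1.
    ring.
  apply: le_trans (_ : \sum_i p i * (u i / (n%:R * p i)) ^+ 2 <= _).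
    by rewrite gerBl sqr_ge0.
  apply: (@le_trans _ _ (avg (fun i => al^-1 * u i ^+ 2))); last first.
    by rewrite avgZ mulrC ler_wpM2r// invr_ge0 ltW.
  rewrite /avg mulr_sumr; apply: ler_sum => i _.
  have -> : p i * (u i / (n%:R * p i)) ^+ 2 = n%:R^-1 * ((n%:R * p i)^-1 * u i ^+ 2).
    by field; rewrite !gt_eqF ?nR_gt0 ?p_gt0.
  rewrite ler_wpM2l ?invr_ge0// ler_wpM2r ?sqr_ge0//.
  by rewrite lef_pV2 ?posrE ?np_gt0.
have se0 : 0 < s%:R * e by rewrite mulr_gt0.
have := walk_chebyshev pge0 p1 s se0 xi0 xi2.
rewrite [X in _ <= X -> _](_ : _ = K / al / (s%:R * e ^+ 2)); last first.
  by field; rewrite !gt_eqF.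
apply: le_trans; rewrite /walk; apply: ler_sum => j _.
rewrite ler_wpM2l ?prodr_ge0// add0r.
rewrite (_ : \sum_(k < s) xi (j k) =
    s%:R * (\sum_(k < s) sub_weight s (j k) * u (j k) - avg u)).
  by rewrite normrM gtr0_norm// ler_pM2l.
rewrite mulrBr mulr_sumr sumrB; congr (_ - _).
  by apply: eq_bigr => k _; rewrite /sub_weight; field; rewrite !gt_eqF ?nR_gt0 ?p_gt0.
by rewrite sumr_const card_ord mulr_natl.
Qed.

End importance_sampling.

Section standardization.
Context {R : realType} {d : nat}.
Implicit Types (u v : 'cV[R]_d) (M Lam W : 'M[R]_d).

Lemma posdef_congruence M Lam : M^T = M -> M \in unitmx -> posdef Lam ->
  posdef (M *m Lam *m M).
Proof.
move=> Ms Mu /posdefP[Ls Lp]; apply/posdefP; split.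
  by rewrite !trmx_mul Ms Ls mulmxA.
move=> v v0; rewrite -!mulmxA dot_trmx Ms; apply: Lp.
apply: contra_neq v0 => Mv.
by rewrite -[v](mul1mx) -(mulVmx Mu) -mulmxA Mv mulmx0.
Qed.

Variables (M Lam : 'M[R]_d) (l : R).
Hypotheses (Mpos : posdef (- M)) (Lpos : posdef Lam) (l0 : 0 < l)
  (Ll : forall v, l * dot v v <= dot v (Lam *m v)).
Local Notation V := (invmx M *m Lam *m invmx M).

Definition standardizer : 'M[R]_d := invsqrtmx V *m invmx M.

Lemma neg_posdef_sym : M^T = M.
Proof. by have /posdefP[+ _] := Mpos; rewrite linearN /= => /oppr_inj. Qed.

Lemma neg_posdef_unit : M \in unitmx.
Proof. by have := posdef_unit Mpos; rewrite -scaleN1r unitmxZ ?unitrN1. Qed.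

Lemma sandwich_posdef : posdef V.
Proof.
apply: posdef_congruence => //; last by rewrite unitmx_inv neg_posdef_unit.
by rewrite trmx_inv neg_posdef_sym.
Qed.

Lemma standardizer_cov : standardizer *m Lam *m standardizer^T = 1%:M.
Proof.
have [/posdefP[Ns _] NN] := invsqrtmxP sandwich_posdef.
set N := invsqrtmx V in Ns NN *.
have Vu := posdef_unit sandwich_posdef.
rewrite /standardizer -/N trmx_mul trmx_inv neg_posdef_sym Ns.
rewrite (_ : _ *m _ = N *m V *m N); last by rewrite !mulmxA.
have h : N *m (N *m V) = 1%:M by rewrite (mulmxA N N) NN mulVmx.
exact: mulmx1C h.
Qed.

Lemma standardizer_M : invsqrtmx V = standardizer *m M.
Proof. by rewrite /standardizer -(mulmxA (invsqrtmx V)) mulVmx ?mulmx1 ?neg_posdef_unit. Qed.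

Lemma standardizer_tr_bound v : enorm (standardizer^T *m v) <= (Num.sqrt l)^-1 * enorm v.
Proof.
have sl : 0 < Num.sqrt l by rewrite sqrtr_gt0.
rewrite mulrC ler_pdivlMr//.
rewrite -(@ler_pXn2r _ 2)// ?nnegrE ?mulr_ge0 ?enorm_ge0 ?sqrtr_ge0//.
rewrite exprMn !enorm_sqr sqr_sqrtr ?(ltW l0)// mulrC.
apply: le_trans (Ll _) _.
by rewrite -dot_trmx !mulmxA -[X in dot v (X *m v)]/(_ *m _ *m _) standardizer_cov mul1mx.
Qed.

Lemma standardizer_bound v : enorm (standardizer *m v) <= (Num.sqrt l)^-1 * enorm v.
Proof.
have sl : 0 <= (Num.sqrt l)^-1 by rewrite invr_ge0 sqrtr_ge0.
have [->|Wv0] := eqVneq (enorm (standardizer *m v)) 0.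
  by rewrite mulr_ge0 ?enorm_ge0.
have Wvp : 0 < enorm (standardizer *m v) by rewrite lt_neqAle eq_sym Wv0 enorm_ge0.
rewrite -(ler_pM2r Wvp) -expr2 enorm_sqr.
rewrite dot_trmx; apply: le_trans (ler_norm _) _.
apply: le_trans (cauchy_schwarz _ _) _.
by rewrite mulrAC ler_wpM2r ?enorm_ge0// standardizer_tr_bound.
Qed.

(** Replacing the weights in [Lam] by nearby ones perturbs the standardized
    covariance by a proportional amount. *)
Lemma standardized_cov_near Lam' e k k' : 0 <= e ->
  (forall i j, `|(Lam' - Lam) i j| <= e) ->
  `|(standardizer *m Lam' *m standardizer^T) k k' - (k == k')%:R| <= d%:R ^+ 2 * e / l.
Proof.
move=> e0 near.
have -> : (k == k')%:R = (standardizer *m Lam *m standardizer^T) k k'.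
  by rewrite standardizer_cov mxE.
have -> : forall A B : 'M[R]_d, A k k' - B k k' = (A - B) k k'.
  by move=> A B; rewrite !mxE.
rewrite -mulmxBl -mulmxBr delta_entry -(mulmxA (standardizer *m _)).
rewrite -(mulmxA standardizer) dot_trmx.
apply: le_trans (dot_entry_bound _ _ e0 near) _.
rewrite ler_wpM2l//; first by rewrite mulr_ge0 ?exprn_ge0.
have b (i : 'I_d) : enorm (standardizer^T *m delta_mx i 0) <= (Num.sqrt l)^-1.
  by have := standardizer_tr_bound (delta_mx i 0); rewrite enorm_delta mulr1.
rewrite (_ : l^-1 = (Num.sqrt l)^-1 * (Num.sqrt l)^-1).
  by rewrite ler_pM ?enorm_ge0.
by rewrite -invfM -expr2 sqr_sqrtr// ltW.
Qed.

End standardization.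

Section weighted_outer_products.
Context {R : realType} {d n : nat}.
Hypothesis n0 : (0 < n)%N.
Implicit Types (q : 'I_n -> R) (a : 'I_n -> 'cV[R]_d).

Definition mean_outer q a : 'M[R]_d :=
  \matrix_(k, l) avg (fun i => a i k 0 * a i l 0 / q i).

Lemma mean_outerE q a : mean_outer q a =
  n%:R^-1 *: \sum_i (q i)^-1 *: (a i *m (a i)^T).
Proof.
apply/matrixP => k l; rewrite !mxE summxE; congr (_ * _); apply: eq_bigr => i _.
by rewrite !mxE big_ord1 !mxE mulrC.
Qed.

Lemma mean_outer_congruence q a (W : 'M[R]_d) :
  W *m mean_outer q a *m W^T = mean_outer q (fun i => W *m a i).
Proof.
rewrite !mean_outerE -scalemxAr -scalemxAl; congr (_ *: _).
rewrite mulmx_sumr mulmx_suml; apply: eq_bigr => i _.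
by rewrite -scalemxAr -scalemxAl trmx_mul !mulmxA.
Qed.

Lemma mean_outer_form q a v : dot v (mean_outer q a *m v) =
  avg (fun i => dot v (a i) ^+ 2 / q i).
Proof.
rewrite mean_outerE -scalemxAl dotZr /avg; congr (_ * _).
rewrite mulmx_suml dotC dot_suml; apply: eq_bigr => i _.
rewrite -scalemxAl dotZl mulrC; congr (_ / _).
rewrite -mulmxA (_ : (a i)^T *m v = (dot v (a i))%:M).
  by rewrite mul_mx_scalar dotZl expr2 (dotC (a i)).
by apply/matrixP => k l; rewrite !ord1 !mxE eqxx mulr1n; apply: eq_bigr => m _; rewrite mxE mulrC.
Qed.

Lemma mean_outer_sym q a : (mean_outer q a)^T = mean_outer q a.
Proof.
apply/matrixP => k l; rewrite !mxE; congr avg; apply: funext => i.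
by rewrite [a i l 0 * _]mulrC.
Qed.

(** The lower bound that makes the limiting covariance nondegenerate: the weights of
    the optimal mixture grow at most linearly in the score. *)
Lemma mean_outer_lower alpha a (l c0 K4 : R) : 0 < alpha -> alpha < 1 -> 0 <= l ->
  0 < c0 -> c0 <= avg (fun i => enorm (a i)) ->
  avg (fun i => enorm (a i) ^+ 4) <= K4 ->
  (forall v, l * dot v v <= avg (fun i => dot v (a i) ^+ 2)) ->
  forall v, l ^+ 2 / ((1 + K4) * (c0^-1 + 1)) * dot v v <=
    dot v (mean_outer (fun i => n%:R * mix_weight alpha a i) a *m v).
Proof.
move=> al0 al1 l0 c00 ac aK la v.
rewrite mean_outer_form -enorm_sqr.
have K40 : 0 <= K4.
  by apply: le_trans aK; apply: avg_ge0 => i; rewrite exprn_ge0 ?enorm_ge0.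
apply: weighted_form_lower => //; last by rewrite enorm_sqr.
- have c0i : 0 < c0^-1 by rewrite invr_gt0.
  by rewrite mulr_gt0//; lra.
- by move=> i; apply: lt_le_trans (n_mix_weight_ge n0 al1 a i).
apply: (@le_trans _ _ (avg (fun i => c0^-1 * enorm (a i) ^+ 3 + enorm (a i) ^+ 2))).
  apply: avg_le => i; rewrite n_mix_weightE//.
  set A := avg _ in ac *; set x := enorm (a i).
  have x0 : 0 <= x by exact: enorm_ge0.
  have A0 : 0 < A by exact: lt_le_trans ac.
  have xA : x / A <= x / c0 by rewrite ler_wpM2l// lef_pV2.
  have xA0 : 0 <= x / A by rewrite divr_ge0// ltW.
  have h : (1 - alpha) * (x / A) + alpha <= x / c0 + 1.
    have : (1 - alpha) * (x / A) <= 1 * (x / A) by rewrite ler_wpM2r//; lra.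
    by lra.
  apply: le_trans (ler_wpM2l (sqr_ge0 _) h) _.
  by rewrite le_eqVlt; apply/orP; left; apply/eqP; field; rewrite gt_eqF.
rewrite avgD avgZ mulrDr mulr1 [X in _ <= X + _]mulrC.
rewrite lerD ?ler_wpM2l ?invr_ge0 ?(ltW c00)//; first exact: avg_cube_le.
exact: avg_sqr_le.
Qed.

End weighted_outer_products.

Section sample_clt.
Context {R : realType} {d : nat}.

Definition sample_clt_bound (x : 'cV[R]_d) (h D : R) : Prop :=
  forall n s (al l e K3 : R) (p : 'I_n -> R) (a : 'I_n -> 'cV[R]_d) (M Lam : 'M[R]_d),
  (0 < n)%N -> (0 < s)%N -> 0 < al -> (forall i, al <= n%:R * p i) -> \sum_i p i = 1 ->
  0 < l -> 0 <= e -> posdef (- M) -> posdef Lam ->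
  (forall v, l * dot v v <= dot v (Lam *m v)) ->
  (forall i j, `|(mean_outer (fun i => n%:R * p i) a - Lam) i j| <= e) ->
  \sum_i a i = 0 -> avg (fun i => enorm (a i) ^+ 3) <= K3 ->
  forall b : R, D * (d%:R ^+ 2 * e / l + (d%:R ^+ 3 / Num.sqrt l ^+ 3 * (K3 / al ^+ 2) + 1)
     / Num.sqrt s%:R) <= b ->
  \prod_k std_normal_cdf (x k 0 - h) - b <=
  \sum_(j : {ffun 'I_s -> 'I_n}) (\prod_(k < s) p (j k)) *
     `[< le_cV (Num.sqrt s%:R *: - (standardizer M Lam *m
           \sum_(k < s) sub_weight p s (j k) *: a (j k))) x >]%:R
  <= \prod_k std_normal_cdf (x k 0 + h) + b.

(** The central limit theorem for the standardized score of the subsample; the data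
    are fixed, and only the draws of the subsample are random. *)
Lemma sample_clt (x : 'cV[R]_d) (h : R) : 0 < h ->
  exists2 D, 0 <= D & sample_clt_bound x h D.
Proof.
move=> h0; have [D D0 HD] := finite_clt x h0; exists D => //.
move=> n [//|s] al l e K3 p a M Lam n0 _ al0 pal p1 l0 e0 Mp Lp Ll near a0 aK b.
set m3 := _ * (K3 / _) => Db.
set W := standardizer M Lam.
have pp i : 0 < p i := p_gt0 n0 al0 pal i.
have npp i : 0 < n%:R * p i := np_gt0 al0 pal i.
pose xi i := - (n%:R * p i)^-1 *: (W *m a i).
have xiE i k : xi i k 0 = - (n%:R * p i)^-1 * (W *m a i) k 0 by rewrite mxE.
have pge0 i : 0 <= p i by rewrite ltW.
have nR := nR_gt0 n0 : 0 < n%:R :> R.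
have xi1 k : \sum_i p i * xi i k 0 = 0.
  have -> : \sum_i p i * xi i k 0 = - n%:R^-1 * \sum_i (W *m a i) k 0.
    rewrite mulr_sumr; apply: eq_bigr => i _; rewrite mxE.
    by field; rewrite !gt_eqF.
  by rewrite -summxE -mulmx_sumr a0 mulmx0 mxE mulr0.
have e'0 : 0 <= d%:R ^+ 2 * e / l by rewrite divr_ge0 ?mulr_ge0 ?exprn_ge0// ltW.
have xi2 k k' : `|\sum_i p i * (xi i k 0 * xi i k' 0) - (k == k')%:R| <= d%:R ^+ 2 * e / l.
  apply: le_trans (standardized_cov_near Mp Lp l0 Ll k k' e0 near).
  rewrite mean_outer_congruence mxE /avg mulr_sumr le_eqVlt; apply/orP; left; apply/eqP.
  congr (`|_ - _|); apply: eq_bigr => i _; rewrite !xiE -/W.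
  by field; rewrite !gt_eqF.
have sl : 0 < Num.sqrt l by rewrite sqrtr_gt0.
have xi3 : \sum_i p i * norm1 (xi i) ^+ 3 <= m3.
  rewrite /m3; set C := d%:R ^+ 3 / Num.sqrt l ^+ 3.
  have C0 : 0 <= C by rewrite divr_ge0 ?exprn_ge0// ltW.
  apply: (@le_trans _ _ (avg (fun i => C * (al ^- 2 * enorm (a i) ^+ 3)))).
    rewrite /avg mulr_sumr; apply: ler_sum => i _.
    have b1 : norm1 (xi i) <= d%:R * ((n%:R * p i)^-1 * ((Num.sqrt l)^-1 * enorm (a i))).
      apply: le_trans (norm1_le_enorm _) _; rewrite ler_wpM2l// enormZ normrN.
      rewrite ger0_norm ?invr_ge0 ?(ltW (npp i))// ler_wpM2l ?invr_ge0 ?(ltW (npp i))//.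
      exact: standardizer_bound.
    have b3 : norm1 (xi i) ^+ 3 <= (d%:R * ((n%:R * p i)^-1 * ((Num.sqrt l)^-1 * enorm (a i)))) ^+ 3.
      by rewrite lerXn2r ?nnegrE ?norm1_ge0// (le_trans (norm1_ge0 _) b1).
    apply: le_trans (ler_wpM2l (pge0 i) b3) _.
    rewrite (_ : p i * _ = n%:R^-1 * (C * ((n%:R * p i) ^- 2 * enorm (a i) ^+ 3))); last first.
      by rewrite /C; field; rewrite !gt_eqF.
    rewrite ler_wpM2l ?invr_ge0// ler_wpM2l// ler_wpM2r ?exprn_ge0 ?enorm_ge0//.
    rewrite lef_pV2 ?posrE ?exprn_gt0//.
    by rewrite lerXn2r ?nnegrE ?(ltW al0) ?(ltW (npp i)).
  rewrite !avgZ ler_wpM2l//.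
  by rewrite mulrC ler_wpM2r ?invr_ge0 ?exprn_ge0 ?(ltW al0).
have step (j : {ffun 'I_s.+1 -> 'I_n}) :
    \sum_(k < s.+1) (Num.sqrt s.+1%:R)^-1 *: xi (j k) =
    Num.sqrt s.+1%:R *: - (W *m \sum_(k < s.+1) sub_weight p s.+1 (j k) *: a (j k)).
  rewrite -mulmxN -sumrN mulmx_sumr scaler_sumr; apply: eq_bigr => k _.
  rewrite mulmxN -scalemxAr -scaleNr /xi !scalerA; congr (_ *: _); rewrite /sub_weight.
  have q0 : 0 < Num.sqrt s.+1%:R :> R by rewrite sqrtr_gt0.
  have qq : s.+1%:R = Num.sqrt s.+1%:R ^+ 2 :> R by rewrite sqr_sqrtr.
  move: (Num.sqrt _) q0 qq (pp (j k)) => q q0 -> pj.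
  by field; rewrite !gt_eqF.
have E : walk p (fun i => (Num.sqrt s.+1%:R)^-1 *: xi i) s.+1
    (fun y => `[< le_cV y x >]%:R) 0 =
    \sum_(j : {ffun 'I_s.+1 -> 'I_n}) (\prod_(k < s.+1) p (j k)) *
     `[< le_cV (Num.sqrt s.+1%:R *: - (W *m
           \sum_(k < s.+1) sub_weight p s.+1 (j k) *: a (j k))) x >]%:R.
  by rewrite /walk; apply: eq_bigr => j _; rewrite add0r step.
have := HD n p xi s _ _ e'0 pge0 p1 xi1 xi2 xi3; rewrite E => /andP[h1 h2].
by apply/andP; split; [apply: le_trans h1; rewrite lerD2l lerN2|apply: le_trans h2 _; rewrite lerD2l].
Qed.

End sample_clt.

Section localization.
Context {R : realType} {d : nat}.
Variables (Th : set 'cV[R]_d) (x0 : 'cV[R]_d) (H0 : 'M[R]_d) (lam r L1 ep : R).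
Hypotheses (cT : segment_convex Th) (lam0 : 0 < lam) (r0 : 0 < r)
  (H0lam : forall v, dot v (H0 *m v) <= - (2 * lam) * dot v v)
  (ball : forall y, enorm (y - x0) <= 2 * r -> Th y)
  (ep0 : 0 <= ep) (small_r : (d%:R ^+ 2 + 2) * L1 * r <= lam / 2)
  (small_ep : d%:R ^+ 2 * ep <= lam / 2) (small_score : d%:R * ep < lam / 2 * r).

(** What is used of an objective: it is concave, its Hessian is Lipschitz, and at [x0]
    its gradient nearly vanishes and its Hessian is nearly that of the population. *)
Record near_population (f : 'cV[R]_d -> R) (g : 'cV[R]_d -> 'cV[R]_d)
    (H : 'cV[R]_d -> 'M[R]_d) (L C : R) : Prop := NearPopulation {
  np_concave : segment_concave Th f;
  np_smooth : smooth_on Th f g H L C;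
  np_L0 : 0 <= L;
  np_L1 : L <= L1;
  np_C0 : 0 <= C;
  np_score : forall k, `|g x0 k 0| <= ep;
  np_hessian : forall k l, `|(H x0 - H0) k l| <= ep }.

Section one_objective.
Variables (f : 'cV[R]_d -> R) (g : 'cV[R]_d -> 'cV[R]_d)
  (H : 'cV[R]_d -> 'M[R]_d) (L C : R).
Hypothesis np : near_population f g H L C.

Lemma near_population_x0 : Th x0.
Proof. by apply: ball; rewrite subrr enorm0 mulr_ge0// ltW. Qed.

Lemma near_population_ball y : enorm (y - x0) <= r -> Th y.
Proof. by move=> yr; apply: ball; have := r0; lra. Qed.

Lemma near_population_hessian x : enorm (x - x0) <= r ->
  forall k l, `|(H x - H0) k l| <= ep + L1 * r.
Proof.
move=> xr k l; have Tx := near_population_ball xr; have [_ _ h] := np_smooth np.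
rewrite (_ : (H x - H0) k l = (H x0 - H0) k l + (H x k l - H x0 k l)); last first.
  by rewrite !mxE; ring.
apply: le_trans (ler_normD _ _) _; rewrite lerD//; first exact: (np_hessian np).
apply: le_trans (h _ _ _ _ near_population_x0 Tx) _.
by rewrite ler_pM ?enorm_ge0 ?(np_L0 np) ?(np_L1 np).
Qed.

Lemma L1_ge0 : 0 <= L1. Proof. exact: le_trans (np_L0 np) (np_L1 np). Qed.

Lemma near_population_curvature x : enorm (x - x0) <= r ->
  forall v, dot v (H x *m v) <= - lam * dot v v.
Proof.
move=> xr v; rewrite -[H x](subrK H0) mulmxDl dotDr.
have e0 : 0 <= ep + L1 * r by rewrite addr_ge0// mulr_ge0 ?L1_ge0// ltW.
have := le_trans (ler_norm _) (dot_entry_bound v v e0 (near_population_hessian xr)).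
rewrite -expr2 enorm_sqr => h1; have h2 := H0lam v.
have : d%:R ^+ 2 * (ep + L1 * r) <= lam.
  have h3 : 0 <= L1 * r by rewrite mulr_ge0 ?L1_ge0// ltW.
  have := small_r; have := small_ep; rewrite mulrDr -mulrA mulrDl.
  by move: (d%:R ^+ 2 * _) (d%:R ^+ 2 * _) h3 => A B; lra.
move=> h3; have := ler_wpM2r (dotvv_ge0 v) h3; lra.
Qed.

Lemma small_rL : (d%:R ^+ 2 + 2) * L * r <= lam / 2.
Proof.
by apply: le_trans small_r; rewrite ler_wpM2r ?(ltW r0)// ler_wpM2l ?(np_L1 np)// addr_ge0.
Qed.

Lemma curvature_x0 v : dot v (H x0 *m v) <= - lam * dot v v.
Proof. by apply: near_population_curvature; rewrite subrr enorm0 ltW. Qed.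

Lemma near_population_maximizer x : is_maximizer Th f x ->
  enorm (x - x0) <= r /\ g x = 0.
Proof.
move=> [Tx mx].
have gx0 : enorm (g x0) < lam / 2 * r.
  by apply: le_lt_trans small_score; apply: enorm_le_coord => // k; exact: (np_score np).
have xr : enorm (x - x0) <= r.
  by apply: (maximizer_near cT (np_smooth np) (np_L0 np) (np_C0 np)
    near_population_x0 lam0 r0 curvature_x0 small_rL (np_concave np)).
split=> //; have [sm1 _ _] := np_smooth np.
apply: (gradient_interior_maximizer sm1 (np_C0 np) Tx r0 _ mx) => y yx; apply: ball.
apply: le_trans (enorm_triangle x _ _) _; rewrite mulr2n mulrDl mul1r; exact: lerD.
Qed.

Lemma near_population_distance x x' : enorm (x - x0) <= r -> g x = 0 ->
  enorm (x' - x0) <= r -> enorm (x - x') <= 2 / lam * enorm (g x').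
Proof.
move=> xr gx x'r.
by apply: (zero_gradient_distance (np_smooth np) (np_L0 np)
    near_population_x0 lam0 r0 curvature_x0 small_rL) => //; exact: near_population_ball.
Qed.

End one_objective.

(** One Newton step: up to terms that are small with [r], [ep] and [1 / sqrt s], the
    standardized error of the subsample estimator [y] is the standardized score at the
    full data estimator [x], an average of independent terms. *)
Lemma standardized_error_linear fn gn Hn Ln Cn fs gs Hs Ls Cs x y (W : 'M[R]_d) w K5 s :
  near_population fn gn Hn Ln Cn -> near_population fs gs Hs Ls Cs ->
  is_maximizer Th fn x -> is_maximizer Th fs y -> 0 <= w ->
  (forall v, enorm (W *m v) <= w * enorm v) -> 0 < s ->
  Num.sqrt s * enorm (gs x) <= K5 ->
  forall K6, 2 / lam * K5 <= K6 ->
  enorm (Num.sqrt s *: (W *m Hn x *m (y - x)) - Num.sqrt s *: - (W *m gs x)) <=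
    w * (d%:R ^+ 2 * (2 * (ep + L1 * r)) * K6 + L1 * (K6 ^+ 2 / Num.sqrt s)).
Proof.
move=> npn nps mx my w0 Wb s0 gK K6 K56.
have [xr _] := near_population_maximizer npn mx.
have [yr gy] := near_population_maximizer nps my.
have dist := near_population_distance nps yr gy xr.
have Tx := near_population_ball xr; have Ty := near_population_ball yr.
have q0 : 0 < Num.sqrt s by rewrite sqrtr_gt0.
set q := Num.sqrt s in gK q0 *; set D := y - x in dist *.
have L10 := L1_ge0 nps.
have qD : q * enorm D <= K6.
  apply: le_trans (ler_wpM2l (ltW q0) dist) _.
  by apply: le_trans K56; rewrite mulrCA ler_wpM2l// divr_ge0// ltW.
have K60 : 0 <= K6 by apply: le_trans qD; rewrite mulr_ge0 ?enorm_ge0// ltW.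
have e0 : 0 <= ep + L1 * r by rewrite addr_ge0// mulr_ge0// ltW.
have HH k l : `|(Hn x - Hs x) k l| <= 2 * (ep + L1 * r).
  rewrite (_ : (Hn x - Hs x) k l = (Hn x - H0) k l - (Hs x - H0) k l).
    apply: le_trans (ler_normB _ _) _; rewrite mulr2n mulrDl mul1r.
    by rewrite lerD//; [exact: (near_population_hessian npn)|exact: (near_population_hessian nps)].
  by rewrite !mxE; ring.
have [_ sm2 _] := np_smooth nps.
have rem := sm2 x y Tx Ty; rewrite gy sub0r -/D in rem.
have -> : q *: (W *m Hn x *m D) - q *: - (W *m gs x) =
   q *: (W *m ((Hn x - Hs x) *m D - (- gs x - Hs x *m D))).
  rewrite -scalerBr opprK -mulmxA -mulmxDr; congr (_ *: (_ *m _)).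
  by rewrite mulmxBl opprB opprK addrA subrK.
rewrite enormZ gtr0_norm//.
apply: le_trans (ler_wpM2l (ltW q0) (Wb _)) _; rewrite mulrCA ler_wpM2l//.
apply: le_trans (ler_wpM2l (ltW q0) (enormB _ _)) _; rewrite mulrDr; apply: lerD.
  have e20 : 0 <= 2 * (ep + L1 * r) by rewrite mulr_ge0.
  apply: le_trans (ler_wpM2l (ltW q0) (enorm_mulmx_entry _ e20 HH)) _.
  by rewrite mulrCA ler_wpM2l// mulr_ge0 ?exprn_ge0.
apply: le_trans (ler_wpM2l (ltW q0) rem) _.
rewrite (_ : q * _ = Ls * ((q * enorm D) ^+ 2 / q)); last by field; rewrite gt_eqF.
rewrite ler_pM ?(np_L0 nps) ?(np_L1 nps)//.
  by rewrite divr_ge0 ?sqr_ge0// ltW.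
rewrite ler_wpM2r ?invr_ge0 ?(ltW q0)// lerXn2r ?nnegrE//.
by rewrite mulr_ge0 ?enorm_ge0// ltW.
Qed.

End localization.

Section negligible_events.
Context {R : realType} {dO : measure_display} {Om : measurableType dO}.
Variable P : probability Om R.

(** Outer probability tending to zero. *)
Definition negl (A : nat -> set Om) : Prop := forall e : R, 0 < e ->
  \forall n \near \oo, exists B, [/\ measurable B, (P B <= e%:E)%E & A n `<=` B].

Lemma negl_sub A B : negl A -> (\forall n \near \oo, B n `<=` A n) -> negl B.
Proof.
move=> nA BA e e0; near=> n.
have [C [mC PC AC]] : exists C, [/\ measurable C, (P C <= e%:E)%E & A n `<=` C].
  by near: n; exact: nA.
exists C; split=> //; apply: subset_trans AC; near: n; exact: BA.
Unshelve. all: by end_near. Qed.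

Lemma negl_union A B : negl A -> negl B -> negl (fun n => A n `|` B n).
Proof.
move=> nA nB e e0; have e20 : 0 < e / 2 by rewrite divr_gt0.
near=> n.
have [C [mC PC AC]] : exists C, [/\ measurable C, (P C <= (e / 2)%:E)%E & A n `<=` C].
  by near: n; exact: nA.
have [D [mD PD BD]] : exists C, [/\ measurable C, (P C <= (e / 2)%:E)%E & B n `<=` C].
  by near: n; exact: nB.
exists (C `|` D); split; first exact: measurableU.
  apply: le_trans (measureU2 _ mC mD) _.
  by rewrite [e in leRHS]splitr EFinD leeD.
by apply: setUSS.
Unshelve. all: by end_near. Qed.

Lemma negl0 : negl (fun=> set0).
Proof.
move=> e e0; near=> n; exists set0; split=> //.
by rewrite measure0 lee_fin ltW.
Unshelve. all: by end_near. Qed.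

Lemma negl_exists (I : finType) (A : I -> nat -> set Om) : (forall i, negl (A i)) ->
  negl (fun n => [set w | exists i, A i n w]).
Proof.
move=> nA.
suff h (r : seq I) : negl (fun n => [set w | exists2 i, i \in r & A i n w]).
  apply: negl_sub (h (enum I)) _; near=> n => w [i Aw].
  by exists i => //; rewrite mem_enum.
elim: r => [|i r IH].
  by apply: negl_sub negl0 _; near=> n => w [].
apply: negl_sub (negl_union (nA i) IH) _; near=> n => w [j].
by rewrite inE => /orP[/eqP ->|jr] Aw; [left|right; exists j].
Unshelve. all: by end_near. Qed.

Lemma negl_bound A : (forall n, measurable (A n)) ->
  (forall e : R, 0 < e -> \forall n \near \oo, (P (A n) <= e%:E)%E) -> negl A.
Proof. by move=> mA h e e0; near=> n; exists (A n); split=> //; near: n; exact: h.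
Unshelve. all: by end_near. Qed.

Lemma negl_measure A e : negl A -> (forall n, measurable (A n)) -> 0 < e ->
  \forall n \near \oo, (P (A n) <= e%:E)%E.
Proof.
move=> nA mA e0; near=> n.
have [C [mC PC AC]] : exists C, [/\ measurable C, (P C <= e%:E)%E & A n `<=` C].
  by near: n; exact: nA.
by apply: le_trans PC; apply: le_measure; rewrite ?inE.
Unshelve. all: by end_near. Qed.

Lemma probability_cvg0 (A : nat -> set Om) :
  (forall e : R, 0 < e -> \forall n \near \oo, (P (A n) <= e%:E)%E) ->
  (fun n => P (A n)) @ \oo --> 0%E.
Proof.
move=> h; apply/fine_cvgP; split.
  near=> n; rewrite ge0_fin_numE//; apply: (@le_lt_trans _ _ 1%:E); last exact: ltry.
  by near: n; exact: h.
apply/cvgrPdist_le => e e0; near=> n; rewrite sub0r normrN ger0_norm ?fine_ge0//.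
have Pe : (P (A n) <= e%:E)%E by near: n; exact: h.
rewrite -lee_fin fineK// ge0_fin_numE//; exact: le_lt_trans Pe (ltry _).
Unshelve. all: by end_near. Qed.

Lemma finite_union_bound N (A : 'I_N -> set Om) (c : R) : (forall k, measurable (A k)) ->
  (forall k, (P (A k) <= c%:E)%E) -> exists B, [/\ measurable B,
    (P B <= (N%:R * c)%:E)%E & forall k, A k `<=` B].
Proof.
move=> mA PA; pose A' i := if insub i is Some k then A k else set0.
have A'E (k : 'I_N) : A' k = A k by rewrite /A' valK.
exists (\big[setU/set0]_(i < N) A' i); split.
- by apply: bigsetU_measurable => i _; rewrite A'E; exact: mA.
- apply: le_trans (Boole_inequality _ _) _ => [i iN|].
    by rewrite -[i]/(val (Ordinal iN)) A'E; exact: mA.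
  rewrite (_ : (N%:R * c)%:E = \sum_(i < N) c%:E)%E.
    by apply: lee_sum => i _; rewrite A'E; exact: PA.
  by rewrite sumEFin sumr_const card_ord mulr_natl.
by move=> k w Aw; rewrite -bigcup_mkord; exists k => //=; rewrite A'E.
Qed.

End negligible_events.

Section conditioning.
Context {R : realType} {dO : measure_display} {Om : measurableType dO}.
Variable P : probability Om R.

Lemma cond_prob_integrable_ge (g : Om -> R) B c : measurable B ->
  P.-integrable setT (EFin \o g) -> (forall w, B w -> c <= g w) ->
  (c%:E * P B <= \int[P]_(w in B) (g w)%:E)%E.
Proof.
move=> mB ig cg; rewrite -integral_cst//; apply: le_integral => //.
- by apply: finite_measure_integrable_cst.
- exact: (integrableS measurableT mB (@subsetT _ _) ig).
- by move=> w Bw; rewrite lee_fin cg// -inE.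
Qed.

Lemma cond_prob_integrable_le (g : Om -> R) B c : measurable B ->
  P.-integrable setT (EFin \o g) -> (forall w, B w -> g w <= c) ->
  (\int[P]_(w in B) (g w)%:E <= c%:E * P B)%E.
Proof.
move=> mB ig cg; rewrite -integral_cst//; apply: le_integral => //.
- exact: (integrableS measurableT mB (@subsetT _ _) ig).
- by apply: finite_measure_integrable_cst.
- by move=> w Bw; rewrite lee_fin cg// -inE.
Qed.

(** Conditional probabilities need not be constructed: a version is determined by its
    integrals over the events [B] of the conditioning sigma-algebra, and it suffices
    to consider the events where it exceeds, or falls below, its limit. *)
Lemma cond_prob_cvg (G : nat -> set (set Om)) (E : nat -> set Om) (phi : R) :
  (forall n, G n `<=` measurable) ->
  (forall n A B, G n A -> G n B -> G n (A `&` B)) ->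
  (forall e : R, 0 < e -> exists Good : nat -> set Om,
    [/\ forall n, G n (Good n),
      \forall n \near \oo, exists C,
        [/\ measurable C, (P C <= e%:E)%E & ~` Good n `<=` C] &
      \forall n \near \oo, forall B, G n B -> B `<=` Good n ->
        (P (B `&` E n) <= phi%:E * P B + e%:E)%E /\
        (phi%:E * P B <= P (B `&` E n) + e%:E)%E]) ->
  forall g, (forall n, is_cond_prob P (G n) (E n) (g n)) ->
  cvg0_in_probability P (fun n w => g n w - phi).
Proof.
move=> Gm GI H g Hg e e0; apply: probability_cvg0 => t t0.
have t30 : 0 < t / 3 by rewrite divr_gt0.
pose u := Num.min (e * (t / 3)) (t / 3).
have u0 : 0 < u by rewrite lt_min mulr_gt0.
have ut : u <= t / 3 by rewrite ge_min lexx orbT.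
have ue : u <= e * (t / 3) by rewrite ge_min lexx.
have [Good [GGood ngood HB]] := H u u0.
near=> n.
have [C [mC PC goodC]] : exists C, [/\ measurable C, (P C <= u%:E)%E & ~` Good n `<=` C].
  by near: n; exact: ngood.
have HB2 : forall B, G n B -> B `<=` Good n ->
        (P (B `&` E n) <= phi%:E * P B + u%:E)%E /\
        (phi%:E * P B <= P (B `&` E n) + u%:E)%E by near: n.
have [mg ig gE] := Hg n.
pose Bp := Good n `&` [set w | phi + e <= g n w].
pose Bm := Good n `&` [set w | g n w <= phi - e].
have GBp : G n Bp.
  apply: GI => //; rewrite (_ : [set w | _] = g n @^-1` `[phi + e, +oo[); first exact: mg.
  by apply/seteqP; split => w /=; rewrite in_itv/= andbT.
have GBm : G n Bm.
  apply: GI => //; rewrite (_ : [set w | _] = g n @^-1` `]-oo, phi - e]); first exact: mg.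
  by apply/seteqP; split => w /=; rewrite in_itv/=.
have mBp := Gm _ _ GBp; have mBm := Gm _ _ GBm.
have fin B : measurable B -> P B = (fine (P B))%:E.
  by move=> mB; rewrite fineK// fin_num_measure.
have PBp : (P Bp <= (t / 3)%:E)%E.
  have [h _] := HB2 _ GBp (@subIsetl _ _ _).
  have := cond_prob_integrable_ge mBp ig (fun w h => proj2 h : phi + e <= g n w).
  rewrite gE// => /le_trans /(_ h); rewrite fin// -!EFinM -EFinD !lee_fin mulrDl.
  by rewrite lerD2l => h2; rewrite -(ler_pM2l e0); exact: le_trans ue.
have PBm : (P Bm <= (t / 3)%:E)%E.
  have [_ h] := HB2 _ GBm (@subIsetl _ _ _).
  have := cond_prob_integrable_le mBm ig (fun w h => proj2 h : g n w <= phi - e).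
  rewrite gE// => /(leeD2r u%:E) h'; have := le_trans h h'.
  rewrite fin// -!EFinM -EFinD !lee_fin => h2.
  have {}h2 : e * fine (P Bm) <= e * (t / 3) by apply: le_trans ue; lra.
  by rewrite -(ler_pM2l e0).
have cov : [set w | e <= `|g n w - phi|] `<=` C `|` (Bp `|` Bm).
  move=> w /= h; have [Gw|nGw] := pselect (Good n w); last by left; exact: goodC.
  right; move: h; have [d0|d0] := leP 0 (g n w - phi).
    by rewrite ger0_norm// => h; left; split=> //=; lra.
  by rewrite ltr0_norm// => h; right; split=> //=; lra.
have mE : measurable [set w | e <= `|g n w - phi|].
  rewrite (_ : [set w | _] = (g n @^-1` `[phi + e, +oo[) `|` (g n @^-1` `]-oo, phi - e])).
    by apply: measurableU; apply: (Gm n); exact: mg.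
  apply/seteqP; split => w /=; rewrite !in_itv/= andbT.
    by rewrite ler_normr => /orP[h|h]; [left|right]; lra.
  by rewrite ler_normr => -[h|h]; apply/orP; [left|right]; lra.
apply: (@le_trans _ _ (P (C `|` (Bp `|` Bm)))).
  by apply: le_measure; rewrite ?inE//; apply: measurableU => //; exact: measurableU.
have mBB : measurable (Bp `|` Bm) by exact: measurableU.
apply: le_trans (measureU2 _ mC mBB) _.
rewrite (_ : t%:E = (t / 3)%:E + ((t / 3)%:E + (t / 3)%:E))%E; last first.
  by rewrite -!EFinD; congr EFin; lra.
apply: leeD; first by apply: le_trans PC _; rewrite lee_fin.
by apply: le_trans (measureU2 _ mBp mBm) _; exact: leeD.
Unshelve. all: by end_near. Qed.

End conditioning.

Section draw_events.
Context {R : realType} {dO : measure_display} {Om : measurableType dO}.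
Variables (P : probability Om R) (G0 : set (set Om)).
Local Notation G := (<<s G0 >>).
Local Notation OmG := (g_sigma_algebraType G0).
Hypothesis Gm : G `<=` measurable.

Lemma measurable_fun_sub (f : Om -> R) : @measurable_fun _ _ OmG R setT f ->
  @measurable_fun _ _ Om R setT f.
Proof. by move=> mf _ Y mY; apply: Gm; exact: (mf measurableT Y mY). Qed.

Variables (D : set Om) (n s : nat) (p : Om -> nat -> R) (J : nat -> Om -> nat).
Hypotheses (draw : drawn_with_replacement P G D n s p J) (n0 : (0 < n)%N)
  (mp : forall i : 'I_n, @measurable_fun _ _ OmG R setT (fun w => p w i)).
Variable B : set Om.
Hypotheses (GB : G B) (BD : B `<=` D) (p0 : forall w (i : 'I_n), B w -> 0 <= p w i).

Lemma draw_event_probability (E : ('I_s -> nat) -> set Om) (c1 c2 : R) :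
  (forall j : {ffun 'I_s -> 'I_n}, G (E (fun k => j k))) ->
  (forall w, B w -> c1 <= \sum_(j : {ffun 'I_s -> 'I_n}) (\prod_(k < s) p w (j k)) *
     `[< E (fun k => j k) w >]%:R <= c2) ->
  (c1%:E * P B <= P (B `&` [set w | E (fun k => J k w) w]) <= c2%:E * P B)%E.
Proof.
move=> GE Hc.
have -> : [set w | E (fun k => J k w) w] = [set w | exists j : {ffun 'I_s -> 'I_n},
      (forall k : 'I_s, J k w = j k) /\ E (fun k => j k) w].
  apply/seteqP; split => w /=.
    move=> Ew; have Jn (k : 'I_s) : (J k w < n)%N by have [_ + _] := draw; exact.
    exists [ffun k => Ordinal (Jn k)]; split; first by move=> k; rewrite ffunE.
    rewrite [X in E X](_ : _ = fun k : 'I_s => J k w)//.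
    by apply: funext => k; rewrite ffunE.
  move=> [j [Jj Ej]]; rewrite [X in E X](_ : _ = fun k : 'I_s => (j k : nat))//.
  by apply: funext => k; exact: Jj.
apply: (draw_probability (E := fun j : {ffun 'I_s -> 'I_n} => E (fun k => j k)) Gm draw) => //.
by move=> i; exact: measurable_fun_sub.
Qed.

Lemma draw_event_measurable (E : ('I_s -> nat) -> set Om) :
  (forall j : {ffun 'I_s -> 'I_n}, measurable (E (fun k => j k))) ->
  measurable [set w | E (fun k => J k w) w].
Proof.
move=> mE; have [mJ Jlt _] := draw.
pose A (j : {ffun 'I_s -> 'I_n}) := E (fun k => j k) `&`
  [set w | forall k : 'I_s, J k w = j k].
have mA j : measurable (A j).
  apply: measurableI => //.
  by apply: (@measurable_set_forall _ _ _ (fun k : 'I_s => [set w | J k w = j k])).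
rewrite (_ : [set w | _] = [set w | exists j, A j w]).
  exact: measurable_set_countable_exists.
apply/seteqP; split => w /=.
  move=> Ew; have Jn (k : 'I_s) : (J k w < n)%N by exact: Jlt.
  exists [ffun k => Ordinal (Jn k)]; split; last by move=> k; rewrite ffunE.
  rewrite [X in E X](_ : _ = fun k : 'I_s => J k w)//.
  by apply: funext => k; rewrite ffunE.
move=> [j [Ej Jj]]; rewrite [X in E X](_ : _ = fun k : 'I_s => (j k : nat))//.
by apply: funext => k; exact: Jj.
Qed.

(** Chebyshev's inequality for the subsample, conditionally on [G]. *)
Lemma draw_chebyshev (u : Om -> nat -> R) (al K e : R) : (0 < s)%N -> 0 < al -> 0 < e ->
  0 <= K -> (forall i : 'I_n, @measurable_fun _ _ OmG R setT (fun w => u w i)) ->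
  (forall w, B w -> [/\ forall i : 'I_n, al <= n%:R * p w i,
     \sum_(i < n) p w i = 1 & avg (fun i : 'I_n => u w i ^+ 2) <= K]) ->
  (P (B `&` [set w | (e <= `|\sum_(k < s) (n%:R * s%:R * p w (J k w))^-1 * u w (J k w) -
     avg (fun i : 'I_n => u w i)|)%R]) <= (K / al / (s%:R * e ^+ 2))%:E)%E.
Proof.
move=> s0 al0 e0 K0 mu HB.
pose E (j : 'I_s -> nat) := [set w | e <= `|\sum_(k < s) (n%:R * s%:R * p w (j k))^-1 *
   u w (j k) - avg (fun i : 'I_n => u w i)|].
have GE (j : {ffun 'I_s -> 'I_n}) : G (E (fun k => j k)).
  rewrite -[G _]/(@measurable _ OmG _).
  apply: (@measurable_set_le _ _ OmG (fun=> e)); first exact: measurable_cst.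
  apply: measurableT_comp => //; apply: measurable_funB.
    apply: measurable_sumr => k; apply: measurable_funM => //.
    by apply: measurable_invr; apply: measurable_funM => //; exact: measurable_cst.
  by apply: measurable_funM; [exact: measurable_cst|exact: measurable_sumr].
have c0 : 0 <= K / al / (s%:R * e ^+ 2).
  by rewrite !divr_ge0 ?mulr_ge0 ?exprn_ge0// ltW.
have /andP[_ h] : (0%:E * P B <= P (B `&` [set w | E (fun k => J k w) w]) <=
    (K / al / (s%:R * e ^+ 2))%:E * P B)%E.
  apply: draw_event_probability => // w Bw; have [pal p1 uK] := HB w Bw.
  apply/andP; split.
    apply: sumr_ge0 => j _; rewrite mulr_ge0// prodr_ge0// => k _; exact: p0.
  have := importance_chebyshev n0 al0 pal p1 s0 e0 uK.
  apply: le_trans; apply: ler_sum => j _; rewrite ler_wpM2l//.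
    by rewrite prodr_ge0// => k _; exact: p0.
  by rewrite /E asboolb.
apply: le_trans h _; rewrite -[leRHS]mule1; apply: lee_wpmul2l; first by rewrite lee_fin.
by apply: probability_le1; exact: Gm.
Qed.

End draw_events.

Section square_integrable.
Context {R : realType} {dT : measure_display} {T : measurableType dT}.
Variable mu : probability T R.
Implicit Types f g : T -> R.

Definition sq_integrable f : Prop :=
  measurable_fun setT f /\ mu.-integrable setT (EFin \o (fun z => f z ^+ 2)).

Lemma integrable_dominated f g : measurable_fun setT f ->
  mu.-integrable setT (EFin \o g) -> (forall z, `|f z| <= g z) ->
  mu.-integrable setT (EFin \o f).
Proof.
move=> mf ig fg; apply: le_integrable ig => //; first exact/measurable_EFinP.
by move=> z _; rewrite /= lee_fin (le_trans (fg z))// ler_norm.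
Qed.

Lemma sq_integrable_expectation f : measurable_fun setT f ->
  ('E_mu[fun z => (f z ^+ 2)%R] < +oo)%E -> sq_integrable f.
Proof.
move=> mf foo; split=> //; apply/integrableP; split.
  by apply/measurable_EFinP; exact: measurable_funX.
rewrite unlock in foo; apply: le_lt_trans foo; rewrite le_eqVlt; apply/orP; left; apply/eqP.
by apply: eq_integral => z _ /=; rewrite ger0_norm ?sqr_ge0.
Qed.

Lemma sq_integrableM f g : sq_integrable f -> sq_integrable g ->
  mu.-integrable setT (EFin \o (fun z => f z * g z)).
Proof.
move=> [mf if2] [mg ig2].
apply: (@integrable_dominated _ (fun z => f z ^+ 2 + g z ^+ 2)).
- exact: measurable_funM.
- exact: (integrableD measurableT if2 ig2).
move=> z; rewrite ler_norml; apply/andP; split.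
  by have := sqr_ge0 (f z + g z); have := sqr_ge0 (f z); have := sqr_ge0 (g z); rewrite !expr2; nra.
by have := sqr_ge0 (f z - g z); have := sqr_ge0 (f z); have := sqr_ge0 (g z); rewrite !expr2; nra.
Qed.

Lemma sq_integrable_cst (c : R) : sq_integrable (fun=> c).
Proof. by split; [exact: measurable_cst|exact: finite_measure_integrable_cst]. Qed.

Lemma sq_integrable_integrable f : sq_integrable f -> mu.-integrable setT (EFin \o f).
Proof.
move=> sf; have := sq_integrableM (sq_integrable_cst 1) sf.
by congr (_.-integrable _ _); apply: funext => z /=; rewrite mul1r.
Qed.

Lemma sq_integrable_dominated f g : measurable_fun setT f -> sq_integrable g ->
  (forall z, `|f z| <= g z) -> sq_integrable f.
Proof.
move=> mf [mg ig] fg; split=> //; apply: integrable_dominated ig _.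
  exact: measurable_funX.
move=> z; rewrite normrX lerXn2r ?nnegrE//; exact: le_trans (fg z).
Qed.

Lemma sq_integrableD f g : sq_integrable f -> sq_integrable g ->
  sq_integrable (fun z => f z + g z).
Proof.
move=> sf sg; have [mf if2] := sf; have [mg ig2] := sg.
split; first exact: measurable_funD.
have := integrableD measurableT (integrableD measurableT if2 ig2)
  (integrableZl measurableT 2 (sq_integrableM sf sg)).
congr (_.-integrable _ _); apply: funext => z /=; rewrite -EFinM -!EFinD; congr EFin; ring.
Qed.

Lemma sq_integrableZ c f : sq_integrable f -> sq_integrable (fun z => c * f z).
Proof.
move=> [mf if2]; split; first by apply: measurable_funM => //; exact: measurable_cst.
have := integrableZl measurableT (c ^+ 2) if2.
by congr (_.-integrable _ _); apply: funext => z /=; rewrite -EFinM exprMn.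
Qed.

Lemma sq_integrable_norm f : sq_integrable f -> sq_integrable (fun z => `|f z|).
Proof.
move=> [mf if2]; split; first exact: measurableT_comp.
have := if2; congr (_.-integrable _ _); apply: funext => z /=.
by rewrite real_normK ?num_real.
Qed.

Lemma sq_integrable_sum (I : Type) (r : seq I) (f : I -> T -> R) :
  (forall i, sq_integrable (f i)) -> sq_integrable (fun z => \sum_(i <- r) f i z).
Proof.
move=> sf; elim: r => [|i r IH].
  by under eq_fun do rewrite big_nil; exact: sq_integrable_cst.
by under eq_fun do rewrite big_cons; exact: sq_integrableD.
Qed.

Lemma sq_integrable_enorm d (f : T -> 'cV[R]_d) : (forall k, sq_integrable (fun z => f z k 0)) ->
  sq_integrable (fun z => enorm (f z)).
Proof.
move=> sf; apply: (@sq_integrable_dominated _ (fun z => norm1 (f z))).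
- by apply: measurable_enorm => k j; rewrite ord1; have [] := sf k.
- by apply: sq_integrable_sum => k; exact: sq_integrable_norm.
- by move=> z; rewrite ger0_norm ?enorm_ge0// enorm_le_norm1.
Qed.

End square_integrable.

Section regular_model.
Context {R : realType} {d : nat} {dT : measure_display} {T : measurableType dT}.
Variables (mu : probability T R) (m : T -> 'cV[R]_d -> R) (Theta : set 'cV[R]_d).

(** What the assumptions say about the model near the population maximizer [x0]. *)
Record regular_at (x0 : 'cV[R]_d) (L C : T -> R) (H0 : 'M[R]_d) (lam l c0 rho : R) :
    Prop := RegularAt {
  ra_convex : segment_convex Theta;
  ra_concave : forall z, segment_concave Theta (m z);
  ra_rho : 0 < rho;
  ra_ball : forall y, enorm (y - x0) <= rho -> Theta y;
  ra_smooth : forall z, smooth_on Theta (m z) (gradient (m z)) (hessian (m z)) (L z) (C z);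
  ra_lip : forall z x y, Theta x -> Theta y ->
    enorm (gradient (m z) y - gradient (m z) x) <= C z * enorm (y - x);
  ra_L0 : forall z, 0 <= L z;
  ra_C0 : forall z, 0 <= C z;
  ra_L : sq_integrable mu L;
  ra_C : sq_integrable mu C;
  ra_score : forall k, sq_integrable mu (fun z => gradient (m z) x0 k 0);
  ra_score0 : forall k, \int[mu]_z gradient (m z) x0 k 0 = 0;
  ra_hess : forall k k', sq_integrable mu (fun z => hessian (m z) x0 k k');
  ra_hess0 : forall k k', \int[mu]_z hessian (m z) x0 k k' = H0 k k';
  ra_lam : 0 < lam;
  ra_curvature : forall v, dot v (H0 *m v) <= - (2 * lam) * dot v v;
  ra_l : 0 < l;
  ra_outer : forall v, l * dot v v <=
    dot v ((\matrix_(k, k') \int[mu]_z (gradient (m z) x0 k 0 * gradient (m z) x0 k' 0)) *m v);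
  ra_c0 : 0 < c0;
  ra_norm : c0 <= \int[mu]_z enorm (gradient (m z) x0) }.

Lemma gradient_lipschitz f x1 (ps A0 D L C : R) : segment_convex Theta ->
  smooth_on Theta f (gradient f) (hessian f) L C -> 0 <= L -> 0 <= ps -> 0 <= A0 ->
  Theta x1 -> (forall x y, Theta x -> Theta y -> enorm (x - y) <= D) ->
  (forall k l, `|hessian f x1 k l| <= A0) ->
  (forall x y k l, Theta x -> Theta y -> `|hessian f x k l - hessian f y k l| <=
     ps * enorm (x - y)) ->
  forall x y, Theta x -> Theta y ->
  enorm (gradient f y - gradient f x) <= (d%:R ^+ 2 * (A0 + ps * D) + L * D) * enorm (y - x).
Proof.
move=> cT [_ sm2 _] L0 ps0 A00 Tx1 diam HA0 Hps x y Tx Ty.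
have D0 : 0 <= D by apply: le_trans (diam _ _ Tx Tx); exact: enorm_ge0.
rewrite -[gradient f y - _](subrK (hessian f x *m (y - x))).
apply: le_trans (enormD _ _) _; rewrite addrC [leRHS]mulrDl lerD//.
  apply: enorm_mulmx_entry; first by rewrite addr_ge0 ?mulr_ge0.
  move=> k l; rewrite -[hessian f x k l](subrK (hessian f x1 k l)) addrC.
  apply: le_trans (ler_normD _ _) _; rewrite lerD//.
  by apply: le_trans (Hps _ _ _ _ Tx Tx1) _; rewrite ler_wpM2l// diam.
apply: le_trans (sm2 _ _ Tx Ty) _; rewrite expr2 mulrA ler_wpM2r ?enorm_ge0//.
by rewrite ler_wpM2l// diam.
Qed.

Lemma compact_diameter : compact Theta ->
  exists2 D : R, 0 <= D & forall x y, Theta x -> Theta y -> enorm (x - y) <= D.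
Proof.
move=> /compact_bounded[N [_ HN]].
have Nx x : Theta x -> enorm x <= d%:R * (`|N| + 1).
  move=> Tx; have Nb : `|x| <= `|N| + 1.
    by apply: HN => //; rewrite (le_lt_trans (ler_norm _))// ltrDl.
  apply: enorm_le_coord => [|k]; first by rewrite addr_ge0.
  by apply: le_trans (coord_le_sup_norm _ _) Nb.
exists (d%:R * (`|N| + 1) + d%:R * (`|N| + 1)).
  by rewrite addr_ge0 ?mulr_ge0 ?addr_ge0.
by move=> x y Tx Ty; apply: le_trans (enormB _ _) _; rewrite lerD ?Nx.
Qed.

Lemma quadratic_on_continuous (f : 'cV[R]_d -> R) g C D : 0 <= C ->
  (forall x y, Theta x -> Theta y -> enorm (x - y) <= D) ->
  quadratic_on Theta f g C -> {within Theta, continuous f}.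
Proof.
move=> C0 diam qf; apply/subspace_continuousP => x Tx.
apply/cvgrPdist_le => e e0.
pose K := (enorm (g x) + C * D + 1) * d%:R + 1.
have D0 : 0 <= D by apply: le_trans (diam _ _ Tx Tx); exact: enorm_ge0.
have K1 : 0 <= enorm (g x) + C * D + 1 by rewrite !addr_ge0 ?enorm_ge0 ?mulr_ge0.
have K0 : 0 < K by rewrite ltr_wpDl// mulr_ge0.
have dlt : 0 < e / K by rewrite divr_gt0.
rewrite near_withinE; near=> y => Ty.
have xy : `|x - y| < e / K.
  by near: y; have := nbhsx_ballx x _ dlt; rewrite -ball_normE.
have n1 : enorm (y - x) <= d%:R * `|x - y|.
  apply: enorm_le_coord => // k.
  by rewrite distrC; exact: coord_le_sup_norm.
rewrite distrC -[f y - f x](subrK (dot (g x) (y - x))).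
apply: le_trans (ler_normD _ _) _.
apply: (@le_trans _ _ (C * enorm (y - x) ^+ 2 + enorm (g x) * enorm (y - x))).
  by rewrite lerD ?cauchy_schwarz// qf.
apply: (@le_trans _ _ ((enorm (g x) + C * D + 1) * enorm (y - x))).
  have : C * enorm (y - x) ^+ 2 <= C * D * enorm (y - x).
    by rewrite expr2 mulrA ler_wpM2r ?enorm_ge0// ler_wpM2l// diam.
  by have := enorm_ge0 (y - x); nra.
apply: le_trans (ler_wpM2l K1 n1) _; rewrite mulrA.
apply: (@le_trans _ _ (K * `|x - y|)); first by rewrite ler_wpM2r// lerDl.
by rewrite mulrC -ler_pdivlMr// ltW.
Unshelve. all: by end_near. Qed.

End regular_model.

Section population.
Context {R : realType} {d : nat} {dT : measure_display} {T : measurableType dT}.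
Variables (mu : probability T R) (m : T -> 'cV[R]_d -> R) (Theta : set 'cV[R]_d).
Hypotheses (d_gt0 : (0 < d)%N)
  (m_diff : forall z theta, Theta theta -> twice_differentiable (m z) theta)
  (m_meas : forall theta, Theta theta -> measurable_fun setT (fun z => m z theta))
  (dm_meas : forall theta k, Theta theta ->
     measurable_fun setT (fun z => gradient (m z) theta k 0))
  (ddm_meas : forall theta k l, Theta theta ->
     measurable_fun setT (fun z => hessian (m z) theta k l))
  (Theta_compact : compact Theta)
  (m_concave : forall z, concave_on Theta (m z))
  (m_L2 : forall theta, Theta theta ->
     ('E_mu[fun z => (m z theta ^+ 2)%R] < +oo)%E)
  (max_interior : forall theta,
     is_maximizer Theta (fun t => fine 'E_mu[m^~ t]) theta ->
     (interior Theta) theta)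
  (ddm_posdef : forall theta, Theta theta ->
     posdef (- \matrix_(k, l) fine 'E_mu[fun z => hessian (m z) theta k l]))
  (ddm_L2 : forall theta k l, Theta theta ->
     ('E_mu[fun z => (hessian (m z) theta k l ^+ 2)%R] < +oo)%E)
  (ddm_lip : exists psi : T -> R,
     [/\ measurable_fun setT psi,
         ('E_mu[fun z => (psi z ^+ 2)%R] < +oo)%E &
         forall z theta1 theta2 k l, Theta theta1 -> Theta theta2 ->
           `|hessian (m z) theta1 k l - hessian (m z) theta2 k l|
             <= psi z * enorm (theta1 - theta2)])
  (Lambda_fin : forall theta k l, Theta theta ->
     mu.-integrable setT
       (fun z => (gradient (m z) theta k 0 * gradient (m z) theta l 0)%:E))
  (Lambda_posdef : forall theta, Theta theta ->
     posdef (\matrix_(k, l) fine 'E_mu[fun z =>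
       (gradient (m z) theta *m (gradient (m z) theta)^T) k l]))
  (Theta_nonempty : exists x, Theta x).

Let score2 x k : Theta x -> sq_integrable mu (fun z => gradient (m z) x k 0).
Proof. by move=> Tx; split; [exact: dm_meas|exact: Lambda_fin]. Qed.

Let hess2 x k l : Theta x -> sq_integrable mu (fun z => hessian (m z) x k l).
Proof. by move=> Tx; apply: sq_integrable_expectation; [exact: ddm_meas|exact: ddm_L2]. Qed.

Let m2 x : Theta x -> sq_integrable mu (fun z => m z x).
Proof. by move=> Tx; apply: sq_integrable_expectation; [exact: m_meas|exact: m_L2]. Qed.

Let fineE (f : T -> R) : fine 'E_mu[f] = \int[mu]_z f z.
Proof. by rewrite unlock. Qed.

Lemma Rintegral_normW (f g : T -> R) : mu.-integrable setT (EFin \o f) ->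
  mu.-integrable setT (EFin \o g) -> (forall z, `|f z| <= g z) ->
  `|\int[mu]_z f z| <= \int[mu]_z g z.
Proof.
move=> intf intg fg; apply: le_trans (le_normr_Rintegral _ _) _ => //.
apply: le_Rintegral => //; exact: (integrable_norm intf).
Qed.

Lemma population_quadratic (C : T -> R) : sq_integrable mu C ->
  (forall z, quadratic_on Theta (m z) (gradient (m z)) (C z)) ->
  quadratic_on Theta (fun t => fine 'E_mu[m^~ t])
    (fun t => \col_k \int[mu]_z gradient (m z) t k 0) (\int[mu]_z C z).
Proof.
move=> C2 qm x y Tx Ty; rewrite !fineE.
have im u : Theta u -> mu.-integrable setT (EFin \o (fun z => m z u)).
  by move=> Tu; apply: sq_integrable_integrable; exact: m2.
have ig u k : Theta u -> mu.-integrable setT (EFin \o (fun z => gradient (m z) u k 0)).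
  by move=> Tu; apply: sq_integrable_integrable; exact: score2.
have igk k : mu.-integrable setT (EFin \o (fun z => gradient (m z) x k 0 * (y - x) k 0)).
  have := integrableZl measurableT ((y - x) k 0) (ig x k Tx).
  by congr (_.-integrable _ _); apply: funext => z /=; rewrite -EFinM mulrC.
have [id dE] := Rintegral_sum (index_enum 'I_d) igk.
have -> : \int[mu]_z m z y - \int[mu]_z m z x -
    dot (\col_k \int[mu]_z gradient (m z) x k 0) (y - x) =
    \int[mu]_z (m z y - m z x - dot (gradient (m z) x) (y - x)).
  have imyx : mu.-integrable setT (EFin \o (fun z => m z y - m z x)).
    exact: (integrableB measurableT (im y Ty) (im x Tx)).
  rewrite (RintegralB measurableT imyx id) (RintegralB measurableT (im y Ty) (im x Tx)).
  congr (_ - _ - _); rewrite dE; apply: eq_bigr => k _.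
  rewrite mxE mulrC -RintegralZl//; last exact: ig.
  by apply: eq_Rintegral => z _; rewrite mulrC.
rewrite mulrC -RintegralZl//; last exact: sq_integrable_integrable.
apply: Rintegral_normW.
- exact: (integrableB measurableT (integrableB measurableT (im y Ty) (im x Tx)) id).
- exact: (integrableZl measurableT (enorm (y - x) ^+ 2) (sq_integrable_integrable C2)).
by move=> z; rewrite mulrC; exact: qm.
Qed.

Lemma positive_norm_integral (g : T -> 'cV[R]_d) k :
  (forall k, sq_integrable mu (fun z => g z k 0)) ->
  0 < \int[mu]_z (g z k 0 ^+ 2) -> 0 < \int[mu]_z enorm (g z).
Proof.
move=> g2 pos; have ge : sq_integrable mu (fun z => enorm (g z)) by exact: sq_integrable_enorm.
have ie := sq_integrable_integrable ge.
rewrite lt_neqAle Rintegral_ge0 ?andbT; last by move=> z _; exact: enorm_ge0.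
apply/eqP => /esym e0; suff : \int[mu]_z (g z k 0 ^+ 2) = 0 by move=> h; rewrite h ltxx in pos.
have ez : (\int[mu]_z `|(enorm (g z))%:E| = 0)%E.
  have <- : (\int[mu]_z (enorm (g z))%:E = \int[mu]_z `|(enorm (g z))%:E|)%E.
    by apply: eq_integral => z _ /=; rewrite ger0_norm ?enorm_ge0.
  by rewrite -[LHS]fineK ?(integrable_fin_num measurableT ie)//; congr EFin.
have me : measurable_fun setT (fun z => (enorm (g z))%:E).
  by apply/measurable_EFinP; case: ge.
have /(ae_eq_integral_abs mu measurableT me) ae0 := ez.
rewrite /Rintegral (_ : (\int[mu]_z (g z k 0 ^+ 2)%:E)%E = 0%E)//.
rewrite -[RHS](integral0 mu setT); apply: ae_eq_integral => //.
  by apply/measurable_EFinP; apply: measurable_funX; case: (g2 k).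
apply: filterS ae0 => z /= h _; have := h I => -[] /enorm_eq0 ->.
by rewrite mxE expr0n.
Qed.

(** The population objective is continuous on the compact parameter set, hence has a
    maximizer, which is interior; there the mean score vanishes. *)
Lemma regular_at_exists : exists x0 L C H0 lam l c0 rho,
  regular_at mu m Theta x0 L C H0 lam l c0 rho.
Proof.
have [x1 Tx1] := Theta_nonempty.
have [psi [mpsi psi2 Hpsi]] := ddm_lip.
have [D D0 diam] := compact_diameter Theta_compact.
have cT : segment_convex Theta by have [] := concave_onP (m_concave point).
pose ps z := `|psi z|.
have ps0 z : 0 <= ps z := normr_ge0 _.
have ps2 : sq_integrable mu ps.
  by apply: sq_integrable_norm; exact: sq_integrable_expectation.
have Hps z x y k l : Theta x -> Theta y ->
    `|hessian (m z) x k l - hessian (m z) y k l| <= ps z * enorm (x - y).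
  move=> Tx Ty; apply: le_trans (Hpsi z x y k l Tx Ty) _.
  by rewrite ler_wpM2r ?enorm_ge0// ler_norm.
pose A z := \sum_k \sum_l `|hessian (m z) x1 k l|.
have A0 z : 0 <= A z by apply: sumr_ge0 => k _; apply: sumr_ge0.
have HA z k l : `|hessian (m z) x1 k l| <= A z.
  rewrite /A (bigD1 k)//= (bigD1 l)//= -!addrA lerDl addr_ge0//.
    exact: sumr_ge0.
  by apply: sumr_ge0 => i _; apply: sumr_ge0.
have A2 : sq_integrable mu A.
  apply: sq_integrable_sum => k; apply: sq_integrable_sum => l.
  by apply: sq_integrable_norm; exact: hess2.
pose L z := (1 + d%:R ^+ 2) * ps z.
pose C z := d%:R ^+ 2 * (A z + ps z * D) + L z * D.
have d1 : 0 <= 1 + d%:R ^+ 2 :> R by rewrite addr_ge0// exprn_ge0.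
have L0 z : 0 <= L z by rewrite mulr_ge0.
have C0 z : 0 <= C z by rewrite addr_ge0 ?mulr_ge0 ?exprn_ge0 ?addr_ge0// ?mulr_ge0.
have sm z : smooth_on Theta (m z) (gradient (m z)) (hessian (m z)) (L z) (C z).
  exact: (smooth_on_lipschitz cT (m_diff z) (ps0 z) Tx1 diam (HA z) (Hps z) d_gt0).
have lip z := gradient_lipschitz cT (sm z) (L0 z) (ps0 z) (A0 z) Tx1 diam (HA z) (Hps z).
have L2 : sq_integrable mu L by exact: sq_integrableZ.
have C2 : sq_integrable mu C.
  have cD (f : T -> R) : sq_integrable mu f -> sq_integrable mu (fun z => f z * D).
    by move=> sf; under eq_fun do rewrite mulrC; exact: sq_integrableZ.
  apply: sq_integrableD; last exact: cD.
  by apply: sq_integrableZ; apply: sq_integrableD => //; exact: cD.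
have IC0 : 0 <= \int[mu]_z C z by apply: Rintegral_ge0.
have qM := population_quadratic C2 (fun z => let: And3 h _ _ := sm z in h).
have [x0 /set_mem Tx0 mx0] := compact_EVT_max Theta_nonempty Theta_compact
  (quadratic_on_continuous IC0 diam qM).
have max0 : is_maximizer Theta (fun t => fine 'E_mu[m^~ t]) x0.
  by split=> // t Tt; apply: mx0; rewrite inE.
have [rho rho0 ball] : exists2 rho : R, 0 < rho & forall y, enorm (y - x0) <= rho -> Theta y.
  have /nbhs_ballP[e /= e0 eT] := max_interior max0.
  exists (e / 2); first by rewrite divr_gt0.
  move=> y yx; apply: eT; rewrite -ball_normE /= distrC.
  apply: le_lt_trans (sup_norm_le_enorm _) _; apply: le_lt_trans yx _.
  by rewrite ltr_pdivrMr// ltr_pMr// ltr1n.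
have G0 := gradient_interior_maximizer qM IC0 Tx0 rho0 ball (proj2 max0).
pose H0 : 'M[R]_d := \matrix_(k, l) \int[mu]_z hessian (m z) x0 k l.
have [lam2 lam20 Hlam] := posdef_lower (ddm_posdef Tx0).
have [l l0 Hl] := posdef_lower (Lambda_posdef Tx0).
have outerE : (\matrix_(k, l) fine 'E_mu[fun z =>
       (gradient (m z) x0 *m (gradient (m z) x0)^T) k l]) =
    (\matrix_(k, k') \int[mu]_z (gradient (m z) x0 k 0 * gradient (m z) x0 k' 0)).
  apply/matrixP => k k'; rewrite !mxE fineE; apply: eq_Rintegral => z _.
  by rewrite mxE big_ord1 !mxE.
rewrite outerE in Hl.
pose k0 := Ordinal d_gt0.
have npos : 0 < \int[mu]_z enorm (gradient (m z) x0).
  apply: (@positive_norm_integral _ k0) => [k|]; first exact: score2.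
  apply: (lt_le_trans l0); have := Hl (delta_mx k0 0).
  rewrite -enorm_sqr enorm_delta expr1n mulr1 -delta_entry mxE.
  by under eq_Rintegral do rewrite -expr2.
exists x0, L, C, H0, (lam2 / 2), l, (\int[mu]_z enorm (gradient (m z) x0)), rho.
split => //.
- by move=> z; have [] := concave_onP (m_concave z).
- by move=> k; exact: score2.
- by move=> k; have /matrixP /(_ k 0) := G0; rewrite !mxE.
- by move=> k k'; exact: hess2.
- by move=> k k'; rewrite mxE.
- by rewrite divr_gt0.
move=> v; have := Hlam v; rewrite mulNmx dotNr.
rewrite (_ : 2 * (lam2 / 2) = lam2); last by field.
rewrite (_ : \matrix_(_, _) _ = H0); first by lra.
by apply/matrixP => k k'; rewrite !mxE fineE.
Qed.

End population.

Section lipschitz_measurability.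
Context {R : realType} {d : nat} {dT : measure_display} {T : measurableType dT}.
Variables (Theta : set 'cV[R]_d) (F : T -> 'cV[R]_d -> R) (C : T -> R).
Hypotheses (mF : forall x, Theta x -> measurable_fun setT (F^~ x))
  (C0 : forall z, 0 <= C z)
  (F_lip : forall z x y, Theta x -> Theta y -> `|F z y - F z x| <= C z * enorm (y - x)).

Lemma measurable_lipschitz {dX} {Om : measurableType dX} (z : Om -> T) (th : Om -> 'cV[R]_d) :
  measurable_fun setT z -> (forall k, measurable_fun setT (fun w => th w k 0)) ->
  (forall w, Theta (th w)) -> measurable_fun setT (fun w => F (z w) (th w)).
Proof.
move=> mz mth Tth.
pose col (y : 'I_d -> R) : 'cV[R]_d := \col_k y k.
have colE w : col (fun k => th w k 0) = th w.
  by apply/matrixP => k j; rewrite mxE ord1.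
suff : measurable_fun setT (fun w => F (z w) (col (fun k => th w k 0))).
  by under eq_fun do rewrite colE.
apply: (@measurable_caratheodory R _ Om 'I_d [set y | Theta (col y)]
  (fun w y => F (z w) (col y)) (fun w k => th w k 0)) => [y Ty|w u y Ty Tu uy|//|w].
- exact: (measurableT_comp (mF Ty) mz).
- apply/cvgrPdist_le => e e0.
  have K0 : 0 < C (z w) * d%:R + 1 by rewrite ltr_wpDl// mulr_ge0.
  have nk : \forall n \near \oo, forall k, `|y k - u n k| <= e / (C (z w) * d%:R + 1).
    apply: filter_forall => k.
    by have /cvgrPdist_le := uy k; apply; rewrite divr_gt0.
  near=> n; have hn : forall k, `|y k - u n k| <= e / (C (z w) * d%:R + 1) by near: n.
  apply: le_trans (F_lip _ (Tu n) Ty) _.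
  have b : enorm (col y - col (u n)) <= d%:R * (e / (C (z w) * d%:R + 1)).
    by apply: enorm_le_coord => [|k]; rewrite ?mxE ?divr_ge0 ?(ltW e0) ?(ltW K0)// !mxE.
  apply: le_trans (ler_wpM2l (C0 _) b) _.
  rewrite !mulrA ler_pdivrMr//.
  by have := ltW e0; have : 0 <= C (z w) * d%:R; [rewrite mulr_ge0|nra].
- by rewrite /= colE.
Unshelve. all: by end_near. Qed.

End lipschitz_measurability.

Section resampling.
Context {R : realType} {d : nat} {dT dO : measure_display} {T : measurableType dT}.
Variables (mu : probability T R) (Omega : measurableType dO) (P : probability Omega R).
Variables (Z : nat -> Omega -> T) (m : T -> 'cV[R]_d -> R) (Theta : set 'cV[R]_d).
Variables (x0 : 'cV[R]_d) (L C : T -> R) (H0 : 'M[R]_d) (lam l c0 rho : R).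
Hypotheses (Z_iid : iid P mu Z) (reg : regular_at mu m Theta x0 L C H0 lam l c0 rho).

(** The functions of one observation whose sample means are controlled. *)
Definition statistic (i : (bool * bool + 'I_d + 'I_d * 'I_d * option bool)%type) : T -> R :=
  match i with
  | inl (inl (true, true)) => L
  | inl (inl (true, false)) => fun z => L z ^+ 2
  | inl (inl (false, true)) => fun z => C z ^+ 2
  | inl (inl (false, false)) => fun z => enorm (gradient (m z) x0)
  | inl (inr k) => fun z => gradient (m z) x0 k 0
  | inr (k, k', None) => fun z => gradient (m z) x0 k 0 * gradient (m z) x0 k' 0
  | inr (k, k', Some true) => fun z => hessian (m z) x0 k k'
  | inr (k, k', Some false) => fun z => hessian (m z) x0 k k' ^+ 2
  end.

Lemma statistic_integrable i : mu.-integrable setT (EFin \o statistic i).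
Proof.
case: i => [[[[] []]|k]|[[k k'] [[]|]]] /=.
- exact: (sq_integrable_integrable (ra_L reg)).
- by have [] := ra_L reg.
- by have [] := ra_C reg.
- exact: (sq_integrable_integrable (sq_integrable_enorm (ra_score reg))).
- exact: (sq_integrable_integrable (ra_score reg k)).
- exact: (sq_integrable_integrable (ra_hess reg k k')).
- by have [] := ra_hess reg k k'.
- exact: (sq_integrableM (ra_score reg k) (ra_score reg k')).
Qed.

Lemma statistic_measurable i : measurable_fun setT (statistic i).
Proof. by have /integrableP[/measurable_EFinP] := statistic_integrable i. Qed.

Definition data_mean n w (f : T -> R) : R := avg (fun i : 'I_n => f (Z i w)).

Definition data_good (ep : R) n : set Omega := [set w | forall i,
  `|data_mean n w (statistic i) - \int[mu]_z statistic i z| < ep].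

Lemma measurable_data_mean {dX} (Om : measurableType dX) (z : nat -> Om -> T) n (f : T -> R) :
  (forall i : 'I_n, measurable_fun setT (z i)) -> measurable_fun setT f ->
  measurable_fun setT (fun w => avg (fun i : 'I_n => f (z i w))).
Proof.
move=> mz mf; apply: measurable_funM; first exact: measurable_cst.
by apply: measurable_sumr => i; exact: measurableT_comp.
Qed.

Lemma data_good_measurable {dX} (Om : measurableType dX) (z : nat -> Om -> T) n ep :
  (forall i : 'I_n, measurable_fun setT (z i)) ->
  measurable [set w | forall i, `|avg (fun k : 'I_n => statistic i (z k w))
     - \int[mu]_z statistic i z| < ep].
Proof.
move=> mz.
pose E i := [set w | `|avg (fun k : 'I_n => statistic i (z k w))
   - \int[mu]_z statistic i z| < ep].
suff mE i : measurable (E i) by exact: (measurable_set_forall mE).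
apply: (@measurable_set_lt _ _ _ _ (fun=> ep)); last exact: measurable_cst.
apply: measurableT_comp => //; apply: measurable_funB; last exact: measurable_cst.
apply: measurable_data_mean => //; exact: statistic_measurable.
Qed.

Lemma data_good_negl ep : 0 < ep -> negl P (fun n => ~` data_good ep n).
Proof.
move=> ep0.
apply: (@negl_sub _ _ _ _ (fun n => [set w | exists i, [set w |
   ep <= `|data_mean n w (statistic i) - \int[mu]_z statistic i z|] w])).
  apply: negl_exists => i; apply: negl_bound => [n|e e0].
    apply: (@measurable_set_le _ _ _ (fun=> ep)); first exact: measurable_cst.
    apply: measurableT_comp => //; apply: measurable_funB; last exact: measurable_cst.
    apply: measurable_data_mean; last exact: statistic_measurable.
    by move=> k; have [] := Z_iid.
  exact: (weak_law Z_iid (statistic_integrable i) ep0 e0).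
near=> n => w /= /existsNP[i /negP]; rewrite -leNgt => h; by exists i.
Unshelve. all: by end_near. Qed.

Definition statistic_bound : R := \sum_i `|\int[mu]_z statistic i z| + 1.

Lemma statistic_bound_ge0 : 0 <= statistic_bound.
Proof. by rewrite addr_ge0// sumr_ge0. Qed.

Lemma data_mean_le ep n w i : ep <= 1 -> data_good ep n w ->
  data_mean n w (statistic i) <= statistic_bound.
Proof.
move=> ep1 /(_ i)/ltr_normlP[_ h].
have : `|\int[mu]_z statistic i z| <= \sum_i `|\int[mu]_z statistic i z|.
  by rewrite (bigD1 i)//= lerDl sumr_ge0.
have := ler_norm (\int[mu]_z statistic i z); rewrite /statistic_bound; lra.
Qed.

Definition weighted_obj N (c : 'I_N -> R) (zs : 'I_N -> T) x := \sum_i c i * m (zs i) x.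
Definition weighted_score N (c : 'I_N -> R) (zs : 'I_N -> T) x :=
  \sum_i c i *: gradient (m (zs i)) x.
Definition weighted_hess N (c : 'I_N -> R) (zs : 'I_N -> T) x :=
  \sum_i c i *: hessian (m (zs i)) x.

Lemma weighted_near_population N (c : 'I_N -> R) (zs : 'I_N -> T) L1 ep :
  (forall i, 0 <= c i) -> \sum_i c i * L (zs i) <= L1 ->
  (forall k, `|\sum_i c i * gradient (m (zs i)) x0 k 0| <= ep) ->
  (forall k k', `|\sum_i c i * hessian (m (zs i)) x0 k k' - H0 k k'| <= ep) ->
  near_population Theta x0 H0 L1 ep (weighted_obj c zs) (weighted_score c zs)
    (weighted_hess c zs) (\sum_i c i * L (zs i)) (\sum_i c i * C (zs i)).
Proof.
move=> cge0 hL hg hH; split => //.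
- by apply: segment_concave_weighted => // i; exact: (ra_concave reg).
- by apply: smooth_on_weighted => // i; exact: (ra_smooth reg).
- by apply: sumr_ge0 => i _; rewrite mulr_ge0// (ra_L0 reg).
- by apply: sumr_ge0 => i _; rewrite mulr_ge0// (ra_C0 reg).
- by move=> k; rewrite summxE; under eq_bigr do rewrite mxE; exact: hg.
- move=> k k'; rewrite mxE summxE [X in _ + X]mxE.
  by under eq_bigr do rewrite mxE; exact: hH.
Qed.

(** The sample means that make an objective resemble that of the population. *)
Definition basic_statistic (i : (unit + 'I_d + 'I_d * 'I_d)%type) : T -> R :=
  match i with
  | inl (inl _) => L
  | inl (inr k) => fun z => gradient (m z) x0 k 0
  | inr (k, k') => fun z => hessian (m z) x0 k k'
  end.

Definition basic_index (i : (unit + 'I_d + 'I_d * 'I_d)%type) :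
    (bool * bool + 'I_d + 'I_d * 'I_d * option bool)%type :=
  match i with
  | inl (inl _) => inl (inl (true, true))
  | inl (inr k) => inl (inr k)
  | inr (k, k') => inr (k, k', Some true)
  end.

Lemma basic_statisticE i : basic_statistic i = statistic (basic_index i).
Proof. by case: i => [[]|[]]. Qed.

Definition basic_square_index (i : (unit + 'I_d + 'I_d * 'I_d)%type) :
    (bool * bool + 'I_d + 'I_d * 'I_d * option bool)%type :=
  match i with
  | inl (inl _) => inl (inl (true, false))
  | inl (inr k) => inr (k, k, None)
  | inr (k, k') => inr (k, k', Some false)
  end.

Lemma basic_square_statisticE i z :
  basic_statistic i z ^+ 2 = statistic (basic_square_index i) z.
Proof. by case: i => [[]|[]]. Qed.

Lemma resampled_near_population N (c : 'I_N -> R) (zs : 'I_N -> T) ep :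
  (forall i, 0 <= c i) -> ep <= 1 ->
  (forall i, `|\sum_k c k * basic_statistic i (zs k) - \int[mu]_z basic_statistic i z| < ep) ->
  near_population Theta x0 H0 statistic_bound ep (weighted_obj c zs)
    (weighted_score c zs) (weighted_hess c zs)
    (\sum_i c i * L (zs i)) (\sum_i c i * C (zs i)).
Proof.
move=> cge0 ep1 h; apply: weighted_near_population => //.
- have /ltr_normlP[_] := h (inl (inl tt)) => /= h1.
  have : `|\int[mu]_z L z| <= \sum_i `|\int[mu]_z statistic i z|.
    by rewrite (bigD1 (inl (inl (true, true))))//= lerDl sumr_ge0.
  have := ler_norm (\int[mu]_z L z); rewrite /statistic_bound; lra.
- by move=> k; have := h (inl (inr k)); rewrite /= (ra_score0 reg) subr0 => /ltW.
- by move=> k k'; have := h (inr (k, k')); rewrite /= (ra_hess0 reg) => /ltW.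
Qed.

End resampling.

Section redraw.
Context {R : realType} {d : nat} {dT dO : measure_display} {T : measurableType dT}.
Variables (mu : probability T R) (Omega : measurableType dO) (P : probability Omega R).
Variables (Z : nat -> Omega -> T) (m : T -> 'cV[R]_d -> R) (Theta : set 'cV[R]_d).
Variables (x0 : 'cV[R]_d) (L C : T -> R) (H0 : 'M[R]_d) (lam l c0 rho : R).
Hypotheses (Z_iid : iid P mu Z) (reg : regular_at mu m Theta x0 L C H0 lam l c0 rho).
Local Notation data_good := (data_good mu Z m x0 L C).
Local Notation bound := (statistic_bound mu m x0 L C).

Lemma size_infty_small (s : nat -> nat) (K e : R) : s n @[n --> \oo] --> \oo -> 0 < e ->
  \forall n \near \oo, K / (s n)%:R <= e.
Proof.
move=> soo e0; have /cvgnyPge/(_ (Num.truncn (`|K| / e)).+1) hs := soo.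
near=> n; have hn : ((Num.truncn (`|K| / e)).+1 <= s n)%N by near: n; exact: hs.
have s0 : 0 < (s n)%:R :> R by rewrite ltr0n (leq_trans _ hn).
rewrite ler_pdivrMr//; apply: le_trans (ler_norm _) _.
rewrite mulrC -ler_pdivrMr//; apply: le_trans (_ : (Num.truncn (`|K| / e)).+1%:R <= _).
  by rewrite ltW// Num.Theory.truncnS_gt.
by rewrite ler_nat.
Unshelve. all: by end_near. Qed.

Variables (G0 : nat -> set (set Omega)) (D : nat -> set Omega) (s : nat -> nat)
  (p : nat -> Omega -> nat -> R) (J : nat -> nat -> Omega -> nat) (B : nat -> set Omega)
  (al ep : R).
Hypotheses (Gm : forall n, <<s G0 n>> `<=` measurable)
  (draw : forall n, drawn_with_replacement P (<<s G0 n>>) (D n) n (s n) (p n) (J n))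
  (ZG : forall n (i : 'I_n),
     @measurable_fun _ _ (g_sigma_algebraType (G0 n)) T setT (Z i))
  (mp : forall n (i : 'I_n),
     @measurable_fun _ _ (g_sigma_algebraType (G0 n)) R setT (fun w => p n w i))
  (soo : s n @[n --> \oo] --> \oo)
  (GB : forall n, <<s G0 n>> (B n)) (BD : forall n, B n `<=` D n)
  (al0 : 0 < al)
  (Bp : forall n w, (0 < n)%N -> B n w ->
     (forall i : 'I_n, al <= n%:R * p n w i) /\ \sum_(i < n) p n w i = 1).

Lemma redraw_p_ge0 n w (i : 'I_n) : B n w -> 0 <= p n w i.
Proof.
case: n i w => [[]//|n] i w Bw; have [/(_ i) h _] := @Bp n.+1 w (ltn0Sn _) Bw.
by have := le_trans (ltW al0) h; rewrite pmulr_rge0// ltr0n.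
Qed.

Definition redraw_mean n w (f : T -> R) : R :=
  \sum_(k < s n) (n%:R * (s n)%:R * p n w (J n k w))^-1 * f (Z (J n k w) w).

Lemma redraw_measurable n (f : T -> R) : (0 < n)%N -> 0 < ep -> measurable_fun setT f ->
  measurable [set w | ep <= `|redraw_mean n w f - data_mean Z n w f|].
Proof.
move=> n0 ep0 mf.
pose E (j : 'I_(s n) -> nat) := [set w | ep <= `|\sum_(k < s n) (n%:R * (s n)%:R *
  p n w (j k))^-1 * f (Z (j k) w) - data_mean Z n w f|].
apply: (draw_event_measurable (draw n) n0 (E := E)) => j.
have ZO (i : 'I_n) : measurable_fun setT (Z i).
  by move=> _ Y mY; apply: (@Gm n _); exact: (@ZG n i measurableT Y mY).
apply: (@measurable_set_le _ _ _ (fun=> ep)); first exact: measurable_cst.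
apply: measurableT_comp => //; apply: measurable_funB; last by apply: (measurable_data_mean ZO).
apply: measurable_sumr => k; apply: measurable_funM; last exact: measurableT_comp.
apply: measurable_invr; apply: measurable_funM; first exact: measurable_cst.
exact: (measurable_fun_sub (@Gm n) (mp (j k))).
Qed.

Lemma redraw_negl (f : T -> R) K : measurable_fun setT f -> 0 < ep -> 0 <= K ->
  (forall n w, (0 < n)%N -> B n w -> data_mean Z n w (fun z => f z ^+ 2) <= K) ->
  negl P (fun n => B n `&` [set w | ep <= `|redraw_mean n w f - data_mean Z n w f|]).
Proof.
move=> mf ep0 K0 HK e e0.
near=> n; have n0 : (0 < n)%N by near: n; exact: nbhs_infty_gt.
have s0 : (0 < s n)%N by near: n; move/cvgnyPge : soo => /(_ 1%N).
exists (B n `&` [set w | ep <= `|redraw_mean n w f - data_mean Z n w f|]); split => //.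
  apply: measurableI; first exact: (@Gm n).
  exact: redraw_measurable.
have := @draw_chebyshev _ _ _ P (G0 n) (@Gm n) (D n) n (s n) (p n) (J n) (draw n) n0
  (@mp n) (B n) (@GB n) (@BD n) (@redraw_p_ge0 n) (fun w i => f (Z i w)) al K ep s0 al0 ep0 K0.
move=> h; apply: le_trans (h _ _) _.
- by move=> i; apply: (@measurableT_comp _ _ _ (g_sigma_algebraType (G0 n))) => //; exact: ZG.
- by move=> w Bw; have [? ?] := Bp n0 Bw; split => //; exact: HK.
rewrite lee_fin (_ : _ / _ = K / al / ep ^+ 2 / (s n)%:R).
  by near: n; exact: size_infty_small.
by rewrite invfM mulrA mulrAC.
Unshelve. all: by end_near. Qed.

Hypotheses (ep0 : 0 < ep) (ep1 : 2 * ep <= 1) (Bdata : forall n, B n `<=` data_good ep n).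

(** With high probability, the reweighted objective of the resampled observations
    resembles that of the population. *)
Lemma redraw_near_population_negl :
  negl P (fun n => B n `&` [set w | ~ near_population Theta x0 H0 bound (2 * ep)
    (weighted_obj m (fun k : 'I_(s n) => (n%:R * (s n)%:R * p n w (J n k w))^-1)
       (fun k : 'I_(s n) => Z (J n k w) w))
    (weighted_score m (fun k : 'I_(s n) => (n%:R * (s n)%:R * p n w (J n k w))^-1)
       (fun k : 'I_(s n) => Z (J n k w) w))
    (weighted_hess m (fun k : 'I_(s n) => (n%:R * (s n)%:R * p n w (J n k w))^-1)
       (fun k : 'I_(s n) => Z (J n k w) w))
    (\sum_(k < s n) (n%:R * (s n)%:R * p n w (J n k w))^-1 * L (Z (J n k w) w))
    (\sum_(k < s n) (n%:R * (s n)%:R * p n w (J n k w))^-1 * C (Z (J n k w) w))]).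
Proof.
pose bad i n := B n `&` [set w | ep <= `|redraw_mean n w (basic_statistic m x0 L i)
   - data_mean Z n w (basic_statistic m x0 L i)|].
have nbad : negl P (fun n => [set w | exists i, bad i n w]).
  apply: negl_exists => i; apply: (@redraw_negl _ bound) => //.
  - rewrite (basic_statisticE m x0 L C); exact: (statistic_measurable reg).
  - exact: statistic_bound_ge0.
  move=> n w n0 /Bdata Dw; under eq_fun do rewrite (basic_square_statisticE m x0 L C).
  by apply: data_mean_le Dw; have := ep0; have := ep1; lra.
apply: negl_sub nbad _; near=> n => w [Bw nnp].
have n0 : (0 < n)%N by near: n; exact: nbhs_infty_gt.
have [//|/forallNP nb] := pselect (exists i, bad i n w).
exfalso; apply: nnp; apply: (resampled_near_population reg) => //.
  move=> k; rewrite invr_ge0 mulr_ge0//.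
  have Jn : (J n k w < n)%N by have [_ + _] := draw n; exact.
  exact: (@redraw_p_ge0 n w (Ordinal Jn)).
move=> i.
have h1 : `|redraw_mean n w (basic_statistic m x0 L i) -
    data_mean Z n w (basic_statistic m x0 L i)| < ep.
  by rewrite ltNge; apply/negP => h; apply: (nb i).
have := Bdata Bw (basic_index i); rewrite -basic_statisticE => h2.
rewrite -[X in X < _](_ : `|(redraw_mean n w (basic_statistic m x0 L i) -
    data_mean Z n w (basic_statistic m x0 L i)) + (data_mean Z n w (basic_statistic m x0 L i) -
    \int[mu]_z basic_statistic m x0 L i z)| = _); last by rewrite addrA subrK.
by apply: le_lt_trans (ler_normD _ _) _; lra.
Unshelve. all: by end_near. Qed.

End redraw.

Section asymptotics.
Context {R : realType} {d : nat} {dT dO : measure_display} {T : measurableType dT}.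
Variables (mu : probability T R) (Omega : measurableType dO) (P : probability Omega R).
Variables (Z : nat -> Omega -> T) (m : T -> 'cV[R]_d -> R) (Theta : set 'cV[R]_d).
Variables (alpha : R) (s0 s : nat -> nat) (J0 J : nat -> nat -> Omega -> nat)
  (theta_hat theta_pilot theta_sub : nat -> Omega -> 'cV[R]_d).
Variables (x0 : 'cV[R]_d) (L C : T -> R) (H0 : 'M[R]_d) (lam l c0 rho : R).
Hypotheses (Z_iid : iid P mu Z) (reg : regular_at mu m Theta x0 L C H0 lam l c0 rho)
  (m_diff : forall z theta, Theta theta -> twice_differentiable (m z) theta)
  (dm_meas : forall theta k, Theta theta ->
     measurable_fun setT (fun z => gradient (m z) theta k 0))
  (ddm_meas : forall theta k l, Theta theta ->
     measurable_fun setT (fun z => hessian (m z) theta k l))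
  (theta_hat_meas : forall n k,
     measurable_wrt (sigma_data Z n) (fun w => theta_hat n w k 0))
  (theta_hat_max : forall n w,
     is_maximizer Theta (mean_objective m n (Z^~ w)) (theta_hat n w))
  (alpha_gt0 : 0 < alpha) (alpha_lt1 : alpha < 1)
  (s0_infty : s0 n @[n --> \oo] --> \oo)
  (s_infty : s n @[n --> \oo] --> \oo)
  (pilot_draw : forall n,
     drawn_with_replacement P (sigma_data Z n) setT n (s0 n)
       (fun _ _ => n%:R^-1) (J0 n))
  (theta_pilot_meas : forall n, random_vector (theta_pilot n))
  (theta_pilot_max : forall n w,
     is_maximizer Theta
       (mean_objective m (s0 n) (fun k => Z (J0 n k w) w)) (theta_pilot n w))
  (second_draw : forall n,
     drawn_with_replacement P (sigma_data_and Z (theta_pilot n) n)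
       [set w | sum_score_norm m n (Z^~ w) (theta_pilot n w) != 0] n (s n)
       (fun w => pi_opt_mix m alpha n (Z^~ w) (theta_pilot n w)) (J n))
  (theta_sub_meas : forall n, random_vector (theta_sub n))
  (theta_sub_max : forall n w,
     is_maximizer Theta
       (weighted_objective m n (s n) (fun k => Z (J n k w) w)
          (fun k => pi_opt_mix m alpha n (Z^~ w) (theta_pilot n w) (J n k w)))
       (theta_sub n w)).

Local Notation data_good := (data_good mu Z m x0 L C).
Local Notation bound := (statistic_bound mu m x0 L C).

Definition data_events n : set (set Omega) :=
  [set B | exists i A, [/\ (i < n)%N, measurable A & B = Z i @^-1` A]].
Definition pilot_events n : set (set Omega) := sigma_data Z n `|`
  [set B | exists k (A : set R), measurable A /\ B = [set w | A (theta_pilot n w k 0)]].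
Local Notation OmD n := (g_sigma_algebraType (data_events n)).
Local Notation OmG n := (g_sigma_algebraType (pilot_events n)).

Lemma sigma_data_sub n : <<s data_events n>> `<=` measurable.
Proof.
apply: smallest_sub; first exact: sigma_algebra_measurable.
move=> _ [i [A [_ mA ->]]]; rewrite -[_ @^-1` _]setTI.
by have [mZ _] := Z_iid; exact: mZ.
Qed.

Lemma sigma_pilot_sub n : <<s pilot_events n>> `<=` measurable.
Proof.
apply: smallest_sub; first exact: sigma_algebra_measurable.
move=> A [/sigma_data_sub//|[k [E [mE ->]]]].
by rewrite -[X in measurable X]setTI; exact: theta_pilot_meas.
Qed.

Lemma sigma_data_pilot n : sigma_data Z n `<=` <<s pilot_events n>>.
Proof. by move=> A GA; apply: sub_sigma_algebra; left. Qed.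

Lemma Z_data_measurable n (i : 'I_n) : @measurable_fun _ _ (OmD n) T setT (Z i).
Proof.
move=> _ A mA; rewrite setTI; apply: sub_sigma_algebra.
by exists i, A; split.
Qed.

Lemma Z_pilot_measurable n (i : 'I_n) : @measurable_fun _ _ (OmG n) T setT (Z i).
Proof.
move=> _ A mA; rewrite setTI; apply: sigma_data_pilot.
by rewrite -[_ @^-1` _]setTI; exact: (@Z_data_measurable n i measurableT A mA).
Qed.

Lemma hat_pilot_measurable n k : @measurable_fun _ _ (OmG n) R setT
  (fun w => theta_hat n w k 0).
Proof. by move=> _ A mA; rewrite setTI; apply: sigma_data_pilot; exact: theta_hat_meas. Qed.

Lemma pilot_pilot_measurable n k : @measurable_fun _ _ (OmG n) R setT
  (fun w => theta_pilot n w k 0).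
Proof.
by move=> _ A mA; rewrite setTI; apply: sub_sigma_algebra; right; exists k, A.
Qed.

Lemma theta_hat_in n w : Theta (theta_hat n w). Proof. by case: (theta_hat_max n w). Qed.
Lemma theta_pilot_in n w : Theta (theta_pilot n w).
Proof. by case: (theta_pilot_max n w). Qed.

Lemma score_measurable {dX} (Om : measurableType dX) (z : Om -> T) (th : Om -> 'cV[R]_d) k :
  measurable_fun setT z -> (forall k, measurable_fun setT (fun w => th w k 0)) ->
  (forall w, Theta (th w)) -> measurable_fun setT (fun w => gradient (m (z w)) (th w) k 0).
Proof.
move=> mz mth Tth.
apply: (@measurable_lipschitz _ _ _ _ Theta (fun z x => gradient (m z) x k 0) C) => //;
  [by move=> x; exact: dm_meas|exact: (ra_C0 reg)|].
move=> z' x y Tx Ty; rewrite -coordB; apply: le_trans (le_coord_enorm _ _) _.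
exact: (ra_lip reg).
Qed.

Lemma hessian_measurable {dX} (Om : measurableType dX) (z : Om -> T) (th : Om -> 'cV[R]_d) k k' :
  measurable_fun setT z -> (forall k, measurable_fun setT (fun w => th w k 0)) ->
  (forall w, Theta (th w)) -> measurable_fun setT (fun w => hessian (m (z w)) (th w) k k').
Proof.
move=> mz mth Tth.
apply: (@measurable_lipschitz _ _ _ _ Theta (fun z x => hessian (m z) x k k') L) => //;
  [by move=> x; exact: ddm_meas|exact: (ra_L0 reg)|].
by move=> z' x y Tx Ty; have [_ _] := ra_smooth reg z'; apply.
Qed.

Lemma mix_measurable {dX} (Om : measurableType dX) n (z : nat -> Om -> T)
  (th : Om -> 'cV[R]_d) (i : 'I_n) : (forall j : 'I_n, measurable_fun setT (z j)) ->
  (forall k, measurable_fun setT (fun w => th w k 0)) -> (forall w, Theta (th w)) ->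
  measurable_fun setT (fun w => pi_opt_mix m alpha n (z^~ w) (th w) i).
Proof.
move=> mz mth Tth.
have me (j : 'I_n) : measurable_fun setT (fun w => enorm (gradient (m (z j w)) (th w))).
  by apply: measurable_enorm => k q; rewrite ord1; exact: score_measurable.
apply: measurable_funD; last exact: measurable_cst.
apply: measurable_funM; first exact: measurable_cst.
apply: measurable_funV_div; first exact: me.
by apply: measurable_sumr => j; exact: me.
Qed.

Lemma pi_measurable n (i : 'I_n) : @measurable_fun _ _ (OmG n) R setT
  (fun w => pi_opt_mix m alpha n (Z^~ w) (theta_pilot n w) i).
Proof.
apply: (@mix_measurable _ (OmG n)); first exact: Z_pilot_measurable.
- exact: pilot_pilot_measurable.
- exact: theta_pilot_in.
Qed.

Lemma hessian_mean_measurable n : @measurable_mx _ _ (OmG n) d d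
  (fun w => mean_hessian m n (Z^~ w) (theta_hat n w)).
Proof.
apply: measurable_mxZ; first exact: measurable_cst.
apply: measurable_mx_sum => i k k'; apply: (@hessian_measurable _ (OmG n)).
- exact: Z_pilot_measurable.
- exact: hat_pilot_measurable.
- exact: theta_hat_in.
Qed.

Lemma hat_score_measurable n (i : 'I_n) k : @measurable_fun _ _ (OmG n) R setT
  (fun w => gradient (m (Z i w)) (theta_hat n w) k 0).
Proof.
apply: (@score_measurable _ (OmG n)).
- exact: Z_pilot_measurable.
- exact: hat_pilot_measurable.
- exact: theta_hat_in.
Qed.

Lemma Lambda_measurable n : @measurable_mx _ _ (OmG n) d d
  (fun w => Lambda_mix m alpha n (Z^~ w) (theta_hat n w)).
Proof.
apply: measurable_mxZ; first exact: measurable_cst.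
apply: measurable_mx_sum => i; apply: measurable_mxZ.
  apply: measurable_invr; apply: (@mix_measurable _ (OmG n)).
  - exact: Z_pilot_measurable.
  - exact: hat_pilot_measurable.
  - exact: theta_hat_in.
apply: measurable_mulmx => [k j|j k]; first by rewrite ord1; exact: hat_score_measurable.
by apply: measurable_trmx => {}k {}j; rewrite ord1; exact: hat_score_measurable.
Qed.

Variables (ep r : R).
Hypotheses (ep0 : 0 < ep) (ep1 : 2 * ep <= 1) (r0 : 0 < r) (r_rho : 2 * r <= rho)
  (small_r : (d%:R ^+ 2 + 2) * bound * r <= lam / 2)
  (small_ep : d%:R ^+ 2 * (2 * ep) <= lam / 2)
  (small_score : d%:R * (2 * ep) < lam / 2 * r).

Lemma ball2 y : enorm (y - x0) <= 2 * r -> Theta y.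
Proof. by move=> h; apply: (ra_ball reg); exact: le_trans r_rho. Qed.

Lemma ep2 : 0 <= 2 * ep. Proof. by have := ep0; lra. Qed.

Let near_max f g H L' C' := @near_population_maximizer R d Theta x0 H0 lam r bound (2 * ep)
  (ra_convex reg) (ra_lam reg) r0 (ra_curvature reg) ball2 ep2 small_r small_ep small_score
  f g H L' C'.

Lemma full_near_population n w : (0 < n)%N -> data_good ep n w ->
  near_population Theta x0 H0 bound (2 * ep) (mean_objective m n (Z^~ w))
    (weighted_score m (fun=> n%:R^-1) (fun i : 'I_n => Z i w)) (mean_hessian m n (Z^~ w))
    (\sum_(i < n) n%:R^-1 * L (Z i w)) (\sum_(i < n) n%:R^-1 * C (Z i w)).
Proof.
move=> n0 Dw.
have <- : weighted_obj m (fun=> n%:R^-1) (fun i : 'I_n => Z i w) = mean_objective m n (Z^~ w).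
  by apply: funext => x; rewrite /weighted_obj /mean_objective mulr_sumr.
have <- : weighted_hess m (fun=> n%:R^-1) (fun i : 'I_n => Z i w) = mean_hessian m n (Z^~ w).
  by apply: funext => x; rewrite /weighted_hess /mean_hessian scaler_sumr.
apply: (resampled_near_population reg) => // i.
rewrite -mulr_sumr; have := Dw (basic_index i); rewrite -basic_statisticE => h.
by apply: lt_trans h _; have := ep0; lra.
Qed.

Lemma hat_near n w : (0 < n)%N -> data_good ep n w ->
  enorm (theta_hat n w - x0) <= r /\ \sum_(i < n) gradient (m (Z i w)) (theta_hat n w) = 0.
Proof.
move=> n0 Dw; have [h1 h2] := near_max (full_near_population n0 Dw) (theta_hat_max n w).
split=> //; move: h2; rewrite /weighted_score -scaler_sumr => /eqP.
by rewrite scaler_eq0 invr_eq0 pnatr_eq0 (gtn_eqF n0) orFb => /eqP.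
Qed.

Lemma pilot_negl : negl P (fun n => data_good ep n `&`
  [set w | ~ enorm (theta_pilot n w - x0) <= r]).
Proof.
have GB n : <<s data_events n>> (data_good ep n).
  exact: (@data_good_measurable _ _ _ _ mu m Theta x0 L C H0 lam l c0 rho reg _ (OmD n) Z n ep
     (@Z_data_measurable n)).
have pB n w : (0 < n)%N -> data_good ep n w ->
    (forall i : 'I_n, 1 <= n%:R * n%:R^-1 :> R) /\ \sum_(i < n) n%:R^-1 = 1 :> R.
  move=> n0 _; have nn : n%:R * n%:R^-1 = 1 :> R by rewrite mulfV// pnatr_eq0 -lt0n.
  by split; [move=> _; rewrite nn|rewrite sumr_const card_ord -[LHS]mulr_natl].
have mp n (i : 'I_n) : @measurable_fun _ _ (OmD n) R setT (fun=> n%:R^-1).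
  exact: measurable_cst.
have := redraw_near_population_negl reg sigma_data_sub pilot_draw Z_data_measurable mp
  s0_infty GB (fun n => @subsetT _ _) ltr01 pB ep0 ep1 (fun n => @subset_refl _ _).
move=> h; apply: negl_sub h _; near=> n => w [Dw far]; split => //= np; apply: far.
have n0 : (0 < n)%N by near: n; exact: nbhs_infty_gt.
have s00 : (0 < s0 n)%N by near: n; move/cvgnyPge : s0_infty => /(_ 1%N).
suff /(near_max np)[] : is_maximizer Theta (weighted_obj m
    (fun k : 'I_(s0 n) => (n%:R * (s0 n)%:R * n%:R^-1)^-1)
    (fun k : 'I_(s0 n) => Z (J0 n k w) w)) (theta_pilot n w) by [].
have <- : mean_objective m (s0 n) (fun k => Z (J0 n k w) w) = weighted_obj m
    (fun k : 'I_(s0 n) => (n%:R * (s0 n)%:R * n%:R^-1)^-1)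
    (fun k : 'I_(s0 n) => Z (J0 n k w) w).
  apply: funext => x; rewrite /weighted_obj -mulr_sumr; congr (_ * _).
  by rewrite mulrAC mulfV ?mul1r// pnatr_eq0 -lt0n.
exact: theta_pilot_max.
Unshelve. all: by end_near. Qed.

(** * The good event *)

Variable K4 : R.
Hypotheses (K40 : 0 <= K4) (small_norm : ep + (1 + bound) * r <= c0 / 2)
  (small_outer : d%:R ^+ 2 * ep <= l / 2) (small_outer_r : bound * r ^+ 2 <= l / 8).

Definition hat_score n w (i : 'I_n) := gradient (m (Z i w)) (theta_hat n w).
Definition pilot_score n w (i : 'I_n) := gradient (m (Z i w)) (theta_pilot n w).
Definition hat_hess n w := mean_hessian m n (Z^~ w) (theta_hat n w).
Definition hat_Lambda n w := Lambda_mix m alpha n (Z^~ w) (theta_hat n w).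
Definition pilot_prob n w := pi_opt_mix m alpha n (Z^~ w) (theta_pilot n w).

Definition good n : set Omega := if n is 0%N then set0 else data_good ep n `&`
  [set w | enorm (theta_pilot n w - x0) <= r] `&`
  [set w | avg (fun i : 'I_n => enorm (hat_score w i) ^+ 4) <= K4].

Lemma good_n0 n w : good n w -> (0 < n)%N. Proof. by case: n. Qed.

Lemma goodP n w : good n w -> [/\ data_good ep n w, enorm (theta_pilot n w - x0) <= r &
  avg (fun i : 'I_n => enorm (hat_score w i) ^+ 4) <= K4].
Proof. by case: n => [//|n] [[? ?] ?]. Qed.

Lemma good_measurable n : <<s pilot_events n>> (good n).
Proof.
rewrite -[X in X _]/(@measurable _ (OmG n)).
case: n => [|n]; first exact: measurable0.
apply: measurableI; first apply: measurableI.
- exact: (@data_good_measurable _ _ _ _ mu m Theta x0 L C H0 lam l c0 rho reg _ (OmG n.+1) Z n.+1 ep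
     (@Z_pilot_measurable n.+1)).
- apply: (@measurable_set_le _ _ _ _ (fun=> r)); last exact: measurable_cst.
  apply: measurable_enorm; apply: measurable_mxB => k j; rewrite ord1.
    exact: pilot_pilot_measurable.
  exact: measurable_cst.
- apply: (@measurable_set_le _ _ _ _ (fun=> K4)); last exact: measurable_cst.
  apply: measurable_funM; first exact: measurable_cst.
  apply: measurable_sumr => i; apply: measurable_funX.
  apply: measurable_enorm => k j; rewrite ord1; apply: score_measurable.
  + exact: Z_pilot_measurable.
  + exact: hat_pilot_measurable.
  + exact: theta_hat_in.
Qed.

Section on_good.
Variables (n : nat) (w : Omega).
Hypothesis gw : good n w.

Let n0 : (0 < n)%N := good_n0 gw.

Let Dw : data_good ep n w. Proof. by case: (goodP gw). Qed.
Let pilot_r : enorm (theta_pilot n w - x0) <= r. Proof. by case: (goodP gw). Qed.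
Let hat_r : enorm (theta_hat n w - x0) <= r. Proof. by have [] := hat_near n0 Dw. Qed.
Let ep_le1 : ep <= 1. Proof. by have := ep0; have := ep1; lra. Qed.
Let bound0 : 0 <= bound := statistic_bound_ge0 mu m x0 L C.

Let avgC2 : avg (fun i : 'I_n => C (Z i w) ^+ 2) <= bound.
Proof. exact: (data_mean_le (inl (inl (false, true))) ep_le1 Dw). Qed.

Let Tx0 : Theta x0. Proof. by apply: ball2; rewrite subrr enorm0 mulr_ge0// ltW. Qed.

Lemma good_fourth : avg (fun i : 'I_n => enorm (hat_score w i) ^+ 4) <= K4.
Proof. by case: (goodP gw). Qed.

Lemma good_score_norm x : Theta x -> enorm (x - x0) <= r ->
  c0 / 2 <= avg (fun i : 'I_n => enorm (gradient (m (Z i w)) x)).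
Proof.
move=> Tx xr.
have h : avg (fun i : 'I_n => enorm (gradient (m (Z i w)) x0)) <=
    avg (fun i : 'I_n => enorm (gradient (m (Z i w)) x) + (r + r * C (Z i w) ^+ 2)).
  apply: avg_le => i; rewrite -{1}[gradient (m (Z i w)) x0](subrK (gradient (m (Z i w)) x)).
  apply: le_trans (enormD _ _) _; rewrite addrC lerD2l.
  apply: le_trans (ra_lip reg _ Tx Tx0) _; rewrite enormBC.
  have c : C (Z i w) <= 1 + C (Z i w) ^+ 2.
    by have := sqr_ge0 (C (Z i w) - 2^-1); rewrite !expr2; nra.
  have := ler_pM (ra_C0 reg _) (enorm_ge0 _) c xr.
  by move/le_trans; apply; rewrite mulrC mulrDr mulr1.
have h1 := Dw (inl (inl (false, false))).
move: h1 => /ltr_normlP[+ _]; rewrite /= /data_mean => h1.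
rewrite !avgD avg_cst// avgZ in h.
have := ra_norm reg; have := small_norm; have := avgC2.
have : r * avg (fun i : 'I_n => C (Z i w) ^+ 2) <= r * bound by rewrite ler_wpM2l// ltW.
lra.
Qed.

Lemma good_score_close (x y : 'cV[R]_d) : Theta x -> Theta y ->
  avg (fun i : 'I_n => enorm (gradient (m (Z i w)) x - gradient (m (Z i w)) y) ^+ 2) <=
  bound * enorm (x - y) ^+ 2.
Proof.
move=> Tx Ty.
apply: (@le_trans _ _ (avg (fun i : 'I_n => enorm (x - y) ^+ 2 * C (Z i w) ^+ 2))).
  apply: avg_le => i; rewrite -exprMn lerXn2r ?nnegrE ?enorm_ge0//.
    by rewrite mulr_ge0 ?enorm_ge0 ?(ra_C0 reg).
  by rewrite mulrC; exact: (ra_lip reg).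
by rewrite avgZ mulrC ler_wpM2r// sqr_ge0.
Qed.

Definition kap : R := 2 * r * (1 + bound).

Lemma good_stability : avg (fun i : 'I_n => enorm (hat_score w i - pilot_score w i) ^+ 2)
  <= kap ^+ 2.
Proof.
apply: le_trans (good_score_close (theta_hat_in n w) (theta_pilot_in n w)) _.
have h : enorm (theta_hat n w - theta_pilot n w) <= 2 * r.
  apply: le_trans (enorm_triangle x0 _ _) _; rewrite (enormBC x0) mulr2n mulrDl mul1r.
  exact: lerD.
have h2 : enorm (theta_hat n w - theta_pilot n w) ^+ 2 <= (2 * r) ^+ 2.
  by rewrite lerXn2r ?nnegrE ?enorm_ge0// mulr_ge0// ltW.
rewrite /kap [leRHS]exprMn mulrC; apply: ler_pM => //; first exact: sqr_ge0.
have := bound0; rewrite expr2; nra.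
Qed.

Lemma good_outer v : l / 8 * dot v v <= avg (fun i : 'I_n => dot v (hat_score w i) ^+ 2).
Proof.
pose g0 i := gradient (m (Z (i : 'I_n) w)) x0.
have h1 : l / 2 * dot v v <= avg (fun i => dot v (g0 i) ^+ 2).
  have -> : avg (fun i => dot v (g0 i) ^+ 2) = dot v (mean_outer (fun=> 1) g0 *m v).
    by rewrite mean_outer_form; congr avg; apply: funext => i; rewrite divr1.
  set E := \matrix_(k, k') \int[mu]_z (gradient (m z) x0 k 0 * gradient (m z) x0 k' 0).
  have near k k' : `|(mean_outer (fun=> 1) g0 - E) k k'| <= ep.
    have /ltW := Dw (inr (k, k', None)); apply: le_trans.
    rewrite /= /data_mean !mxE le_eqVlt; apply/orP; left; apply/eqP.
    by congr (`|_ - _|); congr avg; apply: funext => i; rewrite divr1.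
  rewrite -[mean_outer _ _](subrK E) mulmxDl dotDr.
  have /ler_normlP[h _] := dot_entry_bound v v (ltW ep0) near.
  rewrite -expr2 enorm_sqr in h; have := ra_outer reg v; rewrite -/E.
  have := ler_wpM2r (dotvv_ge0 v) small_outer; lra.
have h2 : avg (fun i => dot v (hat_score w i - g0 i) ^+ 2) <= l / 8 * dot v v.
  apply: (@le_trans _ _ (avg (fun i => enorm v ^+ 2 * enorm (hat_score w i - g0 i) ^+ 2))).
    apply: avg_le => i; rewrite -exprMn -real_normK ?num_real//.
    by rewrite lerXn2r ?nnegrE ?mulr_ge0 ?enorm_ge0// cauchy_schwarz.
  rewrite avgZ enorm_sqr mulrC ler_wpM2r ?dotvv_ge0//.
  apply: le_trans (good_score_close (theta_hat_in n w) Tx0) _.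
  apply: le_trans small_outer_r; rewrite ler_wpM2l//.
  by rewrite lerXn2r ?nnegrE ?enorm_ge0 ?(ltW r0) ?hat_r.
have : avg (fun i => 2^-1 * dot v (g0 i) ^+ 2) <=
   avg (fun i => dot v (hat_score w i) ^+ 2 + dot v (hat_score w i - g0 i) ^+ 2).
  apply: avg_le => i; rewrite dotBr.
  by have := sqr_ge0 (2 * dot v (hat_score w i) - dot v (g0 i)); rewrite !expr2; nra.
rewrite avgZ avgD; lra.
Qed.

Lemma Lambda_mixE : hat_Lambda n w =
  mean_outer (fun i => n%:R * mix_weight alpha (hat_score w) i) (@hat_score n w).
Proof.
have nn : n%:R != 0 :> R by rewrite pnatr_eq0 -lt0n.
rewrite mean_outerE /hat_Lambda /Lambda_mix !scaler_sumr; apply: eq_bigr => i _.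
rewrite !scalerA; congr (_ *: _).
by rewrite [in RHS]invfM expr2 [in LHS]invfM mulrA.
Qed.

Definition lower : R := (l / 8) ^+ 2 / ((1 + K4) * ((c0 / 2)^-1 + 1)).

Lemma lower_gt0 : 0 < lower.
Proof.
have l0 : 0 < l / 8 by rewrite divr_gt0 ?(ra_l reg).
have c00 : 0 < (c0 / 2)^-1 by rewrite invr_gt0 divr_gt0 ?(ra_c0 reg).
by rewrite divr_gt0 ?exprn_gt0// mulr_gt0//; have := K40; lra.
Qed.

Lemma good_Lambda_lower v : lower * dot v v <= dot v (hat_Lambda n w *m v).
Proof.
rewrite Lambda_mixE; apply: mean_outer_lower => //.
- by rewrite divr_ge0// ltW ?(ra_l reg).
- by rewrite divr_gt0 ?(ra_c0 reg).
- exact: good_score_norm (theta_hat_in n w) hat_r.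
- exact: good_fourth.
- exact: good_outer.
Qed.

Lemma good_Lambda_posdef : posdef (hat_Lambda n w).
Proof.
apply: (posdef_of_lower _ lower_gt0 good_Lambda_lower).
by rewrite Lambda_mixE mean_outer_sym.
Qed.

Lemma good_hess_posdef : posdef (- hat_hess n w).
Proof.
apply: (posdef_of_lower (l := lam)); last 1 first.
- move=> v; have := near_population_curvature r0 (ra_curvature reg) ball2 ep2
    small_r small_ep (full_near_population n0 Dw) hat_r v.
  by rewrite mulNmx dotNr -/(hat_hess n w); lra.
- rewrite linearN /=; congr (- _); rewrite /hat_hess /mean_hessian linearZ /= linear_sum /=.
  congr (_ *: _); apply: eq_bigr => i _; apply: hessian_sym.
  by apply: m_diff; exact: theta_hat_in.
- exact: (ra_lam reg).
Qed.

Lemma good_draw : sum_score_norm m n (Z^~ w) (theta_pilot n w) != 0.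
Proof.
apply/eqP => h; have := good_score_norm (theta_pilot_in n w) pilot_r.
have -> : avg (fun i : 'I_n => enorm (gradient (m (Z i w)) (theta_pilot n w))) =
  n%:R^-1 * sum_score_norm m n (Z^~ w) (theta_pilot n w) by [].
by rewrite h mulr0; have := ra_c0 reg; lra.
Qed.

Lemma good_prob_ge (i : 'I_n) : alpha <= n%:R * pilot_prob n w i.
Proof. exact: (n_mix_weight_ge n0 alpha_lt1 (pilot_score w)). Qed.

Lemma good_prob_sum : \sum_(i < n) pilot_prob n w i = 1.
Proof. exact: (mix_weight_sum n0 alpha (a := pilot_score w) good_draw). Qed.

Definition cov_error : R :=
  alpha ^- 2 * ((c0 / 2)^-1 + (c0 / 2) ^- 2) * (1 + K4) * kap.

Lemma kap_gt0 : 0 < kap.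
Proof. by rewrite mulr_gt0 ?mulr_gt0//; have := bound0; lra. Qed.

Lemma good_cov i j : `|(mean_outer (fun k => n%:R * pilot_prob n w k) (@hat_score n w) -
  hat_Lambda n w) i j| <= cov_error.
Proof.
rewrite Lambda_mixE mxE [X in _ + X]mxE !mxE.
apply: (mixture_stability n0 alpha_gt0 alpha_lt1 i j _ kap_gt0) => //.
- by rewrite divr_gt0 ?(ra_c0 reg).
- exact: good_score_norm (theta_hat_in n w) hat_r.
- exact: good_score_norm (theta_pilot_in n w) pilot_r.
- exact: good_fourth.
- exact: good_stability.
Qed.

Lemma good_score_sum : \sum_(i < n) hat_score w i = 0 :> 'cV[R]_d.
Proof. by have [] := hat_near n0 Dw. Qed.

End on_good.

(** Off the good event the covariance may be singular; the matrix is changed there to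
    keep its square root measurable. *)
Definition std n w : 'M[R]_d := posdef_sqrt (if `[< good n w >] then
  invmx (V_mix m alpha n (Z^~ w) (theta_hat n w)) else 1%:M).
Definition std_map n w : 'M[R]_d := std n w *m invmx (hat_hess n w).

Lemma std_good n w : good n w -> std n w = invsqrtmx (V_mix m alpha n (Z^~ w) (theta_hat n w)).
Proof. by move=> gw; rewrite /std asboolT. Qed.

Lemma std_map_good n w : good n w -> std_map n w = standardizer (hat_hess n w) (hat_Lambda n w).
Proof. by move=> gw; rewrite /std_map std_good. Qed.

Lemma posdef1 : posdef (1%:M : 'M[R]_d).
Proof.
apply: (posdef_of_lower (l := 1)) => // [|v]; first exact: trmx1.
by rewrite mul1mx mul1r.
Qed.

Lemma std_measurable n : @measurable_mx _ _ (OmG n) d d (std n).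
Proof.
apply: measurable_posdef_sqrt => [i j|w]; last first.
  case: asboolP => gw; last exact: posdef1.
  apply: posdef_invmx.
  exact: (sandwich_posdef (good_hess_posdef gw) (good_Lambda_posdef gw)).
have mV : @measurable_mx _ _ (OmG n) d d (fun w => invmx (V_mix m alpha n (Z^~ w) (theta_hat n w))).
  apply: measurable_invmx; apply: measurable_mulmx; first apply: measurable_mulmx.
  - by apply: measurable_invmx; exact: hessian_mean_measurable.
  - exact: Lambda_measurable.
  - by apply: measurable_invmx; exact: hessian_mean_measurable.
rewrite (_ : (fun w => _) = (fun w => if `[< good n w >] then
   invmx (V_mix m alpha n (Z^~ w) (theta_hat n w)) i j else (1%:M : 'M[R]_d) i j)); last first.
  by apply: funext => w; case: ifP.
apply: measurable_fun_ifT; [|exact: mV|exact: measurable_cst].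
apply: (measurable_fun_bool true).
rewrite setTI (_ : _ @^-1` _ = good n); first exact: good_measurable.
by apply/seteqP; split => w /= /asboolP.
Qed.

Lemma std_map_measurable n : @measurable_mx _ _ (OmG n) d d (std_map n).
Proof.
apply: measurable_mulmx; first exact: std_measurable.
by apply: measurable_invmx; exact: hessian_mean_measurable.
Qed.

(** * The subsample on the good event *)

Definition lin_error n w (j : 'I_(s n) -> nat) : 'cV[R]_d :=
  Num.sqrt (s n)%:R *: - (std_map n w *m \sum_(k < s n)
    (n%:R * (s n)%:R * pilot_prob n w (j k))^-1 *: gradient (m (Z (j k) w)) (theta_hat n w)).

Definition sub_error n w : 'cV[R]_d :=
  Num.sqrt (s n)%:R *: (invsqrtmx (V_mix m alpha n (Z^~ w) (theta_hat n w)) *m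
    (theta_sub n w - theta_hat n w)).

Lemma lin_error_measurable n (j : 'I_(s n) -> 'I_n) : @measurable_mx _ _ (OmG n) d 1
  (fun w => @lin_error n w j).
Proof.
apply: measurable_mxZ; first exact: measurable_cst.
have h : @measurable_mx _ _ (OmG n) d 1 (fun w => std_map n w *m \sum_(k < s n)
    (n%:R * (s n)%:R * pilot_prob n w (j k))^-1 *:
      gradient (m (Z (j k) w)) (theta_hat n w)).
  apply: measurable_mulmx; first exact: std_map_measurable.
  apply: measurable_mx_sum => k; apply: measurable_mxZ.
    apply: measurable_invr; apply: measurable_funM; first exact: measurable_cst.
    exact: pi_measurable.
  by move=> i i'; rewrite ord1; exact: hat_score_measurable.
move=> i i'; have := h i i'; under [X in _ -> measurable_fun _ X]eq_fun do rewrite mxE.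
by move=> h'; apply: (@measurable_funN _ (OmG n)).
Qed.

Lemma le_cV_measurable {dX} (Om : measurableType dX) (X : Om -> 'cV[R]_d) (x : 'cV[R]_d) :
  measurable_mx X -> measurable [set w | le_cV (X w) x].
Proof.
move=> mX; apply: (@measurable_set_forall _ _ _ (fun k => [set w | X w k 0 <= x k 0])) => k.
by apply: (@measurable_set_le _ _ _ _ (fun=> x k 0)); [exact: mX|exact: measurable_cst].
Qed.

Lemma sub_event_measurable n (B : set Omega) x : <<s pilot_events n>> B -> B `<=` good n ->
  measurable (B `&` [set w | le_cV (sub_error n w) x]).
Proof.
move=> GB Bg.
have -> : B `&` [set w | le_cV (sub_error n w) x] = B `&` [set w |
    le_cV (Num.sqrt (s n)%:R *: (std n w *m (theta_sub n w - theta_hat n w))) x].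
  by apply/seteqP; split => w [Bw h]; split => //=; move: h => /=;
    rewrite /sub_error (std_good (Bg w Bw)).
apply: measurableI; first exact: (sigma_pilot_sub GB).
apply: le_cV_measurable; apply: measurable_mxZ; first exact: measurable_cst.
apply: measurable_mulmx.
  by move=> i j; apply: (measurable_fun_sub (@sigma_pilot_sub n)); exact: std_measurable.
apply: measurable_mxB => k j; rewrite ord1; first exact: theta_sub_meas.
by apply: (measurable_fun_sub (@sigma_pilot_sub n)); exact: hat_pilot_measurable.
Qed.

Lemma good_sub_draw n : good n `<=`
  [set w | sum_score_norm m n (Z^~ w) (theta_pilot n w) != 0].
Proof. by move=> w gw; exact: good_draw. Qed.

Lemma good_prob_ge0 n w (i : 'I_n) : good n w -> 0 <= pilot_prob n w i.
Proof.
move=> gw; have n0 := good_n0 gw; have h := good_prob_ge gw i.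
by rewrite -(pmulr_rge0 _ (nR_gt0 n0)); apply: le_trans h; exact: (ltW alpha_gt0).
Qed.

Definition clt_error D n : R := D * (d%:R ^+ 2 * cov_error / lower +
  (d%:R ^+ 3 / Num.sqrt lower ^+ 3 * ((1 + K4) / alpha ^+ 2) + 1) / Num.sqrt (s n)%:R).

Lemma lin_error_clt (x : 'cV[R]_d) h D n (B : set Omega) : sample_clt_bound x h D ->
  (0 < s n)%N -> (0 < n)%N -> <<s pilot_events n>> B -> B `<=` good n ->
  ((\prod_k std_normal_cdf (x k 0 - h) - clt_error D n)%:E * P B <=
    P (B `&` [set w | le_cV (@lin_error n w (fun k => J n k w)) x]) <=
  (\prod_k std_normal_cdf (x k 0 + h) + clt_error D n)%:E * P B)%E.
Proof.
move=> HD sn n0 GB Bg.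
have := @draw_event_probability _ _ _ P (pilot_events n) (@sigma_pilot_sub n) _ n (s n) _ (J n)
  (second_draw n) n0 (@pi_measurable n) B GB (subset_trans Bg (@good_sub_draw n))
  (fun w i Bw => good_prob_ge0 i (Bg w Bw))
  (fun j => [set w | le_cV (@lin_error n w j) x]).
apply.
  move=> j; rewrite -[X in X _]/(@measurable _ (OmG n)).
  by apply: le_cV_measurable; exact: lin_error_measurable.
move=> w Bw; have gw := Bg w Bw.
have := HD n (s n) alpha lower cov_error (1 + K4) (fun i => pilot_prob n w i)
  (@hat_score n w) (hat_hess n w) (hat_Lambda n w) n0 sn alpha_gt0 (good_prob_ge gw)
  (good_prob_sum gw) lower_gt0 _ (good_hess_posdef gw) (good_Lambda_posdef gw)
  (good_Lambda_lower gw) (good_cov gw) (good_score_sum gw) _ _ (lexx (clt_error D n)).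
have ce : 0 <= cov_error.
  have c0p : 0 < c0 / 2 by rewrite divr_gt0 ?(ra_c0 reg).
  apply: mulr_ge0; last exact: ltW kap_gt0.
  rewrite mulr_ge0 ?addr_ge0 ?mulr_ge0 ?addr_ge0 ?invr_ge0 ?exprn_ge0 ?(ltW alpha_gt0) ?(ltW c0p)//.
have cube : avg (fun i : 'I_n => enorm (hat_score w i) ^+ 3) <= 1 + K4.
  by apply: (avg_cube_le n0); exact: good_fourth gw.
move=> /(_ ce cube).
rewrite (eq_bigr (fun j : {ffun 'I_(s n) -> 'I_n} => (\prod_(k < s n) pilot_prob n w (j k)) *
  `[< le_cV (@lin_error n w (fun k => j k)) x >]%:R))// => j _.
by rewrite /lin_error (std_map_good gw).
Qed.

Local Notation sub_c n w := (fun k : 'I_(s n) => (n%:R * (s n)%:R * pilot_prob n w (J n k w))^-1).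
Local Notation sub_z n w := (fun k : 'I_(s n) => Z (J n k w) w).

Lemma sub_near_population_negl : negl P (fun n => good n `&` [set w |
  ~ near_population Theta x0 H0 bound (2 * ep)
    (weighted_obj m (sub_c n w) (sub_z n w)) (weighted_score m (sub_c n w) (sub_z n w))
    (weighted_hess m (sub_c n w) (sub_z n w))
    (\sum_(k < s n) sub_c n w k * L (sub_z n w k)) (\sum_(k < s n) sub_c n w k * C (sub_z n w k))]).
Proof.
apply: (redraw_near_population_negl reg sigma_pilot_sub second_draw Z_pilot_measurable
  pi_measurable s_infty good_measurable good_sub_draw alpha_gt0 _ ep0 ep1).
  by move=> n w n0 gw; split; [exact: good_prob_ge|exact: good_prob_sum].
by move=> n w /goodP[].
Qed.

(** The score of the subsample at the full data estimator is of order [1 / sqrt s]. *)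
Lemma sub_score_tail n K : (0 < s n)%N -> (0 < n)%N -> 0 < K ->
  exists A, [/\ measurable A, (P A <= (d%:R * ((1 + K4) / alpha / K ^+ 2))%:E)%E &
    good n `&` [set w | ~ Num.sqrt (s n)%:R *
      enorm (weighted_score m (sub_c n w) (sub_z n w) (theta_hat n w)) <= d%:R * K] `<=` A].
Proof.
move=> sn n0 K0.
have sR : 0 < (s n)%:R :> R by rewrite ltr0n.
have q0 : 0 < Num.sqrt (s n)%:R :> R by rewrite sqrtr_gt0.
set q := Num.sqrt _ in q0 *; have qq : q ^+ 2 = (s n)%:R by rewrite sqr_sqrtr.
pose e := K / q; have e0 : 0 < e by rewrite divr_gt0.
pose u k w i := gradient (m (Z i w)) (theta_hat n w) k 0.
pose A k := good n `&` [set w | e <= `|\sum_(k' < s n)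
   (n%:R * (s n)%:R * pilot_prob n w (J n k' w))^-1 * u k w (J n k' w) -
   avg (fun i : 'I_n => u k w i)|].
have PA k : (P (A k) <= ((1 + K4) / alpha / K ^+ 2)%:E)%E.
  have := @draw_chebyshev _ _ _ P (pilot_events n) (@sigma_pilot_sub n) _ n (s n) _ (J n)
    (second_draw n) n0 (@pi_measurable n) (good n) (@good_measurable n) (@good_sub_draw n)
    (fun w i gw => good_prob_ge0 i gw) (u k) alpha (1 + K4) e sn alpha_gt0 e0.
  rewrite [X in (_ -> _ -> _ -> _ <= X%:E)%E](_ : _ = (1 + K4) / alpha / K ^+ 2); last first.
    by rewrite /e -qq; field; rewrite !gt_eqF.
  apply; first by rewrite addr_ge0.
    by move=> i; exact: hat_score_measurable.
  move=> w gw; split; [exact: good_prob_ge|exact: good_prob_sum|].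
  apply: le_trans (avg_sqr_le n0 (a := @hat_score n w) (good_fourth gw)).
  apply: avg_le => i; rewrite -real_normK ?num_real// lerXn2r ?nnegrE ?enorm_ge0//.
  exact: le_coord_enorm.
have mA k : measurable (A k).
  apply: measurableI; first exact: (sigma_pilot_sub (@good_measurable n)).
  apply: (draw_event_measurable (second_draw n) n0 (E := fun j => [set w | e <= `|\sum_(k' < s n)
   (n%:R * (s n)%:R * pilot_prob n w (j k'))^-1 * u k w (j k') -
   avg (fun i : 'I_n => u k w i)|])) => j.
  have mu' i : measurable_fun setT (fun w => u k w (i : 'I_n)).
    by apply: (measurable_fun_sub (@sigma_pilot_sub n)); exact: hat_score_measurable.
  apply: (@measurable_set_le _ _ _ (fun=> e)); first exact: measurable_cst.
  apply: measurableT_comp => //; apply: measurable_funB.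
    apply: measurable_sumr => k'; apply: measurable_funM; last exact: mu'.
    apply: measurable_invr; apply: measurable_funM; first exact: measurable_cst.
    exact: (measurable_fun_sub (@sigma_pilot_sub n) (pi_measurable (j k'))).
  by apply: measurable_funM; [exact: measurable_cst|exact: measurable_sumr].
have [U [mU PU AU]] := finite_union_bound mA PA.
exists U; split => // w [gw big].
have [[k Ak]|/forallNP nA] := pselect (exists k, A k w); first exact: (AU k).
exfalso; apply: big; rewrite mulrC -ler_pdivlMr// -mulrA.
apply: enorm_le_coord => [|k]; first by rewrite ltW.
have na : `|\sum_(k' < s n) (n%:R * (s n)%:R * pilot_prob n w (J n k' w))^-1 * u k w (J n k' w) -
   avg (fun i : 'I_n => u k w i)| < e.
  by rewrite ltNge; apply/negP => h; apply: (nA k).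
have a0 : avg (fun i : 'I_n => u k w i) = 0.
  have /matrixP/(_ k 0) := good_score_sum gw; rewrite summxE mxE => h.
  by rewrite /avg [X in _ * X]h mulr0.
move: na; rewrite a0 subr0 => /ltW; congr (`|_| <= _).
by rewrite /weighted_score summxE; apply: eq_bigr => k' _; rewrite mxE.
Qed.

Definition newton_error K n : R := (Num.sqrt lower)^-1 *
  (d%:R ^+ 2 * (2 * (2 * ep + bound * r)) * (2 / lam * (d%:R * K)) +
   bound * ((2 / lam * (d%:R * K)) ^+ 2 / Num.sqrt (s n)%:R)).

Lemma sub_error_linear n w K : (0 < s n)%N -> good n w ->
  near_population Theta x0 H0 bound (2 * ep)
    (weighted_obj m (sub_c n w) (sub_z n w)) (weighted_score m (sub_c n w) (sub_z n w))
    (weighted_hess m (sub_c n w) (sub_z n w))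
    (\sum_(k < s n) sub_c n w k * L (sub_z n w k)) (\sum_(k < s n) sub_c n w k * C (sub_z n w k)) ->
  Num.sqrt (s n)%:R * enorm (weighted_score m (sub_c n w) (sub_z n w) (theta_hat n w))
    <= d%:R * K ->
  enorm (sub_error n w - lin_error w (fun k : 'I_(s n) => J n k w)) <= newton_error K n.
Proof.
move=> sn gw nps sK; have n0 := good_n0 gw; have [Dw _ _] := goodP gw.
have maxs : is_maximizer Theta (weighted_obj m (sub_c n w) (sub_z n w)) (theta_sub n w).
  have <- : weighted_objective m n (s n) (fun k => Z (J n k w) w)
      (fun k => pilot_prob n w (J n k w)) = weighted_obj m (sub_c n w) (sub_z n w).
    by apply: funext => x; apply: eq_bigr => k _; rewrite mulrC.
  exact: theta_sub_max.
have sR : 0 < (s n)%:R :> R by rewrite ltr0n.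
have Wb := standardizer_bound (good_hess_posdef gw) (good_Lambda_posdef gw) lower_gt0
  (good_Lambda_lower gw).
have w0 : 0 <= (Num.sqrt lower)^-1 by rewrite invr_ge0 sqrtr_ge0.
have := standardized_error_linear (ra_convex reg) (ra_lam reg) r0 (ra_curvature reg) ball2 ep2
  small_r small_ep small_score (full_near_population n0 Dw) nps (theta_hat_max n w) maxs
  w0 Wb sR sK (lexx _).
rewrite /newton_error /sub_error /lin_error (std_map_good gw).
by rewrite [invsqrtmx _](standardizer_M (hat_Lambda n w) (good_hess_posdef gw)).
Qed.

Lemma sub_error_bounds (x : 'cV[R]_d) h D1 D2 K t :
  sample_clt_bound (x + const_mx h) h D1 -> sample_clt_bound (x - const_mx h) h D2 ->
  0 < K -> 0 < t -> (\forall n \near \oo, newton_error K n <= h) ->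
  \forall n \near \oo, forall B, <<s pilot_events n>> B -> B `<=` good n ->
  (P (B `&` [set w | le_cV (sub_error n w) x]) <=
     (\prod_k std_normal_cdf (x k 0 + h + h) + clt_error D1 n)%:E * P B +
     (d%:R * ((1 + K4) / alpha / K ^+ 2) + t)%:E)%E /\
  ((\prod_k std_normal_cdf (x k 0 - h - h) - clt_error D2 n)%:E * P B <=
     P (B `&` [set w | le_cV (sub_error n w) x]) +
     (d%:R * ((1 + K4) / alpha / K ^+ 2) + t)%:E)%E.
Proof.
move=> HD1 HD2 K0 t0 newt; near=> n => B GB Bg.
have n0 : (0 < n)%N by near: n; exact: nbhs_infty_gt.
have sn : (0 < s n)%N by near: n; move/cvgnyPge : s_infty => /(_ 1%N).
have nh : newton_error K n <= h by near: n.
have [A1 [mA1 PA1 cov1]] : exists A, [/\ measurable A, (P A <= t%:E)%E &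
  good n `&` [set w | ~ near_population Theta x0 H0 bound (2 * ep)
    (weighted_obj m (sub_c n w) (sub_z n w)) (weighted_score m (sub_c n w) (sub_z n w))
    (weighted_hess m (sub_c n w) (sub_z n w))
    (\sum_(k < s n) sub_c n w k * L (sub_z n w k))
    (\sum_(k < s n) sub_c n w k * C (sub_z n w k))] `<=` A].
  by near: n; exact: sub_near_population_negl.
have [A2 [mA2 PA2 cov2]] := sub_score_tail sn n0 K0.
have mA : measurable (A1 `|` A2) by exact: measurableU.
have PA : (P (A1 `|` A2) <= (d%:R * ((1 + K4) / alpha / K ^+ 2) + t)%:E)%E.
  apply: le_trans (measureU2 _ mA1 mA2) _.
  by rewrite addrC EFinD; exact: leeD.
have close w : B w -> ~ (A1 `|` A2) w ->
    enorm (sub_error n w - lin_error w (fun k : 'I_(s n) => J n k w)) <= h.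
  move=> Bw nA; have gw := Bg w Bw; apply: le_trans nh; apply: sub_error_linear => //.
    by apply: contrapT => h1; apply: nA; left; apply: cov1.
  by apply: contrapT => h1; apply: nA; right; apply: cov2.
have coord w k : enorm (sub_error n w - lin_error w (fun k : 'I_(s n) => J n k w)) <= h ->
    `|sub_error n w k 0 - lin_error w (fun k : 'I_(s n) => J n k w) k 0| <= h.
  by apply: le_trans; rewrite -coordB; exact: le_coord_enorm.
have mB := sigma_pilot_sub GB.
have mE := sub_event_measurable x GB Bg.
have mlin y : measurable (B `&` [set w | le_cV (lin_error w (fun k : 'I_(s n) => J n k w)) y]).
  apply: measurableI => //.
  apply: (draw_event_measurable (second_draw n) n0
    (E := fun j => [set w | le_cV (@lin_error n w j) y])) => j.
  by apply: (@sigma_pilot_sub n); apply: (@le_cV_measurable _ (OmG n)); exact: lin_error_measurable.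
have /andP[_ up] := lin_error_clt HD1 sn n0 GB Bg.
have /andP[lo _] := lin_error_clt HD2 sn n0 GB Bg.
split.
- apply: (@le_trans _ _ (P ((B `&` [set w | le_cV (lin_error w (fun k : 'I_(s n) => J n k w))
     (x + const_mx h)]) `|` (A1 `|` A2)))).
    apply: le_measure; rewrite ?inE//; first exact: measurableU.
    move=> w [Bw le]; have [|nA] := pselect ((A1 `|` A2) w); first by right.
    left; split=> // k; have /ler_normlP[h1 _] := coord w k (close w Bw nA).
    by have := le k; rewrite !mxE in h1 *; lra.
  apply: le_trans (measureU2 _ (mlin _) mA) _; apply: leeD => //.
  apply: le_trans up _; rewrite le_eqVlt; apply/orP; left; apply/eqP.
  by congr ((_ + _)%:E * _)%E; apply: eq_bigr => k _; rewrite !mxE.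
- apply: (@le_trans _ _ (P (B `&` [set w | le_cV (lin_error w (fun k : 'I_(s n) => J n k w))
     (x - const_mx h)]))).
    apply: le_trans lo; rewrite le_eqVlt; apply/orP; left; apply/eqP.
    by congr ((_ - _)%:E * _)%E; apply: eq_bigr => k _; rewrite !mxE.
  apply: (@le_trans _ _ (P ((B `&` [set w | le_cV (sub_error n w) x]) `|` (A1 `|` A2)))).
    apply: le_measure; rewrite ?inE//; first exact: measurableU.
    move=> w [Bw le]; have [|nA] := pselect ((A1 `|` A2) w); first by right.
    left; split=> // k; have /ler_normlP[_ h1] := coord w k (close w Bw nA).
    by have := le k; rewrite !mxE in h1 *; lra.
  by apply: le_trans (measureU2 _ mE mA) _; exact: leeD.
Unshelve. all: by end_near. Qed.

Lemma good_cover t : 0 < t ->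
  (\forall n \near \oo, exists A, [/\ measurable A, (P A <= t%:E)%E &
    [set w | K4 < avg (fun i : 'I_n => enorm (hat_score w i) ^+ 4)] `<=` A]) ->
  \forall n \near \oo, exists A, [/\ measurable A, (P A <= (t + t + t)%:E)%E &
    ~` good n `<=` A].
Proof.
move=> t0 nK; near=> n.
have [A1 [mA1 PA1 c1]] : exists A, [/\ measurable A, (P A <= t%:E)%E &
  [set w | K4 < avg (fun i : 'I_n => enorm (hat_score w i) ^+ 4)] `<=` A] by near: n.
have [A2 [mA2 PA2 c2]] : exists A, [/\ measurable A, (P A <= t%:E)%E &
  ~` data_good ep n `<=` A] by near: n; exact: (data_good_negl Z_iid reg ep0).
have [A3 [mA3 PA3 c3]] : exists A, [/\ measurable A, (P A <= t%:E)%E &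
  data_good ep n `&` [set w | ~ enorm (theta_pilot n w - x0) <= r] `<=` A].
  by near: n; exact: pilot_negl.
have n0 : (0 < n)%N by near: n; exact: nbhs_infty_gt.
have mA12 : measurable (A1 `|` A2) by exact: measurableU.
exists (A1 `|` A2 `|` A3); split; first exact: measurableU.
  apply: le_trans (measureU2 _ mA12 mA3) _; rewrite EFinD; apply: leeD => //.
  by apply: le_trans (measureU2 _ mA1 mA2) _; rewrite EFinD; exact: leeD.
move=> w ng; apply: contrapT => nA; apply: ng.
have Dw : data_good ep n w.
  by apply: contrapT => h; apply: nA; left; right; exact: c2.
have Pw : enorm (theta_pilot n w - x0) <= r.
  by apply: contrapT => h; apply: nA; right; exact: c3.
have Kw : avg (fun i : 'I_n => enorm (hat_score w i) ^+ 4) <= K4.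
  by rewrite leNgt; apply/negP => h; apply: nA; left; left; exact: c1.
by move: Kw Dw Pw n0 {mA12 c1 c2 c3 nA}; case: (n) => [//|k] *; rewrite /good.
Unshelve. all: by end_near. Qed.

End asymptotics.

Section normal_cdf.
Context {R : realType}.
Local Notation N01 := (@normal_prob R 0 1).

Lemma std_normal_cdf_ge0 (a : R) : 0 <= std_normal_cdf a.
Proof. by rewrite /std_normal_cdf fine_ge0. Qed.

Lemma std_normal_cdf_le1 (a : R) : std_normal_cdf a <= 1.
Proof.
have h : (N01 `]-oo, a] <= 1)%E by exact: probability_le1.
by rewrite /std_normal_cdf -lee_fin fineK ?fin_num_measure.
Qed.

(** The normal density is bounded. *)
Lemma std_normal_cdf_lipschitz (a b : R) : a <= b ->
  std_normal_cdf a <= std_normal_cdf b <= std_normal_cdf a + normal_peak 1 * (b - a).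
Proof.
move=> ab.
have fin (V : set R) : measurable V -> N01 V = (fine (N01 V))%:E.
  by move=> mV; rewrite fineK// fin_num_measure.
have E : N01 `]-oo, b] = (N01 `]-oo, a] + N01 `]a, b])%E.
  rewrite -measureU//; last first.
    by rewrite -subset0 => x /=; rewrite !in_itv /= => -[xa /andP[ax _]]; lra.
  by rewrite -itv_bndbnd_setU// bnd_simp.
have F : std_normal_cdf b = std_normal_cdf a + fine (N01 `]a, b]).
  by rewrite /std_normal_cdf E fineD ?fin_num_measure.
rewrite F lerDl fine_ge0//= lerD2l -lee_fin -fin//.
apply: (@le_trans _ _ (\int[lebesgue_measure]_(x in `]a, b]) (cst (normal_peak 1)%:E x))%E).
  apply: ge0_le_integral => //.
  - by move=> x _; rewrite lee_fin normal_pdf_ge0.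
  - apply/measurable_EFinP; apply: measurable_funTS; exact: measurable_normal_pdf.
  - by move=> x _; rewrite lee_fin normal_pdf_ub// oner_neq0.
rewrite integral_cst//.
rewrite [X in (_ * X <= _)%E](_ : _ = (if (a < b)%R then (b - a)%:E else 0)%E); last first.
  by have := lebesgue_measure_itv `]a, b]; rewrite /= lte_fin -EFinB.
case: ifP => _; first by rewrite -EFinM.
by rewrite mule0 lee_fin mulr_ge0 ?normal_peak_ge0 ?subr_ge0.
Qed.

Lemma prod_dist (I : Type) (r : seq I) (u v : I -> R) (c : R) :
  (forall i, 0 <= u i <= 1) -> (forall i, 0 <= v i <= 1) -> (forall i, `|u i - v i| <= c) ->
  `|\prod_(i <- r) u i - \prod_(i <- r) v i| <= (size r)%:R * c.
Proof.
move=> u01 v01 uv; elim: r => [|i r IH]; first by rewrite !big_nil subrr normr0 mul0r.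
rewrite !big_cons (_ : _ - _ = u i * (\prod_(j <- r) u j - \prod_(j <- r) v j) +
   (u i - v i) * \prod_(j <- r) v j); last by ring.
apply: le_trans (ler_normD _ _) _; rewrite /= -natr1 [leRHS]mulrDl mul1r lerD//.
  rewrite normrM; have /andP[a b] := u01 i; rewrite (ger0_norm a).
  by apply: le_trans IH; rewrite ler_piMl.
rewrite normrM; apply: le_trans (uv i); rewrite ler_piMr//.
have /andP[p0 p1] : 0 <= \prod_(j <- r) v j <= 1.
  elim/big_rec: _ => [|j y _ /andP[y0 y1]]; first by rewrite ler01 lexx.
  by have /andP[a b] := v01 j; rewrite mulr_ge0//= mulr_ile1.
by rewrite ger0_norm.
Qed.

Lemma std_normal_prod_continuous d (x : 'cV[R]_d) (e : R) : 0 < e -> exists2 h : R, 0 < h &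
  \prod_k std_normal_cdf (x k 0 + h + h) <= \prod_k std_normal_cdf (x k 0) + e /\
  \prod_k std_normal_cdf (x k 0) - e <= \prod_k std_normal_cdf (x k 0 - h - h).
Proof.
move=> e0; pose p : R := normal_peak 1.
have p0 : 0 < p by rewrite normal_peak_gt0// oner_neq0.
pose h := e / (2 * p * (d%:R + 1)).
have d0 : 0 < d%:R + 1 :> R by rewrite ltr_wpDl.
have h0 : 0 < h by rewrite divr_gt0// !mulr_gt0.
have ph : d%:R * (p * (2 * h)) <= e.
  rewrite (_ : _ * _ = (d%:R / (d%:R + 1)) * e); last by rewrite /h; field; rewrite !gt_eqF.
  by rewrite ler_piMl ?(ltW e0)// ler_pdivrMr// mul1r lerDl.
have c01 (a : R) : 0 <= std_normal_cdf a <= 1.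
  by apply/andP; split; [exact: std_normal_cdf_ge0|exact: std_normal_cdf_le1].
have sz : size (index_enum 'I_d) = d by rewrite -[RHS](size_enum_ord d) enumT.
exists h => //; split.
- have := @prod_dist _ (index_enum 'I_d) (fun k => std_normal_cdf (x k 0 + h + h))
    (fun k => std_normal_cdf (x k 0)) (p * (2 * h)) (fun=> c01 _) (fun=> c01 _).
  rewrite sz => hp.
  have /hp/ler_normlP[_] : forall i, `|std_normal_cdf (x i 0 + h + h) - std_normal_cdf (x i 0)|
      <= p * (2 * h); last by have := ph; lra.
  move=> k; have xx : x k 0 <= x k 0 + h + h by lra.
  have /andP[a b] := std_normal_cdf_lipschitz xx; rewrite -/p in b.
  rewrite ger0_norm ?subr_ge0//; have -> : 2 * h = x k 0 + h + h - x k 0 by ring.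
  lra.
- have := @prod_dist _ (index_enum 'I_d) (fun k => std_normal_cdf (x k 0))
    (fun k => std_normal_cdf (x k 0 - h - h)) (p * (2 * h)) (fun=> c01 _) (fun=> c01 _).
  rewrite sz => hp.
  have /hp/ler_normlP[_] : forall i, `|std_normal_cdf (x i 0) - std_normal_cdf (x i 0 - h - h)|
      <= p * (2 * h); last by have := ph; lra.
  move=> k; have xx : x k 0 - h - h <= x k 0 by lra.
  have /andP[a b] := std_normal_cdf_lipschitz xx; rewrite -/p in b.
  rewrite ger0_norm ?subr_ge0//; have -> : 2 * h = x k 0 - (x k 0 - h - h) by ring.
  lra.
Qed.

Lemma std_normal_vector_cdf d (dU : measure_display) (OmU : measurableType dU)
  (Q : probability OmU R) (U : OmU -> 'cV[R]_d) (x : 'cV[R]_d) : std_normal_vector Q U ->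
  fine (Q [set u | le_cV (U u) x]) = \prod_k std_normal_cdf (x k 0).
Proof.
move=> [_ HU]; have := HU (fun k => `]-oo, x k 0]%classic) (fun=> measurable_itv _).
rewrite (_ : [set u | _] = [set u | le_cV (U u) x]); last first.
  by apply/seteqP; split => u /= h k; have := h k; rewrite in_itv.
move=> ->; rewrite (eq_bigr (fun k => (std_normal_cdf (x k 0))%:E)).
  by rewrite prodEFin.
by move=> k _; rewrite /std_normal_cdf fineK// fin_num_measure.
Qed.

Lemma small_near (c b : R) : 0 < b -> \forall r \near (0 : R)^'+, c * r <= b.
Proof.
move=> b0; have h : 0 < b / (`|c| + 1) by rewrite divr_gt0// ltr_wpDl.
near=> r; have r0 : 0 < r by near: r; exact: nbhs_right_gt.
have rb : r < b / (`|c| + 1) by near: r; exact: nbhs_right_lt.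
rewrite ltr_pdivlMr ?ltr_wpDl// mulrC in rb.
by have := ler_norm c; nra.
Unshelve. all: by end_near. Qed.

Lemma sqrt_size_small (s : nat -> nat) (K e : R) : s n @[n --> \oo] --> \oo -> 0 < e ->
  \forall n \near \oo, K / Num.sqrt (s n)%:R <= e.
Proof.
move=> soo e0; have e2 : 0 < e ^+ 2 by rewrite exprn_gt0.
near=> n; have sn : (0 < s n)%N by near: n; move/cvgnyPge : soo => /(_ 1%N).
have h : K ^+ 2 / (s n)%:R <= e ^+ 2 by near: n; exact: size_infty_small.
have sR : 0 < (s n)%:R :> R by rewrite ltr0n.
apply: le_trans (ler_norm _) _.
rewrite -(@ler_pXn2r _ 2) ?nnegrE ?(ltW e0)// real_normK ?num_real//.
by rewrite expr_div_n sqr_sqrtr// ltW.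
Unshelve. all: by end_near. Qed.

End normal_cdf.

Theorem theorem5 (R : realType) (d : nat) (dT dO dU : measure_display)
  (T : measurableType dT) (mu : probability T R)
  (Omega : measurableType dO) (P : probability Omega R)
  (Z : nat -> Omega -> T)
  (m : T -> 'cV[R]_d -> R) (Theta : set 'cV[R]_d)
  (alpha : R) (s0 s : nat -> nat)
  (J0 J : nat -> nat -> Omega -> nat)
  (theta_hat theta_pilot theta_sub : nat -> Omega -> 'cV[R]_d)
  (OmegaU : measurableType dU) (Q : probability OmegaU R)
  (U : OmegaU -> 'cV[R]_d)
  (d_gt0 : (0 < d)%N)
  (* independent observations Z_0, Z_1, ... with law mu *)
  (Z_iid : iid P mu Z)
  (* regularity under which the gradient, the Hessian and their expectations
     are meaningful *)
  (m_diff : forall z theta, Theta theta -> twice_differentiable (m z) theta)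
  (m_meas : forall theta, Theta theta ->
     measurable_fun setT (fun z => m z theta))
  (dm_meas : forall theta k, Theta theta ->
     measurable_fun setT (fun z => gradient (m z) theta k 0))
  (ddm_meas : forall theta k l, Theta theta ->
     measurable_fun setT (fun z => hessian (m z) theta k l))
  (* (i) *)
  (Theta_compact : compact Theta)
  (* (ii) *)
  (m_concave : forall z, concave_on Theta (m z))
  (m_max : forall z, exists! theta, is_maximizer Theta (m z) theta)
  (m_L2 : forall theta, Theta theta ->
     ('E_mu[fun z => (m z theta ^+ 2)%R] < +oo)%E)
  (* the population maximizer is interior *)
  (max_interior : forall theta,
     is_maximizer Theta (fun t => fine 'E_mu[m^~ t]) theta ->
     (interior Theta) theta)
  (* (iii) *)
  (ddm_posdef : forall theta, Theta theta ->
     posdef (- \matrix_(k, l) fine 'E_mu[fun z => hessian (m z) theta k l]))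
  (ddm_L2 : forall theta k l, Theta theta ->
     ('E_mu[fun z => (hessian (m z) theta k l ^+ 2)%R] < +oo)%E)
  (ddm_lip : exists psi : T -> R,
     [/\ measurable_fun setT psi,
         ('E_mu[fun z => (psi z ^+ 2)%R] < +oo)%E &
         forall z theta1 theta2 k l, Theta theta1 -> Theta theta2 ->
           `|hessian (m z) theta1 k l - hessian (m z) theta2 k l|
             <= psi z * enorm (theta1 - theta2)])
  (* (iv) *)
  (Lambda_fin : forall theta k l, Theta theta ->
     mu.-integrable setT
       (fun z => (gradient (m z) theta k 0 * gradient (m z) theta l 0)%:E))
  (Lambda_posdef : forall theta, Theta theta ->
     posdef (\matrix_(k, l) fine 'E_mu[fun z =>
       (gradient (m z) theta *m (gradient (m z) theta)^T) k l]))
  (dm_L4 : exists delta : R, 0 < delta /\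
     bounded_in_probability P (fun n w =>
       ereal_sup [set (n%:R^-1 *
           \sum_(i < n) enorm (gradient (m (Z i w)) theta) ^+ 4)%:E |
         theta in [set t | Theta t /\ enorm (t - theta_hat n w) <= delta]]))
  (* full data estimator *)
  (theta_hat_meas : forall n k,
     measurable_wrt (sigma_data Z n) (fun w => theta_hat n w k 0))
  (theta_hat_max : forall n w,
     is_maximizer Theta (mean_objective m n (Z^~ w)) (theta_hat n w))
  (* sampling *)
  (alpha_gt0 : 0 < alpha) (alpha_lt1 : alpha < 1)
  (s_lt : \forall n \near \oo, (s n < n)%N)
  (s0_infty : s0 n @[n --> \oo] --> \oo)
  (s_infty : s n @[n --> \oo] --> \oo)
  (* pilot step *)
  (pilot_draw : forall n,
     drawn_with_replacement P (sigma_data Z n) setT n (s0 n)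
       (fun _ _ => n%:R^-1) (J0 n))
  (theta_pilot_meas : forall n, random_vector (theta_pilot n))
  (theta_pilot_max : forall n w,
     is_maximizer Theta
       (mean_objective m (s0 n) (fun k => Z (J0 n k w) w)) (theta_pilot n w))
  (* second step *)
  (second_draw : forall n,
     drawn_with_replacement P (sigma_data_and Z (theta_pilot n) n)
       [set w | sum_score_norm m n (Z^~ w) (theta_pilot n w) != 0] n (s n)
       (fun w => pi_opt_mix m alpha n (Z^~ w) (theta_pilot n w)) (J n))
  (theta_sub_meas : forall n, random_vector (theta_sub n))
  (theta_sub_max : forall n w,
     is_maximizer Theta
       (weighted_objective m n (s n) (fun k => Z (J n k w) w)
          (fun k => pi_opt_mix m alpha n (Z^~ w) (theta_pilot n w) (J n k w)))
       (theta_sub n w))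
  (U_normal : std_normal_vector Q U) :
  cvg_cond_distribution P Q U (fun n => sigma_data_and Z (theta_pilot n) n)
    (fun n w => Num.sqrt (s n)%:R *:
       (invsqrtmx (V_mix m alpha n (Z^~ w) (theta_hat n w)) *m
          (theta_sub n w - theta_hat n w))).
Proof.
have Tne : exists y, Theta y.
  by exists (theta_hat 0%N point); case: (theta_hat_max 0%N point).
have [x0 [L [C [H0 [lam [l [c0 [rho reg]]]]]]]] := regular_at_exists d_gt0 m_diff m_meas
  dm_meas ddm_meas Theta_compact m_concave m_L2 max_interior ddm_posdef ddm_L2 ddm_lip
  Lambda_fin Lambda_posdef Tne.
move=> x g Hg; rewrite (std_normal_vector_cdf x U_normal).
have Gm n : <<s pilot_events Z theta_pilot n >> `<=` measurable.
  exact: (sigma_pilot_sub Z_iid theta_pilot_meas).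
apply: (@cond_prob_cvg _ _ _ P (fun n => <<s pilot_events Z theta_pilot n >>)
  (fun n => [set w | le_cV (sub_error Z m alpha s theta_hat theta_sub n w) x])) => //.
  by move=> n A B GA GB; exact: (@measurableI _ (g_sigma_algebraType _) _ _ GA GB).
move=> e e0.
set bd := statistic_bound mu m x0 L C.
have bd0 : 0 <= bd := statistic_bound_ge0 mu m x0 L C.
have lam0 := ra_lam reg; have l0 := ra_l reg; have c00 := ra_c0 reg.
have rho0 := ra_rho reg.
have e4 : 0 < e / 4 by rewrite divr_gt0.
have e8 : 0 < e / 8 by rewrite divr_gt0.
have [delta [delta0 bip]] := dm_L4.
have [K nK] := bip (e / 4) e4.
pose K4 := Num.max 0 K.
have K40 : 0 <= K4 by rewrite le_max lexx.
have KK4 : K <= K4 by rewrite le_max lexx orbT.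
pose lw := lower l c0 K4.
have lw0 : 0 < lw := lower_gt0 reg K40.
pose ct := d%:R * ((1 + K4) / alpha) / (e / 8).
have ct0 : 0 <= ct.
  by rewrite divr_ge0 ?(ltW e8)// mulr_ge0// divr_ge0 ?(ltW alpha_gt0)// addr_ge0.
pose Kt := ct + 1.
have Kt0 : 0 < Kt by rewrite ltr_wpDl.
have tail : d%:R * ((1 + K4) / alpha / Kt ^+ 2) <= e / 8.
  rewrite mulrA ler_pdivrMr ?exprn_gt0// -ler_pdivrMl// mulrC -/ct.
  by rewrite /Kt expr2; nra.
have [h h0 [contU contL]] := std_normal_prod_continuous x e8.
have [D1 D10 HD1] := sample_clt (x + const_mx h) h0.
have [D2 D20 HD2] := sample_clt (x - const_mx h) h0.
pose K6 := 2 / lam * (d%:R * Kt).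
pose X := (Num.sqrt lw)^-1 * (d%:R ^+ 2 * (2 * K6)).
pose Ac := alpha ^- 2 * ((c0 / 2)^-1 + (c0 / 2) ^- 2) * (1 + K4).
pose cv := d%:R ^+ 2 * (Ac * (2 * (1 + bd))) / lw.
have [r [[r0 r1 r_rho r_bd] [r_norm r_outer r_newton] [r_cov1 r_cov2]]] : exists r : R,
    [/\ [/\ 0 < r, 1 * r <= 1, 2 * r <= rho & (d%:R ^+ 2 + 2) * bd * r <= lam / 2],
      [/\ (1 + bd) * r <= c0 / 4, bd * r <= l / 8 & X * bd * r <= h / 4] &
      D1 * cv * r <= e / 8 /\ D2 * cv * r <= e / 8].
  near (0 : R)^'+ => r; exists r; split; [split|split|split]; near: r;
    by [exact: nbhs_right_gt|apply: small_near; rewrite ?divr_gt0].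
have [ep [[ep0 ep1 ep_lam ep_score] [ep_norm ep_outer ep_newton]]] : exists ep : R,
    [/\ 0 < ep, 2 * ep <= 1, (d%:R ^+ 2 * 2) * ep <= lam / 2 &
        (d%:R * 2) * ep <= lam / 4 * r] /\
    [/\ 1 * ep <= c0 / 4, d%:R ^+ 2 * ep <= l / 2 & X * 2 * ep <= h / 4].
  near (0 : R)^'+ => ep; exists ep; split; split; near: ep;
    by [exact: nbhs_right_gt|apply: small_near; rewrite ?mulr_gt0 ?divr_gt0].
rewrite mul1r in r1; rewrite mul1r in ep_norm.
have small_ep : d%:R ^+ 2 * (2 * ep) <= lam / 2 by rewrite mulrA.
have small_score : d%:R * (2 * ep) < lam / 2 * r.
  rewrite mulrA; apply: le_lt_trans ep_score _; rewrite ltr_pM2r//; lra.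
have small_norm : ep + (1 + bd) * r <= c0 / 2 by lra.
have small_outer : bd * r ^+ 2 <= l / 8.
  by apply: le_trans r_outer; rewrite ler_wpM2l// expr2 ler_piMl// ltW.
pose Good := good mu Z m theta_hat theta_pilot x0 L C ep r K4.
exists Good; split.
- move=> n; exact: (good_measurable reg dm_meas theta_hat_meas theta_hat_max).
- have t3 : e / 4 + e / 4 + e / 4 <= e by lra.
  have nA : \forall n \near \oo, exists A, [/\ measurable A, (P A <= (e / 4)%:E)%E &
      [set w | K4 < avg (fun i : 'I_n => enorm (hat_score Z m theta_hat w i) ^+ 4)] `<=` A].
    near=> n; have [A [mA PA cA]] : exists A : set Omega, [/\ measurable A,
      (P A <= (e / 4)%:E)%E & [set w | (K%:E < `|ereal_sup [set (n%:R^-1 *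
           \sum_(i < n) enorm (gradient (m (Z i w)) theta) ^+ 4)%:E |
         theta in [set t | Theta t /\ (enorm (t - theta_hat n w) <= delta)%R]]|)%E] `<=` A].
      by near: n.
    exists A; split=> // w Kw; apply: cA => /=.
    apply: (@lt_le_trans _ _ (n%:R^-1 *
           \sum_(i < n) enorm (gradient (m (Z i w)) (theta_hat n w)) ^+ 4)%:E).
      by rewrite lte_fin; exact: le_lt_trans Kw.
    apply: le_trans (lee_abs _); apply: ereal_sup_ubound.
    exists (theta_hat n w) => //; split; first by case: (theta_hat_max n w).
    by rewrite subrr enorm0 ltW.
  near=> n.
  have [A [mA PA cA]] : exists A, [/\ measurable A, (P A <= (e / 4 + e / 4 + e / 4)%:E)%E &
      ~` Good n `<=` A].
    by near: n; apply: (good_cover Z_iid reg s0_infty pilot_draw theta_pilot_max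
      ep0 ep1 r0 r_rho r_bd small_ep small_score e4 nA).
  by exists A; split=> //; apply: le_trans PA _; rewrite lee_fin.
have newt : \forall n \near \oo, newton_error mu m s x0 L C lam l c0 ep r K4 Kt n <= h.
  have h2 : 0 < h / 2 by rewrite divr_gt0.
  near=> n.
  have hn : ((Num.sqrt lw)^-1 * (bd * K6 ^+ 2)) / Num.sqrt (s n)%:R <= h / 2.
    by near: n; exact: sqrt_size_small.
  rewrite /newton_error -/bd -/lw -/K6.
  rewrite (_ : _ * _ = (X * 2 * ep + X * bd * r) +
    ((Num.sqrt lw)^-1 * (bd * K6 ^+ 2)) / Num.sqrt (s n)%:R); last by rewrite /X; ring.
  lra.
have clt D : D * cv * r <= e / 8 -> \forall n \near \oo,
    clt_error mu m alpha s x0 L C l c0 r K4 D n <= e / 4.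
  move=> Dr; near=> n.
  have hn : D * (d%:R ^+ 3 / Num.sqrt lw ^+ 3 * ((1 + K4) / alpha ^+ 2) + 1) /
      Num.sqrt (s n)%:R <= e / 8.
    by near: n; exact: sqrt_size_small.
  rewrite /clt_error -/lw mulrDr [X in _ + X]mulrA.
  rewrite (_ : D * (d%:R ^+ 2 * _ / lw) = D * cv * r); first by lra.
  by rewrite /cv /cov_error /kap -/bd -/Ac; ring.
have bounds := sub_error_bounds Z_iid reg m_diff dm_meas ddm_meas theta_hat_meas theta_hat_max
  alpha_gt0 alpha_lt1 s_infty theta_pilot_meas theta_pilot_max second_draw theta_sub_meas
  theta_sub_max ep0 ep1 r0 r_rho r_bd small_ep small_score K40 small_norm ep_outer small_outer
  HD1 HD2 Kt0 e8 newt.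
apply: filterS3 bounds (clt D1 r_cov1) (clt D2 r_cov2) => n hb c1 c2 B GB BG.
have [up lo] := hb B GB BG.
have mB := Gm n _ GB.
have fB : P B = (fine (P B))%:E by rewrite fineK// fin_num_measure.
have p1 : fine (P B) <= 1 by rewrite -lee_fin -fB; exact: probability_le1.
have p0 : 0 <= fine (P B) by exact: fine_ge0.
rewrite fB -!EFinM in up lo *.
move: (fine (P B)) p0 p1 {fB} up lo => p p0 p1 up lo.
set tl := d%:R * _ in tail up lo.
split.
- apply: le_trans up _; rewrite -!EFinD lee_fin.
  have : (\prod_k std_normal_cdf (x k 0 + h + h) +
    clt_error mu m alpha s x0 L C l c0 r K4 D1 n) * p <=
    (\prod_k std_normal_cdf (x k 0) + e / 8 + e / 4) * p by rewrite ler_wpM2r//; lra.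
  have : (e / 8 + e / 4) * p <= e / 8 + e / 4 by rewrite ler_piMr//; lra.
  rewrite -addrA mulrDl; lra.
- apply: (@le_trans _ _ (((\prod_k std_normal_cdf (x k 0 - h - h) -
    clt_error mu m alpha s x0 L C l c0 r K4 D2 n) * p)%:E + (e / 8 + e / 4)%:E)%E).
    rewrite -EFinD lee_fin.
    have : (\prod_k std_normal_cdf (x k 0) - (e / 8 + e / 4)) * p <=
      (\prod_k std_normal_cdf (x k 0 - h - h) -
       clt_error mu m alpha s x0 L C l c0 r K4 D2 n) * p by rewrite ler_wpM2r//; lra.
    have : (e / 8 + e / 4) * p <= e / 8 + e / 4 by rewrite ler_piMr//; lra.
    rewrite mulrBl; lra.
  apply: le_trans (leeD2r _ lo) _; rewrite -addeA -EFinD; apply: leeD2l.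
  by rewrite lee_fin; lra.
Unshelve. all: by end_near. Qed.
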